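(* Let $0<p<q<\infty$, let $\omega\in\hat{\mathcal D}$, let $k,n\in\mathbb Z$ satisfy $0\le k<n$, and let $g\in H(\mathbb D)$. (i) $T_g^{n,k}:A_\omega^p\to A_\omega^q$ is bounded if and only if $$\sup_{a\in\mathbb D}\frac{(1-|a|)^{n-k}\,|g^{(n-k)}(a)|}{(1-|a|)^{\frac1p-\frac1q}\,\hat\omega(a)^{\frac1p-\frac1q}}<\infty .$$ (ii) $T_g^{n,k}:A_\omega^p\to A_\omega^q$ is compact if and only if $$\lim_{|a|\to1}\frac{(1-|a|)^{n-k}\,|g^{(n-k)}(a)|}{(1-|a|)^{\frac1p-\frac1q}\,\hat\omega(a)^{\frac1p-\frac1q}}=0 .$$
   Context: $\mathbb D$ is the open unit disk in $\mathbb C$ and $H(\mathbb D)$ is the space of all analytic functions on $\mathbb D$; $dA$ is the normalized Lebesgue area measure on $\mathbb D$. A weight is a function $\omega:\mathbb D\to[0,\infty)$ that is positive and integrable; it is radial if $\omega(z)=\omega(|z|)$ for all $z\in\mathbb D$. For a radial weight $\omega$ put $\hat\omega(r)=\int_r^1\omega(s)\,ds$ for $r\in[0,1)$, and $\hat\omega(z)=\hat\omega(|z|)$ for $z\in\mathbb D$. $\omega$ is a doubling weight, written $\omega\in\hat{\mathcal D}$, if $\omega$ is radial and there is a constant $C>0$ such that $\hat\omega(r)<C\hat\omega\left(\frac{1+r}2\right)$ for all $r\in[0,1)$. For $0<p<\infty$ and $\omega\in\hat{\mathcal D}$, the weighted Bergman space $A_\omega^p$ consists of all $f\in H(\mathbb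 D)$ with $\|f\|_{A_\omega^p}=\left(\int_{\mathbb D}|f(z)|^p\omega(z)\,dA(z)\right)^{1/p}<\infty$. For $g\in H(\mathbb D)$ and integers $0\le k<n$, the generalized Volterra operator is $T_g^{n,k}f=I^n\left(f^{(k)}g^{(n-k)}\right)$ for $f\in H(\mathbb D)$, where $I^n$ is the $n$-th iterate of the integration operator $If(z)=\int_0^zf(t)\,dt$. *)

(* Defs.v *)
From HB Require Import structures.
From mathcomp Require Import all_boot all_order all_algebra.
From mathcomp Require Import complex.
From mathcomp Require Import all_classical all_reals all_analysis.

Set Implicit Arguments.
Unset Strict Implicit.
Unset Printing Implicit Defensive.

Import Order.TTheory GRing.Theory Num.Theory.
Import numFieldNormedType.Exports.

Local Open Scope classical_set_scope.
Local Open Scope complex_scope.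
Local Open Scope ring_scope.

(* The normed module structure of the complex numbers [R[i]] over themselves is
   carried by the alias [R[i]^o].  A function on the unit disk is represented by
   a total function on [R[i]]; every notion below depends only on its values on
   the disk. *)

Section UnitDisk.
Context {R : realType}.
Implicit Types (z : R[i]) (f g : R[i] -> R[i]) (w : R[i] -> R).

(* The library's [`|z|] is an element of [R[i]]; this is the real modulus. *)
Definition cmod z : R := ComplexField.Normc.normc z.

Definition disk : set R[i] := [set z | cmod z < 1].

Definition analytic_on_disk f : Prop :=
  forall z, disk z -> derivable (f : R[i]^o -> R[i]^o) z 1.

Definition cderiv (k : nat) f : R[i] -> R[i] :=
  derive1n k (f : R[i]^o -> R[i]^o).

(* [R[i]] has no measurable structure in the library: area integrals are taken
   over [R * R], transported by [toC]. *)
Definition toC (u : R * R) : R[i] := u.1 +i* u.2.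

Fact pi_inv_ge0 : 0 <= (pi : R)^-1.
Proof. by rewrite invr_ge0 pi_ge0. Qed.

Definition dA : {measure set (measurableTypeR R * measurableTypeR R) -> \bar R} :=
  mscale (NngNum pi_inv_ge0) (@lebesgue_measure R \x @lebesgue_measure R)%E.

(* Lebesgue integrability: equality almost everywhere with a Borel integrable
   function.  For nonnegative functions the library integral is the supremum
   of the integrals of the Borel simple functions below, hence it coincides
   with the Lebesgue integral for all Lebesgue measurable integrands. *)
Definition disk_integrable w : Prop :=
  exists2 v : R * R -> R,
    dA.-integrable (toC @^-1` disk) (EFin \o v)
    & {ae dA, forall u, disk (toC u) -> w (toC u) = v u}.

Definition weight w : Prop :=
  (forall z, disk z -> 0 < w z) /\ disk_integrable w.

Definition radial w : Prop := forall z, disk z -> w z = w (cmod z)%:C.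

(* Extended-real valued, so that a divergent integral (only possible at r = 0)
   is not confused with 0 in [doubling]. *)
Definition hatw w (r : R) : \bar R :=
  (\int[lebesgue_measure]_(s in `[r, 1%R[) (w s%:C)%:E)%E.

Definition doubling w : Prop :=
  [/\ weight w, radial w
    & exists2 C : R, 0 < C &
        forall r, 0 <= r < 1 -> (hatw w r < C%:E * hatw w ((1 + r) / 2)%R)%E].

Definition bergman_norm (p : R) w f : \bar R :=
  ((\int[dA]_(u in toC @^-1` disk) (cmod (f (toC u)) `^ p * w (toC u))%R%:E)
     `^ (p^-1)%R)%E.

Definition bergman (p : R) w f : Prop :=
  analytic_on_disk f /\ (bergman_norm p w f < +oo)%E.

Definition bounded_operator (p q : R) w (T : (R[i] -> R[i]) -> R[i] -> R[i]) :=
  exists C : R, forall f, bergman p w f ->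
    bergman q w (T f) /\ (bergman_norm q w (T f) <= C%:E * bergman_norm p w f)%E.

(* Sequential form: the image of a bounded sequence has a convergent subsequence,
   the limit [h] being itself in [A^q_w]. *)
Definition compact_operator (p q : R) w (T : (R[i] -> R[i]) -> R[i] -> R[i]) :=
  (forall f, bergman p w f -> bergman q w (T f)) /\
  forall (F : nat -> R[i] -> R[i]) (M : R),
    (forall j, bergman p w (F j) /\ (bergman_norm p w (F j) <= M%:E)%E) ->
    exists (phi : nat -> nat) (h : R[i] -> R[i]),
      [/\ {homo phi : i j / (i < j)%N}, bergman q w h
        & bergman_norm q w (fun z => T (F (phi j)) z - h z) @[j --> \oo] --> 0%E].

(* [\int_0^z f(t) dt] along the segment [t = s z], [0 <= s <= 1]. *)
Definition volterra f : R[i] -> R[i] := fun z =>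
  z * ((\int[lebesgue_measure]_(s in `[0, 1]) complex.Re (f (s%:C * z)))
       +i* (\int[lebesgue_measure]_(s in `[0, 1]) complex.Im (f (s%:C * z)))).

Definition gen_volterra (g : R[i] -> R[i]) (n k : nat) f : R[i] -> R[i] :=
  iter n volterra (fun z => cderiv k f z * cderiv (n - k) g z).

(* The values of [hatw w] are finite for [w] doubling. *)
Definition symbol_quotient (p q : R) w g (n k : nat) (a : R[i]) : R :=
  ((1 - cmod a) ^+ (n - k) * cmod (cderiv (n - k) g a)) /
  ((1 - cmod a) `^ (p^-1 - q^-1) * fine (hatw w (cmod a)) `^ (p^-1 - q^-1)).

(* [F a] tends to [l] as [|a|] tends to 1 within the disk. *)
Definition lim_boundary (F : R[i] -> R) (l : R) : Prop :=
  forall e : R, 0 < e ->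
    \forall r \near 1^'-, forall a, cmod a = r -> `|F a - l| < e.

End UnitDisk.

(* Main.v *)
Require Import Defs.
From HB Require Import structures.
From mathcomp Require Import all_boot all_order all_algebra.
From mathcomp Require Import complex.
From mathcomp Require Import all_classical all_reals all_analysis.
From mathcomp Require Import measurable_realfun.
From mathcomp Require Import ring lra.

Set Implicit Arguments.
Unset Strict Implicit.
Unset Printing Implicit Defensive.

Import Order.TTheory GRing.Theory Num.Theory.
Import numFieldNormedType.Exports.

Local Open Scope classical_set_scope.
Local Open Scope complex_scope.
Local Open Scope ring_scope.

(** Put m = n - k, W(t) = (1 - t) \hat\omega(t) and delta = 1/p - 1/q.

    Sufficiency.  Subharmonicity of |f|^s for small s and the Hardy-Littlewood
    maximal theorem give a nontangential maximal function N with
    mean N^p <= C (1 + mean |f|^p) on every circle.  On a radius the integrand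
    h = f^(k) g^(m) then obeys two bounds: near the endpoint, h is at most
    N (r - t)^-k (1 - t)^-m W^delta by Cauchy's estimate; everywhere, h is at most
    (1 - t)^-n W^(-1/q) by the growth of A^p functions.  Switching from the second
    to the first at the level W(t0) ~ N^-p, as in Hedberg's inequality, bounds the
    n-fold integral by C N^(p/q), and integration over circles bounds the A^q norm.
    Carrying an additive error eta and a small factor eps through the argument
    yields, with Montel's theorem, compactness when the symbol quotient vanishes
    at the boundary.

    Necessity.  The functions (z - a)^k (1 - conj(a) z)^-(gam + k), scaled to unit
    norm, have at a the largest k-th derivative that the growth of A^p functions
    allows.  As (T f)^(n) = f^(k) g^(m), the growth of the n-th derivatives of A^q
    functions bounds the symbol quotient at a.  These functions tend to 0 locally
    uniformly as |a| -> 1. *)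

(** The exponents dictate the switching level. The near bound carries N W^delta and the far bound
    W^(delta - 1/p) = W^(-1/q); both become N^(p/q) exactly when W = N^(-p), and (N^(p/q))^q = N^p
    is what the maximal theorem integrates. The hypothesis p < q enters as delta > 0: it leaves a
    positive power of the distance to the endpoint in the last of the n integrations, where
    otherwise a logarithmically divergent integral would remain. The argument runs on circles of
    radius r < 1, for which a dilate of f is holomorphic across the closed disk; hence r - t and 1 -
    t occur side by side. The additive 1 in the maximal bound is harmless once f has been scaled to
    mass at most 1. Exponents p <= 1 are reached because |f|^(2^-M) is already subharmonic, so that
    the maximal theorem is used with s = p 2^M >= 2. The estimates see the weight only through its
    tail, which is positive, decreasing and doubling. The weight itself merely agrees almost
    everywhere with a Borel function, so a Borel function of the radius takes its place before polar
    coordinates come in. *)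

Section Modulus.
Context {R : realType}.
Implicit Types (z u : R[i]) (x : R).

Lemma cmodM z u : cmod (z * u) = cmod z * cmod u.
Proof. exact: ComplexField.Normc.normcM. Qed.

Lemma cmodD z u : cmod (z + u) <= cmod z + cmod u.
Proof. exact: le_normcD. Qed.

Lemma cmodN z : cmod (- z) = cmod z.
Proof. exact: normcN. Qed.

Lemma cmodV z : cmod z^-1 = (cmod z)^-1.
Proof. exact: ComplexField.Normc.normcV. Qed.

Lemma cmod0 : cmod (0 : R[i]) = 0.
Proof. exact: ComplexField.Normc.normc0. Qed.

Lemma cmod1 : cmod (1 : R[i]) = 1.
Proof. exact: ComplexField.Normc.normc1. Qed.

Lemma cmod_eq0 z : (cmod z == 0) = (z == 0).
Proof.
apply/eqP/eqP => [|->]; last exact: cmod0.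
exact: ComplexField.Normc.eq0_normc.
Qed.

Lemma cmod_ge0 z : 0 <= cmod z.
Proof. by case: z => a b; rewrite /cmod /= sqrtr_ge0. Qed.

Lemma cmod_gt0 z : (0 < cmod z) = (z != 0).
Proof. by rewrite lt0r cmod_ge0 andbT cmod_eq0. Qed.

Lemma cmodf z u : cmod (z / u) = cmod z / cmod u.
Proof. by rewrite cmodM cmodV. Qed.

Lemma cmodX z n : cmod (z ^+ n) = cmod z ^+ n.
Proof. by elim: n => [|n ih]; rewrite ?expr0 ?cmod1// !exprS cmodM ih. Qed.

Lemma cmodB z u : cmod (z - u) <= cmod z + cmod u.
Proof. by rewrite -(cmodN u) cmodD. Qed.

Lemma cmod_distC z u : cmod (z - u) = cmod (u - z).
Proof. by rewrite -cmodN opprB. Qed.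

Lemma cmod_lb z u : cmod z - cmod u <= cmod (z - u).
Proof. by rewrite lerBlDr (le_trans _ (cmodD _ _))// subrK. Qed.

Lemma cmod_lbD z u : cmod z - cmod u <= cmod (z + u).
Proof. by have := cmod_lb z (- u); rewrite cmodN opprK. Qed.

Lemma realCB x y : (x - y)%:C = x%:C - y%:C :> R[i].
Proof. exact: (rmorphB (real_complex R)). Qed.

Lemma realCD x y : (x + y)%:C = x%:C + y%:C :> R[i].
Proof. exact: (rmorphD (real_complex R)). Qed.

Lemma realCM x y : (x * y)%:C = x%:C * y%:C :> R[i].
Proof. exact: (rmorphM (real_complex R)). Qed.

Lemma realCV x : (x^-1)%:C = (x%:C)^-1 :> R[i].
Proof. exact: (fmorphV (real_complex R)). Qed.

Lemma realC_eq0 x : (x%:C == 0 :> R[i]) = (x == 0).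
Proof. exact: (fmorph_eq0 (real_complex R)). Qed.

Lemma cmodR x : cmod x%:C = `|x|.
Proof. by rewrite /cmod /= expr0n addr0 sqrtr_sqr. Qed.

Lemma cmodR_ge0 x : 0 <= x -> cmod x%:C = x.
Proof. by move=> x0; rewrite cmodR ger0_norm. Qed.

Lemma cmodJ z : cmod (conjc z) = cmod z.
Proof. by case: z => a b; rewrite /cmod /= sqrrN. Qed.

Lemma cmod_nat n : cmod (n%:R : R[i]) = n%:R.
Proof. by rewrite -(rmorph_nat (real_complex R)) cmodR_ge0. Qed.

Lemma sqr_cmod z : cmod z ^+ 2 = complex.Re z ^+ 2 + complex.Im z ^+ 2.
Proof. by case: z => a b; rewrite /cmod /= sqr_sqrtr// addr_ge0 ?sqr_ge0. Qed.

Lemma mul_conjc z : z * conjc z = (cmod z ^+ 2)%:C.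
Proof.
rewrite sqr_cmod; case: z => a b; apply/eqP; rewrite eq_complex /=.
by apply/andP; split; apply/eqP; ring.
Qed.

Lemma norm_Re_le z : `|complex.Re z| <= cmod z.
Proof. by have := normc_ge_Re z; rewrite lecR. Qed.

Lemma norm_Im_le z : `|complex.Im z| <= cmod z.
Proof.
case: z => a b; rewrite /cmod /= -sqrtr_sqr ler_wsqrtr//.
by rewrite lerDr sqr_ge0.
Qed.

Lemma Re_le_cmod z : complex.Re z <= cmod z.
Proof. exact: le_trans (ler_norm _) (norm_Re_le _). Qed.

Lemma cmod_le_Re_Im z : cmod z <= `|complex.Re z| + `|complex.Im z|.
Proof.
rewrite {1}[z]complexE (le_trans (cmodD _ _))// cmodR lerD2l cmodM cmodR.
by rewrite {1}/cmod /= expr0n /= add0r expr1n sqrtr1 mul1r.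
Qed.

Lemma cReD z u : complex.Re (z + u) = complex.Re z + complex.Re u.
Proof. by case: z; case: u. Qed.
Lemma cImD z u : complex.Im (z + u) = complex.Im z + complex.Im u.
Proof. by case: z; case: u. Qed.
Lemma cReN z : complex.Re (- z) = - complex.Re z.
Proof. by case: z. Qed.
Lemma cImN z : complex.Im (- z) = - complex.Im z.
Proof. by case: z. Qed.
Lemma cReM z u : complex.Re (z * u) =
  complex.Re z * complex.Re u - complex.Im z * complex.Im u.
Proof. by case: z; case: u. Qed.
Lemma cImM z u : complex.Im (z * u) =
  complex.Re z * complex.Im u + complex.Im z * complex.Re u.
Proof. by case: z; case: u. Qed.

(** Turns bounds on a modulus into bounds on a real part: an integral or an increment is multiplied
    by the constant [u], after which monotonicity of real integrals or the real mean value theorem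
    applies. *)
Lemma cmod_rotate z : exists2 u, cmod u = 1 & u * z = (cmod z)%:C.
Proof.
have [->|z0] := eqVneq z 0; first by exists 1; rewrite ?cmod1// mulr0 cmod0.
have c0 : cmod z != 0 by rewrite cmod_eq0.
exists (conjc z / (cmod z)%:C).
  by rewrite cmodf cmodJ cmodR_ge0 ?cmod_ge0// divff.
rewrite mulrAC [_ * z]mulrC mul_conjc expr2 realCM mulfK//.
by rewrite realC_eq0.
Qed.

End Modulus.

(** * Complex-valued integrals over [0, 1] *)

Section UnitIntegral.
Context {R : realType}.
Local Notation mu := (@lebesgue_measure R).
Implicit Types (h k : R -> R[i]) (a b : R[i]).

(** Continuity relative to the segment [0, 1], so that curves may be given by total functions
    whatever their values outside. Real functions are embedded into complex ones by [rcont01], and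
    one set of algebraic rules serves both. *)
Definition cont01 h := forall t : R, 0 <= t <= 1 -> forall e : R, 0 < e ->
  exists2 d : R, 0 < d & forall s : R, 0 <= s <= 1 -> `|s - t| < d ->
    cmod (h s - h t) < e.

Definition rcont01 (f : R -> R) := cont01 (fun t => (f t)%:C).

Lemma cont01_cst a : cont01 (fun=> a).
Proof.
by move=> t _ e e0; exists 1 => // s _ _; rewrite subrr cmod0.
Qed.

Lemma cont01D h k : cont01 h -> cont01 k -> cont01 (fun t => h t + k t).
Proof.
move=> ch ck t t01 e e0; have e20 : 0 < e / 2 by lra.
have [d d0 hd] := ch t t01 _ e20; have [d' d'0 kd] := ck t t01 _ e20.
exists (Num.min d d'); first by rewrite lt_min d0.
move=> s s01; rewrite lt_min => /andP[sd sd'].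
have := hd s s01 sd; have := kd s s01 sd'.
have := cmodD (h s - h t) (k s - k t).
rewrite (_ : h s - h t + _ = h s + k s - (h t + k t)); last by ring.
lra.
Qed.

Lemma cont01M h k : cont01 h -> cont01 k -> cont01 (fun t => h t * k t).
Proof.
move=> ch ck t t01 e e0.
set A := cmod (h t) + 1; set B := cmod (k t) + 1.
have A0 : 0 < A by rewrite /A; have := cmod_ge0 (h t); lra.
have B0 : 0 < B by rewrite /B; have := cmod_ge0 (k t); lra.
have eA : 0 < e / (2 * A) by rewrite divr_gt0// mulr_gt0.
have eB : 0 < Num.min (e / (2 * B)) 1 by rewrite lt_min ltr01 divr_gt0// mulr_gt0.
have [d d0 hd] := ch t t01 _ eB; have [d' d'0 kd] := ck t t01 _ eA.
exists (Num.min d d'); first by rewrite lt_min d0.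
move=> s s01; rewrite lt_min => /andP[sd sd'].
have := hd s s01 sd; rewrite lt_min => /andP[h1 h2]; have k1 := kd s s01 sd'.
have hs : cmod (h s) <= A by have := cmod_lb (h s) (h t); rewrite /A; lra.
rewrite (_ : _ - _ = h s * (k s - k t) + (h s - h t) * k t); last by ring.
apply: (le_lt_trans (cmodD _ _)); rewrite !cmodM.
have : cmod (h s) * cmod (k s - k t) <= A * (e / (2 * A)).
  by apply: ler_pM => //; rewrite ?cmod_ge0// ltW.
have : cmod (h s - h t) * cmod (k t) < e / (2 * B) * B.
  have [-> |k0] := eqVneq (cmod (k t)) 0; first by rewrite mulr0 !mulr_gt0// invr_gt0 mulr_gt0.
  by apply: ltr_pM; rewrite ?cmod_ge0// /B; lra.
rewrite (_ : A * _ = e / 2); last by field; lra.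
rewrite (_ : e / (2 * B) * B = e / 2); last by field; lra.
lra.
Qed.

Lemma cont01N h : cont01 h -> cont01 (fun t => - h t).
Proof.
move=> /(cont01M (cont01_cst (-1))).
by under [X in cont01 X -> _]eq_fun do rewrite mulN1r.
Qed.

Lemma cont01B h k : cont01 h -> cont01 k -> cont01 (fun t => h t - k t).
Proof. by move=> ch ck; apply: cont01D => //; exact: cont01N. Qed.

Lemma cont01V h : cont01 h -> (forall t : R, 0 <= t <= 1 -> h t != 0) ->
  cont01 (fun t => (h t)^-1).
Proof.
move=> ch h0 t t01 e e0.
have ht0 : 0 < cmod (h t) by rewrite cmod_gt0 h0.
set m := cmod (h t) in ht0 *.
have m2 : 0 < Num.min (m / 2) (e * m ^+ 2 / 2).
  by rewrite lt_min !divr_gt0//= mulr_gt0// exprn_gt0.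
have [d d0 hd] := ch t t01 _ m2; exists d => // s s01 sd.
have := hd s s01 sd; rewrite lt_min => /andP[h1 h2].
have hs : m / 2 < cmod (h s).
  by have := cmod_lb (h t) (h t - h s); rewrite subKr -/m cmod_distC; lra.
have hs0 : 0 < cmod (h s) by lra.
rewrite (_ : _ - _ = (h t - h s) / (h s * h t)); last first.
  by field; rewrite h0//= h0.
rewrite cmodf cmodM -/m cmod_distC ltr_pdivrMr ?mulr_gt0//.
apply: (lt_le_trans h2); rewrite (_ : _ / 2 = e * (m / 2 * m)); last by ring.
by rewrite ler_pM2l// ler_pM2r//; lra.
Qed.

Lemma cont01_id : rcont01 id.
Proof.
move=> t _ e e0; exists e => // s _; rewrite -realCB cmodR; exact.
Qed.

Lemma cont01_cmod h : cont01 h -> rcont01 (fun t => cmod (h t)).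
Proof.
move=> ch t t01 e e0; have [d d0 hd] := ch t t01 e e0.
exists d => // s s01 sd; apply: le_lt_trans (hd s s01 sd).
rewrite -realCB cmodR ler_norml cmod_lb andbT.
by have := cmod_lb (h t) (h s); rewrite cmod_distC; lra.
Qed.

Lemma cont01_eq h k : (forall t : R, 0 <= t <= 1 -> h t = k t) -> cont01 h -> cont01 k.
Proof.
move=> hk ch t t01 e e0; have [d d0 hd] := ch t t01 e e0.
by exists d => // s s01 sd; rewrite -!hk// hd.
Qed.

Lemma within_rcont01 (f : R -> R) : rcont01 f -> {within `[0, 1], continuous f}.
Proof.
move=> cf; apply/(continuous_within_itvP f ltr01).
have key t (t01 : 0 <= t <= 1) (e : R) (e0 : 0 < e) : exists2 d, 0 < d &
    forall s, 0 <= s <= 1 -> `|t - s| < d -> `|f t - f s| < e.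
  have [d d0 hd] := cf t t01 e e0; exists d => // s s01.
  rewrite distrC => /(hd s s01).
  by rewrite -realCB cmodR distrC.
split.
- move=> t; rewrite in_itv /= => /andP[t0 t1].
  apply/cvgrPdist_lt => e e0.
  have t01 : 0 <= t <= 1 by rewrite !ltW.
  have [d d0 hd] := key t t01 e e0.
  near=> s; apply: hd.
    by apply/andP; split; apply: ltW; near: s; [exact: lt_nbhsr|exact: lt_nbhsl].
  by near: s; exact: (@nbhsx_ballx _ R^o t d d0).
- apply/cvgrPdist_lt => e e0.
  have [d d0 hd] := key 0 ltac:(lra) e e0.
  near=> s; apply: hd.
    by apply/andP; split; apply: ltW; near: s; [exact: nbhs_right_gt|exact: nbhs_right_lt].
  rewrite sub0r normrN gtr0_norm; last by near: s; exact: nbhs_right_gt.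
  by near: s; exact: nbhs_right_lt.
- apply/cvgrPdist_lt => e e0.
  have [d d0 hd] := key 1 ltac:(lra) e e0.
  near=> s; apply: hd.
    by apply/andP; split; apply: ltW; near: s; [exact: nbhs_left_gt|exact: nbhs_left_lt].
  rewrite gtr0_norm; last by rewrite subr_gt0; near: s; exact: nbhs_left_lt.
  rewrite ltrBlDr addrC -ltrBlDr; near: s; apply: nbhs_left_gt; lra.
Unshelve. all: by end_near. Qed.

Lemma rcont01_integrable (f : R -> R) : rcont01 f -> mu.-integrable `[0, 1] (EFin \o f).
Proof.
move=> cf; apply: continuous_compact_integrable; first exact: segment_compact.
exact: within_rcont01.
Qed.

Lemma cont01_Re h : cont01 h -> rcont01 (fun t => complex.Re (h t)).
Proof.
move=> ch t t01 e e0; have [d d0 hd] := ch t t01 e e0.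
exists d => // s s01 sd; apply: le_lt_trans (hd s s01 sd).
by rewrite -realCB cmodR -cReN -cReD norm_Re_le.
Qed.

Lemma cont01_Im h : cont01 h -> rcont01 (fun t => complex.Im (h t)).
Proof.
move=> ch t t01 e e0; have [d d0 hd] := ch t t01 e e0.
exists d => // s s01 sd; apply: le_lt_trans (hd s s01 sd).
by rewrite -realCB cmodR -cImN -cImD norm_Im_le.
Qed.

Definition rint (f : R -> R) : R := \int[mu]_(s in `[0, 1]) f s.
Definition cint h : R[i] :=
  rint (fun s => complex.Re (h s)) +i* rint (fun s => complex.Im (h s)).

Lemma in01 (s : R) : (s \in [set` `[(0 : R), 1]]) = (0 <= s <= 1).
Proof. by rewrite mem_setE in_itv. Qed.

Lemma eq_rint (f g : R -> R) : (forall s : R, 0 <= s <= 1 -> f s = g s) -> rint f = rint g.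
Proof. by move=> fg; apply: eq_Rintegral => s; rewrite in01; exact: fg. Qed.

Lemma rintD (f g : R -> R) : rcont01 f -> rcont01 g ->
  rint (fun s => f s + g s) = rint f + rint g.
Proof. by move=> cf cg; apply: RintegralD => //; exact: rcont01_integrable. Qed.

Lemma rintZ (c : R) (f : R -> R) : rcont01 f -> rint (fun s => c * f s) = c * rint f.
Proof. by move=> cf; apply: RintegralZl => //; exact: rcont01_integrable. Qed.

Lemma le_rint (f g : R -> R) : rcont01 f -> rcont01 g ->
  (forall s : R, 0 <= s <= 1 -> f s <= g s) -> rint f <= rint g.
Proof.
move=> cf cg fg; apply: le_Rintegral => //; try exact: rcont01_integrable.
Qed.

Lemma rint_cst (c : R) : rint (fun=> c) = c.
Proof.
rewrite /rint Rintegral_cst//= lebesgue_measure_itv /= lte_fin ltr01.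
by rewrite -EFinB subr0 /= mulr1.
Qed.

Lemma rint_ge0 (f : R -> R) : (forall s : R, 0 <= s <= 1 -> 0 <= f s) -> 0 <= rint f.
Proof. by move=> f0; apply: Rintegral_ge0 => s /=; rewrite in_itv; exact: f0. Qed.

Lemma eq_cint h k : (forall s : R, 0 <= s <= 1 -> h s = k s) -> cint h = cint k.
Proof.
by move=> hk; congr (_ +i* _); apply: eq_rint => s s01; rewrite hk.
Qed.

Lemma cintD h k : cont01 h -> cont01 k -> cint (fun s => h s + k s) = cint h + cint k.
Proof.
move=> ch ck; rewrite /cint.
under [X in rint X +i* _]eq_fun do rewrite cReD.
under [X in _ +i* rint X]eq_fun do rewrite cImD.
by rewrite !rintD; do ?[exact: cont01_Re|exact: cont01_Im].
Qed.

Lemma cintZ a h : cont01 h -> cint (fun s => a * h s) = a * cint h.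
Proof.
move=> ch; rewrite /cint.
have cr := cont01_Re ch; have ci := cont01_Im ch.
have crz (c : R) f : rcont01 f -> rcont01 (fun t => c * f t).
  by move=> cf; apply: (@cont01_eq _ _ (fun t _ => esym (realCM c (f t)))); apply: cont01M => //; exact: cont01_cst.
have -> : (fun s => complex.Re (a * h s)) =
    (fun s => complex.Re a * complex.Re (h s) + (- complex.Im a) * complex.Im (h s)).
  by apply/funext => s; rewrite cReM; ring.
have -> : (fun s => complex.Im (a * h s)) =
    (fun s => complex.Re a * complex.Im (h s) + complex.Im a * complex.Re (h s)).
  by apply/funext => s; rewrite cImM.
rewrite !rintD ?rintZ//; try exact: crz.
by apply/eqP; rewrite eq_complex; case: (a) => x y /=; apply/andP; split; apply/eqP; ring.
Qed.

Lemma cintN h : cont01 h -> cint (fun s => - h s) = - cint h.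
Proof.
move=> ch; rewrite -mulN1r -cintZ//; apply: eq_cint => s _; by rewrite mulN1r.
Qed.

Lemma cintB h k : cont01 h -> cont01 k -> cint (fun s => h s - k s) = cint h - cint k.
Proof. by move=> ch ck; rewrite cintD ?cintN//; exact: cont01N. Qed.

Lemma cint_cst a : cint (fun=> a) = a.
Proof. by rewrite /cint !rint_cst; case: a. Qed.

Lemma cint_real (f : R -> R) : cint (fun s => (f s)%:C) = (rint f)%:C.
Proof. by rewrite /cint /= rint_cst. Qed.

Lemma Re_cint h : complex.Re (cint h) = rint (fun s => complex.Re (h s)).
Proof. by []. Qed.

(** After rotating [cint h] onto the positive real axis, its modulus is the integral of a real part.
    Estimating the real and imaginary parts separately would lose a constant factor. *)
Lemma cmod_cint h (f : R -> R) : cont01 h -> rcont01 f ->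
  (forall s : R, 0 <= s <= 1 -> cmod (h s) <= f s) -> cmod (cint h) <= rint f.
Proof.
move=> ch cf hf; have [u u1 uE] := cmod_rotate (cint h).
have cu : cont01 (fun s => u * h s) by apply: cont01M => //; exact: cont01_cst.
have -> : cmod (cint h) = complex.Re (cint (fun s => u * h s)).
  by rewrite cintZ// uE.
rewrite Re_cint; apply: le_rint => //; first exact: cont01_Re.
move=> s s01; apply: (le_trans (Re_le_cmod _)).
by rewrite cmodM u1 mul1r hf.
Qed.

Lemma cmod_cint_le h (M : R) : cont01 h ->
  (forall s : R, 0 <= s <= 1 -> cmod (h s) <= M) -> cmod (cint h) <= M.
Proof.
move=> ch hM; rewrite -(rint_cst M); apply: cmod_cint => //.
exact: cont01_cst.
Qed.

End UnitIntegral.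

(** * Path integrals along segments; complex differentiability *)

Section SegmentIntegral.
Context {R : realType}.
Local Notation mu := (@lebesgue_measure R).
Implicit Types (h : R -> R[i]) (f : R[i] -> R[i]).

Lemma cont01_affine h (a c : R) : cont01 h ->
  (forall t : R, 0 <= t <= 1 -> 0 <= a + c * t <= 1) ->
  cont01 (fun t => h (a + c * t)).
Proof.
move=> ch ac t t01 e e0; have [d d0 hd] := ch _ (ac t t01) e e0.
have c1 : 0 < `|c| + 1 by have := normr_ge0 c; lra.
exists (d / (`|c| + 1)); first by rewrite divr_gt0.
move=> s s01 std; apply: hd; first exact: ac.
rewrite (_ : _ - _ = c * (s - t)); last by ring.
rewrite normrM; move: std; rewrite ltr_pdivlMr//.
by have := normr_ge0 (s - t); lra.
Qed.

Lemma rint_affine (f : R -> R) (a c : R) : 0 < c -> 0 <= a -> a + c <= 1 ->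
  rcont01 f ->
  \int[mu]_(x in `[a, a + c]) f x = c * rint (fun x => f (a + c * x)).
Proof.
move=> c0 a0 ac1 cf.
pose F (x : R) := a + c * x.
have dF (x : R) : is_derive x 1 F c.
  have -> : F = (cst a + (c *: id))%R by apply/funext => y; rewrite /F fctE.
  apply: (is_derive_eq (is_deriveD (is_derive_cst a x 1) (is_deriveZ c (is_derive_id x 1)))).
  by rewrite add0r /GRing.scale/= mulr1.
have F' : derive1 F = cst c.
  by apply/funext => x; rewrite derive1E; have /@derive_val := dF x.
have contF : continuous F.
  by move=> x; apply: differentiable_continuous; apply/derivable1_diffP; case: (dF x).
have F0 : F 0 = a by rewrite /F mulr0 addr0.
have F1 : F 1 = a + c by rewrite /F mulr1.
have cfF : {within `[F 0, F 1], continuous f}.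
  rewrite F0 F1; apply: (continuous_subspaceW _ (within_rcont01 cf)).
  by move=> x /=; rewrite !in_itv /= => /andP[xa xc]; lra.
have := @integration_by_substitution_increasing R F f 0 1 ler01.
rewrite F0 F1 /Rintegral => ->//; last first.
- by move: cfF; rewrite F0 F1.
- split; first by move=> x _; case: (dF x).
  - by apply: cvg_at_right_filter; exact: contF.
  - by apply: cvg_at_left_filter; exact: contF.
- by rewrite F'; exact: is_cvg_cst.
- by rewrite F'; exact: is_cvg_cst.
- by rewrite F' => x _; exact: cst_continuous.
- by move=> x y _ _ xy; rewrite /F ltrD2l ltr_pM2l.
rewrite -rintZ.
  by rewrite /rint; congr fine; apply: eq_integral => x _; rewrite /= F' /= mulrC.
by apply: (cont01_affine cf) => t t01; nra.
Qed.

Lemma rint_split (f : R -> R) : rcont01 f ->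
  rint f = 2^-1 * (rint (fun x => f (0 + 2^-1 * x)) + rint (fun x => f (2^-1 + 2^-1 * x))).
Proof.
move=> cf; rewrite mulrDr -!rint_affine//; try lra.
have := Rintegral_itvB (rcont01_integrable cf) (_ : (BLeft 0 <= BRight (2^-1:R))%O) (_ : (BRight (2^-1:R) <= BRight 1)%O).
rewrite !bnd_simp => /(_ _ _)/eqP; rewrite subr_eq => H.
have -> : (2^-1 + 2^-1 = 1 :> R) by lra.
rewrite add0r.
rewrite {1}/rint (eqP (H _ _)) ?invr_ge0//; last by rewrite invf_le1//; lra.
rewrite addrC; congr (_ + _).
rewrite Rintegral_itv_obnd_cbnd//.
apply: integrableS (rcont01_integrable cf) => //.
by move=> x /=; rewrite !in_itv /= => /andP[xa xc]; lra.
Qed.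

(** Both halves are reparametrised by [0, 1], which makes path integrals additive at midpoints, as
    the subdivision of triangles requires. *)
Lemma cint_split h : cont01 h ->
  cint h = 2^-1 * (cint (fun x => h (0 + 2^-1 * x)) + cint (fun x => h (2^-1 + 2^-1 * x))).
Proof.
move=> ch; rewrite /cint (rint_split (cont01_Re ch)) (rint_split (cont01_Im ch)).
apply/eqP; have -> : (2^-1 : R[i]) = (2^-1 : R)%:C by rewrite realCV (rmorph_nat (real_complex R)).
by rewrite eq_complex /= !mul0r subr0 addr0 !eqxx.
Qed.

Lemma rint_rev (f : R -> R) : rcont01 f -> rint f = rint (fun x => f (1 - x)).
Proof.
move=> cf; rewrite /rint Rintegration_by_substitution_onem ?lexx ?ler01//; last exact: within_rcont01.
by rewrite /unstable.onem subrr.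
Qed.

Lemma cint_rev h : cont01 h -> cint h = cint (fun x => h (1 - x)).
Proof.
by move=> ch; congr (_ +i* _); [rewrite (rint_rev (cont01_Re ch))|rewrite (rint_rev (cont01_Im ch))].
Qed.

Lemma rint_id : rint (fun x : R => x) = 2^-1.
Proof.
have c1 : rcont01 (fun x : R => x) by exact: cont01_id.
have := rint_rev c1.
have -> : rint (fun x : R => 1 - x) = rint (fun _ : R => 1) + rint (fun x : R => -1 * x).
  rewrite -rintD; [by apply: eq_rint => s _; rewrite mulN1r|exact: cont01_cst|].
  apply: (@cont01_eq _ (fun t : R => (-1)%:C * t%:C)) => [t _|]; first by rewrite -realCM.
  by apply: cont01M => //; exact: cont01_cst.
by rewrite rintZ// rint_cst; lra.
Qed.

Definition ccont f (z : R[i]) := forall e : R, 0 < e -> exists2 r : R, 0 < r &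
  forall w, cmod (w - z) < r -> cmod (f w - f z) < e.

Definition cdiff f (z d : R[i]) := forall e : R, 0 < e -> exists2 r : R, 0 < r &
  forall h : R[i], cmod h < r -> cmod (f (z + h) - f z - d * h) <= e * cmod h.

(** Mere differentiability at each point of the open disk of radius [r] about 0. That the derivative
    is again [holo] is the content of [holo_derivative]. *)
Definition holo (r : R) f := forall z, cmod z < r -> exists d, cdiff f z d.

Lemma cdiff_ccont f z d : cdiff f z d -> ccont f z.
Proof.
move=> fd e e0; have [r r0 H] := fd 1 ltr01.
set K := cmod d + 1; have K0 : 0 < K by rewrite /K; have := cmod_ge0 d; lra.
exists (Num.min r (e / K)); first by rewrite lt_min r0 divr_gt0.
move=> w; rewrite lt_min => /andP[wr]; rewrite ltr_pdivlMr// => wK.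
have := H _ wr; rewrite [z + _]addrC subrK mul1r => Hw.
have := cmod_lb (f w - f z) (d * (w - z)); rewrite cmodM.
move: wK; rewrite /K; nra.
Qed.

Lemma holo_ccont r f z : holo r f -> cmod z < r -> ccont f z.
Proof. by move=> hf /hf[d]; exact: cdiff_ccont. Qed.

Lemma cmod_seg (a b : R[i]) (r t : R) : 0 <= t <= 1 -> cmod a < r -> cmod b < r ->
  cmod (a + t%:C * (b - a)) < r.
Proof.
move=> t01 ar br.
have -> : a + t%:C * (b - a) = (1 - t)%:C * a + t%:C * b by rewrite realCB; ring.
apply: (le_lt_trans (cmodD _ _)); rewrite !cmodM !cmodR_ge0; try lra.
have [->|t0] := eqVneq t 0; first lra.
have : 0 < t * (r - cmod b) by rewrite mulr_gt0 ?subr_gt0// lt0r t0; lra.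
have : 0 <= (1 - t) * (r - cmod a) by rewrite mulr_ge0 ?subr_ge0 ?(ltW ar)//; lra.
lra.
Qed.

Lemma cont01_comp f h : (forall t : R, 0 <= t <= 1 -> ccont f (h t)) -> cont01 h ->
  cont01 (fun t => f (h t)).
Proof.
move=> cf ch t t01 e e0; have [r r0 fr] := cf t t01 e e0.
have [d d0 hd] := ch t t01 r r0; exists d => // s s01 sd; exact/fr/hd.
Qed.

Lemma cont01_line (a b : R[i]) : cont01 (fun t => a + t%:C * b).
Proof.
apply: cont01D; first exact: cont01_cst.
by apply: cont01M; [exact: cont01_id|exact: cont01_cst].
Qed.

Lemma cont01_seg r f a b : (forall z, cmod z < r -> ccont f z) -> cmod a < r -> cmod b < r ->
  cont01 (fun t => f (a + t%:C * (b - a))).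
Proof.
move=> cf ar br; apply: cont01_comp; last exact: cont01_line.
by move=> t t01; apply: cf; exact: cmod_seg.
Qed.

(** The path integral over the oriented segment from [a] to [b]. *)
Definition cseg f (a b : R[i]) := (b - a) * cint (fun t => f (a + t%:C * (b - a))).

Lemma cseg_split r f a b : (forall z, cmod z < r -> ccont f z) -> cmod a < r -> cmod b < r ->
  cseg f a b = cseg f a ((a + b) / 2) + cseg f ((a + b) / 2) b.
Proof.
move=> cf ar br; rewrite /cseg (cint_split (cont01_seg cf ar br)).
have -> : cint (fun x => f (a + (0 + 2^-1 * x)%:C * (b - a))) =
    cint (fun t => f (a + t%:C * ((a + b) / 2 - a))).
  apply: eq_cint => s _; congr f; rewrite add0r realCM realCV (rmorph_nat (real_complex R)); by field.
have -> : cint (fun x => f (a + (2^-1 + 2^-1 * x)%:C * (b - a))) =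
    cint (fun t => f ((a + b) / 2 + t%:C * (b - (a + b) / 2))).
  apply: eq_cint => s _; congr f; rewrite realCD realCM realCV (rmorph_nat (real_complex R)); by field.
by field.
Qed.

Lemma cseg_rev r f a b : (forall z, cmod z < r -> ccont f z) -> cmod a < r -> cmod b < r ->
  cseg f b a = - cseg f a b.
Proof.
move=> cf ar br; rewrite /cseg (cint_rev (cont01_seg cf ar br)) -mulNr opprB; congr (_ * _).
by apply: eq_cint => s _; congr f; rewrite realCB; ring.
Qed.

Lemma cmod_cseg_le f a b (M : R) : cont01 (fun t => f (a + t%:C * (b - a))) ->
  (forall t : R, 0 <= t <= 1 -> cmod (f (a + t%:C * (b - a))) <= M) ->
  cmod (cseg f a b) <= cmod (b - a) * M.
Proof. by move=> cf fM; rewrite cmodM ler_wpM2l ?cmod_ge0//; exact: cmod_cint_le. Qed.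

(** The midpoint rule is exact on affine functions. Summed over the sides of a triangle these values
    cancel, so subtracting a first-order approximation does not change a triangle integral. *)
Lemma cseg_affine (u v a b : R[i]) : cseg (fun z => u + v * z) a b = (b - a) * (u + v * ((a + b) / 2)).
Proof.
rewrite /cseg; congr (_ * _).
have -> : cint (fun t => u + v * (a + t%:C * (b - a))) =
    cint (fun t => (u + v * a) + (v * (b - a)) * t%:C).
  by apply: eq_cint => s _; ring.
have cid : cont01 (fun t : R => t%:C) by exact: cont01_id.
rewrite cintD ?cintZ//; [|exact: cont01_cst|by apply: cont01M => //; exact: cont01_cst].
rewrite cint_cst cint_real rint_id realCV (rmorph_nat (real_complex R)); by field.
Qed.

Lemma csegD f g a b : cont01 (fun t => f (a + t%:C * (b - a))) ->
  cont01 (fun t => g (a + t%:C * (b - a))) ->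
  cseg (fun z => f z + g z) a b = cseg f a b + cseg g a b.
Proof. by move=> cf cg; rewrite /cseg cintD// mulrDr. Qed.

End SegmentIntegral.

(** * Goursat's lemma and primitives on a disk *)

Section Goursat.
Context {R : realType}.
Implicit Types (f : R[i] -> R[i]).

Lemma exists_exp2 (K e : R) : 0 < e -> exists n : nat, K / 2 ^+ n < e.
Proof.
move=> e0; have [n nP] : exists n, K / e < 2 ^+ n.
  by exists (Num.bound (K / e)); exact: upper_nthrootP.
by exists n; rewrite ltr_pdivrMr ?exprn_gt0// mulrC -ltr_pdivrMr.
Qed.

(** The intervals of centre [x m] and radius 2 K / 2^m meet pairwise, so the supremum of their left
    ends lies in all of them. This gives the limit together with its rate, needed for the vertices
    of nested triangles. *)
Lemma geometric_cauchy_limit (x : nat -> R) (K : R) :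
  (forall n, `|x n.+1 - x n| <= K / 2 ^+ n) ->
  exists l, forall n, `|x n - l| <= 2 * K / 2 ^+ n.
Proof.
move=> xK.
have K0 : 0 <= K by have := xK 0%N; rewrite expr0 divr1; apply: le_trans.
pose q n := K / 2 ^+ n.
have qS n : q n = 2 * q n.+1 by rewrite /q exprS; field; rewrite expf_neq0.
have q0 n : 0 <= q n by rewrite divr_ge0// exprn_ge0.
have step m n : `|x (n + m)%N - x n| <= 2 * q n - 2 * q (n + m)%N.
  elim: m => [|m ih]; first by rewrite addn0 !subrr normr0.
  rewrite addnS (_ : _ - x n = (x (n + m).+1 - x (n + m)%N) + (x (n + m)%N - x n)); last by ring.
  apply: (le_trans (ler_normD _ _)).
  have := xK (n + m)%N; rewrite -/(q (n + m)%N) => xq; have := qS (n + m)%N; lra.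
have bnd m n : x m - 2 * q m <= x n + 2 * q n.
  have [mn|/ltnW nm] := leqP m n.
    have := step (n - m)%N m; rewrite subnKC// ler_norml => /andP[+ _].
    by have := q0 n; lra.
  have := step (m - n)%N n; rewrite subnKC// ler_norml => /andP[_].
  by have := q0 m; lra.
pose E := [set x m - 2 * q m | m in setT].
have hE : has_sup E.
  split; first by exists (x 0%N - 2 * q 0%N), 0%N.
  by exists (x 0%N + 2 * q 0%N) => _ [m _ <-]; exact: bnd.
exists (sup E) => n; rewrite -mulrA -/(q n) ler_distl; apply/andP; split.
  by rewrite lerBlDr; apply: sup_le_ub; [exact: hE.1|move=> _ [m _ <-]; exact: bnd].
by rewrite -lerBlDr; apply: (sup_upper_bound hE); exists n.
Qed.

Definition tri f (T : R[i] * R[i] * R[i]) : R[i] :=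
  cseg f T.1.1 T.1.2 + cseg f T.1.2 T.2 + cseg f T.2 T.1.1.

Definition perim (T : R[i] * R[i] * R[i]) : R :=
  cmod (T.1.2 - T.1.1) + cmod (T.2 - T.1.2) + cmod (T.1.1 - T.2).

Definition inball (r : R) (T : R[i] * R[i] * R[i]) :=
  [/\ cmod T.1.1 < r, cmod T.1.2 < r & cmod T.2 < r].

(** Midpoint subdivision, oriented so that every inner side is traversed once in each direction. The
    first vertex of a child is within one perimeter of the first vertex of its parent, which makes
    the nested vertices a Cauchy sequence. *)
Definition children (T : R[i] * R[i] * R[i]) : seq (R[i] * R[i] * R[i]) :=
  let: (a, b, c) := T in
  let x := (a + b) / 2 in let y := (b + c) / 2 in let z := (c + a) / 2 in
  [:: (a, x, z); (x, b, y); (z, y, c); (x, y, z)].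

Lemma cmod_half (u : R[i]) : cmod (u / 2) = cmod u / 2.
Proof. by rewrite cmodf cmod_nat. Qed.

Lemma perim_children T T' : T' \in children T -> perim T' = perim T / 2.
Proof.
case: T => [[a b] c]; rewrite /perim !inE => /or4P[] /eqP -> /=.
- rewrite (_ : (a + b) / 2 - a = (b - a) / 2); last by field.
  rewrite (_ : (c + a) / 2 - (a + b) / 2 = (c - b) / 2); last by field.
  rewrite (_ : a - (c + a) / 2 = (a - c) / 2); last by field.
  by rewrite !cmod_half; lra.
- rewrite (_ : b - (a + b) / 2 = (b - a) / 2); last by field.
  rewrite (_ : (b + c) / 2 - b = (c - b) / 2); last by field.
  rewrite (_ : (a + b) / 2 - (b + c) / 2 = (a - c) / 2); last by field.
  by rewrite !cmod_half; lra.
- rewrite (_ : (b + c) / 2 - (c + a) / 2 = (b - a) / 2); last by field.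
  rewrite (_ : c - (b + c) / 2 = (c - b) / 2); last by field.
  rewrite (_ : (c + a) / 2 - c = (a - c) / 2); last by field.
  by rewrite !cmod_half; lra.
- rewrite (_ : (b + c) / 2 - (a + b) / 2 = - ((a - c) / 2)); last by field.
  rewrite (_ : (c + a) / 2 - (b + c) / 2 = - ((b - a) / 2)); last by field.
  rewrite (_ : (a + b) / 2 - (c + a) / 2 = - ((c - b) / 2)); last by field.
  by rewrite !cmodN !cmod_half; lra.
Qed.

Lemma cmod_mid (r : R) (a b : R[i]) : cmod a < r -> cmod b < r -> cmod ((a + b) / 2) < r.
Proof. by move=> ar br; rewrite cmod_half; have := cmodD a b; lra. Qed.

Lemma inball_children r T T' : inball r T -> T' \in children T -> inball r T'.
Proof.
case: T => [[a b] c] [/= ar br cr]; rewrite !inE => /or4P[] /eqP ->; split => //=;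
  exact: cmod_mid.
Qed.

Lemma first_vertex_children T T' : T' \in children T -> cmod (T'.1.1 - T.1.1) <= perim T.
Proof.
case: T => [[a b] c]; rewrite /perim /=.
have := cmod_ge0 (b - a); have := cmod_ge0 (c - b); have := cmod_ge0 (a - c).
have E1 : (a + b) / 2 - a = (b - a) / 2 by field.
have E2 : (c + a) / 2 - a = - ((a - c) / 2) by field.
move=> ? ? ?; rewrite !inE => /or4P[] /eqP -> /=; rewrite ?subrr ?cmod0 ?E1 ?E2 ?cmodN ?cmod_half; lra.
Qed.

Lemma tri_split r f T : (forall z, cmod z < r -> ccont f z) -> inball r T ->
  tri f T = \sum_(T' <- children T) tri f T'.
Proof.
move=> cf; case: T => [[a b] c] [/= ar br cr].
rewrite !big_cons big_nil /tri /=.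
set x := (a + b) / 2; set y := (b + c) / 2; set z := (c + a) / 2.
have xr : cmod x < r by exact: cmod_mid.
have yr : cmod y < r by exact: cmod_mid.
have zr : cmod z < r by exact: cmod_mid.
rewrite (cseg_split cf ar br) (cseg_split cf br cr) (cseg_split cf cr ar).
rewrite -/x -/y -/z (cseg_rev cf xr yr) (cseg_rev cf yr zr) (cseg_rev cf zr xr).
ring.
Qed.

(** If all four children carried less than a quarter of the modulus, the triangle inequality in
    [tri_split] would make [cmod (tri f T)] smaller than itself. *)
Lemma tri_child r f T : (forall z, cmod z < r -> ccont f z) -> inball r T ->
  exists2 T', T' \in children T & cmod (tri f T) <= 4 * cmod (tri f T').
Proof.
move=> cf Tr; apply: contrapT => H.
have {}H T' : T' \in children T -> 4 * cmod (tri f T') < cmod (tri f T).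
  by move=> TT'; rewrite ltNge; apply/negP => ?; apply: H; exists T'.
move: (tri_split cf Tr); move: H.
case: T Tr => [[a b] c] Tr H; rewrite !big_cons big_nil.
set x := (a + b) / 2; set y := (b + c) / 2; set z := (c + a) / 2.
set t1 := (a, x, z); set t2 := (x, b, y); set t3 := (z, y, c); set t4 := (x, y, z).
have := H t1; have := H t2; have := H t3; have := H t4.
rewrite !inE !eqxx !orbT => /(_ isT) h4 /(_ isT) h3 /(_ isT) h2 /(_ isT) h1 E.
clearbody t1 t2 t3 t4.
have := cmodD (tri f t1) (tri f t2 + (tri f t3 + (tri f t4 + 0))).
have := cmodD (tri f t2) (tri f t3 + (tri f t4 + 0)).
have := cmodD (tri f t3) (tri f t4 + 0); rewrite addr0 in E *.
move: h1 h2 h3 h4; rewrite E; lra.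
Qed.

(** The first-order approximation at [p] is affine and integrates to 0 around the triangle, so only
    the remainder [g], bounded by [e], contributes. Points of the sides lie within one perimeter of
    the first vertex, whence the radius in the hypothesis. *)
Lemma tri_small f T (p d : R[i]) (r' e : R) :
  (forall z, cmod z < r' -> ccont f z) -> inball r' T ->
  (forall w, cmod (w - p) <= cmod (T.1.1 - p) + perim T ->
     cmod (f w - f p - d * (w - p)) <= e) ->
  cmod (tri f T) <= perim T * e.
Proof.
case: T => [[a b] c] cf [/= ar br cr] He.
pose g w := f w - f p - d * (w - p).
pose l w := (f p - d * p) + d * w.
have fE : f = (fun w => g w + l w) by apply/funext => w; rewrite /g /l; ring.
have cl z : ccont l z.
  apply: (@cdiff_ccont _ _ z d) => e' e'0; exists 1 => // h _.
  rewrite (_ : _ - _ - _ = 0) ?cmod0 ?mulr_ge0 ?cmod_ge0 ?ltW// /l; ring.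
have cg z : cmod z < r' -> ccont g z.
  move=> zr e' e'0; have e2 : 0 < e' / 2 by lra.
  have [r1 r10 H1] := cf z zr _ e2; have [r2 r20 H2] := cl z _ e2.
  exists (Num.min r1 r2); first by rewrite lt_min r10.
  move=> w; rewrite lt_min => /andP[/H1 + /H2].
  have := cmodB (f w - f z) (l w - l z).
  rewrite (_ : f w - f z - _ = g w - g z); last by rewrite /g /l; ring.
  lra.
have T0 : tri f (a, b, c) = tri g (a, b, c).
  have cs h (u v : R[i]) : (forall z, cmod z < r' -> ccont h z) -> cmod u < r' -> cmod v < r' ->
     cont01 (fun t => h (u + t%:C * (v - u))) by exact: cont01_seg.
  have El (u v : R[i]) : cmod u < r' -> cmod v < r' -> cseg f u v = cseg g u v + cseg l u v.
    by move=> ur vr; rewrite {1}fE (csegD (cs g u v cg ur vr) (cs l u v (fun z _ => cl z) ur vr)).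
  rewrite /tri /= !El// /l !cseg_affine; by field.
rewrite T0 /tri /=.
have side (u v : R[i]) : cmod u < r' -> cmod v < r' ->
    (forall t : R, 0 <= t <= 1 -> cmod (u + t%:C * (v - u) - a) <= perim (a, b, c)) ->
    cmod (cseg g u v) <= cmod (v - u) * e.
  move=> ur vr H; apply: cmod_cseg_le; first exact: cont01_seg cg _ _.
  move=> t t01; apply: He.
  rewrite (_ : u + _ - p = (a - p) + (u + t%:C * (v - u) - a)); last by ring.
  by apply: (le_trans (cmodD _ _)); rewrite lerD2l H.
have Hab := side a b ar br; have Hbc := side b c br cr; have Hca := side c a cr ar.
have c1 := cmod_ge0 (b - a); have c2 := cmod_ge0 (c - b); have c3 := cmod_ge0 (a - c).
apply: (le_trans (cmodD _ _)).
have {}Hab : cmod (cseg g a b) <= cmod (b - a) * e.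
  apply: Hab => t t01; rewrite (_ : _ - a = t%:C * (b - a)); last by ring.
  rewrite cmodM cmodR_ge0 /perim /=; last lra.
  have : t * cmod (b - a) <= 1 * cmod (b - a) by apply: ler_wpM2r => //; lra.
  lra.
have {}Hbc : cmod (cseg g b c) <= cmod (c - b) * e.
  apply: Hbc => t t01; rewrite (_ : _ - a = (b - a) + t%:C * (c - b)); last by ring.
  apply: (le_trans (cmodD _ _)).
  rewrite cmodM cmodR_ge0 /perim /=; last lra.
  have : t * cmod (c - b) <= 1 * cmod (c - b) by apply: ler_wpM2r => //; lra.
  lra.
have {}Hca : cmod (cseg g c a) <= cmod (a - c) * e.
  apply: Hca => t t01; rewrite (_ : _ - a = (1 - t)%:C * (c - a)); last by rewrite realCB; ring.
  rewrite cmodM cmodR_ge0 /perim /=; last lra.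
  rewrite [cmod (c - a)]cmod_distC.
  have : (1 - t) * cmod (a - c) <= 1 * cmod (a - c) by apply: ler_wpM2r => //; lra.
  lra.
have := cmodD (cseg g a b) (cseg g b c).
rewrite /perim /= !mulrDl; lra.
Qed.

(** The selected n-th descendant carries at least 4^-n of the integral, while differentiability at
    the limit point bounds its integral by a multiple of [e] times its squared perimeter, which is
    4^-n of the original one. The powers of 4 cancel and [e] is arbitrary. *)
Theorem goursat r f T : holo r f -> inball r T -> tri f T = 0.
Proof.
move=> hf Tr; have cf z : cmod z < r -> ccont f z by exact: holo_ccont.
(* The ball condition sits inside the property so that [choice] yields a total successor function;
   outside the ball any child will do. *)
pose good (S S' : R[i] * R[i] * R[i]) := S' \in children S /\ (inball r S -> cmod (tri f S) <= 4 * cmod (tri f S')).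
have /choice[nxt nxtP] : forall S, exists S', good S S'.
  move=> S; have [Sr|Sr] := pselect (inball r S).
    by have [S' S'S le] := tri_child cf Sr; exists S'.
  case: S Sr => [[a b] c] Sr; exists (a, (a + b) / 2, (c + a) / 2).
  by split => //; rewrite inE eqxx.
pose S n := iter n nxt T.
have Sr n : inball r (S n).
  by elim: n => // n ih; apply: (inball_children ih); exact: (nxtP _).1.
have Sp n : perim (S n) = perim T / 2 ^+ n.
  elim: n => [|n ih]; first by rewrite expr0 divr1.
  by rewrite (perim_children (nxtP _).1) ih exprS; field; rewrite expf_neq0.
have St n : cmod (tri f T) <= 4 ^+ n * cmod (tri f (S n)).
  elim: n => [|n ih]; first by rewrite expr0 mul1r.
  apply: (le_trans ih); rewrite exprSr -mulrA ler_wpM2l ?exprn_ge0//.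
  exact: (nxtP _).2.
have Sv n : cmod ((S n.+1).1.1 - (S n).1.1) <= perim T / 2 ^+ n.
  by rewrite -Sp; apply: first_vertex_children; exact: (nxtP _).1.
have [x xP] : exists l, forall n, `|complex.Re (S n).1.1 - l| <= 2 * perim T / 2 ^+ n.
  apply: geometric_cauchy_limit => n; apply: le_trans (Sv n).
  by rewrite -cReN -cReD norm_Re_le.
have [y yP] : exists l, forall n, `|complex.Im (S n).1.1 - l| <= 2 * perim T / 2 ^+ n.
  apply: geometric_cauchy_limit => n; apply: le_trans (Sv n).
  by rewrite -cImN -cImD norm_Im_le.
pose p := x +i* y.
have pP n : cmod ((S n).1.1 - p) <= 4 * (perim T / 2 ^+ n).
  apply: (le_trans (cmod_le_Re_Im _)).
  have := xP n; have := yP n; rewrite cReD cImD cReN cImN /=; lra.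
(* A limit of points of an open ball could lie on its boundary. The nested triangles all stay in the
   ball of radius (m + r) / 2, where [m] is the largest modulus of a vertex of [T]. *)
have pr : cmod p < r.
  pose m := Num.max (cmod T.1.1) (Num.max (cmod T.1.2) (cmod T.2)).
  have mr : m < r by case: Tr => ? ? ?; rewrite !gt_max; apply/and3P; split.
  pose m' := (m + r) / 2.
  have Sm n : inball m' (S n).
    elim: n => [|n ih]; last by apply: (inball_children ih); exact: (nxtP _).1.
    by split; apply: (@le_lt_trans _ _ m); rewrite /m' /m ?le_max ?lexx ?orbT//; rewrite -/m; lra.
  have rm : 0 < (r - m) / 2 by lra.
  have [n nP] := exists_exp2 (4 * perim T) rm.
  have := cmod_lb p (p - (S n).1.1); rewrite subKr.
  have := pP n; rewrite cmod_distC; have [+ _ _] := Sm n; rewrite /m'; move: nP; lra.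
have [d fd] := hf p pr.
have key (e : R) : 0 < e -> cmod (tri f T) <= 5 * e * perim T ^+ 2.
  move=> e0; have [s s0 sP] := fd e e0.
  have [n nP] := exists_exp2 (5 * perim T) s0.
  apply: (le_trans (St n)).
  have : cmod (tri f (S n)) <= perim (S n) * (e * (5 * (perim T / 2 ^+ n))).
    apply: (@tri_small f _ p d r) => // w wp.
    have {}wp : cmod (w - p) <= 5 * (perim T / 2 ^+ n).
      by move: wp (pP n); rewrite Sp; lra.
    have := sP (w - p); rewrite [p + _]addrC subrK => H.
    apply: (le_trans (H _)); first by move: nP; lra.
    by rewrite ler_wpM2l// ltW.
  rewrite Sp => H.
  have -> : 5 * e * perim T ^+ 2 =
      4 ^+ n * (perim T / 2 ^+ n * (e * (5 * (perim T / 2 ^+ n)))).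
    have -> : 4 ^+ n = 2 ^+ n * 2 ^+ n :> R by rewrite -exprMn; congr (_ ^+ _); lra.
    by field; rewrite expf_neq0.
  by rewrite ler_wpM2l// exprn_ge0.
apply/eqP; rewrite -cmod_eq0 eq_le cmod_ge0 andbT; apply/ler_addgt0Pr => e e0; rewrite add0r.
pose K := 5 * perim T ^+ 2 + 1.
have K0 : 0 < K by rewrite /K; have := sqr_ge0 (perim T); lra.
have := key (e / K); rewrite divr_gt0// => /(_ isT) H; apply: (le_trans H).
rewrite (_ : 5 * (e / K) * _ = e * ((5 * perim T ^+ 2) / K)); last by ring.
by rewrite ler_piMr ?ltW// ltr_pdivrMr// /K; lra.
Qed.

Lemma volterraE f z : volterra f z = cseg f 0 z.
Proof.
rewrite /volterra /cseg subr0; congr (_ * _).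
by apply: eq_cint => s _; rewrite add0r.
Qed.

Lemma volterra0 f : volterra f 0 = 0.
Proof. by rewrite /volterra mul0r. Qed.

(** By Goursat on the triangle 0, z, z + h, the increment of the primitive is the path integral over
    the segment from z to z + h, and this differs from f(z) h by at most |h| times the oscillation
    of [f]. *)
Theorem cdiff_volterra r f z : holo r f -> cmod z < r -> cdiff (volterra f) z (f z).
Proof.
move=> hf zr e e0; have cf u : cmod u < r -> ccont f u by exact: holo_ccont.
have [s s0 sP] := cf z zr e e0.
exists (Num.min s (r - cmod z)); first by rewrite lt_min s0 subr_gt0.
move=> h; rewrite lt_min => /andP[hs hr].
have zhr : cmod (z + h) < r by have := cmodD z h; lra.
have r0 : cmod (0 : R[i]) < r by rewrite cmod0; have := cmod_ge0 z; lra.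
have := goursat hf (_ : inball r (0, z, z + h)); rewrite /inball /= => /(_ (And3 r0 zr zhr)).
rewrite /tri /= (cseg_rev cf r0 zhr) => E.
have E2 : cseg f 0 (z + h) - cseg f 0 z = cseg f z (z + h).
  by move/eqP: E; rewrite subr_eq0 => /eqP <-; rewrite addrAC subrr add0r.
rewrite !volterraE E2.
pose g w := f w - f z.
have cg w : cmod w < r -> ccont g w.
  move=> wr e' e'0; have [s' s'0 s'P] := cf w wr e' e'0; exists s' => // v vs.
  by rewrite (_ : g v - g w = f v - f w) ?s'P// /g; ring.
have -> : cseg f z (z + h) - f z * h = cseg g z (z + h).
  have -> : f = (fun w => g w + (f z + 0 * w)) by apply/funext => w; rewrite /g; ring.
  rewrite csegD; first last.
  - by under eq_fun do rewrite mul0r; exact: cont01_cst.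
  - exact: (cont01_seg cg).
  rewrite cseg_affine (_ : g z = 0) ?/g ?subrr//; ring.
rewrite mulrC; have {2}-> : h = (z + h) - z by ring.
apply: cmod_cseg_le; first exact: (cont01_seg cg).
move=> t t01; apply/ltW/sP.
rewrite (_ : _ - z = t%:C * h); last by ring.
rewrite cmodM cmodR_ge0; last lra.
apply: le_lt_trans hs; rewrite ler_piMl ?cmod_ge0//; lra.
Qed.

End Goursat.

(** * Rules for complex derivatives *)

Section DerivativeRules.
Context {R : realType}.
Implicit Types (f g : R[i] -> R[i]) (z d : R[i]).

Lemma cdiff_cst (a z : R[i]) : cdiff (fun=> a) z 0.
Proof.
move=> e e0; exists 1 => // h _.
by rewrite subrr mul0r subrr cmod0 mulr_ge0 ?cmod_ge0// ltW.
Qed.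

Lemma cdiff_id z : cdiff id z 1.
Proof.
move=> e e0; exists 1 => // h _.
by rewrite (_ : _ - _ = 0) ?cmod0 ?mulr_ge0 ?cmod_ge0 ?ltW// /id; ring.
Qed.

Lemma cdiff_near f g z d (s : R) : 0 < s ->
  (forall w, cmod (w - z) < s -> f w = g w) -> cdiff f z d -> cdiff g z d.
Proof.
move=> s0 fg fd e e0; have [r r0 H] := fd e e0.
exists (Num.min r s); first by rewrite lt_min r0.
move=> h; rewrite lt_min => /andP[hr hs].
rewrite -!fg ?H// ?subrr ?cmod0//.
by rewrite addrAC subrr add0r.
Qed.

Lemma cdiff_unique f z d d' : cdiff f z d -> cdiff f z d' -> d = d'.
Proof.
move=> fd fd'; apply/eqP; rewrite -subr_eq0 -cmod_eq0 eq_le cmod_ge0 andbT.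
apply/ler_addgt0Pr => e e0; rewrite add0r.
have e2 : 0 < e / 2 by lra.
have [r r0 H] := fd _ e2; have [r' r'0 H'] := fd' _ e2.
pose t := Num.min r r' / 2.
have mr : 0 < Num.min r r' by rewrite lt_min r0.
have t0 : 0 < t by rewrite divr_gt0.
have tr : t < Num.min r r' by rewrite /t; lra.
have ct : cmod t%:C = t by rewrite cmodR_ge0// ltW.
move: tr; rewrite lt_min => /andP[tr tr'].
have := H t%:C; rewrite ct => /(_ tr) h1; have := H' t%:C; rewrite ct => /(_ tr') h2.
have := cmodB (f (z + t%:C) - f z - d' * t%:C) (f (z + t%:C) - f z - d * t%:C).
rewrite (_ : _ - _ = (d - d') * t%:C); last by ring.
rewrite cmodM ct => h3; rewrite -(ler_pM2r t0); lra.
Qed.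

Lemma cdiffD f g z d d' : cdiff f z d -> cdiff g z d' ->
  cdiff (fun w => f w + g w) z (d + d').
Proof.
move=> fd gd e e0; have e2 : 0 < e / 2 by lra.
have [r r0 H] := fd _ e2; have [r' r'0 H'] := gd _ e2.
exists (Num.min r r'); first by rewrite lt_min r0.
move=> h; rewrite lt_min => /andP[hr hr'].
have := cmodD (f (z + h) - f z - d * h) (g (z + h) - g z - d' * h).
have := H h hr; have := H' h hr'.
rewrite (_ : _ - _ - d * h + _ = f (z + h) + g (z + h) - (f z + g z) - (d + d') * h); last by ring.
lra.
Qed.

Lemma cdiffM f g z d d' : cdiff f z d -> cdiff g z d' ->
  cdiff (fun w => f w * g w) z (d * g z + f z * d').
Proof.
move=> fd gd e e0.
set A := cmod (g z) + 1; set B := cmod (f z); set D := cmod d + 1.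
have A0 : 0 < A by rewrite /A; have := cmod_ge0 (g z); lra.
have B0 : 0 <= B by exact: cmod_ge0.
have D0 : 0 < D by rewrite /D; have := cmod_ge0 d; lra.
have eA : 0 < e / (4 * A) by rewrite divr_gt0// mulr_gt0.
have eB : 0 < e / (4 * (B + 1)) by rewrite divr_gt0// mulr_gt0//; lra.
have eD : 0 < Num.min (e / (4 * D)) 1 by rewrite lt_min ltr01 divr_gt0// mulr_gt0.
have [r r0 H] := fd _ eA; have [r' r'0 H'] := gd _ eB.
have [s s0 S] := cdiff_ccont gd eD.
exists (Num.min r (Num.min r' s)); first by rewrite !lt_min r0 r'0.
move=> h; rewrite !lt_min => /and3P[hr hr' hs].
have := S (z + h); rewrite (_ : z + h - z = h); last by ring.
move=> /(_ hs); rewrite lt_min => /andP[S1 S2].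
have gzh : cmod (g (z + h)) <= A by have := cmod_lb (g (z + h)) (g z); rewrite /A; lra.
have h1 := H h hr; have h2 := H' h hr'.
rewrite (_ : _ - _ - _ = (f (z + h) - f z - d * h) * g (z + h) +
  (f z * (g (z + h) - g z - d' * h) + d * h * (g (z + h) - g z))); last by ring.
apply: (le_trans (cmodD _ _)).
have t1 : cmod ((f (z + h) - f z - d * h) * g (z + h)) <= e / 4 * cmod h.
  rewrite cmodM; apply: (@le_trans _ _ ((e / (4 * A) * cmod h) * A)).
    by apply: ler_pM; rewrite ?cmod_ge0.
  by rewrite mulrAC (_ : e / (4 * A) * A = e / 4)//; field; lra.
have t2 : cmod (f z * (g (z + h) - g z - d' * h)) <= e / 4 * cmod h.
  rewrite cmodM -/B; apply: (@le_trans _ _ ((B + 1) * (e / (4 * (B + 1)) * cmod h))).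
    by apply: ler_pM; rewrite ?cmod_ge0//; lra.
  by rewrite mulrA (_ : (B + 1) * _ = e / 4)//; field; lra.
have t3 : cmod (d * h * (g (z + h) - g z)) <= e / 4 * cmod h.
  rewrite !cmodM mulrAC; apply: ler_wpM2r; first exact: cmod_ge0.
  apply: (@le_trans _ _ (D * (e / (4 * D)))).
    by apply: ler_pM; rewrite ?cmod_ge0 ?(ltW S1)// /D; lra.
  by rewrite (_ : D * _ = e / 4)//; field; lra.
have E0 : 0 <= e * cmod h by rewrite mulr_ge0 ?cmod_ge0// ltW.
rewrite (_ : e * cmod h = e / 4 * cmod h + (e / 4 * cmod h + e / 2 * cmod h)); last by field.
apply: lerD => //; apply: (le_trans (cmodD _ _)); apply: lerD => //.
apply: (le_trans t3); rewrite ler_wpM2r ?cmod_ge0//; lra.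
Qed.

Lemma cdiff_comp f g z d d' : cdiff g z d -> cdiff f (g z) d' ->
  cdiff (fun w => f (g w)) z (d' * d).
Proof.
move=> gd fd e e0.
set D := cmod d + 1; set D' := cmod d' + 1.
have D0 : 0 < D by rewrite /D; have := cmod_ge0 d; lra.
have D'0 : 0 < D' by rewrite /D'; have := cmod_ge0 d'; lra.
have e1 : 0 < e / (2 * D) by rewrite divr_gt0// mulr_gt0.
have e2 : 0 < Num.min (e / (2 * D')) 1 by rewrite lt_min ltr01 divr_gt0// mulr_gt0.
have [r r0 H] := fd _ e1; have [r' r'0 H'] := gd _ e2.
have [s s0 S] := cdiff_ccont gd r0.
exists (Num.min r' s); first by rewrite lt_min r'0.
move=> h; rewrite lt_min => /andP[hr' hs].
have := S (z + h); rewrite (_ : z + h - z = h); last by ring.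
move=> /(_ hs)/H h1; rewrite [g z + _]addrC subrK in h1.
have {H'} := H' h hr'.
set m := Num.min _ _ => h2.
have m1 : m <= e / (2 * D') by rewrite /m ge_min lexx.
have m2 : m <= 1 by rewrite /m ge_min lexx orbT.
have h3 : cmod (g (z + h) - g z - d * h) <= 1 * cmod h.
  by apply: (le_trans h2); rewrite ler_wpM2r ?cmod_ge0.
have h4 : cmod (g (z + h) - g z - d * h) <= e / (2 * D') * cmod h.
  by apply: (le_trans h2); rewrite ler_wpM2r ?cmod_ge0.
have h5 : cmod (g (z + h) - g z) <= D * cmod h.
  have := cmod_lb (g (z + h) - g z) (d * h); rewrite cmodM /D; lra.
rewrite (_ : _ - _ - _ = (f (g (z + h)) - f (g z) - d' * (g (z + h) - g z)) +
  d' * (g (z + h) - g z - d * h)); last by ring.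
apply: (le_trans (cmodD _ _)).
have t1 : cmod (f (g (z + h)) - f (g z) - d' * (g (z + h) - g z)) <= e / 2 * cmod h.
  apply: (le_trans h1); apply: (@le_trans _ _ (e / (2 * D) * (D * cmod h))).
    by rewrite ler_wpM2l// ltW.
  by rewrite mulrA (_ : _ * D = e / 2)//; field; lra.
have t2 : cmod (d' * (g (z + h) - g z - d * h)) <= e / 2 * cmod h.
  rewrite cmodM; apply: (@le_trans _ _ (D' * (e / (2 * D') * cmod h))).
    by apply: ler_pM; rewrite ?cmod_ge0// /D'; lra.
  by rewrite mulrA (_ : D' * _ = e / 2)//; field; lra.
rewrite [leRHS](splitr (e * _)) -mulrAC; exact: lerD.
Qed.

Lemma cdiff_inv z : z != 0 -> cdiff (fun w => w^-1) z (- (z ^+ 2)^-1).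
Proof.
move=> z0 e e0; have c0 : 0 < cmod z by rewrite cmod_gt0.
set m := cmod z in c0 *.
exists (Num.min (m / 2) (e * m ^+ 3 / 2)).
  by rewrite lt_min !divr_gt0//= mulr_gt0// exprn_gt0.
move=> h; rewrite lt_min => /andP[h1 h2].
have zh : m / 2 < cmod (z + h) by have := cmod_lbD z h; rewrite -/m; lra.
have zh0 : z + h != 0 by rewrite -cmod_gt0; lra.
rewrite (_ : _ - _ - _ = h * h / ((z + h) * z ^+ 2)); last by field; rewrite z0.
rewrite cmodf !cmodM -/m ler_pdivrMr; last by rewrite !mulr_gt0//; lra.
rewrite -mulrA mulrCA; apply: ler_wpM2l; first exact: cmod_ge0.
apply: (le_trans (ltW h2)); rewrite (_ : _ / 2 = e * (m / 2 * (m * m))); last by rewrite !exprS expr0; field.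
by rewrite ler_wpM2l ?(ltW e0)// ler_wpM2r ?mulr_ge0 ?(ltW zh)// ltW.
Qed.

Lemma cdiffV f z d : cdiff f z d -> f z != 0 ->
  cdiff (fun w => (f w)^-1) z (- (f z ^+ 2)^-1 * d).
Proof. by move=> fd f0; apply: (@cdiff_comp (fun w => w^-1)) => //; exact: cdiff_inv. Qed.

Lemma cdiffN f z d : cdiff f z d -> cdiff (fun w => - f w) z (- d).
Proof.
move=> /(cdiffM (cdiff_cst (-1) z)); rewrite mul0r add0r mulN1r.
by under [X in cdiff X _ _ -> _]eq_fun do rewrite mulN1r.
Qed.

Lemma cdiffB f g z d d' : cdiff f z d -> cdiff g z d' ->
  cdiff (fun w => f w - g w) z (d - d').
Proof. by move=> fd gd; apply: cdiffD => //; exact: cdiffN. Qed.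

Lemma cdiff_affine (a b z : R[i]) : cdiff (fun w => a + b * w) z b.
Proof.
have := cdiffD (cdiff_cst a z) (cdiffM (cdiff_cst b z) (cdiff_id z)).
by rewrite add0r mul0r add0r mulr1.
Qed.

Lemma holoD r f g : holo r f -> holo r g -> holo r (fun w => f w + g w).
Proof. by move=> hf hg z zr; have [d] := hf z zr; have [d'] := hg z zr; exists (d + d'); exact: cdiffD. Qed.

Lemma holoM r f g : holo r f -> holo r g -> holo r (fun w => f w * g w).
Proof.
move=> hf hg z zr; have [d ?] := hf z zr; have [d' ?] := hg z zr.
by exists (d * g z + f z * d'); exact: cdiffM.
Qed.

Lemma holo_cst r (a : R[i]) : holo r (fun=> a).
Proof. by move=> z _; exists 0; exact: cdiff_cst. Qed.

Lemma holo_affine r (a b : R[i]) : holo r (fun w => a + b * w).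
Proof. by move=> z _; exists b; exact: cdiff_affine. Qed.

Lemma holoB r f g : holo r f -> holo r g -> holo r (fun w => f w - g w).
Proof. by move=> hf hg z zr; have [d ?] := hf z zr; have [d' ?] := hg z zr; exists (d - d'); exact: cdiffB. Qed.

Lemma holoV r f : holo r f -> (forall z, cmod z < r -> f z != 0) -> holo r (fun w => (f w)^-1).
Proof. by move=> hf f0 z zr; have [d ?] := hf z zr; eexists; apply: cdiffV; eauto. Qed.

Lemma holo_le r r' f : r' <= r -> holo r f -> holo r' f.
Proof. by move=> rr hf z zr; apply: hf; exact: lt_le_trans rr. Qed.

Lemma holo_comp_affine r r' f (a b : R[i]) : holo r f ->
  (forall z, cmod z < r' -> cmod (a + b * z) < r) -> holo r' (fun w => f (a + b * w)).
Proof.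
move=> hf H z zr; have [d fd] := hf _ (H z zr); exists (d * b).
exact: cdiff_comp (cdiff_affine a b z) fd.
Qed.

End DerivativeRules.

(** * Complex-valued functions of a real variable *)

Section RealVariable.
Context {R : realType}.
Implicit Types (G : R -> R[i]).

Definition rdiff G (t : R) (d : R[i]) := forall e : R, 0 < e -> exists2 r : R, 0 < r &
  forall h : R, `|h| < r -> cmod (G (t + h) - G t - h%:C * d) <= e * `|h|.

Lemma is_derive_epsdelta (u : R -> R) (t d : R) :
  (forall e : R, 0 < e -> exists2 r : R, 0 < r &
    forall h : R, `|h| < r -> `|u (t + h) - u t - h * d| <= e * `|h|) <->
  is_derive t 1 u d.
Proof.
split=> [H|[du <-] e e0].
  have lim : h^-1 *: (u (h *: 1 + t) - u t) @[h --> 0^'] --> d.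
    apply/cvgrPdist_le => e e0; have [r r0 Hr] := H e e0.
    near=> h.
    have h0 : h != 0 by near: h; exact: nbhs_dnbhs_neq.
    have hr : `|h| < r.
      by near: h; apply: dnbhs0_lt.
    have := Hr h hr; rewrite /GRing.scale /= mulr1 [t + h]addrC => Hh.
    rewrite (_ : d - _ = - ((u (h + t) - u t - h * d) / h)); last by field.
    by rewrite normrN normrM normfV ler_pdivrMr ?normr_gt0.
  apply: DeriveDef; first by apply/cvg_ex; exists d.
  exact/cvg_lim.
have /cvgrPdist_le /(_ e e0) := du.
rewrite -/(derive u t 1).
rewrite near_withinE => /nbhs_ballP[r /= r0 Hr]; exists r => // h hr.
have [->|h0] := eqVneq h 0; first by rewrite addr0 mul0r !subr0 subrr normr0 mulr0.
have := Hr h; rewrite /ball /= sub0r normrN => /(_ hr h0).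
rewrite /GRing.scale /= mulr1 [h + t]addrC => Hh.
rewrite (_ : _ - _ - _ = - ((derive u t 1 - h^-1 * (u (t + h) - u t)) * h)); last by field.
by rewrite normrN normrM ler_wpM2r.
Unshelve. all: by end_near. Qed.

Lemma rdiff_Re G t d : rdiff G t d -> is_derive t 1 (fun s => complex.Re (G s)) (complex.Re d).
Proof.
move=> Gd; apply/is_derive_epsdelta => e e0; have [r r0 H] := Gd e e0.
exists r => // h /H; apply: le_trans; apply: le_trans (norm_Re_le _).
by rewrite !cReD !cReN cReM /= mul0r subr0.
Qed.

Lemma rdiff_Im G t d : rdiff G t d -> is_derive t 1 (fun s => complex.Im (G s)) (complex.Im d).
Proof.
move=> Gd; apply/is_derive_epsdelta => e e0; have [r r0 H] := Gd e e0.
exists r => // h /H; apply: le_trans; apply: le_trans (norm_Im_le _).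
by rewrite !cImD !cImN cImM /= mul0r addr0.
Qed.

Lemma rdiff_complex (u v : R -> R) (t du dv : R) : is_derive t 1 u du -> is_derive t 1 v dv ->
  rdiff (fun s => u s +i* v s) t (du +i* dv).
Proof.
move=> /is_derive_epsdelta Hu /is_derive_epsdelta Hv e e0; have e2 : 0 < e / 2 by lra.
have [r r0 H] := Hu _ e2; have [r' r'0 H'] := Hv _ e2.
exists (Num.min r r'); first by rewrite lt_min r0.
move=> h; rewrite lt_min => /andP[/H hr /H' hr'].
apply: (le_trans (cmod_le_Re_Im _)) => /=; rewrite !mul0r subr0 addr0; lra.
Qed.

Lemma rdiffZ G t d (u : R[i]) : rdiff G t d -> rdiff (fun s => u * G s) t (u * d).
Proof.
move=> Gd e e0; set K := cmod u + 1; have K0 : 0 < K by rewrite /K; have := cmod_ge0 u; lra.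
have [r r0 H] := Gd (e / K) (divr_gt0 e0 K0); exists r => // h /H Hh.
rewrite (_ : _ - _ - _ = u * (G (t + h) - G t - h%:C * d)); last by ring.
rewrite cmodM; apply: (@le_trans _ _ (K * (e / K * `|h|))).
  by apply: ler_pM; rewrite ?cmod_ge0// /K; lra.
by rewrite mulrA (_ : K * _ = e)//; field; lra.
Qed.

Lemma rdiff_chain (f : R[i] -> R[i]) G t d d' : rdiff G t d -> cdiff f (G t) d' ->
  rdiff (fun s => f (G s)) t (d' * d).
Proof.
move=> Gd fd e e0.
set D := cmod d + 1; set D' := cmod d' + 1.
have D0 : 0 < D by rewrite /D; have := cmod_ge0 d; lra.
have D'0 : 0 < D' by rewrite /D'; have := cmod_ge0 d'; lra.
have e1 : 0 < e / (2 * D) by rewrite divr_gt0// mulr_gt0.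
have e2 : 0 < Num.min (e / (2 * D')) 1 by rewrite lt_min ltr01 divr_gt0// mulr_gt0.
have [r r0 H] := fd _ e1; have [r' r'0 H'] := Gd _ e2.
exists (Num.min r' (r / D)); first by rewrite lt_min r'0 divr_gt0.
move=> h; rewrite lt_min => /andP[hr']; rewrite ltr_pdivlMr// => hs.
have {H'} := H' h hr'.
set m := Num.min _ _ => h2.
have m1 : m <= e / (2 * D') by rewrite /m ge_min lexx.
have m2 : m <= 1 by rewrite /m ge_min lexx orbT.
have n0 := normr_ge0 h.
have h3 : cmod (G (t + h) - G t - h%:C * d) <= 1 * `|h|.
  by apply: (le_trans h2); rewrite ler_wpM2r.
have h4 : cmod (G (t + h) - G t - h%:C * d) <= e / (2 * D') * `|h|.
  by apply: (le_trans h2); rewrite ler_wpM2r.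
have h5 : cmod (G (t + h) - G t) <= D * `|h|.
  have := cmod_lb (G (t + h) - G t) (h%:C * d); rewrite cmodM cmodR /D; lra.
have := H (G (t + h) - G t) _; rewrite [G t + _]addrC subrK => h1.
rewrite (_ : _ - _ - _ = (f (G (t + h)) - f (G t) - d' * (G (t + h) - G t)) +
  d' * (G (t + h) - G t - h%:C * d)); last by ring.
apply: (le_trans (cmodD _ _)).
have t1 : cmod (f (G (t + h)) - f (G t) - d' * (G (t + h) - G t)) <= e / 2 * `|h|.
  apply: (le_trans (h1 _)); first by rewrite (le_lt_trans h5)// mulrC.
  apply: (@le_trans _ _ (e / (2 * D) * (D * `|h|))).
    by rewrite ler_wpM2l// ltW.
  by rewrite mulrA (_ : _ * D = e / 2)//; field; lra.
have t2 : cmod (d' * (G (t + h) - G t - h%:C * d)) <= e / 2 * `|h|.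
  rewrite cmodM; apply: (@le_trans _ _ (D' * (e / (2 * D') * `|h|))).
    by apply: ler_pM; rewrite ?cmod_ge0// /D'; lra.
  by rewrite mulrA (_ : D' * _ = e / 2)//; field; lra.
rewrite [leRHS](splitr (e * _)) -mulrAC; exact: lerD.
Qed.

Lemma rdiff_line (a b : R[i]) t : rdiff (fun s => a + s%:C * b) t b.
Proof.
move=> e e0; exists 1 => // h _.
rewrite (_ : _ - _ - _ = 0) ?cmod0 ?mulr_ge0 ?(ltW e0)//.
by rewrite realCD; ring.
Qed.

Lemma rdiff_cont G t d : rdiff G t d -> forall e : R, 0 < e -> exists2 r : R, 0 < r &
  forall s : R, `|s - t| < r -> cmod (G s - G t) < e.
Proof.
move=> Gd e e0; have [r r0 H] := Gd 1 ltr01.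
set K := cmod d + 1; have K0 : 0 < K by rewrite /K; have := cmod_ge0 d; lra.
exists (Num.min r (e / K)); first by rewrite lt_min r0 divr_gt0.
move=> s; rewrite lt_min => /andP[/H]; rewrite ltr_pdivlMr// [t + _]addrC subrK mul1r => Hs sK.
have := cmod_lb (G s - G t) ((s - t)%:C * d); rewrite cmodM cmodR; move: sK; rewrite /K; lra.
Qed.

(* Rotating the increment of [G] to the positive real axis reduces this to the
   real mean value theorem. *)
Lemma rdiff_dominated G (g : R -> R[i]) (B b : R -> R) (x y : R) : x <= y ->
  (forall t : R, x <= t <= y -> rdiff G t (g t)) ->
  (forall t : R, x <= t <= y -> is_derive t 1 B (b t)) ->
  (forall t : R, x <= t <= y -> cmod (g t) <= b t) ->
  cmod (G y - G x) <= B y - B x.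
Proof.
move=> xy Gg Bb gb; have [u u1 uE] := cmod_rotate (G y - G x).
pose psi s := B s - complex.Re (u * G s).
have dpsi t : x <= t <= y -> is_derive t 1 psi (b t - complex.Re (u * g t)).
  by move=> txy; apply: is_deriveB; [exact: Bb|exact: rdiff_Re (rdiffZ u (Gg t txy))].
have [||c cxy E] := @MVT_segment R psi (fun t => b t - complex.Re (u * g t)) x y xy.
- by move=> t; rewrite in_itv /= => /andP[xt ty]; apply: dpsi; rewrite !ltW.
- apply: derivable_within_continuous => t; rewrite in_itv /= => txy.
  by case: (dpsi t txy).
move: cxy; rewrite in_itv /= => cxy.
have : 0 <= psi y - psi x.
  rewrite E mulr_ge0 ?subr_ge0//; apply: (le_trans (Re_le_cmod _)).
  by rewrite cmodM u1 mul1r gb.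
rewrite /psi; have : complex.Re (u * G y) - complex.Re (u * G x) = cmod (G y - G x).
  by rewrite -cReN -cReD -mulrBr uE.
lra.
Qed.

Lemma cint_FTC G (g : R -> R[i]) : (forall t : R, rdiff G t (g t)) -> cont01 g ->
  cint g = G 1 - G 0.
Proof.
move=> Gg cg.
have FTC (B b : R -> R) : (forall t : R, is_derive t 1 B (b t)) -> rcont01 b ->
    rint b = B 1 - B 0.
  move=> dB cb; have contB : continuous B.
    by move=> x; apply: differentiable_continuous; apply/derivable1_diffP; case: (dB x).
  rewrite /rint /Rintegral (@continuous_FTC2 _ b B 0 1 ltr01)//.
  - exact: within_rcont01.
  - split; first by move=> x _; case: (dB x).
    + by apply: cvg_at_right_filter; exact: contB.
    + by apply: cvg_at_left_filter; exact: contB.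
  - by move=> x _; rewrite derive1E; apply: derive_val.
apply/eqP; rewrite eq_complex /= cReD cReN cImD cImN.
apply/andP; split; apply/eqP.
- by apply: (FTC (fun s => complex.Re (G s))) => [t|]; [exact: rdiff_Re|exact: cont01_Re].
- by apply: (FTC (fun s => complex.Im (G s))) => [t|]; [exact: rdiff_Im|exact: cont01_Im].
Qed.

End RealVariable.

(** * Cauchy's formula; derivatives of holomorphic functions are holomorphic *)

Section Circle.
Context {R : realType}.
Implicit Types (f h : R[i] -> R[i]) (z : R[i]) (rho r : R).

(** One full turn is the unit interval, so [rint] and [cint] are normalised circle averages and no
    constant appears in Cauchy's and Poisson's formulas. *)
Definition cis (t : R) : R[i] := cos (2 * pi * t) +i* sin (2 * pi * t).
Definition circ rho (t : R) : R[i] := rho%:C * cis t.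

Lemma is_derive_scale (u : R -> R) (c t d : R) : is_derive (c * t) 1 u d ->
  is_derive t 1 (fun s => u (c * s)) (c * d).
Proof.
move=> /is_derive_epsdelta H; apply/is_derive_epsdelta => e e0.
set K := `|c| + 1; have K0 : 0 < K by rewrite /K; have := normr_ge0 c; lra.
have [r r0 Hr] := H (e / K) (divr_gt0 e0 K0).
exists (r / K); first by rewrite divr_gt0.
move=> h; rewrite ltr_pdivlMr// => hK.
have n0 := normr_ge0 h.
have ch : `|c * h| <= K * `|h| by rewrite normrM ler_wpM2r// /K; lra.
have := Hr (c * h) (le_lt_trans ch _); rewrite mulrC => /(_ hK).
rewrite -mulrDr (_ : c * h * d = h * (c * d)); last by ring.
move/le_trans; apply; rewrite -mulrA ler_wpM2l ?(ltW e0)//.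
by rewrite mulrC ler_pdivrMr// [_ * K]mulrC.
Qed.

Lemma rdiff_cis t : rdiff cis t ('i * (2 * pi)%:C * cis t).
Proof.
have := rdiff_complex (is_derive_scale (is_derive_cos (2 * pi * t)))
  (is_derive_scale (is_derive_sin (2 * pi * t))).
rewrite (_ : _ +i* _ = 'i * (2 * pi)%:C * cis t)//.
by apply/eqP; rewrite eq_complex /=; apply/andP; split; apply/eqP; ring.
Qed.

Lemma cmod_cis t : cmod (cis t) = 1.
Proof. by rewrite /cmod /= cos2Dsin2 sqrtr1. Qed.

Lemma cis_neq0 t : cis t != 0.
Proof. by rewrite -cmod_gt0 cmod_cis. Qed.

Lemma cis0 : cis 0 = 1.
Proof. by rewrite /cis mulr0 cos0 sin0. Qed.

Lemma cis1 : cis 1 = 1.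
Proof. by rewrite /cis mulr1 mulr_natl cos2pi sin2pi. Qed.

Lemma cisD s t : cis (s + t) = cis s * cis t.
Proof.
apply/eqP; rewrite eq_complex /= mulrDr cosD sinD.
by apply/andP; split; apply/eqP; ring.
Qed.

Lemma cont01_cis : cont01 cis.
Proof. by move=> t _ e e0; have [d d0 H] := rdiff_cont (rdiff_cis t) e0; exists d => // s _; exact: H. Qed.

Lemma cont01_circ rho : cont01 (circ rho).
Proof. by apply: cont01M; [exact: cont01_cst|exact: cont01_cis]. Qed.

Lemma cmod_circ rho t : 0 <= rho -> cmod (circ rho t) = rho.
Proof. by move=> r0; rewrite cmodM cmod_cis mulr1 cmodR_ge0. Qed.

Lemma circ_neq0 rho t : 0 < rho -> circ rho t != 0.
Proof. by move=> r0; rewrite -cmod_gt0 cmod_circ// ltW. Qed.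

Lemma circ_sub_neq0 rho t z : cmod z < rho -> circ rho t - z != 0.
Proof.
move=> zr; have r0 : 0 < rho by have := cmod_ge0 z; lra.
rewrite -cmod_gt0; have := cmod_lb (circ rho t) z; rewrite cmod_circ; lra.
Qed.

Lemma circ_conj rho t : conjc (circ rho t) = (rho ^+ 2)%:C / circ rho t.
Proof.
have [->|r0] := eqVneq rho 0.
  by rewrite /circ mul0r rmorph0 invr0 mulr0.
rewrite -[LHS](mulfK (_ : circ rho t != 0)); last by rewrite mulf_neq0 ?cis_neq0// realC_eq0.
congr (_ / _); rewrite mulrC mul_conjc; congr (_%:C).
by rewrite cmodM cmod_cis mulr1 cmodR -normrX ger0_norm// sqr_ge0.
Qed.

(** Up to the constant 2 pi i the integrand is the derivative of [volterra h] along the circle, a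
    closed curve. *)
Theorem cint_loop r rho h : holo r h -> 0 < rho < r ->
  cint (fun t => circ rho t * h (circ rho t)) = 0.
Proof.
move=> hh /andP[rho0 rhor].
have circr t : cmod (circ rho t) < r by rewrite cmod_circ// ltW.
pose c0 : R[i] := 'i * (2 * pi)%:C.
have c00 : c0 != 0.
  rewrite mulf_neq0//; first by rewrite eq_complex /= oner_eq0 andbF.
  by rewrite realC_eq0 mulf_neq0// gt_eqF// pi_gt0.
have dH t : rdiff (fun s => volterra h (circ rho s)) t (c0 * (circ rho t * h (circ rho t))).
  have := rdiff_chain (rdiffZ rho%:C (rdiff_cis t)) (cdiff_volterra hh (circr t)).
  rewrite /circ (_ : h (rho%:C * cis t) * _ = c0 * (rho%:C * cis t * h (rho%:C * cis t)))//.
  by rewrite /c0; ring.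
have ch : cont01 (fun t => circ rho t * h (circ rho t)).
  apply: cont01M; first exact: cont01_circ.
  apply: cont01_comp; last exact: cont01_circ.
  by move=> t _; exact: holo_ccont (circr t).
have := cint_FTC dH; rewrite cintZ// /circ cis0 cis1 subrr => E.
apply/eqP; have /eqP := E (cont01M (cont01_cst c0) ch).
by rewrite mulf_eq0 (negbTE c00).
Qed.

Lemma cint_conj (h : R -> R[i]) : cont01 h -> cint (fun s => conjc (h s)) = conjc (cint h).
Proof.
move=> ch; apply/eqP; rewrite eq_complex /=; apply/andP; split; apply/eqP.
  by apply: eq_rint => s _; case: (h s).
rewrite -mulN1r -rintZ; last exact: cont01_Im.
by apply: eq_rint => s _; case: (h s) => a b /=; rewrite mulN1r.
Qed.

(** On the circle conj(c) = rho^2 / c, so the conjugate of c / (c - z) is 1 + c h(c) with h(w) =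
    conj(z) / (rho^2 - conj(z) w). This function is holomorphic across the closed disk, and
    [cint_loop] removes its contribution. *)
Lemma cint_cauchy1 rho z : cmod z < rho ->
  cint (fun t => circ rho t / (circ rho t - z)) = 1.
Proof.
move=> zr; have c0 := cmod_ge0 z; have r0 : 0 < rho by lra.
pose h w := conjc z / ((rho ^+ 2)%:C + (- conjc z) * w).
(* A radius strictly between rho and the modulus rho^2 / |z| of the pole of [h], written so as to
   make sense for z = 0. *)
pose r' := 2 * rho ^+ 2 / (rho + cmod z).
have rr' : rho < r' by rewrite /r' ltr_pdivlMr ?expr2; nra.
have den w : cmod w < r' -> (rho ^+ 2)%:C + (- conjc z) * w != 0.
  move=> wr; rewrite -cmod_gt0; have := cmod_lbD (rho ^+ 2)%:C (- conjc z * w).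
  rewrite cmodM cmodN cmodJ cmodR_ge0 ?sqr_ge0//.
  have : cmod z * cmod w < rho ^+ 2.
    have [->|z0] := eqVneq (cmod z) 0; first by rewrite mul0r exprn_gt0.
    have zp : 0 < cmod z by rewrite lt0r z0.
    apply: (@lt_trans _ _ (cmod z * r')); first by rewrite ltr_pM2l.
    rewrite /r' mulrA ltr_pdivrMr; last lra.
    have : 0 < rho ^+ 2 * (rho - cmod z) by rewrite mulr_gt0 ?exprn_gt0 ?subr_gt0.
    lra.
  lra.
have hh : holo r' h.
  by apply: holoM; [exact: holo_cst|apply: holoV => //; exact: holo_affine].
have := cint_loop hh (_ : 0 < rho < r'); rewrite r0 rr' => /(_ isT) loop.
have E t : circ rho t / (circ rho t - z) = conjc (1 + circ rho t * h (circ rho t)).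
  have cn := circ_neq0 t r0; have cz := circ_sub_neq0 t zr.
  have rn : (rho ^+ 2)%:C != 0 :> R[i] by rewrite realC_eq0 expf_neq0// gt_eqF.
  have cq : conjc (rho ^+ 2)%:C = (rho ^+ 2)%:C :> R[i] by rewrite conjc_real.
  have cc := circ_conj rho t; rewrite /h; move: rn cq cc; generalize ((rho ^+ 2)%:C : R[i]) => q rn cq cc.
  move: cn cz cc; generalize (circ rho t) => w cn cz cc.
  rewrite !(rmorphD, rmorph1, rmorphM, fmorphV, rmorphN) /= conjcK cq cc.
  rewrite (_ : q + - z * (q / w) = q * (w - z) / w); last by field.
  by field; rewrite cn cz rn.
have ch : cont01 (fun t => circ rho t * h (circ rho t)).
  apply: cont01M; first exact: cont01_circ.
  apply: cont01_comp; last exact: cont01_circ.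
  by move=> t _; apply: (holo_ccont hh); rewrite cmod_circ ?ltW.
under [X in cint X]eq_fun do rewrite E.
rewrite cint_conj; last by apply: cont01D => //; exact: cont01_cst.
by rewrite cintD//; [rewrite loop cint_cst addr0 rmorph1|exact: cont01_cst].
Qed.

Lemma cdiff_dominated f (phi : R[i] -> R[i]) (a k : R[i]) (M : R) :
  (forall t : R, 0 <= t <= 1 -> cdiff f (a + t%:C * k) (phi (a + t%:C * k))) ->
  (forall t : R, 0 <= t <= 1 -> cmod (phi (a + t%:C * k)) <= M) ->
  cmod (f (a + k) - f a) <= M * cmod k.
Proof.
move=> fphi phiM.
have := @rdiff_dominated R (fun t => f (a + t%:C * k)) (fun t => phi (a + t%:C * k) * k)
  (fun t => M * cmod k * t) (fun=> M * cmod k) 0 1 ler01.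
rewrite mul1r mul0r addr0 mulr1 mulr0 subr0; apply.
- by move=> t t01; apply: rdiff_chain (rdiff_line a k t) (fphi t t01).
- move=> t _; apply/is_derive_epsdelta => e e0; exists 1 => // h _.
  by rewrite (_ : _ - _ - _ = 0) ?normr0 ?mulr_ge0 ?(ltW e0)//; ring.
- by move=> t t01; rewrite cmodM ler_wpM2r ?cmod_ge0// phiM.
Qed.

(* This makes the difference quotient of [f] at [z] complex differentiable at [z]
   itself, so that Goursat's lemma applies to it. *)
Definition expands2 f z (d c : R[i]) := forall e : R, 0 < e -> exists2 s : R, 0 < s &
  forall k : R[i], cmod k < s -> cmod (f (z + k) - f z - d * k - c * k ^+ 2) <= e * cmod k ^+ 2.

(** [f] minus the quadratic polynomial has the first-order remainder of [phi] at [z] as its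
    derivative, and the mean value inequality along the segment from [z] transfers the bound. *)
Lemma second_order r f phi z c : (forall w, cmod w < r -> cdiff f w (phi w)) ->
  cmod z < r -> cdiff phi z c -> expands2 f z (phi z) (c / 2).
Proof.
move=> fphi zr phic e e0; have [s s0 sP] := phic e e0.
exists (Num.min s (r - cmod z)); first by rewrite lt_min s0 subr_gt0.
move=> k; rewrite lt_min => /andP[ks kr].
pose E w := f w - (phi z * (w - z) + c / 2 * ((w - z) * (w - z))).
have := @cdiff_dominated E (fun w => phi w - (phi z + c * (w - z))) z k (e * cmod k).
rewrite /E (_ : f (z + k) - _ - _ = f (z + k) - f z - phi z * k - c / 2 * k ^+ 2); last by ring.
rewrite [e * cmod k ^+ 2](_ : _ = e * cmod k * cmod k); last by rewrite expr2 mulrA.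
apply.
- move=> t t01; set w := z + _.
  have wr : cmod w < r.
    apply: (le_lt_trans (cmodD _ _)); rewrite cmodM cmodR_ge0; last lra.
    have : t * cmod k <= cmod k by rewrite ler_piMl ?cmod_ge0//; lra.
    lra.
  apply: cdiffB; first exact: fphi.
  have dw : cdiff (fun v => v - z) w 1.
    have := cdiff_affine (- z) 1 w.
    by under [X in cdiff X _ _ -> _]eq_fun do rewrite mul1r addrC.
  have := cdiffD (cdiffM (cdiff_cst (phi z) w) dw) (cdiffM (cdiff_cst (c / 2) w) (cdiffM dw dw)).
  by rewrite (_ : _ + _ = phi z + c * (w - z))//; field.
- move=> t t01; have tk : cmod (t%:C * k) <= cmod k.
    by rewrite cmodM cmodR_ge0 ?ler_piMl ?cmod_ge0//; lra.
  have := sP (t%:C * k) (le_lt_trans tk ks).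
  rewrite (_ : _ - _ - _ = phi (z + t%:C * k) - (phi z + c * (z + t%:C * k - z))); last by ring.
  by move/le_trans; apply; rewrite ler_wpM2l// ltW.
Qed.

(** Cauchy's theorem on the circle for the difference quotient of [f] at [z], completed there by the
    value [d]; the term with f(z) is then evaluated by [cint_cauchy1]. *)
Lemma cauchy_of_expands2 r rho f z d c : holo r f -> rho < r -> cmod z < rho ->
  expands2 f z d c ->
  f z = cint (fun t => f (circ rho t) * (circ rho t / (circ rho t - z))).
Proof.
move=> hf rr zr fe; have r0 : 0 < rho by have := cmod_ge0 z; lra.
pose q w := if w == z then d else (f w - f z) / (w - z).
have hq : holo r q.
  move=> w wr; have [->|wz] := eqVneq w z.
    exists c => e e0; have [s s0 sP] := fe e e0; exists s => // k ks.
    rewrite /q eqxx; have [k0|k0] := eqVneq k 0.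
      by rewrite k0 addr0 eqxx subrr mulr0 subrr cmod0 mulr0.
    have -> : (z + k == z) = false by apply/negbTE; rewrite -subr_eq0 addrAC subrr add0r.
    have := sP k ks; rewrite (_ : z + k - z = k); last by ring.
    rewrite (_ : _ / k - d - c * k = (f (z + k) - f z - d * k - c * k ^+ 2) / k); last by field.
    have kp : 0 < cmod k by rewrite cmod_gt0.
    by move=> H; rewrite cmodf ler_pdivrMr// -mulrA -expr2.
  have [d' fd'] := hf w wr.
  have dd : cdiff (fun v => (f v - f z) * (v - z)^-1) w
      ((d' - 0) * (w - z)^-1 + (f w - f z) * (- ((w - z) ^+ 2)^-1 * (1 - 0))).
    apply: cdiffM; first by apply: cdiffB => //; exact: cdiff_cst.
    apply: cdiffV; last by rewrite subr_eq0.
    by apply: cdiffB; [exact: cdiff_id|exact: cdiff_cst].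
  have s0 : 0 < cmod (w - z) by rewrite cmod_gt0 subr_eq0.
  eexists; apply: (cdiff_near s0 _ dd) => v vw; rewrite /q; case: eqP => // vz; move: vw.
  by rewrite vz cmod_distC ltxx.
have cc : cont01 (fun t => circ rho t / (circ rho t - z)).
  apply: cont01M; first exact: cont01_circ.
  apply: cont01V => [|t _]; last exact: circ_sub_neq0.
  by apply: cont01B; [exact: cont01_circ|exact: cont01_cst].
have cf : cont01 (fun t => f (circ rho t)).
  apply: cont01_comp; last exact: cont01_circ.
  by move=> t _; apply: (holo_ccont hf); rewrite cmod_circ// ltW.
have := cint_loop hq (_ : 0 < rho < r); rewrite r0 rr => /(_ isT) loop.
have : cint (fun t => circ rho t * q (circ rho t)) =
    cint (fun t => f (circ rho t) * (circ rho t / (circ rho t - z)) -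
                   f z * (circ rho t / (circ rho t - z))).
  apply: eq_cint => t _; have cz := circ_sub_neq0 t zr.
  have cz' := cz; rewrite subr_eq0 in cz'; rewrite /q (negbTE cz'); by field.
rewrite loop cintB; [|exact: cont01M|by apply: cont01M => //; exact: cont01_cst].
by rewrite cintZ// cint_cauchy1// mulr1 => /esym/eqP; rewrite subr_eq0 => /eqP.
Qed.

(** Intended for u = (x - z - h)^-1 and v = (x - z)^-1, which satisfy u - v = h u v. It
    differentiates (x - z)^-j in z with an error uniform over all x at a fixed distance from z; the
    induction on [j] uses nothing but this identity. *)
Lemma inv_pow_expansion (A : R) (j : nat) : 0 <= A -> exists2 c : R, 0 <= c &
  forall u v h : R[i], cmod u <= A -> cmod v <= A -> u - v = h * u * v ->
  cmod (u ^+ j - v ^+ j - j%:R * h * v ^+ j.+1) <= c * cmod h ^+ 2.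
Proof.
move=> A0; elim: j => [|j [c c0 ih]].
  exists 0 => // u v h _ _ _.
  by rewrite !expr0 subrr !mul0r subrr cmod0.
exists (A * c + j.+1%:R * A ^+ j.+3).
  by apply: addr_ge0; apply: mulr_ge0 => //; exact: exprn_ge0.
move=> u v h uA vA E.
have E2 : u * v ^+ j - v ^+ j.+1 = h * u * v ^+ j.+1 by rewrite [in LHS]exprS -mulrBl E exprS; ring.
rewrite (_ : u ^+ j.+1 - v ^+ j.+1 - j.+1%:R * h * v ^+ j.+2 =
  u * (u ^+ j - v ^+ j - j%:R * h * v ^+ j.+1) + j.+1%:R * h ^+ 2 * u * v ^+ j.+2); last first.
  rewrite (_ : j.+1%:R * h ^+ 2 * u * v ^+ j.+2 = j.+1%:R * h * v ^+ j.+1 * (h * u * v)); last by rewrite !exprS; ring.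
  rewrite -E (_ : u ^+ j.+1 - v ^+ j.+1 - j.+1%:R * h * v ^+ j.+2 =
    u * (u ^+ j - v ^+ j) + (u * v ^+ j - v ^+ j.+1) - j.+1%:R * h * v ^+ j.+2); last by rewrite !exprS; ring.
  by rewrite E2 -!natr1 !exprS; ring.
apply: (le_trans (cmodD _ _)); rewrite mulrDl; apply: lerD.
  rewrite cmodM -[leRHS]mulrA; apply: ler_pM; [exact: cmod_ge0|exact: cmod_ge0|exact: uA|exact: ih].
rewrite 3!cmodM 2!cmodX cmod_nat.
rewrite -[leLHS]mulrA.
rewrite [A ^+ j.+3]exprS (_ : _ * (A * _) * _ = j.+1%:R * cmod h ^+ 2 * (A * A ^+ j.+2)); last by ring.
apply: ler_wpM2l; first by rewrite mulr_ge0 ?exprn_ge0 ?cmod_ge0.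
apply: ler_pM; rewrite ?cmod_ge0 ?exprn_ge0 ?cmod_ge0//.
by apply: lerXn2r; rewrite ?nnegrE ?cmod_ge0.
Qed.

Lemma cont01X (h : R -> R[i]) n : cont01 h -> cont01 (fun t => h t ^+ n).
Proof.
move=> ch; elim: n => [|n ih]; first by under eq_fun do rewrite expr0; exact: cont01_cst.
by under eq_fun do rewrite exprS; exact: cont01M.
Qed.

Lemma cont01_kernel (phi : R -> R[i]) rho z j : cont01 phi -> cmod z < rho ->
  cont01 (fun t => phi t * (circ rho t - z)^-1 ^+ j).
Proof.
move=> cphi zr; apply: cont01M => //; apply: cont01X; apply: cont01V => [|t _]; last exact: circ_sub_neq0.
by apply: cont01B; [exact: cont01_circ|exact: cont01_cst].
Qed.

Lemma cdiff_kernel (phi : R -> R[i]) rho z j : cont01 phi -> cmod z < rho ->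
  cdiff (fun w => cint (fun t => phi t * (circ rho t - w)^-1 ^+ j)) z
        (j%:R * cint (fun t => phi t * (circ rho t - z)^-1 ^+ j.+1)).
Proof.
move=> cphi zr e e0; have z0 := cmod_ge0 z; have r0 : 0 < rho by lra.
pose m := rho - cmod z; have m0 : 0 < m by rewrite subr_gt0.
have A0 : 0 <= 2 / m by rewrite divr_ge0// ltW.
have [c c0 cP] := inv_pow_expansion j A0.
have cP' := cont01_cmod cphi.
have [P [P0 PE]] : exists P : R, 0 <= P /\ rint (fun t => cmod (phi t)) = P.
  by eexists; split; last reflexivity; apply: rint_ge0 => t _; exact: cmod_ge0.
have K0 : 0 < c * P + 1 by rewrite ltr_wpDl// mulr_ge0.
exists (Num.min (m / 2) (e / (c * P + 1))).
  by rewrite lt_min; apply/andP; split; exact: divr_gt0.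
move=> h; rewrite lt_min => /andP[hm]; rewrite ltr_pdivlMr// => he; have h0 := cmod_ge0 h.
have zhr : cmod (z + h) < rho by have := cmodD z h; move: hm; rewrite /m; lra.
have lbz t : m / 2 <= cmod (circ rho t - z).
  by have := cmod_lb (circ rho t) z; rewrite cmod_circ ?(ltW r0)//; move: hm; rewrite /m; lra.
have lbzh t : m / 2 <= cmod (circ rho t - (z + h)).
  by have := cmod_lb (circ rho t) (z + h); have := cmodD z h; rewrite cmod_circ ?(ltW r0)//; move: hm; rewrite /m; lra.
have iv (x : R[i]) : m / 2 <= cmod x -> cmod x^-1 <= 2 / m.
  move=> mx; have m2 : 0 < m / 2 by rewrite divr_gt0.
  by rewrite cmodV -[leRHS]invf_div lef_pV2 ?posrE//; lra.
have ck i y : cmod y < rho -> cont01 (fun t => phi t * (circ rho t - y)^-1 ^+ i) by exact: cont01_kernel.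
rewrite mulrAC -cintZ; last exact: ck.
rewrite -cintB; [|exact: ck|exact: ck].
rewrite -cintB; [|by apply: cont01B; exact: ck|by apply: cont01M; [exact: cont01_cst|exact: ck]].
set G := (X in cint X).
have GM t : cmod (G t) <= cmod (phi t) * (c * cmod h ^+ 2).
  rewrite /G; set u := (circ rho t - (z + h))^-1; set v := (circ rho t - z)^-1.
  rewrite (_ : _ - _ - _ = phi t * (u ^+ j - v ^+ j - j%:R * h * v ^+ j.+1)); last by ring.
  rewrite cmodM ler_wpM2l ?cmod_ge0//; apply: cP; [exact: iv|exact: iv|].
  have n1 := circ_sub_neq0 t zr; have n2 := circ_sub_neq0 t zhr.
  rewrite /u /v; field; rewrite n1 /=; move: n2; rewrite opprD addrA => ->//.
have cG : cont01 G.
  apply: cont01B; first by apply: cont01B; exact: ck.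
  by apply: cont01M; [exact: cont01_cst|exact: ck].
have cf : rcont01 (fun t => c * cmod h ^+ 2 * cmod (phi t)).
  have cc : cont01 (fun t => (c * cmod h ^+ 2)%:C * (cmod (phi t))%:C).
    by apply: cont01M => //; exact: cont01_cst.
  by apply: cont01_eq cc => t _; exact/esym/realCM.
apply: (le_trans (cmod_cint cG cf _)) => [t _|]; first by rewrite mulrC; exact: GM.
rewrite rintZ// PE expr2.
rewrite (_ : c * (cmod h * cmod h) * P = c * P * cmod h * cmod h); last by ring.
apply: ler_wpM2r => //; apply: le_trans (ltW he); rewrite mulrC; apply: ler_wpM2l => //; lra.
Qed.

(** The second primitive of [f] has a first and a second derivative, so Cauchy's formula holds for
    it through [second_order], before anything is known about the derivative of [f] beyond
    existence. Differentiating that formula twice under the integral gives back [f]. *)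
Lemma volterra_cauchy_kernel r f z0 : holo r f -> cmod z0 < r ->
  exists2 rho : R, cmod z0 < rho < r & exists2 phi : R -> R[i], cont01 phi &
    forall z, cmod z < rho -> f z = 2 * cint (fun t => phi t * (circ rho t - z)^-1 ^+ 3).
Proof.
move=> hf z0r; pose rho := (cmod z0 + r) / 2; have c0 := cmod_ge0 z0.
have rr : cmod z0 < rho < r by rewrite /rho; lra.
have [z0rho rhor] := andP rr; have rho0 : 0 < rho by lra.
exists rho => //; pose F1 := volterra f; pose F2 := volterra F1.
have d1 z : cmod z < r -> cdiff F1 z (f z) by exact: cdiff_volterra.
have h1 : holo r F1 by move=> z zr; exists (f z); exact: d1.
have d2 z : cmod z < r -> cdiff F2 z (F1 z) by exact: cdiff_volterra.
have h2 : holo r F2 by move=> z zr; exists (F1 z); exact: d2.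
pose psi t := F2 (circ rho t) * circ rho t.
have cpsi : cont01 psi.
  apply: cont01M; last exact: cont01_circ.
  apply: cont01_comp; last exact: cont01_circ.
  by move=> t _; apply: (holo_ccont h2); rewrite cmod_circ// ltW.
exists psi => //.
have near_r w : cmod w < rho -> 0 < rho - cmod w /\ forall v, cmod (v - w) < rho - cmod w -> cmod v < rho.
  move=> wr; split; first by rewrite subr_gt0.
  by move=> v vw; have := cmodD (v - w) w; rewrite subrK; lra.
have F2E z : cmod z < rho -> F2 z = cint (fun t => psi t * (circ rho t - z)^-1 ^+ 1).
  move=> zr; have zr' : cmod z < r by lra.
  rewrite (cauchy_of_expands2 h2 rhor zr (second_order d2 zr' (d1 z zr'))).
  by apply: eq_cint => t _; rewrite expr1 /psi mulrA.
have F1E z : cmod z < rho -> F1 z = cint (fun t => psi t * (circ rho t - z)^-1 ^+ 2).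
  move=> zr; rewrite -[RHS]mul1r; apply: (cdiff_unique (d2 z _)); first lra.
  have [s0 sP] := near_r z zr.
  by apply: cdiff_near s0 _ (cdiff_kernel 1 cpsi zr) => v /sP vr; rewrite -F2E.
move=> z zr; apply: (cdiff_unique (d1 z _)); first lra.
have [s0 sP] := near_r z zr.
by apply: cdiff_near s0 _ (cdiff_kernel 2 cpsi zr) => v /sP vr; rewrite -F1E.
Qed.

(** The kernel representation of [f] near each point is differentiated twice more: once to identify
    the derivative, once to show that it is differentiable. *)
Theorem holo_derivative r f : holo r f -> exists2 phi : R[i] -> R[i],
  forall z, cmod z < r -> cdiff f z (phi z) & holo r phi.
Proof.
move=> hf; have /choice[phi phiP] : forall z, exists d, cmod z < r -> cdiff f z d.
  move=> z; have [zr|zr] := ltP (cmod z) r; last by exists 0 => ?; lra.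
  by have [d fd] := hf z zr; exists d.
exists phi => // z0 z0r; have [rho /andP[z0rho rhor] [psi cpsi fE]] := volterra_cauchy_kernel hf z0r.
have near_r w : cmod w < rho -> 0 < rho - cmod w /\ forall v, cmod (v - w) < rho - cmod w -> cmod v < rho.
  move=> wr; split; first by rewrite subr_gt0.
  by move=> v vw; have := cmodD (v - w) w; rewrite subrK; lra.
have phiE w : cmod w < rho ->
    phi w = 2%:R * (3%:R * cint (fun t => psi t * (circ rho t - w)^-1 ^+ 4)).
  move=> wr; apply: (cdiff_unique (phiP w _)); first exact: lt_trans rhor.
  have [s0 sP] := near_r w wr.
  have := cdiffM (cdiff_cst 2%:R w) (cdiff_kernel 3 cpsi wr); rewrite mul0r add0r.
  by apply: cdiff_near s0 _ => v /sP vr; rewrite -fE.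
have [s0 sP] := near_r z0 z0rho.
have dd := cdiffM (cdiff_cst 2%:R z0) (cdiffM (cdiff_cst 3%:R z0) (cdiff_kernel 4 cpsi z0rho)).
by eexists; apply: cdiff_near s0 _ dd => v /sP vr; rewrite phiE.
Qed.

Theorem cauchy_formula r rho f z : holo r f -> rho < r -> cmod z < rho ->
  f z = cint (fun t => f (circ rho t) * (circ rho t / (circ rho t - z))).
Proof.
move=> hf rr zr; have [phi phiP hphi] := holo_derivative hf.
have zr' : cmod z < r by exact: lt_trans rr.
have [c phic] := hphi z zr'.
exact: (cauchy_of_expands2 hf rr zr (second_order phiP zr' phic)).
Qed.

End Circle.

(** * Comparison with [derive1] and iterated derivatives *)

Section LibraryDerivative.
Context {R : realType}.
Implicit Types (f g : R[i] -> R[i]) (z : R[i]) (rho r : R).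

Lemma normE z : `|z| = (cmod z)%:C :> R[i].
Proof. by []. Qed.

Lemma gt0_complexP (e : R[i]) : 0 < e -> exists2 x : R, 0 < x & e = x%:C.
Proof.
case: e => a b; rewrite ltcE /= => /andP[/eqP -> a0].
by exists a.
Qed.

Lemma cdiff_is_derive f z d : cdiff f z d ->
  is_derive (z : R[i]^o) 1 (f : R[i]^o -> R[i]^o) d.
Proof.
move=> fd.
have lim : h^-1 *: ((f : R[i]^o -> R[i]^o) (h *: (1 : R[i]^o) + z) - f z) @[h --> (0 : R[i]^o)^'] --> (d : R[i]^o).
  apply/cvgrPdist_le => _ /gt0_complexP[e e0 ->].
  have [r r0 Hr] := fd e e0.
  have r0' : 0 < r%:C :> R[i] by rewrite ltcR.
  rewrite near_withinE; apply/nbhs_ballP; exists r%:C => //= h.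
  rewrite /ball /= sub0r normrN normE ltcR => hr h0.
  have := Hr h hr; rewrite /GRing.scale /= mulr1 [z + h]addrC => Hh.
  rewrite (_ : d - _ = - ((f (h + z) - f z - d * h) / h)); last by field.
  rewrite normrN normE lecR cmodf ler_pdivrMr ?cmod_gt0//.
apply: DeriveDef; first by apply/cvg_ex; exists d.
exact/cvg_lim.
Qed.

Lemma derivable_cdiff f z : derivable (f : R[i]^o -> R[i]^o) z 1 ->
  cdiff f z (derive (f : R[i]^o -> R[i]^o) z 1).
Proof.
move=> du e e0; have e0' : 0 < e%:C :> R[i] by rewrite ltcR.
have /cvgrPdist_le /(_ _ e0') := du.
rewrite -/(derive (f : R[i]^o -> R[i]^o) z 1).
rewrite near_withinE => /nbhs_ballP[r0 /= /gt0_complexP[r rp ->] Hr]; exists r => // h hr.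
have [->|h0] := eqVneq h 0; first by rewrite addr0 subrr mulr0 subrr cmod0 mulr0.
have := Hr h; rewrite /ball /= sub0r normrN normE ltcR => /(_ hr h0).
rewrite /GRing.scale /= mulr1 [h + z]addrC normE lecR => Hh.
set D := derive _ _ _ in Hh *.
rewrite (_ : _ - _ - _ = - ((D - h^-1 * (f (z + h) - f z)) * h)); last by field.
by rewrite cmodN cmodM ler_wpM2r ?cmod_ge0.
Qed.

Lemma cdiff_derive1 f z d : cdiff f z d -> derive1 (f : R[i]^o -> R[i]^o) z = d.
Proof. by move=> /cdiff_is_derive H; rewrite derive1E; exact: derive_val. Qed.

Lemma analytic_on_diskE f : analytic_on_disk f <-> holo 1 f.
Proof.
split=> H z z1; first by eexists; apply: derivable_cdiff; exact: H.
by have [d /cdiff_is_derive[]] := H z z1.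
Qed.

Lemma cderivS j f z : cderiv j.+1 f z = derive1 (cderiv j f : R[i]^o -> R[i]^o) z.
Proof. by []. Qed.

(** Computes iterated derivatives from a list of successive derivatives known only on the disk: the
    derivative at a point of an open disk depends only on nearby values, so the outside does not
    interfere. *)
Lemma cderiv_chain r n (phi : nat -> R[i] -> R[i]) :
  (forall j, (j < n)%N -> forall z, cmod z < r -> cdiff (phi j) z (phi j.+1 z)) ->
  forall j, (j <= n)%N -> forall z, cmod z < r -> cderiv j (phi 0%N) z = phi j z.
Proof.
move=> H; elim=> [//|j ih] jn z zr.
rewrite cderivS; apply: cdiff_derive1.
have s0 : 0 < r - cmod z by rewrite subr_gt0.
apply: (cdiff_near s0 _ (H j jn z zr)) => w wz; rewrite ih//; first exact: ltnW.
by have := cmodD (w - z) z; rewrite subrK; lra.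
Qed.

Lemma holo_cderiv r f : holo r f -> forall j, holo r (cderiv j f) /\
  forall z, cmod z < r -> cdiff (cderiv j f) z (cderiv j.+1 f z).
Proof.
move=> hf; have hol g : holo r g -> holo r (derive1 (g : R[i]^o -> R[i]^o)) /\
    forall z, cmod z < r -> cdiff g z (derive1 (g : R[i]^o -> R[i]^o) z).
  move=> hg; have [phi phiP hphi] := holo_derivative hg.
  have E w : cmod w < r -> derive1 (g : R[i]^o -> R[i]^o) w = phi w by move=> /phiP/cdiff_derive1.
  split=> [z zr|z zr]; last by rewrite E//; exact: phiP.
  have [d phid] := hphi z zr; exists d.
  have s0 : 0 < r - cmod z by rewrite subr_gt0.
  apply: (cdiff_near s0 _ phid) => w wz; rewrite E//.
  by have := cmodD (w - z) z; rewrite subrK; lra.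
have hj j : holo r (cderiv j f) by elim: j => [//|j ih]; exact: (hol _ ih).1.
by move=> j; split=> // z zr; exact: (hol _ (hj j)).2.
Qed.

End LibraryDerivative.

(** * Cauchy's estimates *)

Section DerivativeEstimates.
Context {R : realType}.
Implicit Types (f g : R[i] -> R[i]) (z : R[i]) (rho r : R).

Lemma cderivB r f g : holo r f -> holo r g -> forall j z, cmod z < r ->
  cderiv j (fun w => f w - g w) z = cderiv j f z - cderiv j g z.
Proof.
move=> hf hg j z zr.
apply: (@cderiv_chain _ r j (fun i w => cderiv i f w - cderiv i g w)) => // i _ w wr.
by apply: cdiffB; [exact: (holo_cderiv hf i).2|exact: (holo_cderiv hg i).2].
Qed.

Lemma cderivZ r f (a : R[i]) : holo r f -> forall j z, cmod z < r ->
  cderiv j (fun w => a * f w) z = a * cderiv j f z.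
Proof.
move=> hf j z zr.
apply: (@cderiv_chain _ r j (fun i w => a * cderiv i f w)) => // i _ w wr.
have := cdiffM (cdiff_cst a w) ((holo_cderiv hf i).2 w wr).
by rewrite mul0r add0r.
Qed.

Lemma cderiv_estimate1 r f c rho (M : R) : holo r f -> 0 < rho -> cmod c + rho < r ->
  (forall w, cmod (w - c) <= rho -> cmod (f w) <= M) -> cmod (cderiv 1 f c) <= M / rho.
Proof.
move=> hf r0 cr fM; pose G w := f (c + 1 * w); have c0 := cmod_ge0 c.
have hG : holo (r - cmod c) G.
  apply: (@holo_comp_affine _ r) => // w wr; rewrite mul1r.
  by have := cmodD c w; lra.
have rr : rho < r - cmod c by lra.
pose psi t := G (circ rho t) * circ rho t.
have cpsi : cont01 psi.
  apply: cont01M; last exact: cont01_circ.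
  apply: cont01_comp; last exact: cont01_circ.
  by move=> t _; apply: (holo_ccont hG); rewrite cmod_circ// ltW.
have z0 : cmod (0 : R[i]) < rho by rewrite cmod0.
have dk := cdiff_kernel 1 cpsi z0; rewrite mul1r in dk.
have dG : cdiff G 0 (cderiv 1 f c).
  have fd : cdiff f (c + 1 * 0) (cderiv 1 f c).
    by rewrite mulr0 addr0; apply: (holo_cderiv hf 0).2; lra.
  by have := cdiff_comp (cdiff_affine c 1 0) fd; rewrite mulr1.
have E : cderiv 1 f c = cint (fun t => psi t * (circ rho t - 0)^-1 ^+ 2).
  apply: (cdiff_unique dG); apply: (cdiff_near r0 _ dk) => v vr; rewrite subr0 in vr.
  rewrite (cauchy_formula hG rr vr); apply: eq_cint => t _.
  by rewrite expr1 /psi mulrA.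
rewrite E; apply: cmod_cint_le => [|t _]; first exact: cont01_kernel.
rewrite subr0 /psi -mulrA cmodM.
have cn := circ_neq0 t r0.
rewrite (_ : circ rho t * _ = (circ rho t)^-1); last by field.
rewrite cmodV cmod_circ ?(ltW r0)//; rewrite ler_wpM2r ?invr_ge0 ?(ltW r0)//.
by apply: fM; rewrite mul1r addrAC subrr add0r cmod_circ ?(ltW r0).
Qed.

(** The radius is halved at each differentiation. Of the new factor 2^(k+1), 2^k comes from (rho /
    2)^k and one 2 from the last division. *)
Lemma cderiv_estimate k : exists2 C : R, 0 < C &
  forall r f c rho M, holo r f -> 0 < rho -> cmod c + rho < r ->
  (forall w, cmod (w - c) <= rho -> cmod (f w) <= M) ->
  cmod (cderiv k f c) <= C * M / rho ^+ k.
Proof.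
elim: k => [|k [C C0 ih]].
  exists 1 => // r f c rho M hf r0 cr fM.
  by rewrite mul1r expr0 divr1; apply: fM; rewrite subrr cmod0 ltW.
exists (C * 2 ^+ k.+1); first by rewrite mulr_gt0// exprn_gt0.
move=> r f c rho M hf r0 cr fM; have r2 : 0 < rho / 2 by rewrite divr_gt0.
have hk := (holo_cderiv hf k).1.
have cr2 : cmod c + rho / 2 < r by lra.
have := cderiv_estimate1 (M := C * M / (rho / 2) ^+ k) hk r2 cr2.
rewrite !cderivS; have -> : cderiv 0 (cderiv k f) = cderiv k f by [].
have -> : C * 2 ^+ k.+1 * M / rho ^+ k.+1 = C * M / (rho / 2) ^+ k / (rho / 2).
  by rewrite expr_div_n !exprS; field; rewrite ?expf_neq0 ?gt_eqF.
apply=> w wc; apply: (ih r) => //.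
- by have := cmodD (w - c) c; rewrite subrK; lra.
- move=> v vw; apply: fM; have := cmodD (v - w) (w - c).
  by rewrite addrA subrK; lra.
Qed.

End DerivativeEstimates.

(** * Poisson's formula and Taylor remainders *)

Section Poisson.
Context {R : realType}.
Implicit Types (F f : R[i] -> R[i]) (z : R[i]) (rho r t : R).

Definition poisson z (t : R) : R := (1 - cmod z ^+ 2) / cmod (cis t - z) ^+ 2.

Lemma circ1 t : circ 1 t = cis t :> R[i].
Proof. by rewrite /circ mul1r. Qed.

Lemma poisson_ge0 z t : cmod z < 1 -> 0 <= poisson z t.
Proof.
move=> z1; rewrite divr_ge0 ?exprn_ge0 ?cmod_ge0// subr_ge0.
by rewrite expr_le1 ?cmod_ge0// ltW.
Qed.

(** The Poisson kernel is the Cauchy kernel plus [cis t] times a function holomorphic across the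
    closed disk. In [poisson_formula] this second term, multiplied by [F], disappears by
    [cint_loop], and Cauchy's formula acquires a positive kernel. *)
Lemma poissonE z t : cmod z < 1 ->
  (poisson z t)%:C = cis t / (cis t - z) + cis t * (conjc z / (1 + - conjc z * cis t)).
Proof.
move=> z1; have n1 := @circ_sub_neq0 R 1 t z z1; rewrite circ1 in n1.
have c0 := cis_neq0 (R := R) t.
have cc : conjc (cis t) = (cis t)^-1 :> R[i].
  by have := @circ_conj R 1 t; rewrite circ1 expr1n mul1r.
have cs : conjc (cis t - z) = conjc (cis t) - conjc z by exact: rmorphB.
rewrite /poisson realCM realCV realCB -!mul_conjc cs cc.
have c2 : (cis t)^-1 - conjc z != 0 by rewrite -cc -cs conjc_eq0.
move: n1 c0 c2; generalize (cis t : R[i]) => u n1 c0 c2.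
have n2 : 1 + - conjc z * u != 0.
  rewrite (_ : _ + _ = (u^-1 - conjc z) * u); last by field.
  by rewrite mulf_neq0.
rewrite (_ : u^-1 - conjc z = (1 + - conjc z * u) / u); last by field.
by rewrite rmorph1; field; rewrite n1 c0 n2.
Qed.

Lemma cont01_poisson z : cmod z < 1 -> rcont01 (poisson z).
Proof.
move=> z1; have cd : cont01 (fun t => (cmod (cis t - z))%:C : R[i]).
  by apply: cont01_cmod; apply: cont01B; [exact: cont01_cis|exact: cont01_cst].
have cV : cont01 (fun t => ((cmod (cis t - z))%:C ^+ 2)^-1 : R[i]).
  apply: cont01V => [|t _]; first by apply: cont01M.
  rewrite expf_neq0// realC_eq0 gt_eqF// cmod_gt0.
  by have := @circ_sub_neq0 R 1 t z z1; rewrite circ1.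
have cM : cont01 (fun t => (1 - cmod z ^+ 2)%:C * ((cmod (cis t - z))%:C ^+ 2)^-1).
  by apply: cont01M => //; exact: cont01_cst.
by apply: cont01_eq cM => t _; rewrite /poisson realCM realCV expr2 [_ ^+ 2 in RHS]expr2 realCM.
Qed.

Lemma poisson_formula r F z : 1 < r -> holo r F -> cmod z < 1 ->
  F z = cint (fun t => F (cis t) * (poisson z t)%:C).
Proof.
move=> r1 hF z1; have z0 := cmod_ge0 z.
(* The second bound exceeds 1 and keeps w away from the pole of the added term, whose modulus is 1 /
   |z|. *)
pose r' := Num.min r (2 / (1 + cmod z)).
have z1' : 0 < 1 + cmod z by lra.
have r1' : 1 < r' by rewrite lt_min r1 ltr_pdivlMr//; lra.
have den w : cmod w < r' -> 1 + - conjc z * w != 0.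
  rewrite lt_min => /andP[_]; rewrite ltr_pdivlMr// => wz.
  rewrite -cmod_gt0; have := cmod_lbD 1 (- conjc z * w); rewrite cmod1 cmodM cmodN cmodJ.
  have w0 := cmod_ge0 w; have := ler_wpM2l w0 (ltW z1).
  by move: wz; rewrite mulrDr [cmod z * _]mulrC; lra.
pose h w := F w * (conjc z / (1 + - conjc z * w)).
have hh : holo r' h.
  apply: holoM; first by apply: holo_le hF; rewrite ge_min lexx.
  by apply: holoM; [exact: holo_cst|apply: holoV => //; exact: holo_affine].
have := cint_loop hh (_ : 0 < 1 < r'); rewrite ltr01 r1' => /(_ isT) loop.
have cF : cont01 (fun t => F (cis t)).
  apply: cont01_comp; last exact: cont01_cis.
  by move=> t _; apply: (holo_ccont hF); rewrite cmod_cis.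
have cc : cont01 (fun t => cis t / (cis t - z)).
  apply: cont01M; first exact: cont01_cis.
  apply: cont01V => [|t _]; first by apply: cont01B; [exact: cont01_cis|exact: cont01_cst].
  by have := @circ_sub_neq0 R 1 t z z1; rewrite circ1.
have ch : cont01 (fun t => cis t * h (cis t)).
  apply: cont01M; first exact: cont01_cis.
  apply: cont01_comp; last exact: cont01_cis.
  by move=> t _; apply: (holo_ccont hh); rewrite cmod_cis.
have -> : cint (fun t => F (cis t) * (poisson z t)%:C) =
    cint (fun t => F (cis t) * (cis t / (cis t - z)) + cis t * h (cis t)).
  by apply: eq_cint => t _; rewrite poissonE// mulrDr /h; congr (_ + _); ring.
rewrite cintD//; last exact: cont01M.
rewrite (cauchy_formula hF r1 z1) (_ : cint (fun t => cis t * h (cis t)) = 0); last first.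
  by rewrite -[RHS]loop; apply: eq_cint => t _; rewrite circ1.
by rewrite addr0; apply: eq_cint => t _; rewrite circ1.
Qed.

Lemma rint_poisson z : cmod z < 1 -> rint (poisson z) = 1.
Proof.
move=> z1; have := poisson_formula (ltr1n R 2) (@holo_cst R 2 1) z1.
under [X in _ = cint X -> _]eq_fun do rewrite mul1r.
by rewrite cint_real => /(congr1 (@complex.Re _)).
Qed.

Lemma rcont01M (f g : R -> R) : rcont01 f -> rcont01 g -> rcont01 (fun t => f t * g t).
Proof. by move=> cf cg; apply: cont01_eq (cont01M cf cg) => t _; exact/esym/realCM. Qed.

Lemma rcont01D (f g : R -> R) : rcont01 f -> rcont01 g -> rcont01 (fun t => f t + g t).
Proof. by move=> cf cg; apply: cont01_eq (cont01D cf cg) => t _; exact/esym/realCD. Qed.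

Lemma rcont01_cst (c : R) : rcont01 (fun=> c).
Proof. exact: cont01_cst. Qed.

Lemma cmod_poisson_le r F z : 1 < r -> holo r F -> cmod z < 1 ->
  cmod (F z) <= rint (fun t => poisson z t * cmod (F (cis t))).
Proof.
move=> r1 hF z1.
have cF : cont01 (fun t => F (cis t)).
  apply: cont01_comp; last exact: cont01_cis.
  by move=> t _; apply: (holo_ccont hF); rewrite cmod_cis.
have cP := cont01_poisson z1.
rewrite [F z](poisson_formula r1 hF z1); apply: cmod_cint.
- exact: cont01M.
- by apply: rcont01M => //; exact: cont01_cmod.
by move=> t _; rewrite cmodM cmodR_ge0 ?poisson_ge0// mulrC.
Qed.

Lemma geometric_kernel (c z : R[i]) N : c != 0 -> c - z != 0 ->
  c / (c - z) = \sum_(i < N) z ^+ i / c ^+ i + (z / c) ^+ N * (c / (c - z)).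
Proof.
move=> c0 cz; elim: N => [|N ih]; first by rewrite big_ord0 add0r expr0 mul1r.
rewrite {1}ih big_ord_recr /= -!addrA; congr (_ + _).
have cN : c ^+ N != 0 by rewrite expf_neq0.
by rewrite !expr_div_n !exprS; field; rewrite cz cN c0.
Qed.

Lemma cint_sum n (h : 'I_n -> R -> R[i]) : (forall i, cont01 (h i)) ->
  cont01 (fun t => \sum_(i < n) h i t) /\
  cint (fun t => \sum_(i < n) h i t) = \sum_(i < n) cint (h i).
Proof.
elim: n h => [|n ih] h ch.
  split; first by under eq_fun do rewrite big_ord0; exact: cont01_cst.
  by rewrite big_ord0; under [X in cint X]eq_fun do rewrite big_ord0; rewrite cint_cst.
have [cs sE] := ih (fun i => h (widen_ord (leqnSn n) i)) (fun i => ch _).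
have E : (fun t => \sum_(i < n.+1) h i t) =
    (fun t => \sum_(i < n) h (widen_ord (leqnSn n) i) t + h ord_max t).
  by apply/funext => t; rewrite big_ord_recr.
by rewrite E big_ord_recr /= -sE cintD//; split => //; exact: cont01D.
Qed.

(** The i-th Taylor coefficient at 0 as a circle average, so that sup bounds on the circle pass to
    it directly. *)
Definition taylor_coef rho f (i : nat) : R[i] := cint (fun t => f (circ rho t) / circ rho t ^+ i).

(** Truncating the geometric expansion of the Cauchy kernel after [N] terms leaves the factor (z /
    c)^N in the integrand. *)
Lemma taylor_remainder r rho f : holo r f -> 0 < rho < r -> forall z N, cmod z < rho ->
  cmod (f z - \sum_(i < N) taylor_coef rho f i * z ^+ i) <=
  (cmod z / rho) ^+ N * (rho / (rho - cmod z)) * rint (fun t => cmod (f (circ rho t))).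
Proof.
move=> hf /andP[r0 rr] z N zr.
have cf : cont01 (fun t => f (circ rho t)).
  apply: cont01_comp; last exact: cont01_circ.
  by move=> t _; apply: (holo_ccont hf); rewrite cmod_circ ?ltW.
have ccz : cont01 (fun t => circ rho t / (circ rho t - z)).
  apply: cont01M; first exact: cont01_circ.
  apply: cont01V => [|t _]; last exact: circ_sub_neq0.
  by apply: cont01B; [exact: cont01_circ|exact: cont01_cst].
have cV i : cont01 (fun t => (circ rho t ^+ i)^-1).
  by apply: cont01V => [|t _]; [apply: cont01X; exact: cont01_circ|rewrite expf_neq0 ?circ_neq0].
have cti (i : 'I_N) : cont01 (fun t => z ^+ i * (f (circ rho t) / circ rho t ^+ i)).
  by apply: cont01M; [exact: cont01_cst|exact: cont01M].
have [cs sE] := cint_sum cti.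
rewrite (cauchy_formula hf rr zr).
have -> : \sum_(i < N) taylor_coef rho f i * z ^+ i =
    cint (fun t => \sum_(i < N) z ^+ i * (f (circ rho t) / circ rho t ^+ i)).
  rewrite sE; apply: eq_bigr => i _; rewrite cintZ; first by rewrite mulrC.
  exact: cont01M.
have cfc : cont01 (fun t => f (circ rho t) * (circ rho t / (circ rho t - z))) by exact: cont01M.
rewrite -cintB// -rintZ; last exact: cont01_cmod.
apply: cmod_cint; first exact: cont01B.
  by apply: rcont01M; [exact: rcont01_cst|exact: cont01_cmod].
move=> t _; have cn := circ_neq0 t r0; have cz := circ_sub_neq0 t zr.
have cr : cmod (circ rho t) = rho by rewrite cmod_circ ?(ltW r0).
have lb : rho - cmod z <= cmod (circ rho t - z) by have := cmod_lb (circ rho t) z; rewrite cr.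
move: (circ rho t) (f (circ rho t)) cn cz cr lb => u y cn cz cr lb.
have -> : \sum_(i < N) z ^+ i * (y / u ^+ i) = y * \sum_(i < N) z ^+ i / u ^+ i.
  by rewrite mulr_sumr; apply: eq_bigr => i _; ring.
rewrite (geometric_kernel N cn cz) -mulrBr addrAC subrr add0r.
rewrite cmodM cmodM cmodX !cmodf cr mulrC; apply: ler_wpM2r; first exact: cmod_ge0.
apply: ler_wpM2l; first by rewrite exprn_ge0// divr_ge0 ?cmod_ge0// ltW.
by apply: ler_wpM2l; [exact: ltW|rewrite lef_pV2 ?posrE//; lra].
Qed.

End Poisson.

(** * Iterated square roots, real and complex *)

Section IteratedRoots.
Context {R : realType}.
Implicit Types (x y : R) (w z : R[i]) (M : nat).

(* The small exponent in the subharmonicity of |f|^s is s = 2^-M, so that it can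
   be realised by iterated square roots. *)
Definition rt M x : R := iter M Num.sqrt x.

Lemma rt_ge0 M x : 0 <= x -> 0 <= rt M x.
Proof. by move=> x0; case: M => [//|M]; rewrite /rt /= sqrtr_ge0. Qed.

Lemma le_rt M x y : x <= y -> rt M x <= rt M y.
Proof. by move=> xy; elim: M => [//|M ih]; rewrite /rt /= ler_wsqrtr. Qed.

Lemma rtM M x y : 0 <= x -> rt M (x * y) = rt M x * rt M y.
Proof.
by move=> x0; elim: M => [//|M ih]; rewrite /rt /= -!/(rt M _) ih sqrtrM ?rt_ge0.
Qed.

(** Inherited from the subadditivity of the square root. It yields the uniform continuity [rt_dist],
    on which all approximation arguments for |f|^(2^-M) rest. *)
Lemma rtD_le M x y : 0 <= x -> 0 <= y -> rt M (x + y) <= rt M x + rt M y.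
Proof.
move=> x0 y0; elim: M => [//|M ih]; rewrite /rt /= -!/(rt M _).
have a0 := rt_ge0 M x0; have b0 := rt_ge0 M y0.
apply: (le_trans (ler_wsqrtr ih)).
rewrite -(@ler_pXn2r _ 2)// ?nnegrE ?addr_ge0 ?sqrtr_ge0//.
rewrite sqr_sqrtr ?addr_ge0// sqrrD !sqr_sqrtr// addrAC lerDl mulrn_wge0// mulr_ge0 ?sqrtr_ge0.
Qed.

Lemma rt_expn M x : 0 <= x -> rt M (x ^+ (2 ^ M)) = x.
Proof.
move=> x0; elim: M x x0 => [|M ih] x x0; first by rewrite expn0 expr1.
by rewrite /rt /= -/(rt M _) expnS exprM ih ?exprn_ge0// sqrtr_sqr ger0_norm.
Qed.

Lemma rt_small M (e : R) : 0 < e -> exists2 d : R, 0 < d & rt M d <= e.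
Proof. by move=> e0; exists (e ^+ (2 ^ M)); [exact: exprn_gt0|rewrite rt_expn// ltW]. Qed.

Lemma rt_powR M x : 0 <= x -> rt M x = x `^ (2 ^- M).
Proof.
move=> x0; elim: M => [|M ih]; first by rewrite expr0 invr1 powRr1.
by rewrite /rt /= -/(rt M x) -powR12_sqrt ?rt_ge0// ih -powRrM exprSr invfM.
Qed.

Lemma rt_dist M x y : 0 <= x -> 0 <= y -> `|rt M x - rt M y| <= rt M `|x - y|.
Proof.
wlog yx : x y / y <= x => [H x0 y0|x0 y0].
  have [/H|/ltW xy] := leP y x; first exact.
  by rewrite distrC [`|x - y|]distrC; exact: H.
rewrite [in leRHS]ger0_norm ?subr_ge0// ger0_norm ?subr_ge0 ?le_rt// lerBlDl.
by rewrite -[X in rt M X <= _](subrKC y) rtD_le// subr_ge0.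
Qed.

Lemma cont01_rt M (f : R -> R) : rcont01 f -> (forall t, 0 <= f t) -> rcont01 (fun t => rt M (f t)).
Proof.
move=> cf f0 t t01 e e0; have e20 : 0 < e / 2 by lra.
have [d d0 dP] := rt_small M e20; have [s s0 sP] := cf t t01 d d0.
exists s => // u u01 ut; have := sP u u01 ut; rewrite -!realCB !cmodR => H.
apply: (le_lt_trans (rt_dist M (f0 u) (f0 t))).
by apply: (le_lt_trans (le_rt M (ltW H))); lra.
Qed.

(** The principal root on the right half plane in algebraic form: w + |w| bisects the angle between
    [w] and the positive axis, and its squared modulus 2 |w| (Re w + |w|) explains the
    normalisation. *)
Definition csqrt w : R[i] := (w + (cmod w)%:C) / (Num.sqrt (2 * (complex.Re w + cmod w)))%:C.

Lemma csqrt_den w : 0 < complex.Re w -> 0 < 2 * (complex.Re w + cmod w).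
Proof. by move=> w0; have := cmod_ge0 w; lra. Qed.

Lemma sqr_csqrt w : 0 < complex.Re w -> csqrt w ^+ 2 = w.
Proof.
move=> w0; have D0 := csqrt_den w0; rewrite /csqrt expr_div_n.
have -> : (Num.sqrt (2 * (complex.Re w + cmod w)))%:C ^+ 2 = (2 * (complex.Re w + cmod w))%:C :> R[i].
  by rewrite expr2 -realCM -expr2 sqr_sqrtr// ltW.
have Dn : (2 * (complex.Re w + cmod w))%:C != 0 :> R[i] by rewrite realC_eq0 gt_eqF.
apply: (canLR (mulfK Dn)).
have E : (cmod w)%:C ^+ 2 = w * conjc w :> R[i] by rewrite mul_conjc expr2 -realCM -expr2.
have E2 : (2 * (complex.Re w + cmod w))%:C = w + conjc w + 2 * (cmod w)%:C :> R[i].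
  rewrite mulrDr realCD; congr (_ + _); last by rewrite realCM (rmorph_nat (real_complex R)).
  by case: (w) => a b; apply/eqP; rewrite eq_complex /=; apply/andP; split; apply/eqP; ring.
rewrite E2 (_ : (w + (cmod w)%:C) ^+ 2 = w * w + 2 * (w * (cmod w)%:C) + (cmod w)%:C ^+ 2); last by ring.
by rewrite E; ring.
Qed.

Lemma Re_csqrt_gt0 w : 0 < complex.Re w -> 0 < complex.Re (csqrt w).
Proof.
move=> w0; have D0 := csqrt_den w0; rewrite /csqrt -realCV cReM /= mulr0 subr0.
rewrite mulr_gt0 ?invr_gt0 ?sqrtr_gt0// cReD /=; have := cmod_ge0 w; lra.
Qed.

Lemma cmod_csqrt w : 0 < complex.Re w -> cmod (csqrt w) = Num.sqrt (cmod w).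
Proof.
by move=> w0; rewrite -{2}(sqr_csqrt w0) cmodX sqrtr_sqr ger0_norm ?cmod_ge0.
Qed.

(** From h = (s' - s)(s' + s): both roots lie in the right half plane and cannot cancel, so |s' + s|
    is at least the real part of [s] and s' - s is of the order of h. *)
Lemma cdiff_csqrt w : 0 < complex.Re w -> cdiff csqrt w (2 * csqrt w)^-1.
Proof.
move=> w0 e e0; set s := csqrt w; have s0 : 0 < complex.Re s by exact: Re_csqrt_gt0.
set x := complex.Re s in s0; have E := sqr_csqrt w0; rewrite -/s in E.
exists (Num.min (complex.Re w) (e * (2 * x ^+ 3))).
  by rewrite lt_min w0 mulr_gt0// mulr_gt0// exprn_gt0.
move=> h; rewrite lt_min => /andP[hw he].
have wh0 : 0 < complex.Re (w + h).
  by rewrite cReD; have := norm_Re_le h; rewrite ler_norml => /andP[]; lra.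
set s' := csqrt (w + h); have s'0 : 0 < complex.Re s' by exact: Re_csqrt_gt0.
have E' := sqr_csqrt wh0; rewrite -/s' in E'.
have lb : x <= cmod (s' + s).
  by apply: le_trans (Re_le_cmod _); rewrite cReD /x; lra.
have lb2 : x <= cmod s by exact: Re_le_cmod.
have n1 : s' + s != 0 by rewrite -cmod_gt0; exact: lt_le_trans lb.
have n2 : s != 0 by rewrite -cmod_gt0; exact: lt_le_trans lb2.
have hE : h = (s' - s) * (s' + s) by rewrite -subr_sqr E E'; ring.
have d1 : cmod (s' - s) <= cmod h / x.
  have -> : cmod h = cmod (s' - s) * cmod (s' + s) by rewrite [in LHS]hE cmodM.
  by rewrite ler_pdivlMr// ler_wpM2l ?cmod_ge0.
rewrite (_ : s' - s - (2 * s)^-1 * h = - (h * (s' - s) / (2 * s * (s' + s)))); last first.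
  by rewrite hE; field; rewrite n1 n2.
have x0 : 0 <= x by exact: ltW.
rewrite cmodN cmodf cmodM [cmod (2 * s * _)]cmodM [cmod (2 * s)]cmodM cmod_nat ler_pdivrMr; last first.
  by apply: mulr_gt0; [apply: mulr_gt0 => //; exact: lt_le_trans lb2|exact: lt_le_trans lb].
have h0 := cmod_ge0 h.
apply: (@le_trans _ _ (cmod h * (cmod h / x))); first exact: ler_wpM2l.
rewrite [e * cmod h]mulrC -[leRHS]mulrA; apply: ler_wpM2l => //.
apply: (@le_trans _ _ (e * (2 * x * x))); last first.
  apply: ler_wpM2l; first exact: ltW.
  by apply: ler_pM => //; [rewrite mulr_ge0|rewrite ler_wpM2l].
rewrite ler_pdivrMr//; apply: (le_trans (ltW he)).
by rewrite le_eqVlt; apply/orP; left; apply/eqP; rewrite !exprS expr0; ring.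
Qed.

Definition rootc M w : R[i] := iter M csqrt w.

Lemma Re_rootc_gt0 M w : 0 < complex.Re w -> 0 < complex.Re (rootc M w).
Proof. by move=> w0; elim: M => [//|M ih]; exact: Re_csqrt_gt0. Qed.

Lemma cmod_rootc M w : 0 < complex.Re w -> cmod (rootc M w) = rt M (cmod w).
Proof.
move=> w0; elim: M => [//|M ih]; rewrite /rootc /= -/(rootc M w) cmod_csqrt ?ih//.
exact: Re_rootc_gt0.
Qed.

Lemma holo_rootc r M (G : R[i] -> R[i]) : holo r G -> (forall z, cmod z < r -> 0 < complex.Re (G z)) ->
  holo r (fun z => rootc M (G z)).
Proof.
move=> hG G0; elim: M => [//|M ih] z zr; have [d dP] := ih z zr.
by eexists; apply: (cdiff_comp dP); apply: cdiff_csqrt; exact: Re_rootc_gt0 (G0 z zr).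
Qed.

End IteratedRoots.

(** * Subharmonicity of powers of the modulus *)

Section Subharmonic.
Context {R : realType}.
Implicit Types (f h : R[i] -> R[i]) (z w : R[i]) (M : nat).

Definition submean M f z := rt M (cmod (f z)) <= rint (fun t => poisson z t * rt M (cmod (f (cis t)))).

Lemma cont01_rt_cmod M (h : R -> R[i]) : cont01 h -> rcont01 (fun t => rt M (cmod (h t))).
Proof. by move=> ch; apply: cont01_rt => [|t]; [exact: cont01_cmod|exact: cmod_ge0]. Qed.

(** An error [d] in the modulus costs only [rt M d] by subadditivity, and the Poisson kernel has
    integral 1, so the inequality survives uniform approximation. *)
Lemma submean_approx M f z : cmod z < 1 -> cont01 (fun t => f (cis t)) ->
  (forall d : R, 0 < d -> exists h, [/\ cont01 (fun t => h (cis t)), submean M h z,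
     cmod (f z - h z) <= d & forall t, cmod (f (cis t) - h (cis t)) <= d]) ->
  submean M f z.
Proof.
move=> z1 cf H; apply/ler_addgt0Pr => e e0; have e20 : 0 < e / 2 by lra.
have [d d0 dP] := rt_small M e20; have [h [ch hz fhz fht]] := H d d0.
have step (u v : R[i]) : cmod (u - v) <= d -> rt M (cmod u) <= rt M (cmod v) + e / 2.
  move=> uv; have u1 : cmod u <= cmod v + d by have := cmod_lb u v; lra.
  apply: (le_trans (le_rt M u1)); apply: (le_trans (rtD_le M (cmod_ge0 v) (ltW d0))).
  by rewrite lerD2l.
apply: (le_trans (step _ _ fhz)).
have cP := cont01_poisson z1.
have ES (X : R) : X + e = X + e / 2 + e / 2 by lra.
rewrite ES lerD2r; apply: (le_trans hz).
have EP : e / 2 = rint (fun t => e / 2 * poisson z t) by rewrite rintZ// rint_poisson// mulr1.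
rewrite EP -rintD; first last.
- by apply: rcont01M => //; exact: rcont01_cst.
- by apply: rcont01M => //; exact: cont01_rt_cmod.
apply: le_rint.
- by apply: rcont01M => //; exact: cont01_rt_cmod.
- apply: rcont01D; apply: rcont01M => //; [exact: cont01_rt_cmod|exact: rcont01_cst].
move=> t _; rewrite [e / 2 * _]mulrC -mulrDr; apply: ler_wpM2l; first exact: poisson_ge0.
by apply: step; rewrite cmod_distC.
Qed.

(** For |b| <= 1 the zeros 1 / b avoid the open unit disk. Unlike w - a, each factor 1 - b w stays
    close to 1 in the sense needed for roots: after dilation its real part is positive. *)
Definition factors (K : R[i]) (bs : seq R[i]) w : R[i] := K * \prod_(b <- bs) (1 - b * w).

Lemma factors_cons (K b : R[i]) bs w : factors K (b :: bs) w = (1 - b * w) * factors K bs w.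
Proof. by rewrite /factors big_cons mulrCA. Qed.

Lemma factors_lipschitz (K : R[i]) bs : all (fun b => cmod b <= 1) bs -> exists2 L : R, 0 <= L &
  forall w (l : R), cmod w <= 1 -> 0 <= l <= 1 -> cmod (factors K bs w) <= L /\
    cmod (factors K bs w - factors K bs (l%:C * w)) <= L * (1 - l).
Proof.
elim: bs => [_|b bs ih /= /andP[b1 /ih[L L0 H]]].
  exists (cmod K); first exact: cmod_ge0.
  move=> w l w1 l01; rewrite /factors !big_nil mulr1 subrr cmod0; split => //.
  by rewrite mulr_ge0 ?cmod_ge0//; lra.
exists (3 * L); first by rewrite mulr_ge0.
move=> w l w1 l01; have [l0 l1] := andP l01; have [F1 F2] := H w l w1 l01.
have bw : cmod (b * w) <= 1 by rewrite cmodM mulr_ile1 ?cmod_ge0.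
have B1 : cmod (1 - b * w) <= 2 by have := cmodB 1 (b * w); rewrite cmod1; lra.
rewrite !factors_cons; split.
  rewrite cmodM; apply: (@le_trans _ _ (2 * L)); first by apply: ler_pM; rewrite ?cmod_ge0.
  by apply: ler_wpM2r => //; lra.
rewrite (_ : _ - _ = b * w * (l - 1)%:C * factors K bs w +
  (1 - b * (l%:C * w)) * (factors K bs w - factors K bs (l%:C * w))); last first.
  by rewrite realCB; ring.
apply: (le_trans (cmodD _ _)).
rewrite cmodM [cmod (b * w * _)]cmodM [cmod ((1 - _) * _)]cmodM.
have -> : cmod (l - 1)%:C = 1 - l by rewrite cmodR ler0_norm; lra.
have B2 : cmod (1 - b * (l%:C * w)) <= 2.
  have := cmodB 1 (b * (l%:C * w)); rewrite mulrCA cmodM cmodR_ge0 ?cmod1; last lra.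
  have : l * cmod (b * w) <= 1 by rewrite mulr_ile1 ?cmod_ge0//; lra.
  lra.
have l10 : 0 <= 1 - l by lra.
have t1 : cmod (b * w) * (1 - l) * cmod (factors K bs w) <= 1 * (1 - l) * L.
  by apply: ler_pM; rewrite ?mulr_ge0 ?cmod_ge0//; apply: ler_wpM2r.
have t2 : cmod (1 - b * (l%:C * w)) * cmod (factors K bs w - factors K bs (l%:C * w)) <= 2 * (L * (1 - l)).
  by apply: ler_pM; rewrite ?cmod_ge0.
lra.
Qed.

Lemma holo_factors r K bs : holo r (factors K bs).
Proof.
elim: bs => [|b bs ih].
  rewrite (_ : factors K [::] = fun=> K); first exact: holo_cst.
  by apply/funext => w; rewrite /factors big_nil mulr1.
rewrite (_ : factors K (b :: bs) = fun w => (1 + (- b) * w) * factors K bs w).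
  by apply: holoM => //; exact: holo_affine.
by apply/funext => w; rewrite factors_cons mulNr.
Qed.

Lemma cont01_holo_cis r f : 1 < r -> holo r f -> cont01 (fun t => f (cis t)).
Proof.
move=> r1 hf; apply: cont01_comp; last exact: cont01_cis.
by move=> t _; apply: (holo_ccont hf); rewrite cmod_cis.
Qed.

(* For [l < 1] every factor [1 - b l w] maps the closed unit disk into the right
   half plane, where iterated square roots are holomorphic. *)
Lemma submean_dilated_factors M (K : R[i]) bs z (l : R) : all (fun b => cmod b <= 1) bs ->
  0 < l < 1 -> cmod z < 1 -> submean M (fun w => factors K bs (l%:C * w)) z.
Proof.
move=> bs1 /andP[l0 l1] z1.
have li : 1 < l^-1 by rewrite invf_gt1.
have [h hh hE] : exists2 h, holo l^-1 h & forall w, cmod w < l^-1 ->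
    cmod (h w) = rt M (cmod (factors K bs (l%:C * w))).
  elim: bs bs1 => [_|b bs ih /= /andP[b1 /ih[h hh hE]]].
    exists (fun=> (rt M (cmod K))%:C); first exact: holo_cst.
    by move=> w _; rewrite /factors big_nil mulr1 cmodR_ge0// rt_ge0// cmod_ge0.
  have Re0 w : cmod w < l^-1 -> 0 < complex.Re (1 + (- (b * l%:C)) * w).
    move=> wl; rewrite cReD /=; have := norm_Re_le (- (b * l%:C) * w).
    rewrite cmodM cmodN cmodM cmodR_ge0 ?(ltW l0)// => H.
    have : cmod b * l * cmod w < 1.
      rewrite -mulrA; apply: (@le_lt_trans _ _ (l * cmod w)).
        by rewrite ler_piMl// mulr_ge0 ?cmod_ge0// ltW.
      by rewrite -(mulfV (lt0r_neq0 l0)) ltr_pM2l.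
    by move: H; rewrite ler_norml => /andP[]; lra.
  exists (fun w => rootc M (1 + (- (b * l%:C)) * w) * h w).
    by apply: holoM => //; apply: holo_rootc => //; exact: holo_affine.
  move=> w wl; rewrite cmodM cmod_rootc ?hE ?Re0// -rtM ?cmod_ge0// -cmodM factors_cons.
  by congr (rt M (cmod (_ * _))); ring.
rewrite /submean -hE; last by apply: lt_trans li.
apply: (le_trans (cmod_poisson_le li hh z1)); rewrite le_eqVlt; apply/orP; left; apply/eqP.
by apply: eq_rint => t _; rewrite hE// cmod_cis.
Qed.

(** Zeros may lie on the unit circle itself, so the dilated case is used for l < 1 and the Lipschitz
    bound lets l tend to 1. *)
Lemma submean_factors M (K : R[i]) bs z : all (fun b => cmod b <= 1) bs -> cmod z < 1 ->
  submean M (factors K bs) z.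
Proof.
move=> bs1 z1; apply: submean_approx => //.
  have r2 : (1 : R) < 2 by rewrite ltr1n.
  exact: cont01_holo_cis r2 (@holo_factors 2 K bs).
move=> d d0; have [L L0 H] := factors_lipschitz K bs1.
pose l := 1 - Num.min (d / (L + 1)) 2^-1.
have L1 : 0 < L + 1 by lra.
have m0 : 0 < Num.min (d / (L + 1)) 2^-1 by rewrite lt_min; apply/andP; split; [exact: divr_gt0|rewrite invr_gt0].
have m2 : Num.min (d / (L + 1)) 2^-1 <= 2^-1 by rewrite ge_min lexx orbT.
have l01 : 0 < l < 1 by apply/andP; rewrite /l; split; lra.
have l01' : 0 <= l <= 1 by case/andP: l01 => /ltW -> /ltW ->.
have Ld : L * (1 - l) <= d.
  have m1 : 1 - l <= d / (L + 1) by rewrite /l opprB addrCA subrr addr0 ge_min lexx.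
  apply: (le_trans (ler_wpM2l L0 m1)).
  by rewrite mulrA ler_pdivrMr// [d * _]mulrC; apply: ler_wpM2r; [exact: ltW|lra].
exists (fun w => factors K bs (l%:C * w)); split.
- apply: (@cont01_comp _ (factors K bs) (fun t => l%:C * cis t)); last first.
    by apply: cont01M; [exact: cont01_cst|exact: cont01_cis].
  move=> t _; apply: (holo_ccont (@holo_factors 2 K bs)).
  by rewrite cmodM cmod_cis mulr1 cmodR_ge0; lra.
- exact: submean_dilated_factors.
- by apply: le_trans (H z l (ltW z1) l01').2 _.
- by move=> t; apply: le_trans (H (cis t) l _ l01').2 _ => //; rewrite cmod_cis.
Qed.

(* Zeros [a] inside the disk are reflected: [|w - a| <= |1 - conj a * w|] there,
   with equality on the unit circle. *)
Lemma reflect_zeros (s : seq R[i]) : exists K bs, all (fun b => cmod b <= 1) bs /\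
  forall w, cmod w <= 1 -> cmod (\prod_(a <- s) (w - a)) <= cmod (factors K bs w) /\
    (cmod w = 1 -> cmod (\prod_(a <- s) (w - a)) = cmod (factors K bs w)).
Proof.
elim: s => [|a s [K [bs [bs1 H]]]].
  by exists 1, [::]; split => // w _; rewrite /factors !big_nil mulr1.
have [a1|a1] := leP (cmod a) 1; last first.
  have an : a != 0 by rewrite -cmod_gt0; lra.
  exists (- a * K), (a^-1 :: bs); split.
    by rewrite /= bs1 andbT cmodV invf_le1//; lra.
  move=> w w1; have [H1 H2] := H w w1.
  have E : factors (- a * K) (a^-1 :: bs) w = (w - a) * factors K bs w.
    by rewrite factors_cons /factors; field.
  rewrite big_cons E cmodM [cmod ((w - a) * factors _ _ _)]cmodM; split; first by rewrite ler_wpM2l ?cmod_ge0.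
  by move=> /H2 ->.
exists K, (conjc a :: bs); split; first by rewrite /= bs1 andbT cmodJ.
move=> w w1; have [H1 H2] := H w w1; rewrite big_cons factors_cons cmodM [cmod ((1 - _) * _)]cmodM.
have E : cmod (1 - conjc a * w) ^+ 2 = cmod (w - a) ^+ 2 + (1 - cmod a ^+ 2) * (1 - cmod w ^+ 2).
  rewrite !sqr_cmod; case: (a) => x y; case: (w) => u v /=; ring.
have aw : cmod (w - a) <= cmod (1 - conjc a * w).
  rewrite -(@ler_pXn2r _ 2)// ?nnegrE ?cmod_ge0// E lerDl mulr_ge0// subr_ge0 expr_le1 ?cmod_ge0//.
split; first by apply: ler_pM; rewrite ?cmod_ge0.
move=> w11; rewrite H2//; congr (_ * _); apply/eqP.
by rewrite -(@eqrXn2 _ 2) ?cmod_ge0// E w11 expr1n subrr mulr0 addr0.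
Qed.

(** Reflecting the zeros inside the disk raises the modulus inside and leaves it unchanged on the
    circle, so the inequality for the reflected product implies the one for the polynomial. *)
Lemma submean_poly M (p : {poly R[i]}) z : cmod z < 1 -> submean M (fun w => p.[w]) z.
Proof.
move=> z1; have [s E] := closed_field_poly_normal p.
have [K [bs [bs1 H]]] := reflect_zeros s.
have PE w : p.[w] = lead_coef p * \prod_(a <- s) (w - a).
  rewrite [in LHS]E hornerZ horner_prod; congr (_ * _).
  by apply: eq_bigr => a _; rewrite hornerXsubC.
have FE w : factors (lead_coef p * K) bs w = lead_coef p * factors K bs w by rewrite /factors mulrA.
have := submean_factors M (lead_coef p * K) bs1 z1; rewrite /submean.
rewrite (_ : rint (fun t => poisson z t * rt M (cmod (factors (lead_coef p * K) bs (cis t)))) =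
  rint (fun t => poisson z t * rt M (cmod p.[cis t]))); last first.
  apply: eq_rint => t _; rewrite FE PE; congr (_ * rt M _).
  by rewrite cmodM [in RHS]cmodM (H (cis t) _).2 ?cmod_cis.
apply: le_trans; apply: le_rt; rewrite FE PE cmodM [leRHS]cmodM ler_wpM2l ?cmod_ge0//.
by apply: (H z _).1; exact: ltW.
Qed.

Lemma exists_expr_le (x K e : R) : 0 <= x < 1 -> 0 <= K -> 0 < e -> exists N : nat, x ^+ N * K <= e.
Proof.
move=> /andP[x0 x1] K0 e0; have K1 : 0 < K + 1 by lra.
have xn : `|x| < 1 by rewrite ger0_norm.
have /cvgrPdist_lt/(_ _ (divr_gt0 e0 K1))[N _ HN] := cvg_expr xn.
exists N; have := HN N (leqnn N); rewrite /= sub0r normrN ger0_norm ?exprn_ge0// ltr_pdivlMr// => h.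
apply: le_trans (ltW h); rewrite ler_wpM2l ?exprn_ge0//; lra.
Qed.

(** Taylor polynomials converge uniformly on the closed unit disk because [f] is holomorphic on a
    larger one. *)
Lemma submean_holo M r f z : 1 < r -> holo r f -> cmod z < 1 -> submean M f z.
Proof.
move=> r1 hf z1; apply: submean_approx => //; first exact: cont01_holo_cis hf.
move=> d d0; pose rho := (1 + r) / 2.
have rhor : 0 < rho < r by rewrite /rho; lra.
have rho1 : 1 < rho by rewrite /rho; lra.
have [I [I0 IE]] : exists I : R, 0 <= I /\ rint (fun t => cmod (f (circ rho t))) = I.
  by eexists; split; last reflexivity; apply: rint_ge0 => t _; exact: cmod_ge0.
pose A := rho / (rho - 1) * I.
have A0 : 0 <= A by rewrite mulr_ge0// divr_ge0//; lra.
have ri : 0 <= rho^-1 < 1 by rewrite invr_ge0 invf_lt1; lra.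
have [N NP] := exists_expr_le ri A0 d0.
pose p := \poly_(i < N) taylor_coef rho f i.
have pE w : p.[w] = \sum_(i < N) taylor_coef rho f i * w ^+ i by rewrite horner_poly.
have close w : cmod w <= 1 -> cmod (f w - p.[w]) <= d.
  move=> w1; rewrite pE; apply: le_trans NP.
  have wr : cmod w < rho by lra.
  apply: (le_trans (taylor_remainder hf rhor N wr)); rewrite IE.
  rewrite -mulrA; have w0 := cmod_ge0 w; apply: ler_pM.
  - by rewrite exprn_ge0// divr_ge0//; lra.
  - by rewrite mulr_ge0// divr_ge0//; lra.
  - have wr' : cmod w / rho <= rho^-1 by rewrite ler_pdivrMr ?mulVf; lra.
    by apply: lerXn2r wr'; rewrite nnegrE ?divr_ge0 ?invr_ge0//; lra.
  - rewrite ler_wpM2r// ler_wpM2l//; first lra.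
    by rewrite lef_pV2 ?posrE; lra.
have hp : holo 2 (fun w => p.[w]).
  have -> : (fun w => p.[w]) = (fun w => \sum_(i < size p) p`_i * w ^+ i).
    by apply/funext => w; rewrite horner_coef.
  have hX i : holo 2 (fun w : R[i] => w ^+ i).
    elim: i => [|i ih]; first exact: holo_cst.
    have -> : (fun w : R[i] => w ^+ i.+1) = (fun w => (0 + 1 * w) * w ^+ i).
      by apply/funext => w; rewrite add0r mul1r exprS.
    by apply: holoM => //; exact: holo_affine.
  elim: (size p) => [|n ih].
    have -> : (fun w : R[i] => \sum_(i < 0) p`_i * w ^+ i) = (fun=> 0) by apply/funext => w; rewrite big_ord0.
    exact: holo_cst.
  have -> : (fun w : R[i] => \sum_(i < n.+1) p`_i * w ^+ i) = (fun w => \sum_(i < n) p`_i * w ^+ i + p`_n * w ^+ n).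
    by apply/funext => w; rewrite big_ord_recr.
  by apply: holoD => //; apply: holoM => //; exact: holo_cst.
exists (fun w => p.[w]); split.
- by apply: cont01_holo_cis hp; exact: ltr1n.
- exact: submean_poly.
- by apply: close; exact: ltW.
- by move=> t; apply: close; rewrite cmod_cis.
Qed.

(** A convex power lies above its tangent at [a]: Young's inequality for x / a and 1 with the
    conjugate exponents s and s / (s - 1). *)
Lemma powR_tangent (s x a : R) : 1 <= s -> 0 <= x -> 0 < a ->
  a `^ s + s * a `^ (s - 1) * (x - a) <= x `^ s.
Proof.
rewrite le_eqVlt => /predU1P[<-|s1] x0 a0.
  by rewrite subrr powRr0 !powRr1 ?(ltW a0)//; lra.
have s0 : 0 < s by lra.
have u0 : 0 <= x / a by rewrite divr_ge0// ltW.
have := @conjugate_powR R (x / a) 1 s (s / (s - 1)) u0 ler01 s0.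
rewrite divr_gt0 ?subr_gt0// => /(_ isT).
have -> : s^-1 + (s / (s - 1))^-1 = 1 by field; rewrite gt_eqF//=; lra.
move=> /(_ erefl); rewrite mulr1 powR1 => H.
have E : x `^ s = a `^ s * (x / a) `^ s.
  by rewrite -powRM ?(ltW a0)// mulrC divfK// gt_eqF.
have -> : a `^ (s - 1) = a `^ s / a.
  by rewrite powRB ?gt_eqF ?implybT// powRr1// ltW.
rewrite E (_ : _ + _ = a `^ s * (1 + s * (x / a - 1))); last by field; rewrite gt_eqF.
apply: ler_wpM2l; first exact: powR_ge0.
have : s * (x / a) <= s * ((x / a) `^ s / s + 1 / (s / (s - 1))) by rewrite ler_pM2l.
have -> : s * ((x / a) `^ s / s + 1 / (s / (s - 1))) = (x / a) `^ s + (s - 1).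
  by field; rewrite !gt_eqF//; lra.
lra.
Qed.

Lemma powR_epsdelta (s x e : R) : 0 < s -> 0 <= x -> 0 < e -> exists2 d : R, 0 < d &
  forall y, 0 <= y -> `|y - x| < d -> `|y `^ s - x `^ s| < e.
Proof.
move=> s0; rewrite le_eqVlt => /predU1P[<-|x0] e0.
  exists (e `^ s^-1); first exact: powR_gt0.
  move=> y y0; rewrite subr0 ger0_norm// powR0 ?gt_eqF// subr0 ger0_norm ?powR_ge0//.
  move=> /(gt0_ltr_powR s0) H; have := H y0 (powR_ge0 _ _).
  by rewrite -powRrM mulVf ?gt_eqF// powRr1// ltW.
have dx : derivable (@powR R ^~ s) x 1 by apply: derivable_powR; rewrite in_itv /= andbT.
have cx : {for x, continuous (@powR R ^~ s)}.
  by apply: differentiable_continuous; apply/derivable1_diffP.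
have /cvgrPdist_lt/(_ e e0) := cx.
move=> /nbhs_ballP[d /= d0 dP]; exists d => // y y0 yx.
by rewrite distrC; apply: dP; rewrite /ball /= distrC.
Qed.

Lemma cont01_powR (s : R) (f : R -> R) : 0 < s -> rcont01 f -> (forall t, 0 <= f t) ->
  rcont01 (fun t => f t `^ s).
Proof.
move=> s0 cf f0 t t01 e e0; have [d d0 dP] := powR_epsdelta s0 (f0 t) e0.
have [r r0 rP] := cf t t01 d d0; exists r => // u u01 ut.
rewrite -realCB cmodR; apply: dP => //.
by have := rP u u01 ut; rewrite -realCB cmodR.
Qed.

(** The tangent inequality at the mean value [a] is integrated against the probability density [K];
    its linear term integrates to 0. *)
Lemma jensen_rint (s : R) (K phi : R -> R) : 1 <= s -> rcont01 K -> rcont01 phi ->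
  (forall t, 0 <= K t) -> (forall t, 0 <= phi t) -> rint K = 1 ->
  rint (fun t => K t * phi t) `^ s <= rint (fun t => K t * phi t `^ s).
Proof.
move=> s1 cK cphi K0 phi0 K1; set a := rint (fun t => K t * phi t).
have a0 : 0 <= a by apply: rint_ge0 => t _; rewrite mulr_ge0.
have cs : rcont01 (fun t => K t * phi t `^ s).
  by apply: rcont01M => //; apply: cont01_powR => //; lra.
have [a00|an0] := eqVneq a 0.
  rewrite a00 powR0; last by rewrite gt_eqF//; lra.
  by apply: rint_ge0 => t _; rewrite mulr_ge0 ?powR_ge0.
have ap : 0 < a by rewrite lt0r an0.
set c := s * a `^ (s - 1); set b := a `^ s.
have -> : b = rint (fun t => (b - c * a) * K t + c * (K t * phi t)).
  rewrite rintD; first last.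
  - by apply: rcont01M; [exact: rcont01_cst|exact: rcont01M].
  - by apply: rcont01M => //; exact: rcont01_cst.
  rewrite !rintZ//; last exact: rcont01M.
  by rewrite K1 -/a; ring.
apply: le_rint => //.
  apply: rcont01D; apply: rcont01M => //; try exact: rcont01_cst.
  exact: rcont01M.
move=> t _; have := powR_tangent s1 (phi0 t) ap; rewrite -/b -/c => H.
rewrite (_ : _ + _ = K t * (b + c * (phi t - a))); last by ring.
by rewrite ler_wpM2l.
Qed.

Lemma exists_exp2V (p : R) : 0 < p -> exists M : nat, 2 ^- M <= p.
Proof.
move=> p0; have [M MP] := exists_exp2 1 p0.
by exists M; rewrite -[X in X <= _]mul1r ltW.
Qed.

(** With 2^-M <= p, the power p of |f| is the power p 2^M >= 1 of |f|^(2^-M), and Jensen's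
    inequality applies to the Poisson kernel. *)
Theorem powR_submean (p r : R) f z : 0 < p -> 1 < r -> holo r f -> cmod z < 1 ->
  cmod (f z) `^ p <= rint (fun t => poisson z t * cmod (f (cis t)) `^ p).
Proof.
move=> p0 r1 hf z1; have [M Mp] := exists_exp2V p0.
have s1 : 1 <= p * 2 ^+ M by rewrite -ler_pdivrMr ?exprn_gt0// mul1r.
have E x : 0 <= x -> x `^ p = rt M x `^ (p * 2 ^+ M).
  move=> x0; rewrite rt_powR// -powRrM mulrCA mulVf ?mulr1//.
have cf := cont01_holo_cis r1 hf.
have ct := cont01_rt_cmod M cf.
apply: (@le_trans _ _ (rint (fun t => poisson z t * rt M (cmod (f (cis t)))) `^ (p * 2 ^+ M))).
  rewrite E ?cmod_ge0//; apply: ge0_ler_powR; rewrite ?nnegrE ?rt_ge0 ?cmod_ge0//; first lra.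
    by apply: rint_ge0 => t _; rewrite mulr_ge0 ?poisson_ge0 ?rt_ge0 ?cmod_ge0.
  exact: submean_holo hf z1.
apply: (le_trans (jensen_rint s1 (cont01_poisson z1) ct _ _ (rint_poisson z1))).
- by move=> t; exact: poisson_ge0.
- by move=> t; rewrite rt_ge0 ?cmod_ge0.
rewrite le_eqVlt; apply/orP; left; apply/eqP; apply: eq_rint => t _.
by rewrite E ?cmod_ge0.
Qed.


End Subharmonic.

(** * Affine substitution for Borel functions *)

Section AffineMeasure.
Context {R : realType} (c a : R).
Local Open Scope ereal_scope.
Local Notation mu := (@lebesgue_measure R).

Definition affine_map (x : measurableTypeR R) : measurableTypeR R := (c * x + a)%R.

Lemma measurable_affine_map : measurable_fun setT affine_map.
Proof. by apply: measurable_funD; [exact: measurable_funM|exact: measurable_cst]. Qed.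

Definition affine_image : set (measurableTypeR R) -> \bar R := pushforward mu affine_map.

Let measurable_preimage (A : set (measurableTypeR R)) : measurable A ->
  measurable (affine_map @^-1` A).
Proof. by move=> mA; rewrite -(setTI (_ @^-1` _)); exact: measurable_affine_map. Qed.

Let affine_image0 : affine_image set0 = 0.
Proof. by rewrite /affine_image /pushforward preimage_set0 measure0. Qed.

Let affine_image_ge0 A : 0 <= affine_image A.
Proof. by rewrite /affine_image /pushforward measure_ge0. Qed.

Let affine_image_sigma_additive : semi_sigma_additive affine_image.
Proof.
move=> F mF tF mUF; rewrite /affine_image /pushforward preimage_bigcup.
apply: measure_semi_sigma_additive.
- by move=> n; exact: measurable_preimage.
- apply/trivIsetP => /= i j _ _ ij; rewrite -preimage_setI.
  by move/trivIsetP : tF => /(_ _ _ _ _ ij) ->//; rewrite preimage_set0.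
- by rewrite -preimage_bigcup; exact: measurable_preimage.
Qed.

HB.instance Definition _ := isMeasure.Build _ _ _ affine_image
  affine_image0 affine_image_ge0 affine_image_sigma_additive.

Lemma affine_image_itv (x y : R) : (c != 0)%R ->
  mu `]x, y]%classic = `|c|%:E * affine_image `]x, y]%classic.
Proof.
move=> c0; rewrite /affine_image /pushforward.
have [cp|cn|c00] := ltgtP 0%R c; last by rewrite -c00 eqxx in c0.
  rewrite (_ : affine_map @^-1` _ = `]((x - a) / c)%R, ((y - a) / c)%R]%classic); last first.
    apply/seteqP; split => t /=; rewrite !in_itv /affine_map /= ltr_pdivrMr// ler_pdivlMr//;
      by move=> /andP[? ?]; apply/andP; split; lra.
  rewrite !lebesgue_measure_itv /= !lte_fin ltr_pM2r ?invr_gt0// ltrD2r.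
  case: ifPn => _; last by rewrite mule0.
  by rewrite -!EFinB -EFinM gtr0_norm//; congr (_%:E); field; rewrite gt_eqF.
rewrite (_ : affine_map @^-1` _ = `[((y - a) / c)%R, ((x - a) / c)%R[%classic); last first.
  apply/seteqP; split => t /=; rewrite !in_itv /affine_map /= ltr_ndivlMr// ler_ndivrMr//;
    by move=> /andP[? ?]; apply/andP; split; lra.
rewrite !lebesgue_measure_itv /= !lte_fin ltr_nM2r ?invr_lt0// ltrD2r.
case: ifPn => _; last by rewrite mule0.
by rewrite -!EFinB -EFinM ltr0_norm//; congr (_%:E); field; rewrite lt_eqF.
Qed.

(** Lebesgue measure is determined by half-open intervals, on which it agrees with |c| times its
    image under the affine map. Borel generality is required for sections of functions in the
    plane. *)
Lemma ge0_integral_affine (F : R -> \bar R) : (c != 0)%R ->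
  measurable_fun setT (F : measurableTypeR R -> \bar R) -> (forall x, 0 <= F x) ->
  \int[mu]_x F x = `|c|%:E * \int[mu]_x F (c * x + a)%R.
Proof.
move=> c0 mF F0.
pose m : {measure set (measurableTypeR R) -> \bar R} :=
  mscale (NngNum (normr_ge0 c)) affine_image.
have E A : measurable A -> mu A = m A.
  by apply: lebesgue_measure_unique => _ [[x y] _ <-]; exact: affine_image_itv.
rewrite (@eq_measure_integral _ _ _ _ m)//; last by move=> A mA _; exact: E.
rewrite ge0_integral_mscale//; congr (_ * _).
rewrite ge0_integral_pushforward ?preimage_setT//.
exact: measurable_affine_map.
Qed.

End AffineMeasure.

(** * The Hardy-Littlewood maximal theorem for exponents at least 2 *)

Section MaximalFunction.
Context {R : realType}.
Local Open Scope ereal_scope.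
Local Notation mu := (@lebesgue_measure R).
Local Notation HL := (@HL_maximal R).
Implicit Types (f : R -> R).

Lemma le_lebesgue (A B : set (measurableTypeR R)) : measurable A -> measurable B ->
  A `<=` B -> mu A <= mu B.
Proof. by move=> mA mB AB; apply: le_measure; rewrite ?inE. Qed.

(** The truncation of the Marcinkiewicz interpolation argument. *)
Definition upper_part f (c : R) (x : R) : R := if (c < f x)%R then f x else 0%R.

Lemma measurable_upper_part f c : measurable_fun setT f -> measurable_fun setT (upper_part f c).
Proof.
move=> mf; apply: measurable_fun_ifT => //.
exact: measurable_fun_ltr.
Qed.

Lemma locally_integrable_upper_part f c : (forall x, 0 <= f x)%R -> mu.-integrable setT (EFin \o f) ->
  locally_integrable setT (upper_part f c).
Proof.
move=> f0 intf; have mf : measurable_fun setT f by apply/measurable_EFinP; exact: measurable_int intf.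
apply: open_integrable_locally; first exact: openT.
apply: le_integrable intf => //.
  by apply/measurable_EFinP; exact: measurable_upper_part.
move=> x _ /=; rewrite lee_fin /upper_part; case: ifP => // _.
by rewrite normr0 normr_ge0.
Qed.

(** The part of [f] up to height [c] contributes at most [c] to an average, so an average above 2 c
    leaves more than c to the upper part. The weak-type bound thus sees only the large values of
    [f]. *)
Lemma HL_upper_part f (c x : R) : (0 < c)%R -> (forall x, 0 <= f x)%R -> measurable_fun setT f ->
  (2 * c)%:E < HL f x -> c%:E < HL (upper_part f c) x.
Proof.
move=> c0 f0 mf /ereal_sup_gt[_ [r /= r0 <-]] H.
have rp : (0 < r)%R by move: r0; rewrite in_itv /= andbT.
apply: (@lt_le_trans _ _ (iavg (upper_part f c) (ball x r))); last first.
  by apply: ereal_sup_ubound; exists r.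
move: H; rewrite /iavg lebesgue_measure_ball ?(ltW rp)// inver mulrn_eq0 /= gt_eqF//.
set X := \int[_]_(_ in _) _; set Y := \int[_]_(_ in _) _.
have r20 : (0 < r *+ 2)%R by rewrite pmulrn_lgt0.
have XY : X <= Y + (c * (r *+ 2))%:E.
  rewrite EFinM -(lebesgue_measure_ball x (ltW rp)) -integral_cst; last exact: measurable_ball.
  rewrite -ge0_integralD//; first last.
  - by move=> t _; rewrite lee_fin ltW.
  - apply/measurable_EFinP/measurableT_comp => //; apply: measurable_funTS; exact: measurable_upper_part.
  - exact: measurable_ball.
  apply: ge0_le_integral => //.
  - exact: measurable_ball.
  - by apply/measurable_EFinP/measurableT_comp => //; apply: measurable_funTS.
  - apply: emeasurable_funD => //.
    by apply/measurable_EFinP/measurableT_comp => //; apply: measurable_funTS; exact: measurable_upper_part.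
  move=> t _; rewrite -EFinD lee_fin /upper_part; case: ltP => [_|fc].
    by rewrite lerDl ltW.
  by rewrite normr0 add0r ger0_norm.
move=> H; have : (2 * c)%:E < ((r *+ 2)^-1)%:E * (Y + (c * (r *+ 2))%:E).
  by apply: (lt_le_trans H); rewrite lee_wpmul2l// lee_fin invr_ge0 ltW.
have Y0 : 0 <= Y by exact: integral_ge0.
rewrite ge0_muleDr//; last by rewrite lee_fin mulr_ge0 ?ltW.
have -> : ((r *+ 2)^-1)%:E * (c * (r *+ 2))%:E = c%:E.
  by rewrite -EFinM mulrC mulfK// gt_eqF.
move=> H2.
have : (2 * c)%:E = c%:E + c%:E by rewrite -EFinD; congr (_%:E); lra.
by move=> E; move: H2; rewrite E lteD2rE.
Qed.

Definition HL_gt f (c : R) : set R := [set x | c%:E < HL f x].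

(** A layer-cake majorant of the s-th power of the maximal function: where 2^k < HL f <= 2^(k+1),
    the k-th term suffices, and values up to 1 are covered by the summand 1. A series of indicators
    can be integrated term by term. *)
Definition dyadic_majorant (s : R) f (x : R) : \bar R :=
  1 + \sum_(0 <= k <oo) ((2 `^ s) ^+ k.+1)%:E * (\1_(HL_gt f (2 ^+ k)%R) x)%:E.

Lemma dyadic_majorant_ge (s y : R) f x : (0 < s)%R -> (0 <= y)%R -> y%:E <= HL f x ->
  (y `^ s)%:E <= dyadic_majorant s f x.
Proof.
move=> s0 y0 yH; have A0 : (0 <= 2 `^ s :> R)%R by exact: powR_ge0.
have t0 k : 0 <= ((2 `^ s) ^+ k.+1)%:E * (\1_(HL_gt f (2 ^+ k)%R) x)%:E.
  by rewrite mule_ge0// lee_fin ?exprn_ge0//.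
have [y1|y1] := leP y 1%R.
  apply: (@le_trans _ _ 1); last by rewrite leeDl// nneseries_ge0.
  rewrite lee_fin; have -> : (1 = 1 `^ s :> R)%R by rewrite powR1.
  by apply: ge0_ler_powR; rewrite ?nnegrE// ltW.
have [k /andP[ky yk]] : exists k, (2 ^+ k < y <= 2 ^+ k.+1)%R.
  have [n yn] : exists n, (y <= 2 ^+ n)%R.
    by exists (Num.bound y); apply/ltW/upper_nthrootP.
  elim: n yn => [|n ih]; first by rewrite expr0; lra.
  by move=> yn; have [/ih//|ny] := leP y (2 ^+ n)%R; exists n; rewrite ny yn.
apply: (@le_trans _ _ (((2 `^ s) ^+ k.+1)%:E * (\1_(HL_gt f (2 ^+ k)%R) x)%:E)).
  rewrite indicE mem_set /HL_gt /=; last by apply: lt_le_trans yH; rewrite lte_fin.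
  rewrite mule1 lee_fin -powR_mulrn// -powRrM mulrC powRrM powR_mulrn//.
  by apply: ge0_ler_powR; rewrite ?nnegrE ?exprn_ge0// ltW.
apply: (@le_trans _ _ (\sum_(0 <= j < k.+1) ((2 `^ s) ^+ j.+1)%:E * (\1_(HL_gt f (2 ^+ j)%R) x)%:E)).
  by rewrite big_nat_recr//= leeDr// sume_ge0.
apply: (le_trans (nneseries_lim_ge _ _)); first by move=> *; exact: t0.
by rewrite leeDr.
Qed.

(** The layer-cake sum for one value [y], written as the truncation of a constant function. The
    terms with 2^k < 2 y are dominated by a geometric progression of ratio 2^s / 2, at least 2 since
    s >= 2, hence by its last term, of order y^s. The factor 3 / (2^k / 2) is the weak-type constant
    at level 2^k / 2. *)
Lemma sum_dyadic_le (s y : R) n : (2 <= s)%R -> (0 <= y)%R ->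
  (\sum_(0 <= k < n) (2 `^ s) ^+ k.+1 * (3 / (2 ^+ k / 2)) * upper_part (fun=> y) (2 ^+ k / 2) 0 <=
   24 * (2 `^ s) ^+ 2 * y `^ s)%R.
Proof.
move=> s2 y0; set A := (2 `^ s)%R.
have A4 : (4 <= A)%R.
  rewrite (_ : 4 = 2 `^ 2%:R)%R; last by rewrite powR_mulrn// expr2; lra.
  by apply: ler_powR => //; lra.
have [->|yn0] := eqVneq y 0%R.
  rewrite big1 ?mulr_ge0 ?powR_ge0 ?exprn_ge0//; try lra.
  by move=> k _; rewrite /upper_part if_same mulr0.
have yp : (0 < y)%R by rewrite lt0r yn0.
have key k : (2 ^+ k < 2 * y)%R -> ((A / 2) ^+ k * y <= A * y `^ s)%R.
  move=> ky; have -> : ((A / 2) ^+ k = (2 ^+ k) `^ (s - 1))%R.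
    rewrite powRB; last by rewrite expf_neq0 ?implybT.
    rewrite powRr1 ?exprn_ge0// expr_div_n; congr (_ / _)%R.
    by rewrite -powR_mulrn ?powR_ge0// /A -powRrM mulrC powRrM powR_mulrn.
  apply: (@le_trans _ _ ((2 * y) `^ (s - 1) * y)%R).
    rewrite ler_wpM2r//; apply: ge0_ler_powR; rewrite ?nnegrE ?mulr_ge0 ?exprn_ge0//; first lra.
    exact: ltW.
  rewrite powRM// -mulrA [(y `^ _ * y)%R]mulrC mulr_powRB1//; last lra.
  apply: ler_wpM2r; first exact: powR_ge0.
  by apply: ler_powR; lra.
suff H : (\sum_(0 <= k < n) (A / 2) ^+ k * upper_part (fun=> y) (2 ^+ k / 2) 0 <= 2 * (A * y `^ s))%R.
  apply: (@le_trans _ _ (6 * A * (\sum_(0 <= k < n) (A / 2) ^+ k * upper_part (fun=> y) (2 ^+ k / 2) 0)))%R.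
    rewrite mulr_sumr ler_sum// => k _; rewrite le_eqVlt; apply/orP; left; apply/eqP.
    by rewrite expr_div_n exprS; field; rewrite expf_neq0.
  apply: (@le_trans _ _ (6 * A * (2 * (A * y `^ s))))%R.
    by rewrite ler_wpM2l//; lra.
  rewrite (_ : 6 * A * _ = 12 * A ^+ 2 * y `^ s)%R; last by ring.
  by rewrite ler_wpM2r ?powR_ge0// ler_wpM2r ?exprn_ge0//; lra.
have geo m : (\sum_(0 <= k < m.+1) (A / 2) ^+ k <= 2 * (A / 2) ^+ m)%R.
  elim: m => [|m ih]; first by rewrite big_nat1 expr0; lra.
  rewrite big_nat_recr//= exprS; have : (0 <= (A / 2) ^+ m)%R by rewrite exprn_ge0//; lra.
  move: ih; set X := (_ ^+ m)%R; nra.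
elim: n => [|n ih]; first by rewrite big_geq// !mulr_ge0 ?powR_ge0//; lra.
have [ny|ny] := ltP (2 ^+ n / 2)%R y; last first.
  by rewrite big_nat_recr//= /upper_part ltNge ny /= mulr0 addr0.
apply: (@le_trans _ _ ((\sum_(0 <= k < n.+1) (A / 2) ^+ k) * y))%R.
  rewrite mulr_suml ler_sum// => k _; rewrite ler_wpM2l//; first by rewrite exprn_ge0//; lra.
  by rewrite /upper_part; case: ifP.
apply: (@le_trans _ _ (2 * (A / 2) ^+ n * y))%R; first by rewrite ler_wpM2r.
by rewrite -mulrA ler_wpM2l// key//; lra.
Qed.

Lemma measurable_HL_gt f (c : R) : locally_integrable setT f ->
  measurable (HL_gt f c).
Proof.
move=> lf; rewrite -[X in measurable X]setTI.
by apply: emeasurable_fun_o_infty => //; exact: measurable_HL_maximal.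
Qed.

Lemma measurable_dyadic_majorant s f : locally_integrable setT f ->
  measurable_fun setT (dyadic_majorant s f).
Proof.
move=> lf; apply: emeasurable_funD => //.
apply: ge0_emeasurable_sum => [k x _ _|k _].
  by rewrite mule_ge0 ?lee_fin ?exprn_ge0 ?powR_ge0.
apply: measurable_funeM; apply/measurable_EFinP.
by apply: measurable_indic; exact: measurable_HL_gt.
Qed.

(** Each level set is estimated by the weak-type inequality for the truncation at half its height;
    exchanging sum and integral reduces the claim to the pointwise [sum_dyadic_le]. *)
Lemma integral_dyadic_majorant s f : (2 <= s)%R -> (forall x, 0 <= f x)%R ->
  mu.-integrable setT (EFin \o f) ->
  \int[mu]_(x in `[0%R, 1%R]) dyadic_majorant s f x <=
  1 + (24 * (2 `^ s) ^+ 2)%:E * \int[mu]_x (f x `^ s)%:E.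
Proof.
move=> s2 f0 intf; have mf : measurable_fun setT f by apply/measurable_EFinP; exact: measurable_int intf.
have A0 : (0 <= 2 `^ s :> R)%R by exact: powR_ge0.
have lf : locally_integrable setT f by apply: open_integrable_locally => //; exact: openT.
have mfs : measurable_fun setT (fun x => (f x `^ s)%:E).
  by apply/measurable_EFinP; exact: (measurableT_comp (@measurable_powR R s) mf).
pose D k := (HL_gt f (2 ^+ k)).
have mD k : measurable (D k) by exact: measurable_HL_gt.
have t0 k x : 0 <= ((2 `^ s) ^+ k.+1)%:E * (\1_(D k) x)%:E.
  by rewrite mule_ge0// lee_fin ?exprn_ge0//.
have mt k : measurable_fun setT (fun x => ((2 `^ s) ^+ k.+1)%:E * (\1_(D k) x)%:E).
  by apply: measurable_funeM; apply/measurable_EFinP; exact: measurable_indic.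
rewrite /dyadic_majorant ge0_integralD//; first last.
- by apply: measurable_funTS; apply: ge0_emeasurable_sum => [k x _ _|k _]; [exact: t0|exact: mt].
- by move=> x _; apply: nneseries_ge0 => k _ _; exact: t0.
rewrite integral_cst//= lebesgue_measure_itv /= lte_fin ltr01 -EFinB subr0 mul1e leeD2l//.
apply: (@le_trans _ _ (\int[mu]_x \sum_(0 <= k <oo) ((2 `^ s) ^+ k.+1)%:E * (\1_(D k) x)%:E)).
  apply: ge0_subset_integral => //.
  - by apply: ge0_emeasurable_sum => [k x _ _|k _]; [exact: t0|exact: mt].
  - by move=> x _; apply: nneseries_ge0 => k _ _; exact: t0.
rewrite integral_nneseries//.
have step k : \int[mu]_x (((2 `^ s) ^+ k.+1)%:E * (\1_(D k) x)%:E) <=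
   \int[mu]_x ((2 `^ s) ^+ k.+1 * (3 / (2 ^+ k / 2)) * upper_part f (2 ^+ k / 2) x)%:E.
  have c0 : (0 < 2 ^+ k / 2 :> R)%R by rewrite divr_gt0 ?exprn_gt0.
  have lu := locally_integrable_upper_part (2 ^+ k / 2) f0 intf.
  have u0 x : (0 <= upper_part f (2 ^+ k / 2) x)%R by rewrite /upper_part; case: ifP.
  have mDk : measurable_fun setT (fun x : measurableTypeR R => (\1_(D k) x)%:E : \bar R).
    by apply/measurable_EFinP; apply: measurable_indic; exact: mD.
  have Dk0 x : 0 <= (\1_(D k) x)%:E :> \bar R by rewrite lee_fin indicE.
  rewrite ge0_integralZl_EFin; [|exact: measurableT|by []|exact: mDk|by rewrite exprn_ge0].
  have E1 : \int[mu]_x (\1_(D k) x)%:E = mu (D k).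
    by rewrite integral_indic ?setIT//; exact: mD.
  rewrite [X in _ * X <= _]E1.
  under [leRHS]eq_integral do rewrite EFinM EFinM -muleA.
  have mu_ : measurable_fun setT (EFin \o upper_part f (2 ^+ k / 2)).
    by apply/measurable_EFinP; exact: measurable_upper_part.
  rewrite ge0_integralZl_EFin; [|exact: measurableT|by move=> x _; rewrite mule_ge0// lee_fin// divr_ge0// ltW|
    exact: measurable_funeM|by rewrite exprn_ge0].
  rewrite ge0_integralZl_EFin; [|exact: measurableT|by move=> x _; rewrite lee_fin|
    exact: mu_|by rewrite divr_ge0// ltW].
  apply: lee_wpmul2l; first by rewrite lee_fin exprn_ge0.
  apply: (@le_trans _ _ (mu (HL_gt (upper_part f (2 ^+ k / 2)) (2 ^+ k / 2)))).
    apply: (le_lebesgue (mD k) (measurable_HL_gt (2 ^+ k / 2) lu)).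
    rewrite /D /HL_gt => x /= H; apply: HL_upper_part => //.
    by rewrite mulrC divfK.
  apply: (le_trans (maximal_inequality lu c0)); apply: lee_wpmul2l.
    by rewrite lee_fin divr_ge0// ltW.
  rewrite le_eqVlt; apply/orP; left; apply/eqP; apply: eq_integral => x _.
  by rewrite gee0_abs// lee_fin.
apply: (le_trans (lee_nneseries _ (fun k _ => step k))).
  by move=> k _ _; exact: integral_ge0.
rewrite -integral_nneseries//; first last.
- move=> k x _; rewrite lee_fin !mulr_ge0 ?exprn_ge0 ?invr_ge0//.
  by rewrite /upper_part; case: ifP.
- by move=> k; apply/measurable_EFinP/measurable_funM => //; exact: measurable_upper_part.
rewrite -ge0_integralZl_EFin ?mulr_ge0 ?exprn_ge0//; first last.
- by move=> x _; rewrite lee_fin powR_ge0.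
apply: ge0_le_integral => //.
- by move=> x _; apply: nneseries_ge0 => k _ _; rewrite lee_fin !mulr_ge0 ?exprn_ge0 ?invr_ge0// /upper_part; case: ifP.
- apply: ge0_emeasurable_sum => [k x _ _|k _].
    by rewrite lee_fin !mulr_ge0 ?exprn_ge0 ?invr_ge0// /upper_part; case: ifP.
  by apply/measurable_EFinP/measurable_funM => //; exact: measurable_upper_part.
- by apply: measurable_funeM; exact: mfs.
move=> x _; apply: lime_le.
  apply: is_cvg_nneseries => k _ _.
  by rewrite lee_fin !mulr_ge0 ?exprn_ge0 ?invr_ge0// /upper_part; case: ifP.
apply: nearW => n; rewrite sumEFin -EFinM lee_fin.
exact: (sum_dyadic_le n s2 (f0 x)).
Qed.

End MaximalFunction.

(** * Domination of kernel averages by the maximal function *)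

Section KernelMaximal.
Context {R : realType}.
Local Notation mu := (@lebesgue_measure R).
Implicit Types (phi : R -> R) (y x : R).

Definition cauchy_kernel y x : R := y / (y ^+ 2 + x ^+ 2).

Lemma cauchy_kernel_ge0 y x : 0 < y -> 0 <= cauchy_kernel y x.
Proof. by move=> y0; rewrite divr_ge0 ?addr_ge0 ?sqr_ge0// ltW. Qed.

Lemma rcont01V (g : R -> R) : rcont01 g -> (forall t, g t != 0) -> rcont01 (fun t => (g t)^-1).
Proof.
move=> cg g0; rewrite /rcont01; under eq_fun do rewrite realCV.
by apply: cont01V => // t _; rewrite realC_eq0.
Qed.

Lemma cont01_cauchy_kernel y : 0 < y -> rcont01 (cauchy_kernel y).
Proof.
move=> y0; apply: rcont01M; first exact: rcont01_cst.
apply: rcont01V => [|t]; last by rewrite gt_eqF// ltr_pwDl ?exprn_gt0 ?sqr_ge0.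
apply: rcont01D; first exact: rcont01_cst.
by apply: rcont01M; exact: cont01_id.
Qed.

(** On 2^j y <= x < 2^(j+1) y the kernel is at most 1 / (4^j y), the weight of step j + 1. As x <= 1
    < 2^J y, finitely many steps suffice. *)
Lemma cauchy_kernel_dyadic y x J : 0 < y -> 0 <= x <= 1 -> 1 < 2 ^+ J * y ->
  cauchy_kernel y x <= \sum_(0 <= j < J.+1) 4 / (4 ^+ j * y) * (x < 2 ^+ j * y)%R%:R.
Proof.
move=> y0 x01 Jy.
have t0 j : 0 <= 4 / (4 ^+ j * y) * (x < 2 ^+ j * y)%R%:R.
  by rewrite mulr_ge0// divr_ge0// mulr_ge0 ?exprn_ge0// ltW.
have pick j : (j <= J)%N -> x < 2 ^+ j * y -> cauchy_kernel y x <= 4 / (4 ^+ j * y) ->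
    cauchy_kernel y x <= \sum_(0 <= j < J.+1) 4 / (4 ^+ j * y) * (x < 2 ^+ j * y)%R%:R.
  move=> jJ xj H; apply: (le_trans H).
  rewrite (bigD1_seq j) ?iota_uniq//=; last by rewrite mem_index_iota ltnS.
  by rewrite xj mulr1 lerDl sumr_ge0// => i _; exact: t0.
have den : 0 < y ^+ 2 + x ^+ 2 by rewrite ltr_pwDl ?exprn_gt0 ?sqr_ge0.
have [xy|yx] := ltP x y.
  apply: (pick 0%N) => //; first by rewrite expr0 mul1r.
  rewrite expr0 mul1r /cauchy_kernel ler_pdivrMr// mulrAC ler_pdivlMr//.
  by rewrite expr2; have := sqr_ge0 x; nra.
have [j [jJ xj1 xj2]] : exists j, [/\ (j < J)%N, 2 ^+ j * y <= x & x < 2 ^+ j.+1 * y].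
  have xJ : x < 2 ^+ J * y by lra.
  elim: J xJ {Jy pick} => [|J ih]; first by rewrite expr0; lra.
  move=> xJ; have [/ih[j [jJ a b]]|Jx] := ltP x (2 ^+ J * y).
    by exists j; split => //; exact: ltnW.
  by exists J.
apply: (pick j.+1) => //.
rewrite exprS /cauchy_kernel ler_pdivrMr//.
rewrite (_ : 4 / (4 * 4 ^+ j * y) = (4 ^+ j * y)^-1); last first.
  by field; rewrite expf_neq0 ?gt_eqF.
rewrite mulrC ler_pdivlMr ?mulr_gt0 ?exprn_gt0//.
have -> : y * (4 ^+ j * y) = (2 ^+ j * y) ^+ 2.
  by rewrite (_ : 4 = 2 ^+ 2) -?exprM 1?mulnC ?exprM; [ring|rewrite expr2; lra].
apply: (@le_trans _ _ (x ^+ 2)); last by rewrite lerDr sqr_ge0.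
by rewrite lerXn2r// ?nnegrE ?mulr_ge0 ?exprn_ge0//; lra.
Qed.

Lemma EFin_rint (g : R -> R) : rcont01 g -> ((rint g)%:E = \int[mu]_(x in `[0%R, 1%R]) (g x)%:E)%E.
Proof.
move=> cg; rewrite /rint /Rintegral fineK//.
exact: integrable_fin_num (rcont01_integrable cg).
Qed.

(** Cuts a 1-periodic function down to three periods: it becomes integrable on the line, and t0 + x
    and t0 - x stay inside for t0 and x in [0, 1]. *)
Definition window phi (x : R) : R := if (-1 <= x) && (x <= 2) then phi x else 0.

Variable phi : R -> R.
Hypothesis phi0 : forall x, 0 <= phi x.
Hypothesis phiC : continuous phi.
Hypothesis phiP : forall x, phi (x + 1) = phi x.

Lemma measurable_window : measurable_fun setT (window phi).
Proof.
apply: measurable_fun_ifT => //; last exact: continuous_measurable_fun.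
by apply: measurable_and; apply: measurable_fun_ler.
Qed.

Lemma window_ge0 x : 0 <= window phi x.
Proof. by rewrite /window; case: ifP. Qed.

Lemma phi_periodicN x : phi (x - 1) = phi x.
Proof. by rewrite -[in RHS](subrK 1 x) phiP. Qed.

Lemma rcont01_of_continuous (g : R -> R) : continuous g -> rcont01 g.
Proof.
move=> cg t t01 e e0; have /cvgrPdist_lt/(_ e e0) := cg t.
move=> /nbhs_ballP[d d0 dP]; exists d => [//|s s01 st].
by rewrite -realCB cmodR distrC; apply: dP; rewrite /ball /= distrC.
Qed.

Lemma rcont01_isometry (g : R -> R) (a e : R) : continuous g -> `|e| = 1 ->
  rcont01 (fun x => g (a + e * x)).
Proof.
move=> cg e1 t t01 s s0; have /cvgrPdist_lt/(_ s s0) := cg (a + e * t).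
move=> /nbhs_ballP[d d0 dP]; exists d => [//|u u01 ut].
rewrite -realCB cmodR distrC; apply: dP; rewrite /ball /= distrC opprD addrACA subrr add0r.
by rewrite -mulrBr normrM e1 mul1r.
Qed.

Lemma ge0_integral_shift (a : R) (F : R -> \bar R) :
  measurable_fun setT (F : measurableTypeR R -> \bar R) -> (forall x, (0 <= F x)%E) ->
  (\int[mu]_x F (x + a)%R = \int[mu]_x F x)%E.
Proof.
move=> mF F0; rewrite [RHS](@ge0_integral_affine R 1 a)// ?oner_eq0//.
by rewrite normr1 mul1e; apply: eq_integral => x _; rewrite mul1r.
Qed.

Lemma measurable_cond01 (G : R -> R) : measurable_fun setT G ->
  measurable_fun setT (fun x : R => if (0 <= x) && (x <= 1) then G x else 0).
Proof.
move=> mG; apply: measurable_fun_ifT => //.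
by apply: measurable_and; apply: measurable_fun_ler.
Qed.

Lemma integral_cond01 (G : R -> R) :
  (\int[mu]_x (if (0 <= x)%R && (x <= 1)%R then G x else 0%R)%:E = \int[mu]_(x in `[0%R, 1%R]) (G x)%:E)%E.
Proof.
rewrite [RHS]integral_mkcond; apply: eq_integral => x _.
by rewrite patchE mem_setE in_itv /=; case: ifP.
Qed.

Lemma integral_window_powR (s : R) : 0 < s ->
  (\int[mu]_x (window phi x `^ s)%:E <= (3 * rint (fun x => phi x `^ s))%:E)%E.
Proof.
move=> s0; pose G x := phi x `^ s.
have cG : rcont01 G by apply: cont01_powR => //; exact: rcont01_of_continuous.
have mG : measurable_fun setT G.
  apply: (measurableT_comp (@measurable_powR R s)); exact: continuous_measurable_fun.
pose g x : R := if (0 <= x) && (x <= 1) then G x else 0.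
have G0 x : 0 <= G x by exact: powR_ge0.
have g0 x : 0 <= g x by rewrite /g; case: ifP.
have mg : measurable_fun setT g by exact: measurable_cond01.
have mgE (a : R) : measurable_fun setT (fun x : R => (g (x + a))%:E).
  apply/measurable_EFinP; apply: (measurableT_comp mg); exact: measurable_funD.
have Eg (a : R) : (\int[mu]_x (g (x + a))%:E = (rint G)%:E)%E.
  rewrite (@ge0_integral_shift a (EFin \o g)); first by rewrite EFin_rint// -integral_cond01.
    exact/measurable_EFinP.
  by move=> x; rewrite lee_fin.
apply: (@le_trans _ _ (\int[mu]_x ((g (x + 1))%:E + ((g (x + 0))%:E + (g (x + -1))%:E)))%E).
  apply: ge0_le_integral => //.
  - by move=> x _; rewrite lee_fin powR_ge0.
  - apply/measurable_EFinP; apply: (measurableT_comp (@measurable_powR R s)).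
    exact: measurable_window.
  - exact: (emeasurable_funD (mgE 1) (emeasurable_funD (mgE 0) (mgE (-1)))).
  move=> x _; rewrite -!EFinD lee_fin /window.
  case: ifPn => [/andP[x1 x2]|_]; last by rewrite powR0 ?gt_eqF// !addr_ge0.
  have [x0|x0] := ltP x 0.
    have -> : phi x `^ s = g (x + 1) by rewrite /g /G phiP ifT//; lra.
    by rewrite lerDl addr_ge0.
  have [x1'|x1'] := leP x 1.
    have -> : phi x `^ s = g (x + 0) by rewrite /g /G addr0 x0 x1'.
    by rewrite addrCA lerDl addr_ge0.
  have -> : phi x `^ s = g (x + -1) by rewrite /g /G phi_periodicN ifT//; lra.
  by rewrite addrA lerDr addr_ge0.
rewrite ge0_integralD//; first last.
- exact: (emeasurable_funD (mgE 0) (mgE (-1))).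
- by move=> x _; rewrite -EFinD lee_fin addr_ge0.
- exact: (mgE 1).
- by move=> x _; rewrite lee_fin.
rewrite ge0_integralD//; first last.
- exact: (mgE (-1)).
- by move=> x _; rewrite lee_fin.
- exact: (mgE 0).
- by move=> x _; rewrite lee_fin.
by rewrite !Eg -!EFinD lee_fin /G; lra.
Qed.

Lemma integrable_window : mu.-integrable setT (EFin \o window phi).
Proof.
apply/integrableP; split; first by apply/measurable_EFinP; exact: measurable_window.
have := @integral_window_powR 1 ltr01; move=> H; apply: le_lt_trans (ltry _).
apply: le_trans H; rewrite le_eqVlt; apply/orP; left; apply/eqP; apply: eq_integral => x _.
by rewrite gee0_abs /= ?lee_fin ?window_ge0// powRr1 ?window_ge0.
Qed.

(** Each step of the dyadic majorant is controlled by the average over the ball of radius 2^j y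
    about [t0]; weight times length is 8 / 2^j, which sums to at most 16. The sign [e] selects the
    side of [t0]. *)
Lemma cauchy_kernel_HL (y t0 e : R) : 0 < y -> 0 <= t0 <= 1 -> `|e| = 1 ->
  ((rint (fun x => cauchy_kernel y x * phi (t0 + e * x)))%:E <= 16%:E * HL_maximal (window phi) t0)%E.
Proof.
move=> y0 t01 e1.
have e2 : e != 0 by rewrite -normr_gt0 e1.
have [J JP] : exists J, 1 < 2 ^+ J * y.
  by have [J] := exists_exp2 1 y0; rewrite ltr_pdivrMr ?exprn_gt0// mulrC => H; exists J.
have cphi : rcont01 (fun x => phi (t0 + e * x)).
  exact: rcont01_isometry.
rewrite EFin_rint; last by apply: rcont01M => //; exact: cont01_cauchy_kernel.
pose c j : R := 4 / (4 ^+ j * y).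
have c0 j : 0 <= c j by rewrite divr_ge0// mulr_ge0 ?exprn_ge0// ltW.
pose u j x : R := c j * ((x < 2 ^+ j * y)%R%:R * phi (t0 + e * x)).
have u0 j x : 0 <= u j x by rewrite /u mulr_ge0 ?c0// mulr_ge0 ?phi0.
have mphi : measurable_fun setT (fun x => phi (t0 + e * x)).
  apply: (measurableT_comp (continuous_measurable_fun phiC)).
  by apply: measurable_funD => //; exact: measurable_funM.
have mlt (a : R) : measurable_fun setT (fun x : R => (x < a)%R%:R : R).
  have -> : (fun x : R => (x < a)%R%:R : R) = (fun x : R => if x < a then 1 else 0).
    by apply/funext => x; case: ifP.
  by apply: measurable_fun_ifT => //; exact: measurable_fun_ltr.
have mu_ j : measurable_fun setT (u j).
  by apply: measurable_funM => //; apply: measurable_funM.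
have win x : 0 <= x <= 1 -> phi (t0 + e * x) = window phi (e * x + t0).
  move=> x01; rewrite /window addrC ifT//.
  have : `|e * x| <= 1 by rewrite normrM e1 mul1r ger0_norm; lra.
  by rewrite ler_norml => /andP[? ?]; apply/andP; split; lra.
apply: (@le_trans _ _ (\int[mu]_(x in `[0%R, 1%R]) (\sum_(j < J.+1) u j x)%:E)%E).
  apply: ge0_le_integral => //.
  - by move=> x _; rewrite lee_fin mulr_ge0// cauchy_kernel_ge0.
  - apply/measurable_EFinP/measurable_funTS/measurable_funM => //.
    apply: measurable_funM => //.
    have -> : (fun x => (y ^+ 2 + x ^+ 2)^-1) = (fun x : R => (y ^+ 2 + x ^+ 2) `^ (-1)).
      by apply/funext => x; rewrite powR_inv1// addr_ge0 ?sqr_ge0.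
    apply: (measurableT_comp (@measurable_powR R (-1))).
    by apply: measurable_funD => //; exact: measurable_funX.
  - apply/measurable_EFinP/measurable_funTS; exact: (@measurable_sum _ _ _ _ _ _ (fun (j : 'I_J.+1) x => u j x)).
  - move=> x /=; rewrite in_itv /= => x01; rewrite lee_fin.
    have := cauchy_kernel_dyadic y0 x01 JP => H.
    apply: (le_trans (ler_wpM2r (phi0 _) H)).
    by rewrite big_mkord mulr_suml ler_sum// => j _; rewrite /u mulrA.
under eq_integral do rewrite -sumEFin.
rewrite ge0_integral_sum//; first last.
- by move=> j x _; rewrite lee_fin.
- by move=> j; apply/measurable_EFinP; apply: measurable_funTS; exact: (mu_ j).
have HL0 : (0 <= HL_maximal (window phi) t0)%E.
  apply: HL_maximalT_ge0; apply: open_integrable_locally; [exact: openT|exact: integrable_window].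
apply: (@le_trans _ _ (\sum_(j < J.+1) (c j * (2 * (2 ^+ j * y)))%:E * HL_maximal (window phi) t0)%E).
  apply: lee_sum => j _; rewrite EFinM -muleA /u.
  under eq_integral do rewrite EFinM.
  rewrite ge0_integralZl_EFin//; first last.
  - by apply/measurable_EFinP; apply: measurable_funTS; apply: measurable_funM; [exact: mlt|exact: mphi].
  - by move=> x _; rewrite lee_fin mulr_ge0.
  apply: lee_wpmul2l; first by rewrite lee_fin.
  set rho := 2 ^+ j * y; have rho0 : 0 < rho by rewrite mulr_gt0// exprn_gt0.
  have mb : measurable (ball t0 rho) by exact: measurable_ball.
  pose F (v : R) : R := \1_(ball t0 rho) v * window phi v.
  have F0 v : 0 <= F v by rewrite mulr_ge0 ?window_ge0// indicE.
  have mF : measurable_fun setT F.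
    by apply: measurable_funM; [exact: measurable_indic|exact: measurable_window].
  have mFe : measurable_fun setT (fun x : R => F (e * x + t0)).
    by apply: (measurableT_comp mF); apply: measurable_funD => //; exact: measurable_funM.
  apply: (@le_trans _ _ (\int[mu]_x (F (e * x + t0)%R)%:E)%E).
    rewrite integral_mkcond; apply: ge0_le_integral => //.
    - move=> x _; rewrite patchE; case: ifP => // _; rewrite lee_fin mulr_ge0//.
    - apply/(measurable_restrictT _ _).1 => //.
      by apply/measurable_EFinP; apply: measurable_funTS; apply: measurable_funM; [exact: mlt|exact: mphi].
    - exact/measurable_EFinP.
    move=> x _; rewrite patchE mem_setE in_itv /=; case: ifPn => [x01|_]; last by rewrite lee_fin.
    rewrite lee_fin /F (win x x01); case: ltP => [xr|_]; last by rewrite mul0r mulr_ge0 ?window_ge0// indicE.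
    rewrite indicE mem_set// /ball /= opprD addrCA subrr addr0 normrN normrM e1 mul1r ger0_norm//; lra.
  have := @ge0_integral_affine R e t0 (EFin \o F) e2 (_ : measurable_fun setT (EFin \o F : measurableTypeR R -> _)) _.
  rewrite e1 mul1e => <-; [|exact/measurable_EFinP|by move=> x; rewrite lee_fin].
  have -> : (\int[mu]_x (EFin \o F) x = \int[mu]_(x in ball t0 rho) `|(window phi x)%:E|)%E.
    rewrite [RHS]integral_mkcond; apply: eq_integral => x _.
    rewrite patchE /F /= indicE; case: ifP => _; last by rewrite mul0r.
    by rewrite mul1r ger0_norm ?window_ge0.
  have : (iavg (window phi) (ball t0 rho) <= HL_maximal (window phi) t0)%E.
    by apply: ereal_sup_ubound; exists rho => //=; rewrite in_itv /= rho0.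
  rewrite /iavg lebesgue_measure_ball ?(ltW rho0)// inver mulrn_eq0 /= gt_eqF// => H.
  have r2 : 0 < rho *+ 2 by rewrite pmulrn_lgt0.
  have := lee_wpmul2l (_ : (0 <= (rho *+ 2)%:E)%E) H; rewrite lee_fin => /(_ (ltW r2)).
  by rewrite muleA -EFinM divff ?gt_eqF// mul1e mulr_natl.
rewrite -ge0_sume_distrl; last first.
  move=> j _; rewrite lee_fin; apply: mulr_ge0 => //; apply: mulr_ge0 => //.
  by apply: mulr_ge0; rewrite ?exprn_ge0 ?ltW.
apply: lee_wpmul2r => //; rewrite sumEFin lee_fin.
have cE j : c j * (2 * (2 ^+ j * y)) = 8 * 2^-1 ^+ j.
  rewrite /c exprVn (_ : 4 ^+ j = 2 ^+ j * 2 ^+ j); last by rewrite -exprMn; congr (_ ^+ _); lra.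
  by field; rewrite expf_neq0 ?gt_eqF.
under eq_bigr do rewrite cE.
rewrite -mulr_sumr; have : \sum_(j < J.+1) 2^-1 ^+ j <= 2 :> R; last lra.
have -> : \sum_(j < J.+1) (2^-1 : R) ^+ j = 2 - 2^-1 ^+ J.
  elim: J {JP} => [|J ih]; first by rewrite big_ord_recr big_ord0 /= expr0; lra.
  by rewrite big_ord_recr /= ih !exprS; field.
by rewrite lerBlDr lerDl exprn_ge0.
Qed.

End KernelMaximal.

(** * The nontangential maximal theorem *)

Section Nontangential.
Context {R : realType}.
Local Notation mu := (@lebesgue_measure R).
Implicit Types (f : R[i] -> R[i]) (z : R[i]).

(** Up to 1/4 the mean value theorem applies, with cosine at least 1/2 and pi at least 2; beyond,
    sin(pi x) >= sin(pi / 4) >= 1/2 >= x. *)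
Lemma sin_pi_ge (x : R) : 0 <= x <= 2^-1 -> x <= sin (pi * x).
Proof.
move=> x01; have p2 := pi_ge2 R; have p0 := pi_gt0 R.
pose q : R := pi / 4.
have q0 : 0 < q by rewrite /q divr_gt0.
have cq : cos q ^+ 2 = 2^-1.
  have := cos_mulr2n q; rewrite (_ : q *+ 2 = pi / 2); last by rewrite /q -mulr_natr; field.
  by rewrite cos_pihalf -[X in _ = X - _]mulr_natr; lra.
have cq0 : 0 < cos q by apply: cos_gt0_pihalf; rewrite /q; lra.
have cq2 : 2^-1 <= cos q.
  rewrite -(@ler_pXn2r _ 2) ?nnegrE ?(ltW cq0)// cq expr2; lra.
have sq : sin q ^+ 2 = 2^-1 by have := cos2Dsin2 q; lra.
have sq0 : 0 < sin q by apply: sin_gt0_pihalf; rewrite /q; lra.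
have sq2 : 2^-1 <= sin q.
  rewrite -(@ler_pXn2r _ 2) ?nnegrE ?(ltW sq0)// sq expr2; lra.
have [x4|x4] := leP x (4^-1); last first.
  apply: (@le_trans _ _ (sin q)); first lra.
  rewrite leNgt ltr_sin ?in_itv /= /q; try by apply/andP; split; nra.
  by rewrite -leNgt mulrC; nra.
have [->|xn0] := eqVneq x 0; first by rewrite mulr0 sin0.
have xp : 0 < x by rewrite lt0r xn0; lra.
have pxp : 0 < pi * x by rewrite mulr_gt0.
have [|c] := @MVT R sin cos 0 (pi * x) pxp (fun t _ => is_derive_sin t).
  by apply: continuous_subspaceT => t; exact: continuous_sin.
rewrite in_itv /= sin0 !subr0 => /andP[c0 cx] ->.
have : 2^-1 <= cos c.
  apply: (le_trans cq2); rewrite leNgt ltr_cos ?in_itv /= -?leNgt /q; try by apply/andP; split; nra.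
  by nra.
nra.
Qed.

Lemma cis_sub1_ge (x : R) : 0 <= x <= 1 -> Num.min x (1 - x) <= cmod (cis x - 1).
Proof.
move=> x01; set d := Num.min x (1 - x).
have d0 : 0 <= d by rewrite le_min; lra.
have E : cmod (cis x - 1) ^+ 2 = (2 * sin (pi * x)) ^+ 2.
  rewrite sqr_cmod /= (_ : 2 * pi * x = (pi * x) *+ 2); last by rewrite -[RHS]mulr_natl mulrA.
  rewrite cos_mulr2n sin_mulr2n subr0.
  have := cos2Dsin2 (pi * x).
  move: (cos (pi * x)) (sin (pi * x)) => c s H; have Hc : c ^+ 2 = 1 - s ^+ 2 by rewrite -H addrK.
  rewrite !mulr2n.
  have -> : (c ^+ 2 + c ^+ 2 - 1 - 1) ^+ 2 + (c * s + c * s) ^+ 2 =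
      (c ^+ 2 + c ^+ 2 - 1 - 1) ^+ 2 + 4 * c ^+ 2 * s ^+ 2 by ring.
  by rewrite Hc; ring.
have s1 : d <= sin (pi * x).
  have [x2|x2] := leP x 2^-1.
    by apply: le_trans (sin_pi_ge _); rewrite ?ge_min ?lexx//; lra.
  have -> : sin (pi * x) = sin (pi * (1 - x)).
    by rewrite mulrBr mulr1 sinB sinpi cospi; lra.
  by apply: le_trans (sin_pi_ge _); rewrite ?ge_min ?lexx ?orbT//; lra.
rewrite -(@ler_pXn2r _ 2) ?nnegrE ?cmod_ge0// E.
by rewrite lerXn2r// ?nnegrE ?mulr_ge0//; lra.
Qed.

(** With y = 1 - t and [d] the distance from x to the nearer of 0 and 1, the numerator is at most 3
    y and y^2 + d^2 is at most 20 times the denominator; 60 is their product. The parameters 0 and 1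
    are the same point of the circle, hence the two kernels. *)
Lemma poisson_le_cauchy_kernel z (t x : R) : 0 <= t < 1 -> cmod (z - t%:C) <= (1 - t) / 2 -> 0 <= x <= 1 ->
  poisson z x <= 60 * (cauchy_kernel (1 - t) x + cauchy_kernel (1 - t) (1 - x)).
Proof.
move=> t01 zt x01; set y := 1 - t.
have y0 : 0 < y by rewrite /y; lra.
have z1 : cmod z <= 1 - y / 2.
  by have := cmodD (z - t%:C) t%:C; rewrite subrK cmodR_ge0 /y; lra.
have zn : 1 - 3 / 2 * y <= cmod z.
  by have := cmod_lb t%:C (t%:C - z); rewrite subKr cmod_distC cmodR_ge0 /y; lra.
set d := Num.min x (1 - x); have d0 : 0 <= d by rewrite le_min; lra.
set D := cmod (cis x - z).
have D1 : y / 2 <= D by have := cmod_lb (cis x) z; rewrite cmod_cis /D; lra.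
have D2 : d <= 4 * D.
  have := cis_sub1_ge x01; rewrite -/d.
  have := cmodD (cis x - z) (z - 1); rewrite addrA subrK -/D.
  have := cmodD (z - t%:C) (t%:C - 1); rewrite addrA subrK.
  rewrite (cmod_distC t%:C) -(realCB 1 t) (cmodR_ge0 (ltW y0)) -/y.
  move: zt; rewrite -/y; lra.
have Dp : 0 < D by lra.
apply: (@le_trans _ _ (60 * cauchy_kernel y d)); last first.
  rewrite ler_pM2l// /d /Num.min; case: ifP => _.
    by rewrite lerDl cauchy_kernel_ge0.
  by rewrite lerDr cauchy_kernel_ge0.
have den : 0 < y ^+ 2 + d ^+ 2 by rewrite ltr_pwDl ?exprn_gt0 ?sqr_ge0.
rewrite /poisson -/D /cauchy_kernel ler_pdivrMr ?exprn_gt0//.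
have H1 : 1 - cmod z ^+ 2 <= 3 * y by have := cmod_ge0 z; rewrite expr2; nra.
have H2 : y ^+ 2 + d ^+ 2 <= 20 * D ^+ 2.
  have : (y / 2) ^+ 2 <= D ^+ 2 by rewrite lerXn2r// nnegrE; lra.
  have : d ^+ 2 <= (4 * D) ^+ 2 by rewrite lerXn2r// nnegrE; lra.
  rewrite !exprMn; lra.
apply: (le_trans H1); rewrite mulrA mulrAC ler_pdivlMr//.
rewrite -mulrA [60 * _]mulrC; nra.
Qed.

Lemma continuous_cis_comp f r : 1 < r -> holo r f -> continuous (fun t : R => cmod (f (cis t))).
Proof.
move=> r1 hf t; have cr : cmod (cis t) < r by rewrite cmod_cis.
apply/cvgrPdist_lt => e e0; have [s s0 sP] := holo_ccont hf cr e0.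
have [d d0 dP] := rdiff_cont (rdiff_cis t) s0.
apply/nbhs_ballP; exists d => // u; rewrite /ball /= distrC => ut.
have := sP _ (dP u ut); apply: le_lt_trans.
rewrite ler_norml; apply/andP; split.
  by have := cmod_lb (f (cis u)) (f (cis t)); lra.
by have := cmod_lb (f (cis t)) (f (cis u)); rewrite cmod_distC; lra.
Qed.

Lemma continuous_rt M (g : R -> R) : continuous g -> (forall x, 0 <= g x) ->
  continuous (fun x => rt M (g x)).
Proof.
move=> cg g0 t; apply/cvgrPdist_lt => e e0; have e20 : 0 < e / 2 by lra.
have [d d0 dP] := rt_small M e20.
have /cvgrPdist_lt/(_ d d0) := cg t; apply: filterS => u H.
apply: (le_lt_trans (rt_dist M (g0 t) (g0 u))).
apply: (le_lt_trans (le_rt M (ltW H))); lra.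
Qed.

Definition circle_trace M f (t : R) : R := rt M (cmod (f (cis t))).

Lemma circle_trace_ge0 M f t : 0 <= circle_trace M f t.
Proof. by rewrite rt_ge0 ?cmod_ge0. Qed.

Lemma circle_trace_periodic M f t : circle_trace M f (t + 1) = circle_trace M f t.
Proof. by rewrite /circle_trace cisD cis1 mulr1. Qed.

Lemma continuous_circle_trace M f r : 1 < r -> holo r f -> continuous (circle_trace M f).
Proof.
move=> r1 hf; apply: continuous_rt; first exact: continuous_cis_comp hf.
by move=> x; exact: cmod_ge0.
Qed.

Lemma nontangential_HL : exists2 K : R, 1 <= K & forall M (r : R) f (t0 t : R) z,
  1 < r -> holo r f -> 0 <= t0 <= 1 -> 0 <= t < 1 -> cmod (z - t%:C * cis t0) <= (1 - t) / 2 ->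
  ((rt M (cmod (f z)))%:E <= K%:E * HL_maximal (window (circle_trace M f)) t0)%E.
Proof.
(* 60 from the Poisson kernel, times 16 for each of the two Cauchy kernels. *)
exists 1920; first by rewrite ler1n.
move=> M r f t0 t z r1 hf t01 t1 zt.
pose phi := circle_trace M f.
have phi0 x : 0 <= phi x by exact: circle_trace_ge0.
have phiC : continuous phi by exact: continuous_circle_trace hf.
have phiP x : phi (x + 1) = phi x by exact: circle_trace_periodic.
pose c : R[i] := cis t0; pose z' := z / c.
have c0 : c != 0 by exact: cis_neq0.
have c1 : cmod c = 1 by exact: cmod_cis.
have y0 : 0 < 1 - t by lra.
have z't : cmod (z' - t%:C) <= (1 - t) / 2.
  rewrite -(mulfK c0 t%:C) -mulrBl cmodf c1 divr1; exact: zt.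
have z'1 : cmod z' < 1.
  have := cmod_lb z' t%:C; rewrite cmodR_ge0; last lra.
  by move: z't; lra.
(* The rotation moves the vertex of the region to the point 1; in the circle parameter it is the
   shift by [t0]. *)
pose g w := f (0 + c * w).
have hg : holo r g.
  by apply: (@holo_comp_affine _ r) => // w wr; rewrite add0r cmodM c1 mul1r.
have := submean_holo M r1 hg z'1; rewrite /submean.
have -> : g z' = f z by rewrite /g /z' add0r mulrCA divff// mulr1.
have gE x : rt M (cmod (g (cis x))) = phi (t0 + 1 * x).
  by rewrite /g /phi /circle_trace add0r mul1r cisD.
have -> : rint (fun x => poisson z' x * rt M (cmod (g (cis x)))) =
    rint (fun x => poisson z' x * phi (t0 + 1 * x)).
  by apply: eq_rint => x _; rewrite gE.
have n1 : `|1 : R| = 1 by rewrite normr1.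
have n2 : `|-1 : R| = 1 by rewrite normrN1.
have cphi : rcont01 (fun x => phi (t0 + 1 * x)) by exact: rcont01_isometry.
have ck := cont01_cauchy_kernel y0.
have ck' : rcont01 (fun x => cauchy_kernel (1 - t) (1 - x)).
  have h : cont01 (fun x => (cauchy_kernel (1 - t) (1 + (-1) * x))%:C).
    by apply: (cont01_affine (h := fun x => (cauchy_kernel (1 - t) x)%:C) ck) => x x01; lra.
  by apply: cont01_eq h => x _; rewrite mulN1r.
have H1 := cauchy_kernel_HL phi0 phiC phiP y0 t01 n1.
have H2 := cauchy_kernel_HL phi0 phiC phiP y0 t01 n2.
(* Reversing the circle turns the kernel centred at 1 into the one centred at 0, read on the other
   side of [t0]; periodicity absorbs the full turn. *)
have E2 : rint (fun x => cauchy_kernel (1 - t) (1 - x) * phi (t0 + 1 * x)) =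
    rint (fun x => cauchy_kernel (1 - t) x * phi (t0 + (-1) * x)).
  rewrite rint_rev; last exact: rcont01M.
  apply: eq_rint => x _; rewrite opprB addrCA subrr addr0; congr (_ * _).
  by rewrite mul1r mulN1r addrA addrAC phiP.
rewrite -E2 in H2.
have bound : rint (fun x => poisson z' x * phi (t0 + 1 * x)) <=
    60 * (rint (fun x => cauchy_kernel (1 - t) x * phi (t0 + 1 * x)) +
          rint (fun x => cauchy_kernel (1 - t) (1 - x) * phi (t0 + 1 * x))).
  have c3 : rcont01 (fun x => cauchy_kernel (1 - t) x * phi (t0 + 1 * x)) by exact: rcont01M.
  have c4 : rcont01 (fun x => cauchy_kernel (1 - t) (1 - x) * phi (t0 + 1 * x)) by exact: rcont01M.
  rewrite -rintD// -rintZ; last exact: rcont01D.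
  apply: le_rint.
  - by apply: rcont01M => //; exact: cont01_poisson.
  - by apply: rcont01M; [exact: rcont01_cst|exact: rcont01D].
  move=> x x01; rewrite -mulrDl mulrA; apply: ler_wpM2r => //.
  exact: poisson_le_cauchy_kernel.
move=> H; have {H bound} H := le_trans H bound.
move: (rint _) (rint _) H H1 H2 => A B.
rewrite -/phi; case: (HL_maximal (window phi) t0) => [l| |].
- by move=> h h1 h2; rewrite -!EFinM !lee_fin in h1 h2 *; lra.
- by move=> _ _ _; rewrite gt0_muley ?lte_fin ?ltr0n// leey.
- by move=> _; rewrite gt0_muleNy ?lte_fin ?ltr0n.
Qed.

(** [S] is a dyadic series of indicators rather than a supremum over a region, so it is measurable
    by construction, and its summand 1 gives S >= 1. With 2^-M <= p / 2 the exponent s = p 2^M is at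
    least 2, so one maximal theorem serves every p > 0. *)
Theorem nontangential_maximal (p : R) : 0 < p -> exists2 C : R, 0 < C & forall (r : R) f,
  1 < r -> holo r f -> exists S : R -> \bar R, [/\ measurable_fun setT S, forall t : R, (1 <= S t)%E,
    (\int[mu]_(t in `[0%R, 1%R]) S t <= (C * (1 + rint (fun t => cmod (f (cis t)) `^ p)))%:E)%E
  & forall (t0 t : R) z, 0 <= t0 <= 1 -> 0 <= t < 1 -> cmod (z - t%:C * cis t0) <= (1 - t) / 2 ->
     ((cmod (f z) `^ p)%:E <= S t0)%E].
Proof.
move=> p0; have [K K1 HK] := nontangential_HL.
have [M Mp] := exists_exp2V (divr_gt0 p0 (ltr0n R 2)).
pose s := p * 2 ^+ M; have M0 : 0 < (2 ^+ M : R) by rewrite exprn_gt0.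
have s2 : 2 <= s.
  move: Mp; rewrite ler_pdivlMr// ler_pdivrMl//; first by rewrite /s mulrC.
have s0 : 0 < s by lra.
have E x : 0 <= x -> x `^ p = rt M x `^ s.
  move=> x0; rewrite rt_powR// -powRrM /s mulrCA mulVf ?mulr1//.
have Ks : 1 <= K `^ s.
  have <- : 1 `^ s = 1 :> R by rewrite powR1.
  by apply: ge0_ler_powR; rewrite ?nnegrE; lra.
have Ks0 : 0 <= K `^ s by exact: powR_ge0.
exists (K `^ s * (1 + 72 * (2 `^ s) ^+ 2)).
  have Q0 : 0 <= (2 `^ s) ^+ 2 :> R by exact: sqr_ge0.
  by apply: mulr_gt0; lra.
move=> r f r1 hf; pose phi := circle_trace M f.
have phi0 x : 0 <= phi x by exact: circle_trace_ge0.
have phiC : continuous phi by exact: continuous_circle_trace hf.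
have phiP x : phi (x + 1) = phi x by exact: circle_trace_periodic.
have iw := integrable_window phi0 phiC phiP.
have lf : locally_integrable setT (window phi) by apply: open_integrable_locally => //; exact: openT.
have w0 := window_ge0 phi0.
pose D := dyadic_majorant s (window phi).
have mD : measurable_fun setT D by exact: measurable_dyadic_majorant.
have D1 x : (1 <= D x)%E.
  apply: leeDl; apply: nneseries_ge0 => k _ _.
  by apply: mule_ge0; rewrite lee_fin// exprn_ge0// powR_ge0.
have D0 x : (0 <= D x)%E by apply: le_trans (D1 x).
exists (fun x => ((K `^ s)%:E * D x)%E); split.
- exact: measurable_funeM.
- by move=> x; apply: (le_trans (D1 x)); rewrite lee_pemull// lee_fin.
- rewrite ge0_integralZl_EFin//; last exact: measurable_funTS.
  rewrite -mulrA EFinM; apply: lee_wpmul2l; first by rewrite lee_fin.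
  apply: (le_trans (integral_dyadic_majorant s2 w0 iw)).
  have IW := integral_window_powR phi0 phiC phiP s0.
  have -> : rint (fun t => cmod (f (cis t)) `^ p) = rint (fun x => phi x `^ s).
    by apply: eq_rint => x _; rewrite E ?cmod_ge0.
  have P0 : 0 <= rint (fun x => phi x `^ s) by apply: rint_ge0 => x _; exact: powR_ge0.
  move: (rint _) P0 IW => P P0 IW; have Q0 : 0 <= (2 `^ s) ^+ 2 :> R by exact: sqr_ge0.
  apply: (@le_trans _ _ (1 + (24 * (2 `^ s) ^+ 2)%:E * (3 * P)%:E)%E).
    apply: leeD => //; apply: lee_wpmul2l => //; rewrite lee_fin mulr_ge0//.
  rewrite -EFinM -EFinD lee_fin; move: ((2 `^ s) ^+ 2) Q0 => Q Q0.
  have QP : 0 <= Q * P by exact: mulr_ge0.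
  lra.
move=> t0 t z t01 t1 zt; have H := HK M r f t0 t z r1 hf t01 t1 zt.
have K0 : 0 < K by lra.
have y0 : 0 <= rt M (cmod (f z)) / K by rewrite divr_ge0 ?rt_ge0 ?cmod_ge0// ltW.
have H' : ((rt M (cmod (f z)) / K)%:E <= HL_maximal (window phi) t0)%E.
  move: H; rewrite -/phi; case: (HL_maximal (window phi) t0) => [l| |].
  - by rewrite -EFinM !lee_fin ler_pdivrMr// mulrC.
  - by rewrite leey.
  - by rewrite gt0_muleNy ?lte_fin.
have := dyadic_majorant_ge s0 y0 H'; rewrite -/D => DH.
have -> : cmod (f z) `^ p = K `^ s * (rt M (cmod (f z)) / K) `^ s.
  rewrite E ?cmod_ge0// -powRM ?(ltW K0)//; congr (_ `^ s).
  by rewrite mulrC divfK// gt_eqF.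
by rewrite EFinM; apply: lee_wpmul2l; rewrite ?lee_fin.
Qed.

End Nontangential.

(** * Iterated integration along a radius *)

Section Hedberg.
Context {R : realType}.

Lemma is_derive_powR_sub (r a t : R) : t < r ->
  is_derive t 1 (fun s => (r - s) `^ a) (- (a * (r - t) `^ (a - 1))).
Proof.
move=> tr; apply/is_derive_epsdelta => e e0.
have rt : 0 < r - t by lra.
have /is_derive_epsdelta/(_ e e0)[d d0 dP] := is_derive1_powR a rt.
exists d => // h hd; have := dP (- h); rewrite normrN => /(_ hd).
by rewrite opprD addrA mulNr mulrN.
Qed.

Lemma powR_le0 (x y a : R) : 0 < x -> x <= y -> a <= 0 -> y `^ a <= x `^ a.
Proof.
move=> x0 xy a0; have y0 : 0 < y by lra.
rewrite -[a]opprK !(powRN _ (- a)) lef_pV2 ?posrE ?powR_gt0//.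
by apply: ge0_ler_powR; rewrite ?nnegrE ?oppr_ge0//; exact: ltW.
Qed.

Definition wgt (H : R -> R) t := (1 - t) * H t.

Variable c : R[i].
Hypothesis c1 : cmod c = 1.

Section Step.
Variables (phi psi : R -> R[i]) (r x y A E a : R).
Hypotheses (xy : x <= y) (yr : y < r) (E0 : 0 <= E).
Hypothesis psiE : forall t, x <= t <= y -> rdiff psi t (c * phi t).
Hypothesis phiE : forall t, x <= t <= y -> cmod (phi t) <= A + E * (r - t) `^ a.

Lemma ray_step : a + 1 != 0 ->
  cmod (psi y - psi x) <= A * (y - x) + E / (a + 1) * ((r - x) `^ (a + 1) - (r - y) `^ (a + 1)).
Proof.
move=> a0.
pose B s := A * s - E / (a + 1) * (r - s) `^ (a + 1).
have -> : A * (y - x) + E / (a + 1) * ((r - x) `^ (a + 1) - (r - y) `^ (a + 1)) = B y - B x.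
  by rewrite /B; ring.
apply: (@rdiff_dominated _ psi (fun t => c * phi t) B (fun t => A + E * (r - t) `^ a) x y xy psiE) => t txy; last first.
  by rewrite cmodM c1 mul1r; exact: (phiE txy).
have tr : t < r by case/andP: txy => _ ty; exact: le_lt_trans ty yr.
have H := is_deriveB (is_deriveZ A (is_derive_id t 1))
  (is_deriveZ (E / (a + 1)) (is_derive_powR_sub (a + 1) tr)).
have -> : A + E * (r - t) `^ a = A *: 1 - E / (a + 1) *: - ((a + 1) * (r - t) `^ (a + 1 - 1)).
  by rewrite /GRing.scale /= addrK; field.
exact: H.
Qed.

(** While the new exponent is negative, the upper endpoint dominates and the value of the primitive
    at [x] is dropped; the distance of a + 1 from 0 controls the constant. *)
Lemma ray_step_neg (kap : R) : 0 < kap -> a + 1 <= - kap ->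
  cmod (psi y - psi x) <= A * (y - x) + E / kap * (r - y) `^ (a + 1).
Proof.
move=> k0 ak; have a0 : a + 1 != 0 by rewrite lt_eqF//; lra.
apply: (le_trans (ray_step a0)); rewrite lerD2l.
have -> : E / (a + 1) * ((r - x) `^ (a + 1) - (r - y) `^ (a + 1)) =
    E * (- (a + 1))^-1 * ((r - y) `^ (a + 1) - (r - x) `^ (a + 1)).
  by rewrite invrN; ring.
have i0 : 0 < (- (a + 1))^-1 by rewrite invr_gt0; lra.
apply: (@le_trans _ _ (E * (- (a + 1))^-1 * (r - y) `^ (a + 1))).
  by apply: ler_wpM2l; [rewrite mulr_ge0// ltW|have := powR_ge0 (r - x) (a + 1); lra].
apply: ler_wpM2r; first exact: powR_ge0.
by apply: ler_wpM2l => //; rewrite lef_pV2 ?posrE; lra.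
Qed.

(** Once the new exponent is positive the lower endpoint dominates, and the bound remains finite as
    y tends to [r]. *)
Lemma ray_step_pos (s : R) : 0 < s -> a + 1 = s ->
  cmod (psi y - psi x) <= A * (y - x) + E / s * (r - x) `^ s.
Proof.
move=> s0 as_; have a0 : a + 1 != 0 by rewrite gt_eqF//; lra.
apply: (le_trans (ray_step a0)); rewrite lerD2l as_.
apply: ler_wpM2l; first by rewrite divr_ge0// ltW.
by have := powR_ge0 (r - y) s; lra.
Qed.

End Step.

Variables (p q D : R) (n k : nat) (H : R -> R).
Hypotheses (p0 : 0 < p) (pq : p < q) (kn : (k < n)%N) (D0 : 0 < D).
Hypothesis H_gt0 : forall t, 0 <= t < 1 -> 0 < H t.
Hypothesis H_mono : forall s t, 0 <= s -> s <= t -> t < 1 -> H t <= H s.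
Hypothesis H_doubling : forall t, 0 <= t < 1 -> H t <= D * H ((1 + t) / 2).
Variables (delta kap : R).
Hypotheses (deltaE : delta = p^-1 - q^-1) (kapE : kap = q^-1).
Local Notation W := (wgt H).

Let q0 : 0 < q. Proof. exact: lt_trans p0 pq. Qed.
Let kap0 : 0 < kap. Proof. by rewrite kapE invr_gt0 q0. Qed.
Let delta0 : 0 < delta. Proof. by rewrite deltaE subr_gt0 ltf_pV2 ?posrE ?pq ?p0 ?q0. Qed.

Lemma weight_gt0 t : 0 <= t < 1 -> 0 < W t.
Proof. by move=> t01; rewrite mulr_gt0 ?H_gt0//; lra. Qed.

Lemma weight_mono s t : 0 <= s -> s <= t -> t < 1 -> W t <= W s.
Proof.
move=> s0 st t1; apply: ler_pM; try lra; last exact: H_mono.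
by apply/ltW/H_gt0; lra.
Qed.

Lemma weight_doubling t : 0 <= t < 1 -> W t <= 2 * D * W ((1 + t) / 2).
Proof.
move=> t01; rewrite /wgt.
have -> : 2 * D * ((1 - (1 + t) / 2) * H ((1 + t) / 2)) = (1 - t) * (D * H ((1 + t) / 2)).
  by field.
by apply: ler_wpM2l; [lra|exact: H_doubling].
Qed.

(* [t0] is dyadic, so that [H_doubling] compares [W t0] with the level [N `^ (- p)]
   without any continuity of [H]. *)
Lemma weight_level (N : R) : 1 <= N -> exists t0 : R, [/\ 0 <= t0 < 1, W t0 <= N `^ (- p) &
  t0 = 0 \/ N `^ (- p) <= 2 * D * W t0].
Proof.
move=> N1; pose tt i : R := 1 - 2 ^- i.
have tt01 i : 0 <= tt i < 1.
  have : 0 < 2 ^- i :> R by rewrite invr_gt0 exprn_gt0.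
  have : 2 ^- i <= 1 :> R by rewrite invf_le1 ?exprn_gt0// exprn_ege1//; lra.
  by rewrite /tt; lra.
have N0 : 0 < N `^ (- p) by rewrite powR_gt0; lra.
have [i0 i0P] := exists_exp2 (H 0) N0.
have ex : exists i, W (tt i) <= N `^ (- p).
  exists i0; apply: ltW; apply: le_lt_trans i0P.
  rewrite /wgt (_ : 1 - tt i0 = 2 ^- i0); last by rewrite /tt; ring.
  rewrite mulrC; apply: ler_wpM2r; first by rewrite invr_ge0 exprn_ge0.
  by have := tt01 i0; move=> /andP[a b]; exact: H_mono.
case: (ex_minnP ex) => i iP imin; exists (tt i); split=> //.
case: i iP imin => [|i] iP imin; first by left; rewrite /tt expr0 invr1 subrr.
right; have tiE : tt i.+1 = (1 + tt i) / 2.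
  by rewrite /tt exprS invfM; field; rewrite expf_neq0.
rewrite tiE; apply: le_trans (weight_doubling (tt01 i)).
by rewrite leNgt; apply/negP => /ltW/imin; rewrite ltnn.
Qed.

(** [phi j] stands for the j-fold primitive along the ray of direction [c], [N] for the
    nontangential maximal function at its endpoint, [eta] for an additive error and [eps] for the
    size of the symbol quotient. *)
Variables (phi : nat -> R -> R[i]) (r N eta eps : R).
Hypotheses (r01 : 0 <= r < 1) (N1 : 1 <= N) (eta0 : 0 <= eta) (eps0 : 0 <= eps).
Hypothesis phiE : forall j t, 0 <= t < 1 -> rdiff (phi j.+1) t (c * phi j t).
Hypothesis phi00 : forall j, phi j.+1 0 = 0.
Hypothesis phi_near : forall t, 0 <= t < r ->
  cmod (phi 0%N t) <= eta + eps * (N * (r - t) `^ (- k%:R) * (1 - t) `^ (- (n - k)%:R) * W t `^ delta).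
Hypothesis phi_far : forall t, 0 <= t < 1 ->
  cmod (phi 0%N t) <= eta + eps * ((1 - t) `^ (- n%:R) * W t `^ (- kap)).

Variable lam : R.
Hypotheses (lam1 : 1 <= lam) (lamK : kap^-1 <= lam).

Let N0 : 0 < N. Proof. exact: lt_le_trans N1. Qed.

(** Each integration raises the exponent of 1 - t by one, and it stays at most -kap because j <= n,
    so [ray_step_neg] applies every time with the same constant. By monotonicity H(t)^(-kap) is
    replaced by its largest value H(T)^(-kap) and leaves the integrals; [eta] does not grow since
    the path is shorter than 1. *)
Lemma hedberg_far T j : (j <= n)%N -> 0 <= T < 1 -> forall t, 0 <= t <= T ->
  cmod (phi j t) <= eta + eps * lam ^+ j * H T `^ (- kap) * (1 - t) `^ (j%:R - n%:R - kap).
Proof.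
move=> jn T01; have HT := H_gt0 T01.
elim: j jn => [|j ih] jn t tT.
  have t01 : 0 <= t < 1 by lra.
  apply: (le_trans (phi_far t01)); rewrite lerD2l expr0 mulr1 -mulrA ler_wpM2l//.
  rewrite (powRM _ (_ : 0 <= 1 - t)) ?(ltW (H_gt0 t01))//; last lra.
  have -> : 0%:R - n%:R - kap = - n%:R + - kap by rewrite mulr0n; ring.
  rewrite powRD; last by apply/implyP => _; rewrite gt_eqF//; lra.
  rewrite mulrA mulrC; apply: ler_wpM2r; first by rewrite mulr_ge0 ?powR_ge0.
  by apply: powR_le0; [exact: HT|apply: H_mono; lra|rewrite oppr_le0; exact: ltW kap0].
have {}ih := ih (ltnW jn).
have E0 : 0 <= eps * lam ^+ j * H T `^ (- kap).
  by rewrite mulr_ge0 ?powR_ge0// mulr_ge0 ?eps0// exprn_ge0// (le_trans ler01 lam1).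
have t1 : t < 1 by lra.
have dom s : 0 <= s <= t -> rdiff (phi j.+1) s (c * phi j s) by move=> st; apply: phiE; lra.
have bnd s : 0 <= s <= t -> cmod (phi j s) <= eta + eps * lam ^+ j * H T `^ (- kap) * (1 - s) `^ (j%:R - n%:R - kap).
  by move=> st; apply: ih; lra.
have tp : 0 <= t by lra.
have ak : j%:R - n%:R - kap + 1 <= - kap.
  have jn1 : j.+1%:R <= n%:R :> R by rewrite ler_nat.
  by move: jn1; rewrite -natr1; lra.
have := ray_step_neg tp t1 E0 dom bnd kap0 ak.
rewrite phi00 !subr0 => G; apply: (le_trans G).
have -> : j.+1%:R - n%:R - kap = j%:R - n%:R - kap + 1 by rewrite -natr1; ring.
apply: lerD; first by rewrite -[leRHS]mulr1; apply: ler_wpM2l => //; lra.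
apply: ler_wpM2r; first exact: powR_ge0.
have -> : eps * lam ^+ j.+1 * H T `^ (- kap) = eps * lam ^+ j * H T `^ (- kap) * lam by rewrite exprS; ring.
by apply: ler_wpM2l; [exact: E0|exact: lamK].
Qed.

Section Near.
(** [del] is the part of delta that is kept on 1 - t. Being at most 1/2, it leaves the exponents at
    most -1/2 until the last integration, where alone the exponent becomes positive. The rest of
    W^delta is frozen at [t0] inside [E]. *)
Variables t0 del E : R.
Hypotheses (t001 : 0 <= t0) (t0r : t0 < r) (Wt0 : W t0 <= N `^ (- p)).
Hypotheses (del0 : 0 < del) (del2 : del <= 2^-1) (deld : del <= delta).
Hypothesis EE : E = N * H t0 `^ delta * (1 - t0) `^ (delta - del).

Let t01 : 0 <= t0 < 1.
Proof. by rewrite t001 (lt_trans t0r)//; case/andP: r01. Qed.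
Let Ht0 : 0 < H t0. Proof. exact: H_gt0. Qed.

Let E0 : 0 <= E.
Proof. by rewrite EE mulr_ge0 ?powR_ge0// mulr_ge0 ?powR_ge0// ltW. Qed.

(** [H] and the power delta - del of 1 - t are replaced by their values at [t0]. Then 1 - t is
    lowered to r - t, which is allowed since its exponent -(n - k) + del is negative: n - k >= 1 >
    del. *)
Lemma hedberg_near0 t : t0 <= t < r ->
  N * (r - t) `^ (- k%:R) * (1 - t) `^ (- (n - k)%:R) * W t `^ delta <= E * (r - t) `^ (- n%:R + del).
Proof.
move=> tt; have := r01; have := t01 => t01' r01'; have rt : 0 < r - t by lra.
have ot : 0 < 1 - t by lra.
have m1 : 1 <= (n - k)%:R :> R by rewrite ler1n subn_gt0.
have nE : (n%:R : R) = k%:R + (n - k)%:R by rewrite -natrD subnKC// ltnW.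
have W1 : W t `^ delta <= (1 - t) `^ delta * H t0 `^ delta.
  rewrite /wgt powRM ?(ltW ot)//; last by apply/ltW/H_gt0; lra.
  apply: ler_wpM2l; first exact: powR_ge0.
  by apply: ge0_ler_powR; rewrite ?nnegrE ?(ltW delta0) ?(ltW Ht0)//; [apply/ltW/H_gt0; lra|apply: H_mono; lra].
have W2 : (1 - t) `^ delta <= (1 - t0) `^ (delta - del) * (1 - t) `^ del.
  have -> : (1 - t) `^ delta = (1 - t) `^ (delta - del) * (1 - t) `^ del.
    by rewrite -powRD ?subrK//; apply/implyP => _; rewrite gt_eqF.
  apply: ler_wpM2r; first exact: powR_ge0.
  by apply: ge0_ler_powR; rewrite ?nnegrE ?subr_ge0//; lra.
have W3 : (1 - t) `^ (- (n - k)%:R) * (1 - t) `^ del <= (r - t) `^ (- (n - k)%:R + del).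
  rewrite -powRD; last by apply/implyP => _; rewrite gt_eqF.
  by have d2 := del2; apply: powR_le0 => //; lra.
have -> : - n%:R + del = - k%:R + (- (n - k)%:R + del) :> R by rewrite nE; ring.
rewrite powRD; last by apply/implyP => _; rewrite gt_eqF.
apply: (@le_trans _ _ (N * (r - t) `^ (- k%:R) * (1 - t) `^ (- (n - k)%:R) *
    ((1 - t0) `^ (delta - del) * (1 - t) `^ del * H t0 `^ delta))).
  apply: ler_wpM2l; first by rewrite !mulr_ge0 ?powR_ge0// ltW.
  by apply: (le_trans W1); apply: ler_wpM2r; first exact: powR_ge0.
rewrite (_ : N * (r - t) `^ (- k%:R) * (1 - t) `^ (- (n - k)%:R) *
    ((1 - t0) `^ (delta - del) * (1 - t) `^ del * H t0 `^ delta) =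
  E * (r - t) `^ (- k%:R) * ((1 - t) `^ (- (n - k)%:R) * (1 - t) `^ del)); last by rewrite EE; ring.
rewrite [leRHS]mulrA; apply: ler_wpM2l => //.
by rewrite mulr_ge0 ?powR_ge0.
Qed.

(** Since r - t0 <= 1 - t0, the left side is at most N W(t0)^delta; then W(t0) <= N^(-p) and 1 - p
    delta = p / q. *)
Lemma hedberg_E : E * (r - t0) `^ del <= N `^ (p / q).
Proof.
apply: (@le_trans _ _ (E * (1 - t0) `^ del)).
  apply: ler_wpM2l => //.
  have := t01; have := r01; have := t0r => a1 a2 a3.
  by apply: ge0_ler_powR; rewrite ?nnegrE ?(ltW del0)//; lra.
have t01' := t01; have N0' := N0.
rewrite EE -mulrA -powRD; last by apply/implyP => _; rewrite gt_eqF//; lra.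
rewrite subrK -mulrA [_ * (1 - t0) `^ _]mulrC -powRM ?(ltW Ht0)//; last lra.
rewrite -[(1 - t0) * H t0]/(W t0); apply: (@le_trans _ _ (N * (N `^ (- p)) `^ delta)).
  apply: ler_wpM2l; first lra.
  apply: ge0_ler_powR; rewrite ?nnegrE ?powR_ge0 ?(ltW delta0)//.
  by apply/ltW/weight_gt0; lra.
rewrite -powRrM -{1}[N]powRr1; last lra.
rewrite -powRD; last by apply/implyP => _; rewrite gt_eqF//; lra.
by rewrite (_ : 1 + - p * delta = p / q)// deltaE; field; rewrite !gt_eqF.
Qed.

Variable P : R.
Hypothesis P0 : 0 <= P.
Hypothesis phi_start : forall j, (j.+1 <= n)%N -> cmod (phi j.+1 t0) <= eta + eps * P * (1 - t0) `^ (j.+1%:R - n%:R).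

(** Each integration keeps the exponent of r - t at most -1/2, hence a factor 2, and adds the
    starting value at [t0] from [phi_start]. The multiples of [P] add up linearly because t - t0 <=
    1 - t0. *)
Lemma hedberg_near j : (j < n)%N -> forall t, t0 <= t < r ->
  cmod (phi j t) <= (j.+1%:R * eta + eps * (j%:R * P * (1 - t0) `^ (j%:R - n%:R))) +
     eps * (2 ^+ j * E) * (r - t) `^ (j%:R - n%:R + del).
Proof.
have t01' := t01; have r01' := r01; have t0r' := t0r; have del2' := del2; have del0' := del0.
elim: j => [|j ih] jn t tt.
  have t1 : 0 <= t < r by lra.
  apply: (le_trans (phi_near t1)); rewrite mulr0n !mul0r mulr0 addr0 mul1r lerD2l expr0 mul1r.
  by rewrite -[eps * E * _]mulrA; apply: ler_wpM2l => //; rewrite sub0r; exact: hedberg_near0.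
have {}ih := ih (ltnW jn).
have tp : t0 <= t by lra.
have tr : t < r by lra.
have Ej : 0 <= eps * (2 ^+ j * E) by rewrite mulr_ge0// mulr_ge0// exprn_ge0.
have dom s : t0 <= s <= t -> rdiff (phi j.+1) s (c * phi j s) by move=> st; apply: phiE; lra.
have bnd s : t0 <= s <= t -> cmod (phi j s) <= (j.+1%:R * eta + eps * (j%:R * P * (1 - t0) `^ (j%:R - n%:R))) +
     eps * (2 ^+ j * E) * (r - s) `^ (j%:R - n%:R + del).
  by move=> st; apply: ih; lra.
have h0 : 0 < 2^-1 :> R by lra.
have ak : j%:R - n%:R + del + 1 <= - 2^-1.
  have jn1 : j.+2%:R <= n%:R :> R by rewrite ler_nat.
  by rewrite -!natr1 in jn1; lra.
have := ray_step_neg tp tr Ej dom bnd h0 ak => G.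
have := cmodD (phi j.+1 t - phi j.+1 t0) (phi j.+1 t0); rewrite subrK => G2.
have := phi_start (ltnW jn) => G3.
have -> : j.+1%:R - n%:R + del = j%:R - n%:R + del + 1 by rewrite -natr1; ring.
have X0 : 0 <= (1 - t0) `^ (j%:R - n%:R) by exact: powR_ge0.
have XE : (1 - t0) `^ (j.+1%:R - n%:R) = (1 - t0) `^ (j%:R - n%:R) * (1 - t0).
  have -> : j.+1%:R - n%:R = j%:R - n%:R + 1 :> R by rewrite -natr1; ring.
  rewrite powRD ?powRr1//; last by apply/implyP => _; rewrite gt_eqF//; lra.
  lra.
rewrite XE in G3 *.
set X := (1 - t0) `^ (j%:R - n%:R) in X0 G G3 *.
set Y := (r - t) `^ _ in G *.
have -> : eps * (2 ^+ j.+1 * E) * Y = eps * (2 ^+ j * E) / 2^-1 * Y by rewrite exprS; field.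
apply: (le_trans G2); apply: (le_trans (lerD G G3)).
rewrite addrAC lerD2r.
have G4 : (j.+1%:R * eta + eps * (j%:R * P * X)) * (t - t0) <= j.+1%:R * eta + eps * (j%:R * P * X) * (1 - t0).
  rewrite mulrDl; apply: lerD.
    by rewrite -[leRHS]mulr1; apply: ler_wpM2l; [rewrite mulr_ge0|lra].
  by apply: ler_wpM2l; [rewrite mulr_ge0// !mulr_ge0|lra].
apply: (le_trans (lerD G4 (lexx _))).
by rewrite le_eqVlt; apply/orP; left; apply/eqP; ring.
Qed.

Lemma hedberg_last : cmod (phi n r) <= n.+1%:R * eta + eps * (n%:R * P + 2 ^+ n / del * N `^ (p / q)).
Proof.
have t01' := t01; have r01' := r01; have t0r' := t0r; have del2' := del2; have del0' := del0.
set X := (X in _ <= X).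
have [n' nE] : exists n', n = n'.+1 by case: (n) kn => // n' _; exists n'.
have main t : t0 <= t < r -> cmod (phi n t) <= X.
  move=> tt; have tp : t0 <= t by lra.
  have tr : t < r by lra.
  have jn : (n' < n)%N by rewrite nE.
  have Ej : 0 <= eps * (2 ^+ n' * E) by rewrite mulr_ge0 ?eps0// mulr_ge0 ?E0// exprn_ge0.
  have dom s : t0 <= s <= t -> rdiff (phi n'.+1) s (c * phi n' s) by move=> st; apply: phiE; lra.
  have bnd s : t0 <= s <= t -> cmod (phi n' s) <= (n'.+1%:R * eta + eps * (n'%:R * P * (1 - t0) `^ (n'%:R - n%:R))) +
     eps * (2 ^+ n' * E) * (r - s) `^ (n'%:R - n%:R + del).
    by move=> st; apply: (hedberg_near jn); lra.
  have eE : n'%:R - n%:R + del + 1 = del by rewrite nE -natr1; ring.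
  have G := ray_step_pos tp tr Ej dom bnd del0 eE.
  have := cmodD (phi n'.+1 t - phi n'.+1 t0) (phi n'.+1 t0); rewrite subrK => G2.
  have := phi_start (_ : (n'.+1 <= n)%N); rewrite nE leqnn => /(_ isT).
  rewrite -nE subrr powRr0 mulr1 => G3.
  rewrite -nE in G G2.
  apply: (le_trans G2); apply: (le_trans (lerD G G3)).
  have XE : (1 - t0) `^ (n'%:R - n%:R) * (1 - t0) = 1.
    rewrite (_ : n'%:R - n%:R = -1 :> R); last by rewrite nE -natr1; ring.
    by rewrite powR_inv1 ?mulVf// ?gt_eqF//; lra.
  have X0 : 0 <= (1 - t0) `^ (n'%:R - n%:R) by exact: powR_ge0.
  have G4 : (n%:R * eta + eps * (n'%:R * P * (1 - t0) `^ (n'%:R - n%:R))) * (t - t0) <=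
      n%:R * eta + eps * (n'%:R * P).
    rewrite mulrDl; apply: lerD.
      by rewrite -[leRHS]mulr1; apply: ler_wpM2l; [rewrite mulr_ge0|lra].
    rewrite (_ : eps * (n'%:R * P) = eps * (n'%:R * P * (1 - t0) `^ (n'%:R - n%:R)) * (1 - t0)); last first.
      by rewrite -!mulrA XE mulr1.
    by apply: ler_wpM2l; [rewrite mulr_ge0// !mulr_ge0|lra].
  have G5 : eps * (2 ^+ n' * E) / del * (r - t0) `^ del <= eps * (2 ^+ n / del * N `^ (p / q)).
    have -> : eps * (2 ^+ n' * E) / del * (r - t0) `^ del = eps * (2 ^+ n' / del * (E * (r - t0) `^ del)).
      by ring.
    apply: ler_wpM2l => //; apply: ler_pM.
    - by rewrite divr_ge0 ?exprn_ge0// ltW.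
    - by rewrite mulr_ge0 ?powR_ge0.
    - apply: ler_wpM2r; first by rewrite invr_ge0 ltW.
      by rewrite nE ler_eXn2l//; lra.
    exact: hedberg_E.
  apply: (le_trans (lerD (lerD G4 G5) (lexx _))).
  rewrite /X -[in leRHS]natr1 mulrDr nE -[n'.+1%:R]natr1 le_eqVlt; apply/orP; left; apply/eqP; ring.
(* The estimate is available for t < r only; continuity of the n-fold primitive at [r] extends it to
   the endpoint. *)
apply/ler_addgt0Pr => e e0.
have r0 : 0 <= r < 1 by [].
have [n'' nE'] : exists n', n = n'.+1 by exists n'.
have [d d0 dP] : exists2 d : R, 0 < d & forall s : R, `|s - r| < d -> cmod (phi n s - phi n r) < e.
  by have := rdiff_cont (phiE n' r0) e0; rewrite -nE.
pose s := Num.max t0 (r - d / 2).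
have sr : t0 <= s < r by rewrite /s le_max lexx /= gt_max t0r; lra.
have sd : `|s - r| < d.
  rewrite ltr0_norm; last lra.
  have : r - d / 2 <= s by rewrite /s le_max lexx orbT.
  lra.
have := main s sr; have := dP s sd; have := cmodD (phi n r - phi n s) (phi n s).
by rewrite subrK cmod_distC; lra.
Qed.

End Near.

(** The lower half of the level condition: W^(-1/q) is at most of order (N^(-p))^(-1/q) =
    N^(p/q). *)
Lemma wgt_powR_le t : 0 <= t < 1 -> N `^ (- p) <= 2 * D * W t ->
  W t `^ (- kap) <= (2 * D) `^ kap * N `^ (p / q).
Proof.
move=> t01 HN; have W0 := weight_gt0 t01.
have DD : 0 < 2 * D by rewrite mulr_gt0.
have Np : 0 < N `^ (- p) by rewrite powR_gt0.
apply: (@le_trans _ _ ((N `^ (- p) / (2 * D)) `^ (- kap))).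
  apply: powR_le0; first by rewrite divr_gt0.
    by rewrite ler_pdivrMr// mulrC.
  by rewrite oppr_le0 ltW.
rewrite powRM ?(ltW Np)//; last by rewrite invr_ge0 ltW.
rewrite -powRrM mulrNN -kapE mulrC ler_wpM2r ?powR_ge0//.
by rewrite -powR_inv1 ?(ltW DD)// -powRrM mulN1r opprK.
Qed.

Lemma hedberg_far_wgt T j : (j <= n)%N -> 0 <= T < 1 ->
  cmod (phi j T) <= eta + eps * (lam ^+ n * W T `^ (- kap)) * (1 - T) `^ (j%:R - n%:R).
Proof.
move=> jn T01; have TT : 0 <= T <= T by case/andP: T01 => -> _; rewrite /=.
apply: (le_trans (hedberg_far jn T01 TT)); rewrite lerD2l.
have T1 : 0 < 1 - T by lra.
rewrite [wgt H T]/wgt powRM ?(ltW T1)//; last by apply/ltW/H_gt0.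
rewrite powRD; last by apply/implyP => _; rewrite gt_eqF.
have -> : eps * (lam ^+ n * ((1 - T) `^ (- kap) * H T `^ (- kap))) * (1 - T) `^ (j%:R - n%:R) =
  eps * lam ^+ n * H T `^ (- kap) * ((1 - T) `^ (j%:R - n%:R) * (1 - T) `^ (- kap)) by ring.
apply: ler_wpM2r; first by rewrite mulr_ge0 ?powR_ge0.
apply: ler_wpM2r; first exact: powR_ge0.
by apply: ler_wpM2l; [exact: eps0|rewrite ler_weXn2l].
Qed.

(** At the dyadic level point t0 both estimates are of order N^(p/q). If r <= t0 the far bound alone
    suffices, because W(r) >= W(t0) is still above the level up to the factor 2 D; otherwise it
    supplies the starting values at t0 and the near bound leads from there to [r]. *)
Lemma hedberg_fixed (del : R) : 0 < del -> del <= 2^-1 -> del <= delta ->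
  cmod (phi n r) <= (n.+1%:R + n.+1%:R * (lam ^+ n * (2 * D) `^ kap) + 2 ^+ n / del) * (eta + eps * N `^ (p / q)).
Proof.
move=> del0 del2 deld.
have [t0 [t01 Wt0 t0N]] := weight_level N1.
set X := lam ^+ n * (2 * D) `^ kap; set Y := N `^ (p / q).
have X0 : 0 <= X by rewrite mulr_ge0 ?powR_ge0// exprn_ge0// (le_trans ler01 lam1).
have Y0 : 0 <= Y by exact: powR_ge0.
have Z0 : 0 <= 2 ^+ n / del by rewrite divr_ge0 ?exprn_ge0// ltW.
have n1 : 1 <= n.+1%:R :> R by rewrite ler1n.
have nn : n%:R <= n.+1%:R :> R by rewrite ler_nat.
have eY : 0 <= eps * Y by rewrite mulr_ge0.
have e0 := eta0; have r01' := r01.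
have lamW t : 0 <= t < 1 -> N `^ (- p) <= 2 * D * W t -> lam ^+ n * W t `^ (- kap) <= X * Y.
  move=> tt /(wgt_powR_le tt) ?; rewrite /X -mulrA; apply: ler_wpM2l => //.
  by rewrite exprn_ge0// (le_trans ler01 lam1).
have [r00|rne] := eqVneq r 0.
  have -> : phi n r = 0 by rewrite r00; case: (n) kn.
  rewrite cmod0 mulr_ge0//; last exact: addr_ge0.
  apply: addr_ge0 => //; apply: addr_ge0 => //; exact: mulr_ge0.
have [rt0|t0r] := leP r t0.
  have Nr : N `^ (- p) <= 2 * D * W r.
    case: t0N => [t00|H0]; first by move: rne; rewrite (_ : r = 0) ?eqxx//; lra.
    apply: (le_trans H0); apply: ler_wpM2l; first by rewrite mulr_ge0// ltW.
    by apply: weight_mono; lra.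
  have := hedberg_far_wgt (leqnn n) r01; rewrite subrr powRr0 mulr1 => G.
  apply: (le_trans G).
  have G2 := ler_wpM2l eps0 (lamW r r01 Nr).
  move: n1 Z0; generalize (n.+1%:R : R) (2 ^+ n / del : R) => A Z A1 Z0.
  have A0 : 0 <= A by lra.
  have h1 : eta <= A * eta by rewrite ler_peMl.
  have h2 : eps * (X * Y) <= A * (X * (eps * Y)) by rewrite mulrCA ler_peMl// mulr_ge0.
  have h3 : 0 <= A * (eps * Y) by rewrite mulr_ge0.
  have h4 : 0 <= A * X * eta by apply: mulr_ge0 => //; exact: mulr_ge0.
  have h5 : 0 <= Z * eta by rewrite mulr_ge0.
  have h6 : 0 <= Z * (eps * Y) by rewrite mulr_ge0.
  apply: (le_trans (lerD h1 (le_trans G2 h2))).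
  have -> : (A + A * X + Z) * (eta + eps * Y) = A * eta + A * (X * (eps * Y)) +
    (A * (eps * Y) + A * X * eta + Z * eta + Z * (eps * Y)) by ring.
  by rewrite lerDl !addr_ge0.
(* At t0 = 0 no lower bound for W(t0) is available, but there the primitives vanish. *)
pose P := if t0 == 0 then 0 else X * Y.
have P0 : 0 <= P by rewrite /P; case: ifP => // _; rewrite mulr_ge0.
have PXY : P <= X * Y by rewrite /P; case: ifP => // _; rewrite mulr_ge0.
have start j : (j.+1 <= n)%N -> cmod (phi j.+1 t0) <= eta + eps * P * (1 - t0) `^ (j.+1%:R - n%:R).
  move=> jn; rewrite /P; case: eqP => [->|t0n].
    by rewrite phi00 cmod0 mulr0 mul0r addr0.
  case: t0N => [//|Nt].
  apply: (le_trans (hedberg_far_wgt jn t01)); rewrite lerD2l.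
  apply: ler_wpM2r; first exact: powR_ge0.
  by apply: ler_wpM2l => //; exact: lamW.
have [t00 t1] := andP t01.
have := hedberg_last t00 t0r Wt0 del0 del2 deld erefl P0 start; rewrite -/Y => G.
apply: (le_trans G).
have G1 : n%:R * P <= n.+1%:R * (X * Y) by apply: ler_pM.
have G2 := ler_wpM2l eps0 G1.
move: n1 Z0 G2; generalize (n.+1%:R : R) (2 ^+ n / del : R) (n%:R * P) => A Z B A1 Z0 G2.
have A0 : 0 <= A by lra.
have h3 : 0 <= A * (eps * Y) by rewrite mulr_ge0.
have h4 : 0 <= A * X * eta by apply: mulr_ge0 => //; exact: mulr_ge0.
have h5 : 0 <= Z * eta by rewrite mulr_ge0.
apply: (@le_trans _ _ (A * eta + (eps * (A * (X * Y)) + eps * (Z * Y)))).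
  by rewrite mulrDr !lerD2l lerD2r.
have -> : (A + A * X + Z) * (eta + eps * Y) = A * eta + (eps * (A * (X * Y)) + eps * (Z * Y)) +
  (A * (eps * Y) + A * X * eta + Z * eta) by ring.
by rewrite lerDl !addr_ge0.
Qed.

End Hedberg.

(** [C] is fixed before the ray, the radius, the level [N] and the errors. This uniformity permits
    integration over directions and radii, and small [eta] and [eps] for compactness. *)
Theorem hedberg (R : realType) (p q D : R) (n k : nat) (H : R -> R) :
  0 < p -> p < q -> (k < n)%N -> 0 < D -> (forall t, 0 <= t < 1 -> 0 < H t) ->
  (forall s t, 0 <= s -> s <= t -> t < 1 -> H t <= H s) ->
  (forall t, 0 <= t < 1 -> H t <= D * H ((1 + t) / 2)) ->
  exists2 C : R, 0 < C & forall (c : R[i]) (phi : nat -> R -> R[i]) (r N eta eps : R),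
    cmod c = 1 -> 0 <= r < 1 -> 1 <= N -> 0 <= eta -> 0 <= eps ->
    (forall j t, 0 <= t < 1 -> rdiff (phi j.+1) t (c * phi j t)) ->
    (forall j, phi j.+1 0 = 0) ->
    (forall t, 0 <= t < r -> cmod (phi 0%N t) <= eta +
       eps * (N * (r - t) `^ (- k%:R) * (1 - t) `^ (- (n - k)%:R) * wgt H t `^ (p^-1 - q^-1))) ->
    (forall t, 0 <= t < 1 -> cmod (phi 0%N t) <= eta + eps * ((1 - t) `^ (- n%:R) * wgt H t `^ (- q^-1))) ->
    cmod (phi n r) <= C * (eta + eps * N `^ (p / q)).
Proof.
move=> p0 pq kn D0 H_gt0 H_mono H_dbl.
pose lam := Num.max 1 (q^-1)^-1.
have lam1 : 1 <= lam by rewrite le_max lexx.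
have lamK : (q^-1)^-1 <= lam by rewrite le_max lexx orbT.
pose del := Num.min (p^-1 - q^-1) 2^-1.
have del0 : 0 < del.
  have q0 : 0 < q by exact: lt_trans pq.
  by rewrite lt_min subr_gt0 ltf_pV2 ?posrE// pq /= invr_gt0 ltr0n.
have del2 : del <= 2^-1 by rewrite ge_min lexx orbT.
have deld : del <= p^-1 - q^-1 by rewrite ge_min lexx.
exists (n.+1%:R + n.+1%:R * (lam ^+ n * (2 * D) `^ q^-1) + 2 ^+ n / del).
  have := divr_gt0 (exprn_gt0 n (ltr0Sn R 1)) del0.
  have : 0 <= n.+1%:R * (lam ^+ n * (2 * D) `^ q^-1).
    by rewrite mulr_ge0// mulr_ge0 ?powR_ge0// exprn_ge0//; lra.
  have : 0 <= n.+1%:R :> R by [].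
  by move=> *; lra.
move=> c phi r N eta eps c1 r01 N1 eta0 eps0 phiE phi00 near far.
exact: (hedberg_fixed c1 p0 pq kn D0 H_gt0 H_mono H_dbl erefl erefl r01 N1 eta0 eps0 phiE phi00 near far lam1 lamK del0 del2 deld).
Qed.

(** * Circle averages through the arctangent *)

Section CircleIntegral.
Context {R : realType}.
Local Notation mu := (@lebesgue_measure R).
Local Notation pi2 := (2 * pi : R).

Let pi2_gt0 : 0 < pi2. Proof. by rewrite mulr_gt0// pi_gt0. Qed.

Lemma antiderivative (h : R -> R) : continuous h ->
  exists G : R -> R, forall x : R, -2 < x < 3 -> is_derive x 1 G (h x).
Proof.
move=> ch; exists (fun x => \int[mu]_(t in `[(-3 : R), x]) h t) => x x23.
have x4 : x < 4 by lra.
have x3 : -3 < x by lra.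
have ih : mu.-integrable `[-3, 4] (EFin \o h).
  by apply: continuous_compact_integrable; [exact: segment_compact|exact: continuous_subspaceT].
have [dF F'] := continuous_FTC1_closed x4 ih x3 (ch x).
by apply: DeriveDef; [exact: dF|rewrite -derive1E].
Qed.

Lemma is_derive_atan_turn (G : R -> R) (t d : R) : is_derive (atan t / pi2) 1 G d ->
  is_derive t 1 (fun t => pi2 * G (atan t / pi2)) ((1 + t ^+ 2)^-1 * d).
Proof.
move=> HG; have p0 := pi2_gt0.
have H1 : is_derive t 1 (fun t => atan t / pi2) ((1 + t ^+ 2)^-1 / pi2).
  have H0 := is_derive1_atan t.
  have := is_deriveZ pi2^-1 H0.
  have -> : pi2^-1 \*: atan = (fun t => atan t / pi2) by apply/funext => u; exact: mulrC.
  have -> : pi2^-1 *: (1 + t ^+ 2)^-1 = (1 + t ^+ 2)^-1 / pi2 by exact: mulrC.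
  by [].
have H2 := @is_derive1_comp _ G (fun t => atan t / pi2) t _ _ HG H1.
have E X : pi2 * (d * (X / pi2)) = X * d.
  by rewrite mulrCA [pi2 * _]mulrC divfK ?gt_eqF// mulrC.
have := is_deriveZ pi2 H2; rewrite /GRing.scale /= E.
exact: id.
Qed.

Lemma atan_turn_itv (t : R) : -4^-1 < atan t / pi2 < 4^-1.
Proof.
have p0 := pi2_gt0; have := atan_gtNpi2 t; have := atan_ltpi2 t.
move=> H1 H2; apply/andP; split; first by rewrite ltr_pdivlMr//; lra.
by rewrite ltr_pdivrMr//; lra.
Qed.

Lemma continuous_atan_turn (h : R -> R) : continuous h ->
  continuous (fun t : R => (1 + t ^+ 2)^-1 * h (atan t / pi2)).
Proof.
move=> ch t; apply: cvgM.
  apply: cvgV; first by rewrite gt_eqF// ltr_pwDl ?sqr_ge0.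
  by apply: cvgD; [exact: cvg_cst|exact: exprn_continuous].
apply: (@continuous_comp _ _ _ (fun t => atan t / pi2) h); last exact: ch.
by apply: cvgM; [exact: continuous_atan|exact: cvg_cst].
Qed.

Lemma integral_atan_half (h G : R -> R) : continuous h -> (forall x, 0 <= h x) ->
  (forall x : R, -2^-1 < x < 2^-1 -> is_derive x 1 G (h x)) ->
  (\int[mu]_(t in `[0%R, +oo[) ((1 + t ^+ 2)^-1 * h (atan t / pi2))%:E = (pi2 * (G (4^-1) - G 0))%:E)%E.
Proof.
move=> ch h0 dG; pose F (t : R) := pi2 * G (atan t / pi2).
have dF (t : R) : is_derive t 1 F ((1 + t ^+ 2)^-1 * h (atan t / pi2)).
  by apply: is_derive_atan_turn; apply: dG; have := atan_turn_itv t; lra.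
have cF (t : R) : {for t, continuous F}.
  by apply: differentiable_continuous; apply/derivable1_diffP; case: (dF t).
have cG (x : R) : -2^-1 < x < 2^-1 -> {for x, continuous G}.
  by move=> /dG[dGx _]; apply: differentiable_continuous; exact/derivable1_diffP.
have -> : pi2 * (G 4^-1 - G 0) = pi2 * G (4^-1) - F 0 by rewrite /F atan0 mul0r; ring.
rewrite EFinB; apply: ge0_continuous_FTC2y.
- by move=> t _; rewrite mulr_ge0// invr_ge0 addr_ge0// sqr_ge0.
- by apply: continuous_subspaceT; exact: continuous_atan_turn.
- apply: cvgM; first exact: cvg_cst.
  apply: (@cvg_comp _ _ _ (fun t : R => atan t / pi2) G); last first.
    by apply: cG; lra.
  rewrite (_ : nbhs (4^-1 : R) = nbhs (pi / 2 / pi2 : R)); last first.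
    congr nbhs; have p2n : pi2 != 0 by rewrite gt_eqF.
    by apply: (mulIf p2n); rewrite divfK//; lra.
  by apply: cvgM; [exact: cvgy_atan|exact: cvg_cst].
- by move=> t _; case: (dF t).
- by apply: cvg_at_right_filter; exact: cF.
- by move=> t _; rewrite derive1E; case: (dF t).
Qed.

Lemma integral_atan (h G : R -> R) : continuous h -> (forall x, 0 <= h x) ->
  (forall x : R, -2^-1 < x < 2^-1 -> is_derive x 1 G (h x)) ->
  (\int[mu]_t ((1 + t ^+ 2)^-1 * h (atan t / pi2))%:E = (pi2 * (G (4^-1) - G (-4^-1)))%:E)%E.
Proof.
move=> ch h0 dG; pose f (t : R) := (1 + t ^+ 2)^-1 * h (atan t / pi2).
have cf : continuous f by exact: continuous_atan_turn.
have f0 t : 0 <= f t by rewrite mulr_ge0// invr_ge0 addr_ge0// sqr_ge0.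
have mf : measurable_fun [set: R] f by exact: continuous_measurable_fun.
have mposnums : measurable [set x : R | 0 <= x]%R by rewrite -set_itvcy.
rewrite -(setUv [set x : R | 0 <= x]%R) ge0_integral_setU//= ; last 4 first.
  exact: measurableC.
  by apply/measurable_EFinP; rewrite setUv.
  by move=> x _; rewrite lee_fin f0.
  exact/disj_setPCl.
rewrite -set_itvcy// setCitvr integral_itv_bndo_bndc; last exact/measurable_EFinP/measurable_funTS.
rewrite (integral_atan_half ch h0 dG).
have := @ge0_integration_by_substitutionNy R f 0; rewrite oppr0 => ->; last by move=> x _.
  2: exact: continuous_subspaceT.
pose h' x := h (- x); pose G' x := - G (- x).
have ch' : continuous h'.
  move=> x; apply: (@continuous_comp _ _ _ -%R h); last exact: ch.
  by apply: cvgN; exact: cvg_id.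
have dG' (x : R) : -2^-1 < x < 2^-1 -> is_derive x 1 G' (h' x).
  move=> x2; apply/is_derive_epsdelta => e e0.
  have /is_derive_epsdelta/(_ e e0)[d d0 dP] : is_derive (- x) 1 G (h (- x)) by apply: dG; lra.
  exists d => // u ud; have := dP (- u); rewrite normrN => /(_ ud).
  rewrite /G' /h' opprD -[leLHS]normrN; congr (`|_| <= _); ring.
have := integral_atan_half ch' (fun x => h0 (- x)) dG'; rewrite /h' /G' oppr0 => H.
rewrite (_ : (\int[mu]_(x in `[0%R, +oo[) _)%E = (pi2 * (- G (- 4^-1) - - G 0))%:E); last first.
  rewrite -H; apply: eq_integral => x _ /=.
  by rewrite /f sqrrN atanN mulNr.
by rewrite -EFinD; congr EFin; ring.
Qed.

(** As t runs over the line, atan t / (2 pi) covers the half turn from -1/4 to 1/4, and the shift by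
    1/2 covers the other half. An antiderivative of [h] turns both integrals into boundary
    values. *)
Lemma integral_circle (h : R -> R) : continuous h -> (forall x, 0 <= h x) -> (forall x, h (x + 1) = h x) ->
  (\int[mu]_t ((1 + t ^+ 2)^-1 * h (atan t / pi2))%:E +
   \int[mu]_t ((1 + t ^+ 2)^-1 * h (atan t / pi2 + 2^-1))%:E = (pi2 * rint h)%:E)%E.
Proof.
move=> ch h0 hP; have [G dG] := antiderivative ch.
have shift (a x : R) : -2 < x + a < 3 -> is_derive x 1 (fun x => G (x + a)) (h (x + a)).
  move=> xa; apply/is_derive_epsdelta => e e0.
  have /is_derive_epsdelta/(_ e e0)[d d0 dP] := dG _ xa.
  by exists d => // u ud; have := dP u ud; rewrite [x + u + a]addrAC.
have E1 : (\int[mu]_t ((1 + t ^+ 2)^-1 * h (atan t / pi2))%:E = (pi2 * (G (4^-1) - G (-4^-1)))%:E)%E.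
  by apply: integral_atan => // x x2; apply: dG; lra.
pose h1 x := h (x + 2^-1).
have ch1 : continuous h1.
  move=> x; have := @continuous_comp _ _ _ (fun x : R => x + 2^-1) h x; apply; last exact: ch.
  by apply: cvgD; [exact: cvg_id|exact: cvg_cst].
have E2 : (\int[mu]_t ((1 + t ^+ 2)^-1 * h (atan t / pi2 + 2^-1))%:E =
    (pi2 * (G (4^-1 + 2^-1) - G (-4^-1 + 2^-1)))%:E)%E.
  by apply: (@integral_atan h1 (fun x => G (x + 2^-1)) ch1 (fun x => h0 _)) => x x2; apply: shift; lra.
have E3 : rint h = G 1 - G 0.
  rewrite /rint /Rintegral (@continuous_FTC2 _ h G 0 1 ltr01)//.
  - exact: continuous_subspaceT.
  - have cG (x : R) : -2 < x < 3 -> {for x, continuous G}.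
      by move=> /dG[dGx _]; apply: differentiable_continuous; exact/derivable1_diffP.
    split.
    + by move=> x; rewrite in_itv /= => x01; have [] := dG x; first lra.
    + by apply: cvg_at_right_filter; apply: cG; lra.
    + by apply: cvg_at_left_filter; apply: cG; lra.
  - by move=> x; rewrite in_itv /= => x01; rewrite derive1E; have [] := dG x; first lra.
(* The two halves form the period starting at -1/4. It is moved to the one starting at 0 because G(x
   + 1) - G(x) has derivative 0. *)
have E4 : G (-4^-1 + 1) - G (-4^-1) = G (0 + 1) - G 0.
  pose psi x := G (x + 1) - G x.
  have dpsi (x : R) : -1 < x < 1 -> is_derive x 1 psi 0.
    move=> x1; have -> : 0 = h (x + 1) - h x by rewrite hP subrr.
    by apply: is_deriveB; [apply: shift; lra|apply: dG; lra].
  have n4 : -4^-1 <= 0 :> R by lra.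
  have [||c cxy E] := @MVT_segment R psi (fun=> 0) (-4^-1) 0 n4.
  - by move=> t; rewrite in_itv /= => t01; apply: dpsi; lra.
  - by apply: derivable_within_continuous => t; rewrite in_itv /= => t01; have [] := dpsi t; first lra.
  by move: E; rewrite mul0r => /eqP; rewrite subr_eq0 => /eqP E; exact: esym.
rewrite E1 E2 -EFinD E3; congr EFin; rewrite -mulrDr; congr (_ * _).
move: E4; rewrite add0r (_ : -4^-1 + 1 = 4^-1 + 2^-1 :> R); last by field.
rewrite (_ : -4^-1 + 2^-1 = 4^-1 :> R); last by field.
lra.
Qed.

End CircleIntegral.

(** * Polar coordinates on a half plane *)

Section HalfPlane.
Context {R : realType}.
Local Notation mu := (@lebesgue_measure R).
Local Notation mT := (measurableTypeR R).
Local Open Scope ereal_scope.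
Variable F : mT * mT -> \bar R.
Hypothesis mF : measurable_fun setT F.
Hypothesis F0 : forall u, 0 <= F u.

(* Polar coordinates through x = s cos(atan t), y = s sin(atan t): only the
   substitutions y = t x, x = s cos(atan t) in single integrals are needed. *)
Definition polar_kernel (u : mT * mT) := if (0 < u.1)%R then
  (u.1 * (1 + u.2 ^+ 2)^-1)%:E * F (u.1 * cos (atan u.2), u.1 * sin (atan u.2))%R else 0.
Local Notation L := polar_kernel.

Lemma polar_kernel_ge0 u : 0 <= L u.
Proof.
by rewrite /L; case: ifPn => // u0; rewrite mule_ge0// lee_fin mulr_ge0 ?(ltW u0)// invr_ge0 addr_ge0// sqr_ge0.
Qed.
Local Notation L0 := polar_kernel_ge0.

Lemma cos_atan_gt0 (t : R) : (0 < cos (atan t))%R.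
Proof. by apply: cos_gt0_pihalf; rewrite atan_gtNpi2 atan_ltpi2. Qed.

Lemma sqr_cos_atan (t : R) : (cos (atan t) ^+ 2 = (1 + t ^+ 2)^-1)%R.
Proof. by rewrite cos_atan exprVn sqr_sqrtr// addr_ge0// sqr_ge0. Qed.

Lemma measurable_polar_kernel : measurable_fun setT L.
Proof.
have mat : measurable_fun setT (fun u : mT * mT => atan u.2 : R).
  apply: (measurableT_comp (continuous_measurable_fun (@continuous_atan R))); exact: measurable_snd.
apply: measurable_fun_ifT => //.
  by apply: measurable_fun_ltr => //; exact: measurable_fst.
apply: emeasurable_funM.
  apply/measurable_EFinP; apply: measurable_funM; first exact: measurable_fst.
  under eq_fun do rewrite -sqr_cos_atan.
  by apply: measurable_funX; apply: (measurableT_comp (continuous_measurable_fun (@continuous_cos R))).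
apply: (measurableT_comp mF); apply: measurable_fun_pair; apply: measurable_funM; try exact: measurable_fst.
  by apply: (measurableT_comp (continuous_measurable_fun (@continuous_cos R))).
by apply: (measurableT_comp (continuous_measurable_fun (@continuous_sin R))).
Qed.
Local Notation mL := measurable_polar_kernel.

(** For fixed x, the substitution y = t x brings a factor x; after Tonelli, x = s cos(atan t) brings
    another cosine, and s cos(atan t)^2 = s / (1 + t^2) is the weight of the kernel. *)
Lemma half_plane_kernel :
  \int[mu]_x (if (0 < x)%R then \int[mu]_y F (x, y) else 0) = \int[mu]_t \int[mu]_s L (s, t).
Proof.
have bE (t : R) : (sin (atan t) = cos (atan t) * t)%R.
  by rewrite -{3}[t]atanK /tan mulrCA mulfV ?mulr1// gt_eqF// cos_atan_gt0.
pose K (u : mT * mT) := if (0 < u.1)%R then u.1%:E * F (u.1, u.1 * u.2)%R else 0.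
have K0 u : 0 <= K u by rewrite /K; case: ifPn => // u0; rewrite mule_ge0// lee_fin ltW.
have mK : measurable_fun setT K.
  apply: measurable_fun_ifT => //.
    by apply: measurable_fun_ltr => //; exact: measurable_fst.
  apply: emeasurable_funM.
    by apply/measurable_EFinP; exact: measurable_fst.
  apply: (measurableT_comp mF); apply: measurable_fun_pair; first exact: measurable_fst.
  by apply: measurable_funM; [exact: measurable_fst|exact: measurable_snd].
have mFx (x : mT) : measurable_fun setT (fun y : mT => F (x, y)).
  by apply: (measurableT_comp mF); exact: measurable_pair1.
transitivity (\int[mu]_x \int[mu]_t K (x, t)).
  apply: eq_integral => x _; rewrite /K /=; case: ifPn => [x0|_]; last by rewrite integral0.
  rewrite (ge0_integral_affine 0 (lt0r_neq0 x0) (mFx x))// gtr0_norm//.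
  under [X in _ * X]eq_integral do rewrite addr0.
  rewrite ge0_integralZl_EFin ?(ltW x0)//.
  apply: (measurableT_comp (mFx x)); exact: measurable_funM.
apply: (etrans (fubini_tonelli K mK K0)).
apply: eq_integral => t _; have a0 := cos_atan_gt0 t.
have mKt : measurable_fun setT (fun x : mT => K (x, t)).
  by apply: (measurableT_comp mK); exact: measurable_pair2.
rewrite (ge0_integral_affine 0 (lt0r_neq0 a0) mKt)// gtr0_norm//.
rewrite -ge0_integralZl_EFin ?(ltW a0)//; last first.
  apply: (measurableT_comp mKt); apply: measurable_funD => //; exact: measurable_funM.
apply: eq_integral => s _; rewrite addr0 /K /L /= pmulr_rgt0//.
case: ifPn => s0; last by rewrite mule0.
by rewrite muleA -EFinM bE -sqr_cos_atan expr2; congr (_%:E * F (_, _)); ring.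
Qed.

Lemma polar_kernel_section s : \int[mu]_t L (s, t) =
  if (0 < s)%R then s%:E * \int[mu]_t ((1 + t ^+ 2)^-1%:E * F (s * cos (atan t), s * sin (atan t))%R) else 0.
Proof.
rewrite /L /=; case: ifPn => [s0|_]; last by rewrite integral0.
rewrite -ge0_integralZl_EFin ?(ltW s0)//.
- by apply: eq_integral => t _; rewrite EFinM muleA.
- by move=> t _; rewrite mule_ge0// lee_fin invr_ge0 addr_ge0// sqr_ge0.
- have := measurableT_comp mL (measurable_pair1 (s : mT) : measurable_fun setT (pair s : mT -> mT * mT)).
  move=> /(emeasurable_funM (measurable_cst (s^-1)%:E : measurable_fun setT (cst (s^-1)%:E : mT -> \bar R))).
  apply: eq_measurable_fun => t _ /=.
  by rewrite /L /= s0 muleA -EFinM mulrA mulVf ?mul1r// gt_eqF.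
Qed.

Lemma measurable_half_plane_polar : measurable_fun setT (fun s : mT =>
  if (0 < s)%R then s%:E * \int[mu]_t ((1 + t ^+ 2)^-1%:E * F (s * cos (atan t), s * sin (atan t))%R) else 0).
Proof.
rewrite (_ : (fun s : mT => _) = fun s : mT => \int[mu]_t L (s, t)).
  exact: (@measurable_fun_fubini_tonelli_F _ _ _ _ _ mu L mL L0).
by apply/funext => s; rewrite polar_kernel_section.
Qed.

Lemma half_plane_polar :
  \int[mu]_x (if (0 < x)%R then \int[mu]_y F (x, y) else 0) =
  \int[mu]_s (if (0 < s)%R then s%:E * \int[mu]_t ((1 + t ^+ 2)^-1%:E * F (s * cos (atan t), s * sin (atan t))%R)
                else 0).
Proof.
rewrite half_plane_kernel; apply: (etrans (esym (fubini_tonelli L mL L0))).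
by apply: eq_integral => s _; rewrite polar_kernel_section.
Qed.

(** The line x = 0 is null, and the left half plane is the image of the right one under the point
    reflection at 0. *)
Lemma integral_reflect : \int[mu \x mu]_u F u =
  \int[mu]_x (if (0 < x)%R then \int[mu]_y (F (x, y) + F (- x, - y)%R) else 0).
Proof.
rewrite (fubini_tonelli1 F mF F0).
have N1 : (-1 != 0 :> R)%R by rewrite oppr_eq0 oner_eq0.
have mG := @measurable_fun_fubini_tonelli_F _ _ _ _ _ mu F mF F0.
pose G (x : mT) := \int[mu]_y F (x, y).
have G0 x : 0 <= G x by exact: integral_ge0.
have mFx (x : mT) : measurable_fun setT (fun y : mT => F (x, y)).
  by apply: (measurableT_comp mF); exact: measurable_pair1.
have mFx' (x : mT) : measurable_fun setT (fun y : mT => F (x, - y)%R).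
  by apply: (measurableT_comp (mFx x)); exact: measurable_funN.
have GN (x : mT) : \int[mu]_y F (x, - y)%R = G x.
  rewrite /G (ge0_integral_affine 0 N1 (mFx x))// normrN1 mul1e.
  by apply: eq_integral => y _; rewrite mulN1r addr0.
have mpos : measurable_fun setT (fun x : mT => (0 < x)%R) by exact: measurable_fun_ltr.
have mneg : measurable_fun setT (fun x : mT => (x < 0)%R) by exact: measurable_fun_ltr.
pose Gp (x : mT) := if (0 < x)%R then G x else 0.
pose Gn (x : mT) := if (x < 0)%R then G x else 0.
have mGp : measurable_fun setT Gp by apply: measurable_fun_ifT; [exact: mpos|exact: mG|exact: measurable_cst].
have mGn : measurable_fun setT Gn by apply: measurable_fun_ifT; [exact: mneg|exact: mG|exact: measurable_cst].
have Gp0 x : 0 <= Gp x by rewrite /Gp; case: ifP.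
have Gn0 x : 0 <= Gn x by rewrite /Gn; case: ifP.
transitivity (\int[mu]_x (Gp x + Gn x)).
  apply: ae_eq_integral => //; first exact: emeasurable_funD.
  exists [set 0%R]; split => //; first exact: lebesgue_measure_set1.
  move=> x /=; apply: contra_notP => /eqP x0 _.
  rewrite /Gp /Gn -/(G x); have [xp|xn|xe] := ltgtP (0%R : R) x.
  - by rewrite adde0.
  - by rewrite add0e.
  - by rewrite -xe eqxx in x0.
rewrite ge0_integralD//.
have -> : \int[mu]_x Gn x = \int[mu]_x (if (0 < x)%R then G (- x)%R else 0).
  rewrite (ge0_integral_affine 0 N1 mGn)// normrN1 mul1e.
  by apply: eq_integral => x _; rewrite mulN1r addr0 /Gn oppr_lt0.
rewrite -ge0_integralD//; last 2 first.
- by move=> x _; case: ifP.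
- have mN : measurable_fun setT (fun x : mT => (- x)%R : mT) by exact: measurable_funN.
  have mGN : measurable_fun setT (fun x : mT => G (- x)%R).
    exact: (measurableT_comp mG mN).
  by apply: measurable_fun_ifT; [exact: mpos|exact: mGN|exact: measurable_cst].
apply: eq_integral => x _; rewrite /Gp; case: ifP => _; last by rewrite adde0.
by rewrite ge0_integralD// GN.
Qed.

End HalfPlane.

(** * Integrals of functions that are Borel only up to a null set *)

Section LowerIntegral.
Local Open Scope ereal_scope.
Context d (T : measurableType d) (R : realType) (mu : {measure set T -> \bar R}).
Implicit Types (D N : set T) (f g : T -> \bar R).
Import HBNNSimple.

(** The integral of a nonnegative function is a supremum over simple functions below it, hence
    monotone on arbitrary functions. The weight may fail to be Borel, so this generality matters. *)
Lemma ge0_le_integral_any D f g : (forall x, D x -> 0 <= f x) ->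
  (forall x, D x -> f x <= g x) -> \int[mu]_(x in D) f x <= \int[mu]_(x in D) g x.
Proof.
move=> f0 fg; have g0 x : D x -> 0 <= g x by move=> Dx; exact: le_trans (f0 x Dx) (fg x Dx).
rewrite !ge0_integralE//; apply: ereal_sup_le => _ [h hf <-]; exists h => // x.
apply: (le_trans (hf x)); rewrite !patchE; case: ifPn => // /set_mem; exact: fg.
Qed.

(** Serves to replace the weight by a Borel function. A simple function below [f] lies, off [N],
    below [g], and discarding [N] does not change its integral. *)
Lemma ge0_integral_eq_off_null D N f g : measurable D -> measurable N -> mu N = 0 ->
  measurable_fun D g -> (forall x, D x -> 0 <= f x) -> (forall x, D x -> 0 <= g x) ->
  (forall x, D x -> ~ N x -> f x = g x) -> \int[mu]_(x in D) f x = \int[mu]_(x in D) g x.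
Proof.
move=> mD mN N0 mg f0 g0 fg; apply/eqP; rewrite eq_le; apply/andP; split; last first.
  rewrite (ge0_negligible_integral mN mD mg g0 N0).
  apply: (@le_trans _ _ (\int[mu]_(x in D `\` N) f x)).
    by apply: ge0_le_integral_any => x [Dx Nx]; [exact: g0|rewrite fg].
  rewrite integral_mkcond [leRHS]integral_mkcond; apply: ge0_le_integral_any => x _.
    by rewrite patchE; case: ifPn => // /set_mem[/f0].
  rewrite !patchE; case: ifPn => [/set_mem[Dx _]|_]; first by rewrite mem_set.
  by case: ifPn => // /set_mem/f0.
rewrite {1}ge0_integralE//; apply: ge_ereal_sup => _ [h hf <-].
have -> : sintegral mu h = \int[mu]_x (h x)%:E.
  by rewrite integral_nnsfun// patch_setT.
have mh : measurable_fun setT (EFin \o h) by apply/measurable_EFinP.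
rewrite (ge0_negligible_integral mN measurableT mh)//; last first.
  by move=> x _; rewrite lee_fin fun_ge0.
rewrite integral_mkcond [leRHS]integral_mkcond; apply: ge0_le_integral_any => x _.
  by rewrite patchE; case: ifPn => // _; rewrite lee_fin fun_ge0.
rewrite patchE; case: ifPn => [/set_mem[_ Nx]|_].
  by apply: (le_trans (hf x)); rewrite !patchE; case: ifPn => // /set_mem Dx; rewrite fg.
by rewrite patchE; case: ifPn => // /set_mem/g0.
Qed.

End LowerIntegral.

(** * Borel measurability in the plane *)

Section PlaneMeasurability.
Context {R : realType}.
Local Notation mT := (measurableTypeR R).

(** Such a set is the union of the countably many boxes with rational centre and dyadic size that it
    contains. *)
Lemma open_box_measurable (U : set (mT * mT)) :
  (forall u, U u -> exists2 e : R, 0 < e & forall v : R * R, `|v.1 - u.1| < e -> `|v.2 - u.2| < e -> U v) ->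
  measurable U.
Proof.
move=> Uo.
pose box (a b : R) (k : nat) : set (mT * mT) :=
  [set v | `|v.1 - a| < 2 ^- k /\ `|v.2 - b| < 2 ^- k].
have mbox a b k : measurable (box a b k).
  have -> : box a b k = [set` `]a - 2 ^- k, a + 2 ^- k[] `*` [set` `]b - 2 ^- k, b + 2 ^- k[].
    apply/seteqP; split => -[x y]; rewrite /box /= !in_itv /= !ltr_norml => -[/andP[? ?] /andP[? ?]];
      by split; apply/andP; split; lra.
  by apply: measurableX; exact: measurable_itv.
pose B (i : nat) : set (mT * mT) := if unpickle i is Some (a, b, k) then
  if `[< box (ratr a) (ratr b) k `<=` U >] then box (ratr a) (ratr b) k else set0 else set0.
have -> : U = \bigcup_i B i.
  apply/seteqP; split => [u Uu|u [i _]]; last first.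
    by rewrite /B; case: (unpickle i) => [[[a b] k]|//]; case: ifPn => // /asboolP; exact.
  have [e e0 eP] := Uo u Uu; have [k ke] := exists_exp2 2 e0.
  have k0 : 0 < 2 ^- k :> R by rewrite invr_gt0 exprn_gt0.
  have near (x : R) : exists a : rat, `|x - ratr a| < 2 ^- k.
    have [|a] := @rat_in_itvoo R (x - 2 ^- k) (x + 2 ^- k); first by lra.
    by rewrite in_itv /= => /andP[xa ax]; exists a; rewrite ltr_norml; lra.
  have [a ua] := near u.1; have [b ub] := near u.2.
  have ke' : 2 ^- k + 2 ^- k < e by lra.
  have sub : box (ratr a) (ratr b) k `<=` U.
    move=> v [va vb]; apply: eP.
      apply: le_lt_trans ke'; rewrite (_ : v.1 - u.1 = (v.1 - ratr a) - (u.1 - ratr a)); last by ring.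
      by rewrite (le_trans (ler_normB _ _))// lerD// ltW.
    apply: le_lt_trans ke'; rewrite (_ : v.2 - u.2 = (v.2 - ratr b) - (u.2 - ratr b)); last by ring.
    by rewrite (le_trans (ler_normB _ _))// lerD// ltW.
  exists (pickle (a, b, k)); first exact: I.
  rewrite /B pickleK (asboolT sub); split; [exact: ua|exact: ub].
apply: bigcup_measurable => i _; rewrite /B; case: (unpickle i) => [[[a b] k]|//].
by case: ifPn.
Qed.

Lemma toC_near (u v : R * R) (e : R) : `|v.1 - u.1| < e / 2 -> `|v.2 - u.2| < e / 2 ->
  cmod (toC v - toC u) < e.
Proof.
move=> h1 h2; have := cmod_le_Re_Im (toC v - toC u).
rewrite cReD cReN cImD cImN /= => H; apply: (le_lt_trans H); lra.
Qed.

Lemma measurable_disk : measurable ((@toC R) @^-1` disk : set (mT * mT)).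
Proof.
apply: open_box_measurable => u Du; have u1 : cmod (toC u) < 1 by [].
exists ((1 - cmod (toC u)) / 2); first by lra.
move=> v h1 h2; have := toC_near h1 h2; have := cmodD (toC v - toC u) (toC u).
rewrite subrK => h3 h4; change (cmod (toC v) < 1); lra.
Qed.

Lemma measurable_disk_continuous (Phi : R[i] -> R) :
  (forall z, cmod z < 1 -> forall e : R, 0 < e -> exists2 d : R, 0 < d &
     forall y, cmod (y - z) < d -> `|Phi y - Phi z| < e) ->
  measurable_fun ((@toC R) @^-1` disk : set (mT * mT)) (fun u : mT * mT => Phi (toC u)).
Proof.
move=> cPhi mD; apply: (measurability _ (RGenOInfty.measurableE R)) => //= _ [_ [a ->] <-].
apply: open_box_measurable => u [Du ua]; have u1 : cmod (toC u) < 1 by [].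
have {}ua : a < Phi (toC u) by move: ua; rewrite /preimage /mkset in_itv /= andbT.
have ua' : 0 < Phi (toC u) - a by rewrite subr_gt0.
have [d d0 dP] := cPhi _ u1 _ ua'.
have m0 : 0 < Num.min d (1 - cmod (toC u)) by rewrite lt_min d0 subr_gt0.
exists (Num.min d (1 - cmod (toC u)) / 2); first by rewrite divr_gt0.
move=> v h1 h2; have vu := toC_near h1 h2.
have vd : cmod (toC v - toC u) < d by apply: (lt_le_trans vu); rewrite ge_min lexx.
have v1 : cmod (toC v - toC u) < 1 - cmod (toC u).
  by apply: (lt_le_trans vu); rewrite ge_min lexx orbT.
split.
  have := cmodD (toC v - toC u) (toC u); rewrite subrK => h3.
  by change (cmod (toC v) < 1); lra.
have := dP _ vd; rewrite ltr_norml => /andP[h3 _].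
by rewrite /preimage /mkset in_itv /= andbT; lra.
Qed.

Lemma measurable_cmod_toC : measurable_fun setT (fun u : mT * mT => cmod (toC u) : mT).
Proof.
apply: (@measurableT_comp _ _ _ _ _ _ (@Num.sqrt R : mT -> mT)).
  by apply: continuous_measurable_fun; exact: sqrt_continuous.
by apply: measurable_funD; apply: measurable_funX; [exact: measurable_fst|exact: measurable_snd].
Qed.

End PlaneMeasurability.

(** * Polar coordinates and null sets in the plane *)

Section Polar.
Context {R : realType}.
Local Notation mu := (@lebesgue_measure R).
Local Notation mT := (measurableTypeR R).
Local Open Scope ereal_scope.

Section PlanePolar.
Variable F : mT * mT -> \bar R.
Hypotheses (mF : measurable_fun setT F) (F0 : forall u, 0 <= F u).

Let F2 (u : mT * mT) := F u + F (- u.1, - u.2)%R.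

Let mF2 : measurable_fun setT F2.
Proof.
apply: emeasurable_funD => //; apply: (measurableT_comp mF).
by apply: measurable_fun_pair; apply: measurable_funN; [exact: measurable_fst|exact: measurable_snd].
Qed.

Let F20 u : 0 <= F2 u.
Proof. by rewrite adde_ge0. Qed.

Definition polar_section (s : mT) : \bar R := if (0 < s)%R then s%:E * \int[mu]_t ((1 + t ^+ 2)^-1%:E *
  (F (s * cos (atan t), s * sin (atan t))%R + F (- (s * cos (atan t)), - (s * sin (atan t)))%R)) else 0.

Lemma measurable_polar_section : measurable_fun setT polar_section.
Proof. exact: (measurable_half_plane_polar mF2 F20). Qed.

Lemma polar_section_ge0 s : 0 <= polar_section s.
Proof.
rewrite /polar_section; case: ifPn => // s0; rewrite mule_ge0 ?lee_fin ?(ltW s0)// integral_ge0// => t _.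
by rewrite mule_ge0 ?adde_ge0// lee_fin invr_ge0 addr_ge0// sqr_ge0.
Qed.

Lemma plane_polar : \int[mu \x mu]_u F u = \int[mu]_s polar_section s.
Proof. by rewrite (integral_reflect mF F0); exact: (half_plane_polar mF2 F20). Qed.

End PlanePolar.

Lemma cmod_toC_polar (s t : R) : (0 <= s)%R -> cmod (toC (s * cos t, s * sin t)%R) = s.
Proof.
move=> s0; rewrite /cmod /toC /= !exprMn -mulrDr cos2Dsin2 mulr1 sqrtr_sqr ger0_norm//.
Qed.

Lemma cmod_toCN (u : R * R) : cmod (toC (- u.1, - u.2)%R) = cmod (toC u).
Proof. by rewrite /cmod /toC /= !sqrrN. Qed.

(** In polar coordinates the integral over a circle vanishes for every radius outside [N]. Hence
    what holds at almost every radius holds almost everywhere in the plane. *)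
Lemma null_radial (N : set mT) : measurable N -> mu N = 0 ->
  (mu \x mu) ((fun u : mT * mT => cmod (toC u)) @^-1` N) = 0.
Proof.
move=> mN N0; set M := (X in _ X = 0).
have mM : measurable M.
  by rewrite /M -[X in measurable X]setTI; exact: (measurable_cmod_toC measurableT mN).
rewrite -[LHS]mul1e -[M]setIT -integral_indic//.
have mF : measurable_fun setT (fun u : mT * mT => (\1_M u)%:E : \bar R).
  by apply/measurable_EFinP; exact: measurable_indic.
rewrite mul1e (plane_polar mF)//.
rewrite -[RHS](@integral0 _ _ _ mu setT); apply: (ge0_integral_eq_off_null measurableT mN N0) => //.
- by move=> s _; exact: polar_section_ge0.
move=> s _ Ns; rewrite /polar_section; case: ifPn => // s0.
rewrite integral0_eq ?mule0// => t _.
have E u : cmod (toC u) = s -> \1_M u = 0%R :> R.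
  by move=> us; rewrite indicE memNset// /M /preimage /mkset us.
rewrite !E ?adde0 ?mule0//; last exact: cmod_toC_polar (ltW s0).
by rewrite (@cmod_toCN (s * cos (atan t), s * sin (atan t))%R); exact: cmod_toC_polar (ltW s0).
Qed.

Lemma ae_exists (P : mT -> Prop) : {ae mu, forall x, P x} -> exists x, P x.
Proof.
move=> [A [mA A0 PA]]; apply: contrapT => nP.
have : mu `[0%R, 1%R]%classic <= mu A.
  apply: (le_lebesgue (measurable_itv _) mA).
  by move=> x _; apply: PA => /= Px; apply: nP; exists x.
by rewrite A0 lebesgue_measure_itv /= lte_fin ltr01 sube0 lee_fin ler10.
Qed.

(** Almost every ray meets a planar null set in a linear null set; [t] is the slope of one such
    ray. *)
Lemma exists_ray (N : set (mT * mT)) : measurable N -> (mu \x mu) N = 0 ->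
  exists t : R, exists N1 : set mT, [/\ measurable N1, mu N1 = 0 &
    forall s : R, (0 < s)%R -> ~ N1 s -> ~ N (s * cos (atan t), s * sin (atan t))%R].
Proof.
move=> mN N0; pose F (u : mT * mT) : \bar R := (\1_N u)%:E.
have mF : measurable_fun setT F by apply/measurable_EFinP; exact: measurable_indic.
have F0 u : 0 <= F u by rewrite lee_fin.
have L0 := polar_kernel_ge0 F0; have mL := measurable_polar_kernel mF.
have I0 : \int[mu]_t \int[mu]_s polar_kernel F (s, t) = 0.
  rewrite -(half_plane_kernel mF F0); apply/eqP; rewrite eq_le; apply/andP; split; last first.
    by apply: integral_ge0 => x _; case: ifP => // _; exact: integral_ge0.
  have FI : \int[mu \x mu]_u F u = 0 by rewrite integral_indic// setIT.
  rewrite -[leRHS]FI (fubini_tonelli1 F mF F0); apply: ge0_le_integral_any => x _.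
    by case: ifP => // _; exact: integral_ge0.
  by case: ifP => // _; exact: integral_ge0.
pose G (t : mT) := \int[mu]_s polar_kernel F (s, t).
have mG : measurable_fun setT G := @measurable_fun_fubini_tonelli_G _ _ _ _ _ mu (polar_kernel F) mL L0.
have G0 t : 0 <= G t by exact: integral_ge0.
have [t Gt] : exists t, G t = 0.
  have : \int[mu]_t `|G t| = 0 by rewrite -[RHS]I0; apply: eq_integral => t _; rewrite gee0_abs.
  move/(ae_eq_integral_abs mu measurableT mG) => H; apply: ae_exists; move: H.
  by apply: filterS => t; apply.
have mLt : measurable_fun setT (fun s : mT => polar_kernel F (s, t)).
  by apply: (measurableT_comp mL); exact: measurable_pair2.
have : \int[mu]_s `|polar_kernel F (s, t)| = 0.
  by rewrite -[RHS]Gt; apply: eq_integral => s _; rewrite gee0_abs.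
move/(ae_eq_integral_abs mu measurableT mLt) => [N1 [mN1 N10 HN1]].
exists t, N1; split => // s s0 Ns NN; apply: Ns; apply: HN1 => /= /(_ I).
rewrite /polar_kernel /= s0 /F indicE mem_set// mule1 => /eqP.
by rewrite eqe mulf_eq0 gt_eqF//= invr_eq0 gt_eqF// ltr_pwDl// sqr_ge0.
Qed.

End Polar.

(** * Borel profile of a radial weight; area integrals in polar form *)

Section Profile.
Context {R : realType}.
Local Notation mu := (@lebesgue_measure R).
Local Notation mT := (measurableTypeR R).
Variable w : R[i] -> R.

(* [psi] is a Borel representative of the radial part of [w]. *)
Definition profile (psi : R -> R) :=
  [/\ measurable_fun setT (psi : mT -> mT), forall s, 0 <= psi s
    & exists N : set mT, [/\ measurable N, mu N = 0%E & forall s, 0 < s < 1 -> ~ N s -> w s%:C = psi s]].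

Hypotheses (w_weight : weight w) (w_radial : radial w).

(** The Borel representative of the weight is read along a ray that meets its exceptional set in a
    null set of radii, and radiality identifies these values with those on the real axis. The
    absolute value ensures nonnegativity at the remaining radii. *)
Lemma exists_profile : exists psi, profile psi.
Proof.
have [w0 [v iv [M [mM M0 HM]]]] := w_weight.
have M0' : (mu \x mu)%E M = 0%E.
  move: M0; rewrite /dA /mscale /= => /eqP; rewrite mule_eq0 eqe /= invr_eq0 gt_eqF ?pi_gt0//=.
  by move/eqP.
have [t [N [mN N0 HN]]] := exists_ray mM M0'.
pose D : set (mT * mT) := (@toC R) @^-1` disk.
have mD : measurable D by exact: measurable_disk.
have mv : measurable_fun D v.
  by have /integrableP[/measurable_EFinP] := iv.
have mv' : measurable_fun setT (v \_ D) by apply/(measurable_restrictT _ mD).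
pose ray (s : mT) : mT * mT := (s * cos (atan t), s * sin (atan t)).
have mray : measurable_fun setT ray by apply: measurable_fun_pair; exact: measurable_funM.
exists (fun s => `|(v \_ D) (ray s)|); split => //.
  by apply: (measurableT_comp (@normr_measurable R setT)); exact: (measurableT_comp mv' mray).
exists N; split => // s s01 Ns; have [s0 s1] := andP s01.
have rs : cmod (toC (ray s)) = s by apply: cmod_toC_polar; exact: ltW.
have Ds : D (ray s) by change (cmod (toC (ray s)) < 1); rewrite rs.
have vE : w (toC (ray s)) = v (ray s).
  by apply: contrapT => nE; apply: (HN s s0 Ns); apply: HM => /= H; apply: nE; exact: H.
rewrite patchE mem_set// -vE ger0_norm; last by apply/ltW/w0.
by rewrite [RHS]w_radial// rs.
Qed.

Variable psi : R -> R.
Hypothesis psiP : profile psi.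

Lemma hatw_profile r : 0 <= r < 1 -> hatw w r = (\int[mu]_(s in `[r, 1%R[) (psi s)%:E)%E.
Proof.
move=> /andP[r0 r1]; have [mpsi psi0 [N [mN N0 HN]]] := psiP.
(* The profile is compared with the weight for s > 0 only, so the point 0 joins the exceptional
   set. *)
have mN' : measurable (N `|` [set 0]) by apply: measurableU.
have N'0 : mu (N `|` [set 0]) = 0%E by rewrite measureU0//; exact: lebesgue_measure_set1.
rewrite /hatw; apply: (ge0_integral_eq_off_null _ mN' N'0) => //.
- by apply/measurable_EFinP; exact: measurable_funTS.
- move=> s /=; rewrite in_itv /= lee_fin => /andP[rs s1]; apply/ltW; apply: w_weight.1.
  by change (cmod s%:C < 1); rewrite cmodR_ge0 ?(le_trans r0 rs).
- by move=> s _; rewrite lee_fin.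
move=> s /=; rewrite in_itv /= => /andP[rs s1] Ns; rewrite HN//; last by move=> ?; apply: Ns; left.
by rewrite s1 andbT lt_neqAle (le_trans r0 rs) andbT eq_sym; apply/eqP => s0; apply: Ns; right.
Qed.

Variable Phi : R[i] -> R.
Hypothesis Phi0 : forall z, 0 <= Phi z.
Hypothesis mPhi : measurable_fun ((@toC R) @^-1` disk : set (mT * mT)) (fun u : mT * mT => Phi (toC u)).
Hypothesis cPhi : forall s, 0 < s < 1 -> continuous (fun t : R => Phi (s%:C * cis t)).

Definition circle_mean (s : R) : R := rint (fun t => Phi (s%:C * cis t)).

Lemma toC_polar (s t : R) : toC (s * cos (atan t), s * sin (atan t)) = s%:C * cis (atan t / (2 * pi)).
Proof.
rewrite /toC /cis [2 * pi * _]mulrC divfK ?gt_eqF ?mulr_gt0 ?pi_gt0//.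
by apply/eqP; rewrite eq_complex /= !mul0r subr0 addr0 !eqxx.
Qed.

Lemma toC_polarN (s t : R) :
  toC (- (s * cos (atan t)), - (s * sin (atan t))) = s%:C * cis (atan t / (2 * pi) + 2^-1).
Proof.
have -> : toC (- (s * cos (atan t)), - (s * sin (atan t))) = - toC (s * cos (atan t), s * sin (atan t)).
  by apply/eqP; rewrite eq_complex /= !eqxx.
have -> : cis (atan t / (2 * pi) + 2^-1) = - cis (atan t / (2 * pi)) :> R[i]; last by rewrite toC_polar mulrN.
rewrite cisD (_ : cis 2^-1 = -1) ?mulrN1// /cis.
rewrite (_ : 2 * pi * 2^-1 = pi); last by field.
by rewrite cospi sinpi; apply/eqP; rewrite eq_complex /= oppr0 !eqxx.
Qed.

(** Exceptional radii have a null preimage in the disk, so the weight yields to its profile before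
    polar coordinates are applied. The factor 2 s is the Jacobian s, times 2 pi from the normalised
    circle average, divided by pi. *)
Lemma area_polar : (\int[dA]_(u in (@toC R) @^-1` disk) (Phi (toC u) * w (toC u))%R%:E =
  \int[mu]_(s in `]0%R, 1%R[) (2 * s * psi s * circle_mean s)%:E)%E.
Proof.
have [mpsi psi0 [N [mN N0 HN]]] := psiP.
have mN' : measurable (N `|` [set 0]) by apply: measurableU.
have N'0 : mu (N `|` [set 0]) = 0%E by rewrite measureU0//; exact: lebesgue_measure_set1.
set D := _ @^-1` disk; have mD : measurable (D : set (mT * mT)) by exact: measurable_disk.
pose M : set (mT * mT) := (fun u : mT * mT => cmod (toC u)) @^-1` (N `|` [set 0]).
have mM : measurable M.
  by rewrite /M -[X in measurable X]setTI; exact: (measurable_cmod_toC measurableT mN').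
have M0 : dA M = 0%E.
  transitivity ((pi^-1)%:E * (mu \x mu) M)%E; first by [].
  by rewrite (null_radial mN' N'0) mule0.
pose f (u : mT * mT) := Phi (toC u) * psi (cmod (toC u)).
have f0 u : 0 <= f u by rewrite mulr_ge0.
have mf : measurable_fun (D : set (mT * mT)) f.
  apply: measurable_funM => //; apply: measurable_funTS.
  exact: (measurableT_comp mpsi measurable_cmod_toC).
have mF : measurable_fun setT ((EFin \o f) \_ (D : set (mT * mT))).
  by apply/(measurable_restrictT _ mD); exact/measurable_EFinP.
have F0 u : (0 <= ((EFin \o f) \_ (D : set (mT * mT))) u)%E.
  by rewrite patchE; case: ifP => // _; rewrite lee_fin.
transitivity (\int[dA]_(u in D) (f u)%:E)%E.
  apply: (ge0_integral_eq_off_null mD mM M0).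
  - exact/measurable_EFinP.
  - by move=> u Du; rewrite lee_fin mulr_ge0// ltW//; exact: w_weight.1.
  - by move=> u _; rewrite lee_fin.
  move=> u Du Mu; rewrite /f w_radial// HN//; last by move=> ?; apply: Mu; left.
  rewrite (_ : (_ < 1) = true) ?andbT; last exact: Du.
  rewrite lt_neqAle cmod_ge0 andbT eq_sym; apply/eqP => u0; apply: Mu; right; exact: u0.
rewrite ge0_integral_mscale//; last 2 first.
- exact/measurable_EFinP.
- by move=> u _; rewrite lee_fin.
rewrite integral_mkcond (plane_polar mF F0) [RHS]integral_mkcond.
rewrite -ge0_integralZl//; last 2 first.
- exact: (measurable_polar_section mF F0).
- by move=> s _; exact: (polar_section_ge0 F0).
apply: eq_integral => s _; rewrite [RHS]patchE mem_setE in_itv /= /polar_section.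
case: ifPn => [s0|s0] /=; last by rewrite mule0.
have cs t : cmod (toC (s * cos (atan t), s * sin (atan t))) = s by exact: cmod_toC_polar (ltW s0).
have csN t : cmod (toC (- (s * cos (atan t)), - (s * sin (atan t)))) = s.
  by rewrite (@cmod_toCN R (s * cos (atan t), s * sin (atan t))) cs.
case: ifPn => [s1|s1]; last first.
  rewrite integral0_eq ?mule0// => t _; rewrite !patchE !memNset ?adde0 ?mule0//.
    by move=> H; move/negP: s1; apply; rewrite -(csN t).
  by move=> H; move/negP: s1; apply; rewrite -(cs t).
pose h (x : R) : R := Phi (s%:C * cis x).
have ch : continuous h by apply: cPhi; rewrite s0 s1.
have hP x : h (x + 1) = h x by rewrite /h cisD cis1 mulr1.
have ch2 : continuous (fun x : R => h (x + 2^-1)).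
  move=> x; have := @continuous_comp _ _ _ (fun x : R => x + 2^-1) h x; apply; last exact: ch.
  by apply: cvgD; [exact: cvg_id|exact: cvg_cst].
have h0 x : 0 <= h x by exact: Phi0.
have m1 : measurable_fun setT (fun t : mT => ((1 + t ^+ 2)^-1 * h (atan t / (2 * pi)))%:E).
  by apply/measurable_EFinP; exact: (continuous_measurable_fun (continuous_atan_turn ch)).
have m2 : measurable_fun setT (fun t : mT => ((1 + t ^+ 2)^-1 * h (atan t / (2 * pi) + 2^-1))%:E).
  by apply/measurable_EFinP; exact: (continuous_measurable_fun (continuous_atan_turn ch2)).
have p1 (a b : R) : (0 <= ((1 + a ^+ 2)^-1 * h b)%:E)%E.
  by rewrite lee_fin mulr_ge0// invr_ge0 addr_ge0// sqr_ge0.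
have E : (\int[mu]_t ((1 + t ^+ 2)^-1%:E *
     (((EFin \o f) \_ (D : set (mT * mT))) (s * cos (atan t), s * sin (atan t))%R +
      ((EFin \o f) \_ (D : set (mT * mT))) (- (s * cos (atan t)), - (s * sin (atan t)))%R)) =
   (psi s)%:E * (2 * pi * rint h)%:E)%E.
  rewrite -(integral_circle ch h0 hP) -ge0_integralD//.
  rewrite -ge0_integralZl//; first last.
  - by rewrite lee_fin.
  - by move=> t _; rewrite adde_ge0.
  - exact: emeasurable_funD.
  apply: eq_integral => t _; rewrite !patchE !mem_set.
  - rewrite /= /f cs csN toC_polar toC_polarN -!EFinD -!EFinM; congr EFin; rewrite /h; ring.
  - by change (cmod (toC (- (s * cos (atan t)), - (s * sin (atan t)))) < 1); rewrite csN.
  - by change (cmod (toC (s * cos (atan t), s * sin (atan t))) < 1); rewrite cs.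
rewrite E -!EFinM; congr EFin; rewrite /circle_mean -/h.
have p0 : (pi : R) != 0 by rewrite gt_eqF ?pi_gt0.
by move: (pi : R) (rint h) p0 => P I p0; rewrite /=; field.
Qed.

End Profile.

(** * Circle means of continuous functions on the disk *)

Section DiskContinuous.
Context {R : realType}.
Local Notation mu := (@lebesgue_measure R).
Local Notation mT := (measurableTypeR R).
Implicit Types (Phi : R[i] -> R) (f : R[i] -> R[i]).

Definition disk_cont Phi := forall z, cmod z < 1 -> forall e : R, 0 < e -> exists2 d : R, 0 < d &
  forall y, cmod (y - z) < d -> `|Phi y - Phi z| < e.

Lemma cmod_circle (s t : R) : 0 <= s -> cmod (s%:C * cis t) = s.
Proof. by move=> s0; rewrite cmodM cmod_cis mulr1 cmodR_ge0. Qed.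

Lemma disk_cont_circle Phi (s : R) : 0 <= s < 1 -> disk_cont Phi ->
  continuous (fun t : R => Phi (s%:C * cis t)).
Proof.
move=> /andP[s0 s1] cPhi t; have z1 : cmod (s%:C * cis t) < 1 by rewrite cmod_circle.
apply/cvgrPdist_lt => e e0; have [d d0 dP] := cPhi _ z1 e e0.
have [d' d'0 dP'] := rdiff_cont (rdiff_cis t) d0.
apply/nbhs_ballP; exists d' => // u; rewrite /ball /= distrC => ut.
rewrite distrC; apply: dP; rewrite -mulrBr cmodM cmodR_ge0//.
apply: le_lt_trans (dP' u ut); rewrite ler_piMl ?cmod_ge0//; exact: ltW.
Qed.

Lemma rcont01_circle Phi (s : R) : 0 <= s < 1 -> disk_cont Phi -> rcont01 (fun t : R => Phi (s%:C * cis t)).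
Proof. by move=> s01 cPhi; apply: rcont01_of_continuous; exact: disk_cont_circle. Qed.

Lemma disk_cont_cmod_powR (p : R) f : 0 < p -> holo 1 f -> disk_cont (fun z => cmod (f z) `^ p).
Proof.
move=> p0 hf z z1 e e0; have [d d0 dP] := powR_epsdelta p0 (cmod_ge0 (f z)) e0.
have [r r0 rP] := holo_ccont hf z1 d0; exists r => // y yz.
apply: dP; first exact: cmod_ge0.
apply: le_lt_trans (rP y yz); rewrite ler_norml cmod_lb andbT.
by have := cmod_lb (f z) (f y); rewrite cmod_distC; lra.
Qed.

(** As a function of the radius the mean is a partial integral of a nonnegative Borel function on
    the plane, so its measurability is part of Tonelli's theorem. *)
Lemma measurable_circle_mean Phi : (forall z, 0 <= Phi z) -> disk_cont Phi ->
  measurable_fun (`]0, 1[%classic : set mT) (circle_mean Phi : mT -> mT).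
Proof.
move=> Phi0 cPhi; pose D : set (mT * mT) := (@toC R) @^-1` disk.
have mD : measurable D by exact: measurable_disk.
have mP := measurable_disk_continuous cPhi.
pose F := (fun u : mT * mT => Phi (toC u)) \_ D.
have mF : measurable_fun setT F by apply/(measurable_restrictT _ mD).
have F0 u : 0 <= F u by rewrite /F patchE; case: ifP.
pose J (u : mT * mT) : \bar R :=
  (if (0 <= u.2) && (u.2 <= 1) then F (u.1 * cos (2 * pi * u.2), u.1 * sin (2 * pi * u.2)) else 0)%:E.
have mJ : measurable_fun setT J.
  apply/measurable_EFinP; apply: measurable_fun_ifT => //.
    by apply: measurable_and; apply: measurable_fun_ler => //; exact: measurable_snd.
  apply: (measurableT_comp mF); apply: measurable_fun_pair; apply: measurable_funM; try exact: measurable_fst.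
    apply: (measurableT_comp (continuous_measurable_fun (@continuous_cos R))).
    by apply: measurable_funM => //; exact: measurable_snd.
  apply: (measurableT_comp (continuous_measurable_fun (@continuous_sin R))).
  by apply: measurable_funM => //; exact: measurable_snd.
have J0 u : (0 <= J u)%E by rewrite lee_fin; case: ifP.
have mI := @measurable_fun_fubini_tonelli_F _ _ _ _ _ mu J mJ J0.
apply/measurable_EFinP; apply: (@eq_measurable_fun _ _ _ _ _ (fubini_F mu J)); last first.
  exact: measurable_funTS.
move=> s /set_mem; rewrite /= in_itv /= => /andP[s0 s1].
have cP : rcont01 (fun t : R => Phi (s%:C * cis t)) by apply: rcont01_circle => //; rewrite (ltW s0) s1.
rewrite /circle_mean EFin_rint// /fubini_F /J /= -integral_cond01; apply: eq_integral => t _.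
case: ifP => // _; congr EFin.
have E : toC (s * cos (2 * pi * t), s * sin (2 * pi * t)) = s%:C * cis t.
  by rewrite /toC /cis; apply/eqP; rewrite eq_complex /= !mul0r subr0 addr0 !eqxx.
rewrite /F patchE mem_set ?E//; change (cmod (toC (s * cos (2 * pi * t), s * sin (2 * pi * t))) < 1).
by rewrite E cmod_circle// ltW.
Qed.

Lemma poisson_le z (t : R) : cmod z < 1 -> poisson z t <= 2 / (1 - cmod z).
Proof.
move=> z1; have z0 := cmod_ge0 z; have := cmod_lb (cis t) z; rewrite cmod_cis => H.
have D0 : 0 < cmod (cis t - z) by lra.
have H2 : (1 - cmod z) ^+ 2 <= cmod (cis t - z) ^+ 2 by rewrite lerXn2r ?nnegrE//; lra.
rewrite /poisson ler_pdivrMr ?exprn_gt0// mulrAC ler_pdivlMr; last lra.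
move: (cmod (cis t - z) ^+ 2) H2 => Y; move: (cmod z) z0 z1 => x x0 x1 HY.
have x3 : 0 <= (1 - x) ^+ 3 by rewrite exprn_ge0// subr_ge0 ltW.
apply: (@le_trans _ _ (2 * (1 - x) ^+ 2)); last lra.
by rewrite (_ : 2 * (1 - x) ^+ 2 = (1 - x ^+ 2) * (1 - x) + (1 - x) ^+ 3) ?lerDl//; ring.
Qed.

(** The sub-mean inequality for the dilate v -> f(s v), with the Poisson kernel at z / s bounded by
    2 / (1 - |z| / s). *)
Lemma powR_le_circle_mean (p s : R) f z : 0 < p -> holo 1 f -> cmod z < s -> s < 1 ->
  (s - cmod z) / 2 * cmod (f z) `^ p <= circle_mean (fun z => cmod (f z) `^ p) s.
Proof.
move=> p0 hf zs s1; have s0 : 0 < s by exact: le_lt_trans (cmod_ge0 z) zs.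
pose g v := f (0 + s%:C * v).
have r1 : 1 < s^-1 by rewrite invf_gt1.
have hg : holo s^-1 g.
  apply: (holo_comp_affine hf) => v vr; rewrite add0r cmodM cmodR_ge0 ?(ltW s0)//.
  by rewrite -ltr_pdivlMl// mulr1.
pose z' := s^-1%:C * z.
have z'E : cmod z' = cmod z / s by rewrite /z' cmodM cmodR_ge0 ?invr_ge0 ?(ltW s0)// mulrC.
have z'1 : cmod z' < 1 by rewrite z'E ltr_pdivrMr// mul1r.
have gz : g z' = f z.
  by rewrite /g add0r /z' mulrA -realCM divff ?mul1r// gt_eqF.
have := powR_submean p0 r1 hg z'1; rewrite gz => H.
have cM : rcont01 (fun t => cmod (g (cis t)) `^ p).
  apply: cont01_powR => //; first by apply: cont01_cmod; exact: (cont01_holo_cis r1 hg).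
  by move=> t; exact: cmod_ge0.
have d0 : 0 < 1 - cmod z' by rewrite subr_gt0.
have {}H : cmod (f z) `^ p <= 2 / (1 - cmod z') * circle_mean (fun z => cmod (f z) `^ p) s.
  apply: (le_trans H); rewrite /circle_mean.
  have -> : rint (fun t => cmod (f (s%:C * cis t)) `^ p) = rint (fun t => cmod (g (cis t)) `^ p).
    by apply: eq_rint => t _; rewrite /g add0r.
  rewrite -rintZ//; apply: le_rint; [|by apply: rcont01M => //; exact: rcont01_cst|].
    by apply: rcont01M => //; exact: cont01_poisson.
  by move=> t _; rewrite ler_wpM2r ?powR_ge0// poisson_le.
have {}H : cmod (f z) `^ p * (1 - cmod z') <= 2 * circle_mean (fun z => cmod (f z) `^ p) s.
  by rewrite -ler_pdivlMr// mulrAC.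
apply: (@le_trans _ _ (cmod (f z) `^ p * (1 - cmod z') / 2)); last by rewrite ler_pdivrMr// [_ * 2]mulrC.
rewrite [leLHS]mulrC mulrA ler_pM2r ?invr_gt0// ler_wpM2l ?powR_ge0//.
rewrite z'E (_ : 1 - cmod z / s = (s - cmod z) / s); last by rewrite mulrBl divff// gt_eqF.
by rewrite ler_peMr ?subr_ge0 ?(ltW zs)// invf_ge1// ltW.
Qed.

End DiskContinuous.

(** * The tail of the weight and the growth of Bergman functions *)

Section Weighted.
Context {R : realType}.
Local Notation mu := (@lebesgue_measure R).
Local Notation mT := (measurableTypeR R).
Variables (w : R[i] -> R) (psi : R -> R).
Hypotheses (w_doubling : doubling w) (psiP : profile w psi).

Definition tail (r : R) : R := fine (hatw w r).

Let w_weight : weight w. Proof. by case: w_doubling. Qed.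
Let w_radial : radial w. Proof. by case: w_doubling. Qed.
Let psi0 s : 0 <= psi s. Proof. by case: psiP. Qed.
Let mpsi : measurable_fun setT (psi : mT -> mT). Proof. by case: psiP. Qed.

Let hatw_ge0 r : 0 <= r < 1 -> (0 <= hatw w r)%E.
Proof. by move=> r01; rewrite (hatw_profile w_weight psiP r01) integral_ge0// => s _; rewrite lee_fin. Qed.

Let hatw_mono s t : 0 <= s -> s <= t -> t < 1 -> (hatw w t <= hatw w s)%E.
Proof.
move=> s0 st t1; rewrite !(hatw_profile w_weight psiP)//; try by apply/andP; split; lra.
apply: ge0_subset_integral => //.
- by apply/measurable_EFinP; exact: measurable_funTS.
- by move=> x _; rewrite lee_fin.
by move=> x /=; rewrite !in_itv /= => /andP[tx ->]; rewrite (le_trans st tx).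
Qed.

(** The strict inequality in the doubling condition forces finiteness, since the left side lies
    below some extended real, and then positivity, since 0 <= tail r < D tail((1 + r) / 2). *)
Lemma tail_spec : exists2 D : R, 0 < D & [/\ forall r, 0 <= r < 1 -> hatw w r = (tail r)%:E,
  forall r, 0 <= r < 1 -> 0 < tail r, forall s t, 0 <= s -> s <= t -> t < 1 -> tail t <= tail s
  & forall t, 0 <= t < 1 -> tail t <= D * tail ((1 + t) / 2)].
Proof.
have [_ _ [D D0 HD]] := w_doubling.
have mid (r : R) : 0 <= r < 1 -> 0 <= (1 + r) / 2 < 1 by move=> r01; lra.
have fin r : 0 <= r < 1 -> hatw w r = (tail r)%:E.
  move=> r01; rewrite /tail fineK// ge0_fin_numE ?hatw_ge0//.
  by apply: (lt_le_trans (HD r r01)); exact: leey.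
have tail0 r : 0 <= r < 1 -> 0 <= tail r by move=> r01; rewrite /tail fine_ge0 ?hatw_ge0.
have dbl t : 0 <= t < 1 -> tail t < D * tail ((1 + t) / 2).
  by move=> t01; have := HD t t01; rewrite !fin ?mid// lte_fin.
have mono s t : 0 <= s -> s <= t -> t < 1 -> tail t <= tail s.
  move=> s0 st t1; have := hatw_mono s0 st t1.
  by rewrite !fin ?lee_fin//; apply/andP; split; lra.
exists D => //; split => //; last by move=> t /dbl/ltW.
move=> r r01; have := mid r r01 => m01.
have : 0 < D * tail ((1 + r) / 2) by exact: le_lt_trans (tail0 r r01) (dbl r r01).
by rewrite pmulr_rgt0// => H; apply: (lt_le_trans H); apply: mono; lra.
Qed.

(** The p-th power of the Bergman norm, which can be integrated and compared without extracting
    roots. *)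
Definition mass (p : R) (f : R[i] -> R[i]) : \bar R :=
  (\int[dA]_(u in (@toC R) @^-1` disk) (cmod (f (toC u)) `^ p * w (toC u))%R%:E)%E.

Lemma mass_polar p f : 0 < p -> holo 1 f -> (mass p f =
  \int[mu]_(s in `]0%R, 1%R[) (2 * s * psi s * circle_mean (fun z => cmod (f z) `^ p) s)%:E)%E.
Proof.
move=> p0 hf; have cPhi := disk_cont_cmod_powR p0 hf.
apply: (area_polar w_weight w_radial psiP _ (measurable_disk_continuous cPhi)).
- by move=> z; exact: powR_ge0.
- move=> s /andP[s0 s1]; have s01 : 0 <= s < 1 by rewrite (ltW s0) s1.
  exact: (disk_cont_circle s01 cPhi).
Qed.

Lemma mass_ge0 p f : (0 <= mass p f)%E.
Proof.
apply: integral_ge0 => u Du; rewrite lee_fin mulr_ge0 ?powR_ge0// ltW//; exact: w_weight.1.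
Qed.

(** For (1 + |z|) / 2 <= s < 1 the circle mean at radius s is at least (1 - |z|) / 4 times |f(z)|^p,
    and 2 s >= 1. Integration over these radii against the profile produces the tail at (1 + |z|) /
    2, which doubling compares with the tail at |z|. *)
Lemma growth : exists2 C : R, 0 < C & forall (p B : R) f z, 0 < p -> holo 1 f ->
  (mass p f <= B%:E)%E -> cmod z < 1 -> cmod (f z) `^ p * wgt tail (cmod z) <= C * B.
Proof.
have [D D0 [fin pos mono dbl]] := tail_spec.
exists (4 * D); first by rewrite mulr_gt0.
move=> p B f z p0 hf; rewrite mass_polar// => HB z1; have z0 := cmod_ge0 z.
have z01 : 0 <= cmod z < 1 by rewrite z0.
set rho := (1 + cmod z) / 2; have rho01 : 0 <= rho < 1 by rewrite /rho; lra.
pose X := (1 - cmod z) / 4 * cmod (f z) `^ p.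
have X0 : 0 <= X by rewrite mulr_ge0 ?powR_ge0// divr_ge0//; lra.
have : (X%:E * hatw w rho <= B%:E)%E.
  apply: le_trans HB; rewrite (hatw_profile w_weight psiP rho01).
  rewrite -ge0_integralZl//; last 2 first.
  - by apply/measurable_EFinP; exact: measurable_funTS.
  - by move=> s _; rewrite lee_fin.
  rewrite integral_mkcond [leRHS]integral_mkcond; apply: ge0_le_integral_any => s _; rewrite !patchE.
    by case: ifP => // _; rewrite -EFinM lee_fin mulr_ge0.
  have M0 x : 0 <= circle_mean (fun z => cmod (f z) `^ p) x by apply: rint_ge0 => t _; exact: powR_ge0.
  case: ifPn => [/set_mem|_]; last first.
    case: ifPn => // /set_mem /=; rewrite in_itv /= => s01.
    by rewrite lee_fin mulr_ge0// mulr_ge0//; lra.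
  rewrite /= in_itv /= => /andP[rs s1].
  have s01 : 0 < s < 1 by apply/andP; split => //; move: rs rho01; rewrite /rho; lra.
  rewrite mem_set; last by rewrite /= in_itv.
  rewrite -EFinM lee_fin.
  have zs : cmod z < s by move: rs; rewrite /rho; lra.
  have := powR_le_circle_mean p0 hf zs s1.
  set M := circle_mean _ s; set P := cmod (f z) `^ p => H.
  have P0 : 0 <= P by exact: powR_ge0.
  have XM : X <= M.
    apply: le_trans H; rewrite /X -/P ler_wpM2r//; move: rs; rewrite /rho; lra.
  have s2 : 1 <= 2 * s by move: rs; rewrite /rho; lra.
  apply: (@le_trans _ _ (M * psi s)); first by rewrite ler_wpM2r.
  rewrite (_ : 2 * s * psi s * M = (2 * s) * (M * psi s)); last by ring.
  by rewrite ler_peMl// mulr_ge0// M0.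
rewrite fin// -EFinM lee_fin => H.
have H2 := dbl _ z01; rewrite -/rho in H2.
rewrite /wgt; have P0 : 0 <= (1 - cmod z) * cmod (f z) `^ p by rewrite mulr_ge0 ?powR_ge0//; lra.
have := ler_wpM2l P0 H2; move: H; rewrite /X => H H3.
have := ler_wpM2l (ltW D0) H; lra.
Qed.

(** Cauchy's estimate on the disk of radius (1 - |z|) / 2 about [z], on which doubling keeps W at
    least a fixed multiple of W(|z|). *)
Lemma growth_cderiv (p : R) (k : nat) : 0 < p -> exists2 C : R, 0 < C & forall f z, holo 1 f ->
  (mass p f <= 1)%E -> cmod z < 1 ->
  cmod (cderiv k f z) <= C * ((1 - cmod z) `^ (- k%:R) * wgt tail (cmod z) `^ (- p^-1)).
Proof.
move=> p0; have [C C0 HC] := growth; have [K K0 HK] := cderiv_estimate (R := R) k.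
have [D D0 [fin pos mono dbl]] := tail_spec.
exists (K * (2 ^+ k * ((2 * D) * C) `^ p^-1)).
  by rewrite mulr_gt0// mulr_gt0 ?exprn_gt0// powR_gt0// mulr_gt0// mulr_gt0.
move=> f z hf f1 z1; have z0 := cmod_ge0 z.
have z01 : 0 <= cmod z < 1 by rewrite z0.
set W := wgt tail (cmod z).
have W0 : 0 < W by apply: weight_gt0.
have ip : 0 < p^-1 by rewrite invr_gt0.
have rho0 : 0 < (1 - cmod z) / 2 by lra.
pose Mx := ((2 * D) * C) `^ p^-1 * W `^ (- p^-1).
have bd v : cmod (v - z) <= (1 - cmod z) / 2 -> cmod (f v) <= Mx.
  move=> vz; have vle : cmod v <= (1 + cmod z) / 2.
    by have := cmodD (v - z) z; rewrite subrK; lra.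
  have v1 : cmod v < 1 by lra.
  have v0 := cmod_ge0 v.
  have := HC p 1 f v p0 hf f1 v1; rewrite mulr1 => Hv.
  have Wv : W <= 2 * D * wgt tail (cmod v).
    apply: (le_trans (weight_doubling dbl z01)); apply: ler_wpM2l; first by rewrite mulr_ge0// ltW.
    by apply: (weight_mono pos mono) => //; lra.
  have Hp : cmod (f v) `^ p <= 2 * D * C / W.
    rewrite ler_pdivlMr//; apply: (@le_trans _ _ (cmod (f v) `^ p * (2 * D * wgt tail (cmod v)))).
      by rewrite ler_wpM2l ?powR_ge0.
    rewrite (_ : cmod (f v) `^ p * (2 * D * wgt tail (cmod v)) = 2 * D * (cmod (f v) `^ p * wgt tail (cmod v))); last by ring.
    by apply: ler_wpM2l => //; rewrite mulr_ge0// ltW.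
  rewrite -[cmod (f v)]powRr1 ?cmod_ge0// -(mulfV (lt0r_neq0 p0)) powRrM.
  apply: (@le_trans _ _ ((2 * D * C / W) `^ p^-1)).
    apply: ge0_ler_powR => //; rewrite ?nnegrE ?powR_ge0 ?(ltW ip)//.
    by rewrite divr_ge0 ?(ltW W0)// !mulr_ge0// ltW.
  rewrite powRM ?invr_ge0 ?(ltW W0)//; last by rewrite !mulr_ge0// ltW.
  by rewrite /Mx -[W^-1]powR_inv1 ?(ltW W0)// -powRrM mulN1r.
have zr : cmod z + (1 - cmod z) / 2 < 1 by lra.
apply: (le_trans (HK 1 f z _ Mx hf rho0 zr bd)).
rewrite powR_invn; last lra.
rewrite expr_div_n invf_div /Mx le_eqVlt; apply/orP; left; apply/eqP.
rewrite -/W; move: (W `^ _) ((2 * D * C) `^ _) ((1 - cmod z) ^- k) (2 ^+ k) => a b c d; ring.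
Qed.

End Weighted.

(** * Sufficiency: estimates on circles and on the disk *)

Section Sufficiency.
Context {R : realType}.
Local Notation mu := (@lebesgue_measure R).
Local Notation mT := (measurableTypeR R).

Lemma powR_add_le (q a b : R) : 0 < q -> 0 <= a -> 0 <= b -> (a + b) `^ q <= 2 `^ q * (a `^ q + b `^ q).
Proof.
move=> q0; wlog ab : a b / a <= b => [H a0 b0|a0 b0].
  have [ab|/ltW ba] := leP a b; first exact: H.
  by rewrite [a + b]addrC [a `^ q + _]addrC; exact: H.
apply: (@le_trans _ _ ((2 * b) `^ q)).
  by apply: ge0_ler_powR; rewrite ?nnegrE ?(ltW q0) ?addr_ge0 ?mulr_ge0//; lra.
by rewrite powRM// ler_wpM2l ?powR_ge0// lerDr powR_ge0.
Qed.

Lemma holo_volterra (f : R[i] -> R[i]) : holo 1 f -> holo 1 (volterra f).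
Proof. by move=> hf z z1; exists (f z); exact: (cdiff_volterra hf). Qed.

Lemma holo_iter_volterra (f : R[i] -> R[i]) j : holo 1 f -> holo 1 (iter j volterra f).
Proof. by move=> hf; elim: j => [//|j ih]; exact: holo_volterra. Qed.

Variables (w : R[i] -> R) (psi : R -> R) (p q : R) (k n : nat).
Hypotheses (w_doubling : doubling w) (psiP : profile w psi) (p0 : 0 < p) (pq : p < q) (kn : (k < n)%N).
Local Notation W := (wgt (tail w)).
Local Notation delta := (p^-1 - q^-1).
Implicit Types (f g : R[i] -> R[i]).

Let q0 : 0 < q. Proof. exact: lt_trans pq. Qed.

(** In each direction the radial estimate bounds |T f|^q by a multiple of eta^q + eps^q S, where [S]
    majorises the nontangential maximal function of the dilate of [f] to radius [r]; the integral of
    [S] is controlled by the circle mean of |f|^p. *)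
Lemma gen_volterra_circle : exists2 C : R, 0 < C & forall f g (eta eps : R), holo 1 f -> holo 1 g ->
  (mass w p f <= 1)%E -> 0 <= eta -> 0 < eps ->
  (forall z, cmod z < 1 -> cmod (cderiv k f z * cderiv (n - k) g z) <=
     eta + eps * ((1 - cmod z) `^ (- (n - k)%:R) * W (cmod z) `^ delta * cmod (cderiv k f z))) ->
  forall r, 0 < r < 1 -> circle_mean (fun z => cmod (gen_volterra g n k f z) `^ q) r <=
    C * (eta `^ q + eps `^ q * (1 + circle_mean (fun z => cmod (f z) `^ p) r)).
Proof.
have [D D0 [fin pos mono dbl]] := tail_spec w_doubling psiP.
have [Ch Ch0 Hh] := hedberg p0 pq kn D0 pos mono dbl.
have [Cg Cg0 Hg] := growth_cderiv w_doubling psiP k p0.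
have [Ce Ce0 He] := cderiv_estimate (R := R) k.
have [Cm Cm0 Hm] := nontangential_maximal p0.
have [A [A0 Ag Ae]] : exists A : R, [/\ 0 < A, Cg <= A & Ce * 2 ^+ k <= A].
  by exists (Num.max Cg (Ce * 2 ^+ k)); rewrite lt_max Cg0 !le_max !lexx orbT.
have [K [K0 KE]] : exists K : R, 0 < K /\ K = Ch `^ q * 2 `^ q.
  by exists (Ch `^ q * 2 `^ q); rewrite mulr_gt0// powR_gt0.
exists (K + K * A `^ q * Cm); first by rewrite addr_gt0// !mulr_gt0// powR_gt0.
move=> f g eta eps hf hg f1 eta0 eps_gt0 hyp r r01; have [r0 r1] := andP r01.
have eps0 : 0 <= eps by exact: ltW.
have q0' : 0 < q by exact: q0.
have p0' : 0 < p by exact: p0.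
pose h z := cderiv k f z * cderiv (n - k) g z.
have hh : holo 1 h by apply: holoM; [exact: (holo_cderiv hf k).1|exact: (holo_cderiv hg (n - k)%N).1].
have hT := holo_iter_volterra n hh.
pose fr v := f (0 + r%:C * v).
have ir1 : 1 < r^-1 by rewrite invf_gt1.
have hfr : holo r^-1 fr.
  apply: (holo_comp_affine hf) => v vr; rewrite add0r cmodM cmodR_ge0 ?(ltW r0)//.
  by rewrite -ltr_pdivlMl// mulr1.
have [S [mS S1 IS HS]] := Hm _ _ ir1 hfr.
have frE z : f z = fr (r^-1%:C * z).
  by rewrite /fr add0r mulrA -realCM divff ?mul1r// gt_eqF.
have [a [a0 aE]] : exists a : R, 0 <= a /\ a = K * eta `^ q.
  by exists (K * eta `^ q); split => //; apply: mulr_ge0; [exact: ltW|exact: powR_ge0].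
have [b [b_gt0 bE]] : exists b : R, 0 < b /\ b = K * A `^ q * eps `^ q.
  by exists (K * A `^ q * eps `^ q); split => //; do 2! [apply: mulr_gt0; last exact: powR_gt0].
have b0 : 0 <= b by exact: ltW.
have S0 t : (0 <= S t)%E by exact: le_trans (S1 t).
have main t0 : 0 <= t0 <= 1 ->
    ((cmod (gen_volterra g n k f (r%:C * cis t0)) `^ q)%:E <= a%:E + b%:E * S t0)%E.
  (* Where [S] is infinite so is the right side, because b > 0; this is where eps > 0 enters. *)
  move=> t01; have [Sfin|Sinf] := boolP (S t0 \is a fin_num); last first.
    have Soo : S t0 = +oo%E.
      by move: Sinf; rewrite ge0_fin_numE// -leNgt leye_eq => /eqP.
    by rewrite Soo gt0_muley ?lte_fin// addey ?leey.
  have [s sE] : exists s : R, S t0 = s%:E by exists (fine (S t0)); rewrite fineK.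
  have s1 : 1 <= s by rewrite -lee_fin -sE.
  have s0 : 0 <= s by exact: le_trans s1.
  have [N NE] : exists N : R, N = s `^ p^-1 by exists (s `^ p^-1).
  have ip0 : 0 <= p^-1 by rewrite invr_ge0; exact: ltW p0'.
  have N1 : 1 <= N.
    rewrite NE (_ : 1 = 1 `^ p^-1); last by rewrite powR1.
    by apply: ge0_ler_powR; rewrite ?nnegrE.
  have Np : N `^ p = s by rewrite NE -powRrM mulVf ?(gt_eqF p0')// powRr1.
  pose c : R[i] := cis t0; have c1 : cmod c = 1 by exact: cmod_cis.
  pose phi j (t : R) := iter j volterra h (t%:C * c).
  have tc (t : R) : 0 <= t -> cmod (t%:C * c) = t by move=> ?; exact: cmod_circle.
  have dphi j t : 0 <= t < 1 -> rdiff (phi j.+1) t (c * phi j t).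
    move=> /andP[t0' t1]; rewrite mulrC.
    have z1 : cmod (0 + t%:C * c) < 1 by rewrite add0r tc.
    have := rdiff_chain (rdiff_line 0 c t) (cdiff_volterra (holo_iter_volterra j hh) z1).
    by rewrite add0r; under eq_fun do rewrite add0r.
  have phi00 j : phi j.+1 0 = 0 by rewrite /phi mul0r /= volterra0.
  (* Division by [r] carries the disk of radius (r - t) / 2 about t c into the nontangential region
     of the dilate at t / r. *)
  have fN t v : 0 <= t < r -> cmod (v - t%:C * c) <= (r - t) / 2 -> cmod (f v) <= N.
    move=> t01' vt; have tr1 : 0 <= t / r < 1.
      by have [ta tb] := andP t01'; rewrite divr_ge0 ?(ltW r0)//= ltr_pdivrMr// mul1r.
    have : cmod (r^-1%:C * v - (t / r)%:C * c) <= (1 - t / r) / 2.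
      have -> : r^-1%:C * v - (t / r)%:C * c = r^-1%:C * (v - t%:C * c).
        by rewrite mulrBr mulrA -realCM [r^-1 * t]mulrC.
      rewrite cmodM cmodR_ge0 ?invr_ge0 ?(ltW r0)//.
      have -> : (1 - t / r) / 2 = r^-1 * ((r - t) / 2) by field; rewrite gt_eqF.
      by rewrite ler_wpM2l// invr_ge0 ltW.
    move/(HS t0 (t / r) _ t01 tr1); rewrite -frE sE lee_fin => H.
    rewrite -[cmod (f v)]powRr1 ?cmod_ge0// -(mulfV (lt0r_neq0 p0)) powRrM NE.
    by apply: ge0_ler_powR; rewrite ?nnegrE ?powR_ge0.
  have epsA : 0 <= eps * A by rewrite mulr_ge0// ltW.
  have near t : 0 <= t < r -> cmod (phi 0%N t) <= eta +
      eps * A * (N * (r - t) `^ (- k%:R) * (1 - t) `^ (- (n - k)%:R) * W t `^ delta).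
    move=> t01'; have [t0' tr] := andP t01'.
    have zt := tc t t0'.
    have z1 : cmod (t%:C * c) < 1 by rewrite zt; exact: lt_trans r1.
    apply: (le_trans (hyp _ z1)); rewrite lerD2l zt.
    have rho0 : 0 < (r - t) / 2 by rewrite divr_gt0// subr_gt0.
    have zr : cmod (t%:C * c) + (r - t) / 2 < 1.
      by rewrite zt (lt_trans _ r1)// -ltrBrDl ltr_pdivrMr// ltr_pMr ?subr_gt0// ltr1n.
    have G := He 1 f (t%:C * c) _ N hf rho0 zr (fun v => fN t v t01').
    have {}G : cmod (cderiv k f (t%:C * c)) <= A * (N * (r - t) `^ (- k%:R)).
      apply: (le_trans G); rewrite powR_invn; last by rewrite subr_ge0 ltW.
      rewrite expr_div_n invf_div.
      have -> : Ce * N * (2 ^+ k / (r - t) ^+ k) = Ce * 2 ^+ k * (N * (r - t) ^- k) by ring.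
      apply: ler_wpM2r Ae; apply: mulr_ge0; [exact: le_trans N1|by rewrite invr_ge0 exprn_ge0 // subr_ge0 ltW].
    set X := (1 - t) `^ _ * W t `^ delta.
    have X0 : 0 <= X by rewrite mulr_ge0 ?powR_ge0.
    have -> : eps * A * (N * (r - t) `^ (- k%:R) * (1 - t) `^ (- (n - k)%:R) * W t `^ delta) =
      eps * (X * (A * (N * (r - t) `^ (- k%:R)))) by rewrite /X; ring.
    by apply: ler_wpM2l => //; exact: ler_wpM2l.
  (* The growth of the k-th derivative contributes W^(-1/p), and delta - 1/p = -1/q. *)
  have far t : 0 <= t < 1 -> cmod (phi 0%N t) <= eta +
      eps * A * ((1 - t) `^ (- n%:R) * W t `^ (- q^-1)).
    move=> t01'; have [t0' t1] := andP t01'.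
    have zt := tc t t0'.
    have z1 : cmod (t%:C * c) < 1 by rewrite zt.
    apply: (le_trans (hyp _ z1)); rewrite lerD2l zt.
    have := Hg f _ hf f1 z1; rewrite zt => G.
    have Wt := weight_gt0 pos t01'.
    set X := (1 - t) `^ _ * W t `^ delta.
    have X0 : 0 <= X by rewrite mulr_ge0 ?powR_ge0.
    rewrite -mulrA; apply: ler_wpM2l => //.
    apply: (le_trans (ler_wpM2l X0 G)).
    have -> : - n%:R = - (n - k)%:R + - k%:R :> R.
      by rewrite natrB ?(ltnW kn)//; ring.
    have -> : - q^-1 = delta + - p^-1 by ring.
    have t1' : 1 - t != 0 by rewrite gt_eqF// subr_gt0.
    rewrite powRD ?t1' ?implybT// [W t `^ (delta + _)]powRD ?(gt_eqF Wt) ?implybT//.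
    have -> : X * (Cg * ((1 - t) `^ (- k%:R) * W t `^ (- p^-1))) = Cg *
      ((1 - t) `^ (- (n - k)%:R) * (1 - t) `^ (- k%:R) * (W t `^ delta * W t `^ (- p^-1))).
      by rewrite /X; ring.
    apply: ler_wpM2r Ag; apply: mulr_ge0; apply: mulr_ge0; exact: powR_ge0.
  have r01' : 0 <= r < 1 by rewrite (ltW r0).
  have G := Hh c phi r N eta (eps * A) c1 r01' N1 eta0 epsA dphi phi00 near far.
  have -> : gen_volterra g n k f (r%:C * cis t0) = phi n r by [].
  rewrite sE -EFinM -EFinD lee_fin.
  have Npq : 0 <= N `^ (p / q) by exact: powR_ge0.
  have eN : 0 <= eps * A * N `^ (p / q) by rewrite mulr_ge0.
  apply: (@le_trans _ _ ((Ch * (eta + eps * A * N `^ (p / q))) `^ q)).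
    apply: ge0_ler_powR => //; rewrite ?nnegrE ?cmod_ge0 ?(ltW q0)//.
    by rewrite mulr_ge0 ?addr_ge0// ltW.
  rewrite powRM ?addr_ge0//; last exact: ltW.
  apply: (@le_trans _ _ (Ch `^ q * (2 `^ q * (eta `^ q + (eps * A * N `^ (p / q)) `^ q)))).
    by apply: ler_wpM2l; [exact: powR_ge0|exact: powR_add_le].
  rewrite (powRM q epsA (powR_ge0 N (p / q))) (powRM q eps0 (ltW A0)).
  rewrite -powRrM divfK ?gt_eqF// Np aE bE KE le_eqVlt; apply/orP; left; apply/eqP; ring.
have cq := disk_cont_cmod_powR q0 hT.
have r01' : 0 <= r < 1 by rewrite (ltW r0).
have crq := rcont01_circle r01' cq.
rewrite -lee_fin /circle_mean EFin_rint//.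
have mS' : measurable_fun (`[0, 1]%classic : set mT) S by exact: measurable_funTS.
apply: (@le_trans _ _ (\int[mu]_(t in `[0%R, 1%R]) (a%:E + b%:E * S t))%E).
  apply: ge0_le_integral_any => t /=; first by rewrite lee_fin powR_ge0.
  by rewrite in_itv; exact: main.
rewrite ge0_integralD//; first last.
- exact: measurable_funeM.
- by move=> t _; rewrite mule_ge0.
rewrite ge0_integralZl_EFin// -(EFin_rint (rcont01_cst a)) rint_cst.
apply: (@le_trans _ _ (a%:E + b%:E * (Cm * (1 + circle_mean (fun z => cmod (f z) `^ p) r))%:E)%E).
  have <- : rint (fun t => cmod (fr (cis t)) `^ p) = circle_mean (fun z => cmod (f z) `^ p) r.
    by apply: eq_rint => t _; rewrite /fr add0r.
  by apply: leeD2l; apply: lee_wpmul2l; [rewrite lee_fin; exact: b0|exact: IS].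
rewrite -EFinM -EFinD lee_fin -/(circle_mean (fun z => cmod (f z) `^ p) r).
set M := circle_mean _ r.
have M0 : 0 <= M by apply: rint_ge0 => t _; exact: powR_ge0.
have e1 : 0 <= eta `^ q by exact: powR_ge0.
have e2 : 0 <= eps `^ q by exact: powR_ge0.
rewrite aE bE; have KA : 0 <= K * A `^ q * Cm by rewrite !mulr_ge0 ?powR_ge0// ltW.
rewrite (_ : (K + K * A `^ q * Cm) * (eta `^ q + eps `^ q * (1 + M)) =
  K * eta `^ q + K * A `^ q * eps `^ q * (Cm * (1 + M)) + (K * A `^ q * Cm * eta `^ q + K * (eps `^ q * (1 + M)))); last by ring.
have M1 : 0 <= eps `^ q * (1 + M) by apply: mulr_ge0 => //; exact: addr_ge0.
by rewrite lerDl; apply: addr_ge0; [exact: mulr_ge0|apply: mulr_ge0 => //; exact: ltW].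
Qed.

Lemma profile_integral_le : (\int[mu]_(s in `]0%R, 1%R[) (2 * s * psi s)%:E <= (2 * tail w 0)%:E)%E.
Proof.
have [_ _ [fin _ _ _]] := tail_spec w_doubling psiP.
have [mpsi psi0 _] := psiP.
rewrite EFinM -fin ?lexx ?ltr01// (hatw_profile _ psiP) ?lexx ?ltr01//; last by case: w_doubling.
rewrite -ge0_integralZl_EFin//; first last.
- by apply/measurable_EFinP; exact: measurable_funTS.
- by move=> s _; rewrite lee_fin.
rewrite [leLHS]integral_mkcond [leRHS]integral_mkcond.
apply: ge0_le_integral_any => s _; rewrite !patchE.
  case: ifPn => // /set_mem; rewrite /= in_itv /= => s01.
  by rewrite lee_fin mulr_ge0//; lra.
case: ifPn => [/set_mem|_]; last by case: ifPn => // _; rewrite -EFinM lee_fin mulr_ge0.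
rewrite /= in_itv /= => /andP[s0 s1]; rewrite mem_set; last by rewrite /= in_itv /= (ltW s0).
by rewrite -EFinM lee_fin ler_wpM2r//; lra.
Qed.

(** The circle estimate is integrated against 2 s psi(s): the constant terms yield a multiple of the
    tail at 0, and the circle mean of |f|^p yields the mass, at most 1. *)
Theorem gen_volterra_mass : exists2 C : R, 0 < C & forall f g (eta eps : R), holo 1 f -> holo 1 g ->
  (mass w p f <= 1)%E -> 0 <= eta -> 0 < eps ->
  (forall z, cmod z < 1 -> cmod (cderiv k f z * cderiv (n - k) g z) <=
     eta + eps * ((1 - cmod z) `^ (- (n - k)%:R) * W (cmod z) `^ delta * cmod (cderiv k f z))) ->
  (mass w q (gen_volterra g n k f) <= (C * (eta `^ q + eps `^ q))%:E)%E.
Proof.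
have [C C0 HC] := gen_volterra_circle.
have [D D0 [fin pos mono dbl]] := tail_spec w_doubling psiP.
have [mpsi psi0 _] := psiP.
have H0 : 0 < tail w 0 by apply: pos; rewrite lexx ltr01.
exists (C * (2 * tail w 0) + C * (2 * tail w 0 + 1)).
  by rewrite addr_gt0// mulr_gt0//; lra.
move=> f g eta eps hf hg f1 eta0 eps_gt0 hyp.
have eps0 : 0 <= eps by exact: ltW.
have hh : holo 1 (fun z => cderiv k f z * cderiv (n - k) g z).
  by apply: holoM; [exact: (holo_cderiv hf k).1|exact: (holo_cderiv hg (n - k)%N).1].
rewrite (mass_polar w_doubling psiP q0 (holo_iter_volterra n hh)).
set M := circle_mean (fun z => cmod (f z) `^ p).
have M0 s : 0 <= M s by apply: rint_ge0 => t _; exact: powR_ge0.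
have mM : measurable_fun (`]0, 1[%classic : set mT) (M : mT -> mT).
  apply: measurable_circle_mean; first by move=> z; exact: powR_ge0.
  exact: disk_cont_cmod_powR.
pose a := C * (eta `^ q + eps `^ q); pose b := C * eps `^ q.
have a0 : 0 <= a by rewrite mulr_ge0 ?addr_ge0 ?powR_ge0// ltW.
have b0 : 0 <= b by rewrite mulr_ge0 ?powR_ge0// ltW.
have mpsi' : measurable_fun (`]0, 1[%classic : set mT) (fun s : mT => 2 * s * psi s).
  by apply: measurable_funM; [apply: measurable_funM => //; exact: measurable_id|exact: measurable_funTS].
apply: (@le_trans _ _ (\int[mu]_(s in `]0%R, 1%R[) (a%:E * (2 * s * psi s)%:E + b%:E * (2 * s * psi s * M s)%:E))%E).
  apply: ge0_le_integral_any => s /=; rewrite in_itv /= => s01; have s0 : 0 <= 2 * s * psi s.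
  - by rewrite mulr_ge0//; lra.
  - by rewrite lee_fin (mulr_ge0 s0)//; apply: rint_ge0 => t _; exact: powR_ge0.
  - by rewrite mulr_ge0//; lra.
  rewrite -!EFinM -EFinD lee_fin.
  have := HC f g eta eps hf hg f1 eta0 eps_gt0 hyp s s01; rewrite -/(M s) => /(ler_wpM2l s0) H.
  apply: (le_trans H); rewrite /a /b le_eqVlt; apply/orP; left; apply/eqP; ring.
have n0 s : (`]0, 1[%classic : set mT) s -> (0 <= (2 * s * psi s)%:E)%E.
  by rewrite /= in_itv /= => s01; rewrite lee_fin mulr_ge0//; lra.
have n1 s : (`]0, 1[%classic : set mT) s -> (0 <= (2 * s * psi s * M s)%:E)%E.
  by move=> /n0; rewrite !lee_fin => ?; rewrite mulr_ge0.
have m1 : measurable_fun (`]0, 1[%classic : set mT) (fun s : mT => (2 * s * psi s)%:E) by exact/measurable_EFinP.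
have m2 : measurable_fun (`]0, 1[%classic : set mT) (fun s : mT => (2 * s * psi s * M s)%:E).
  by apply/measurable_EFinP; exact: measurable_funM.
rewrite ge0_integralD//; first last.
- exact: measurable_funeM.
- by move=> s /n1 ?; rewrite mule_ge0.
- exact: measurable_funeM.
- by move=> s /n0 ?; rewrite mule_ge0.
rewrite !ge0_integralZl_EFin//.
have I1 := profile_integral_le.
have I2 : (\int[mu]_(s in `]0%R, 1%R[) (2 * s * psi s * M s)%:E <= 1)%E.
  by rewrite -(mass_polar w_doubling psiP p0 hf).
apply: (@le_trans _ _ (a%:E * (2 * tail w 0)%:E + b%:E * 1)%E).
  by apply: leeD; apply: lee_wpmul2l; rewrite ?lee_fin.
rewrite mule1 -EFinM -EFinD lee_fin /a /b.
have e1 : 0 <= eta `^ q by exact: powR_ge0.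
have e2 : 0 <= eps `^ q by exact: powR_ge0.
rewrite (_ : (C * (2 * tail w 0) + C * (2 * tail w 0 + 1)) * (eta `^ q + eps `^ q) =
  C * (eta `^ q + eps `^ q) * (2 * tail w 0) + C * eps `^ q +
  (C * (2 * tail w 0) * (eta `^ q + eps `^ q) + C * eta `^ q)); last by ring.
by rewrite lerDl addr_ge0 ?mulr_ge0 ?addr_ge0// ltW.
Qed.

End Sufficiency.

(** * Test functions: derivatives and circle means *)

Section TestKernel.
Context {R : realType}.
Implicit Types (f phi : R[i] -> R[i]) (a z : R[i]).

Lemma cdiff_expS a z d : cdiff (fun w => (w - a) ^+ d.+1) z (d.+1%:R * (z - a) ^+ d).
Proof.
have H1 : cdiff (fun w => w - a) z 1.
  by have := cdiffB (cdiff_id z) (cdiff_cst a z); rewrite subr0.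
elim: d => [|d ih]; first by rewrite expr0 mulr1; under eq_fun do rewrite expr1.
have := cdiffM H1 ih; under eq_fun do rewrite -exprS.
rewrite (_ : 1 * _ + _ = d.+2%:R * (z - a) ^+ d.+1)//.
by rewrite !exprS -[d.+2%:R]natr1 -[d.+1%:R]natr1; ring.
Qed.

(** The j-th derivative has the form (z - a)^(k - j) Phi_j with Phi_(j+1) = (k - j) Phi_j + (z - a)
    Phi_j'. At [a] only the first term survives, and the factors k - j multiply to k!. *)
Lemma cderiv_mul_exp r k a phi : holo r phi -> cmod a < r ->
  cderiv k (fun z => (z - a) ^+ k * phi z) a = k`!%:R * phi a.
Proof.
move=> hphi ar.
pose Phi := fix Phi j := if j is j'.+1 then
  fun z => (k - j')%N%:R * Phi j' z + (z - a) * cderiv 1 (Phi j') z else phi.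
have hPhi j : holo r (Phi j).
  elim: j => [//|j ih] /=; apply: holoD; apply: holoM => //; first exact: holo_cst.
    by move=> z _; exists 1; have := cdiffB (cdiff_id z) (cdiff_cst a z); rewrite subr0.
  exact: (holo_cderiv ih 1).1.
pose F j z := (z - a) ^+ (k - j)%N * Phi j z.
have dF j : (j < k)%N -> forall z, cmod z < r -> cdiff (F j) z (F j.+1 z).
  move=> jk z zr; have [d dE] : exists d, (k - j = d.+1)%N by exists (k - j.+1)%N; rewrite subnSK.
  have dE' : (k - j.+1 = d)%N by rewrite subnS dE.
  have := cdiffM (cdiff_expS a z d) ((holo_cderiv (hPhi j) 0).2 z zr).
  rewrite /F dE dE' (_ : _ * _ + _ = (z - a) ^+ d * Phi j.+1 z)//=.
  by rewrite dE exprS; ring.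
have H := cderiv_chain dF (leqnn k) ar.
have F0 : F 0%N = fun z => (z - a) ^+ k * phi z by rewrite /F subn0.
rewrite -F0 H /F subnn expr0 mul1r.
have PhiS j : Phi j.+1 a = (k - j)%N%:R * Phi j a by rewrite /= subrr mul0r addr0.
have : forall j, (j <= k)%N -> (k - j)`!%:R * Phi j a = k`!%:R * phi a.
  elim=> [|j ih] jk; first by rewrite subn0.
  rewrite PhiS -(ih (ltnW jk)) mulrA -natrM mulnC.
  by rewrite -[in RHS](subnSK jk) factS subnSK.
by move=> /(_ k (leqnn k)); rewrite subnn fact0 mul1r.
Qed.

(** The difference of the squares is (1 - |a|^2)(1 - |z|^2), the identity behind the automorphisms
    of the disk. *)
Lemma cmod_sub_le a z : cmod a < 1 -> cmod z < 1 -> cmod (z - a) <= cmod (1 - conjc a * z).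
Proof.
move=> a1 z1; rewrite -(@ler_pXn2r _ 2) ?nnegrE ?cmod_ge0//.
have E : cmod (1 - conjc a * z) ^+ 2 - cmod (z - a) ^+ 2 = (1 - cmod a ^+ 2) * (1 - cmod z ^+ 2).
  rewrite !sqr_cmod; case: a z {a1 z1} => u v [x y] /=; ring.
rewrite -subr_ge0 E mulr_ge0// subr_ge0 expr_le1 ?cmod_ge0//; exact: ltW.
Qed.

Lemma cmod_one_sub_ge a z : 1 - cmod a * cmod z <= cmod (1 - conjc a * z).
Proof. by have := cmod_lb 1 (conjc a * z); rewrite cmod1 (cmodM (conjc a)) cmodJ. Qed.

(* With the factor (z - a)^k the k-th derivative at [a] is explicit; it costs nothing,
   since |z - a| <= |1 - conj(a) z|. *)
Definition test_fun (gam k : nat) a z := (z - a) ^+ k * ((1 - conjc a * z) ^+ (gam + k))^-1.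

Lemma one_sub_neq0 a z : cmod a < 1 -> cmod z < 1 -> 1 - conjc a * z != 0.
Proof.
move=> a1 z1; rewrite -cmod_gt0; apply: lt_le_trans (cmod_one_sub_ge a z).
rewrite subr_gt0; apply: (@le_lt_trans _ _ (cmod a)) => //.
by rewrite ler_piMr ?cmod_ge0// ltW.
Qed.

Lemma holoX r f d : holo r f -> holo r (fun z => f z ^+ d).
Proof.
move=> hf; elim: d => [|d ih]; first by under eq_fun do rewrite expr0; exact: holo_cst.
by under eq_fun do rewrite exprS; exact: holoM.
Qed.

Lemma holo_kernel gam a : cmod a < 1 -> holo 1 (fun z => ((1 - conjc a * z) ^+ gam)^-1).
Proof.
move=> a1; apply: holoV => [|z z1]; last by rewrite expf_neq0// one_sub_neq0.
apply: holoX; have := @holo_affine _ 1 1 (- conjc a).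
by under eq_fun do rewrite mulNr.
Qed.

Lemma holo_test_fun gam k a : cmod a < 1 -> holo 1 (test_fun gam k a).
Proof.
move=> a1; apply: holoM; last exact: holo_kernel.
apply: holoX => z _; exists 1.
by have := cdiffB (cdiff_id z) (cdiff_cst a z); rewrite subr0.
Qed.

Lemma cmod_test_fun_le gam k a z : cmod a < 1 -> cmod z < 1 ->
  cmod (test_fun gam k a z) <= cmod (1 - conjc a * z) ^- gam.
Proof.
move=> a1 z1; have k0 : 0 < cmod (1 - conjc a * z) by rewrite cmod_gt0 one_sub_neq0.
rewrite /test_fun cmodM cmodV !cmodX exprD invfM mulrCA.
rewrite ler_piMr ?invr_ge0 ?exprn_ge0 ?(ltW k0)//.
by rewrite ler_pdivrMr ?exprn_gt0// mul1r lerXn2r ?nnegrE ?cmod_ge0// cmod_sub_le.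
Qed.

Lemma cderiv_test_fun gam k a : cmod a < 1 ->
  k`!%:R / (2 * (1 - cmod a)) ^+ (gam + k) <= cmod (cderiv k (test_fun gam k a) a).
Proof.
move=> a1; have a0 := cmod_ge0 a.
have -> : cderiv k (test_fun gam k a) a = k`!%:R * ((1 - conjc a * a) ^+ (gam + k))^-1.
  by apply: (cderiv_mul_exp k _ a1); exact: holo_kernel.
have d0 : 0 < cmod (1 - conjc a * a) by rewrite cmod_gt0 one_sub_neq0.
rewrite cmodM cmod_nat cmodV cmodX ler_wpM2l//.
rewrite lef_pV2 ?posrE ?exprn_gt0//; last by rewrite mulr_gt0//; lra.
rewrite lerXn2r ?nnegrE ?(ltW d0)//; first by rewrite mulr_ge0//; lra.
rewrite mulrC mul_conjc -(realCB 1) cmodR_ge0.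
  have : 0 <= (1 - cmod a) ^+ 2 by rewrite sqr_ge0.
  rewrite !expr2; lra.
by rewrite subr_ge0 expr_le1// ltW.
Qed.

Lemma cmod_conj_kernel a (t : R) : cmod (1 - conjc a * cis t) = cmod (cis t - a).
Proof.
have -> : cis t - a = cis t * (1 - a * cis (- t)).
  by rewrite mulrBr mulr1 mulrCA -cisD subrr cis0 mulr1.
rewrite cmodM cmod_cis mul1r -[RHS]cmodJ; congr cmod.
case: a => u v; rewrite /cis mulrN cosN sinN; apply/eqP; rewrite eq_complex /=.
by apply/andP; split; apply/eqP; ring.
Qed.

(** For kap = 2 the integrand is a multiple of the Poisson kernel at [a], whose mean is 1. The
    remaining power 2 - kap is nonpositive and estimated through the lower bound 1 - |a| of the
    modulus. *)
Lemma rint_kernel a (kap : R) : cmod a < 1 -> 2 <= kap ->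
  rint (fun t => cmod (1 - conjc a * cis t) `^ (- kap)) <= (1 - cmod a) `^ (1 - kap).
Proof.
move=> a1 k2; have a0 := cmod_ge0 a.
have d0 : 0 < 1 - cmod a by lra.
have D0 : 0 < 1 - cmod a ^+ 2 by rewrite subr_gt0 expr_lt1.
have lb t : 1 - cmod a <= cmod (1 - conjc a * cis t).
  by have := cmod_one_sub_ge a (cis t); rewrite cmod_cis mulr1.
have pt t : cmod (1 - conjc a * cis t) `^ (- kap) <=
    ((1 - cmod a) `^ (2 - kap) / (1 - cmod a ^+ 2)) * poisson a t.
  have x0 : 0 < cmod (1 - conjc a * cis t) by exact: lt_le_trans (lb t).
  rewrite -{1}[kap](subrK 2) opprD opprB powRD; last by apply/implyP => _; rewrite gt_eqF.
  rewrite (powR_invn 2 (ltW x0)) /poisson -cmod_conj_kernel mulrA divfK ?gt_eqF//.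
  apply: ler_wpM2r; first by rewrite invr_ge0 exprn_ge0// ltW.
  by apply: powR_le0 => //; lra.
have cl : rcont01 (fun t => cmod (1 - conjc a * cis t) `^ (- kap)).
  under eq_fun do rewrite powRN.
  apply: rcont01V => [|t]; last by rewrite gt_eqF// powR_gt0// (lt_le_trans d0 (lb t)).
  apply: cont01_powR; [lra| |by move=> t; exact: cmod_ge0].
  apply: cont01_cmod; apply: cont01B; first exact: cont01_cst.
  by apply: cont01M; [exact: cont01_cst|exact: cont01_cis].
apply: le_trans (le_rint cl _ (fun t _ => pt t)) _.
  by apply: rcont01M; [exact: rcont01_cst|exact: cont01_poisson].
rewrite rintZ ?rint_poisson ?mulr1//; last exact: cont01_poisson.
have -> : (1 - cmod a) `^ (1 - kap) = (1 - cmod a) `^ (2 - kap) * (1 - cmod a)^-1.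
  rewrite -[(1 - cmod a)^-1]powR_inv1 ?(ltW d0)// -powRD; last by apply/implyP => _; rewrite gt_eqF.
  by congr (_ `^ _); ring.
apply: ler_wpM2l; first exact: powR_ge0.
by rewrite lef_pV2 ?posrE// lerD2l lerN2 expr2 ler_piMl// ltW.
Qed.

End TestKernel.

(** * Integrals of the test kernels against the weight *)

Section TestMass.
Context {R : realType}.
Local Notation mu := (@lebesgue_measure R).
Local Notation mT := (measurableTypeR R).
Variables (w : R[i] -> R) (psi : R -> R) (D : R).
Hypotheses (w_doubling : doubling w) (psiP : profile w psi) (D0 : 0 < D).
Local Notation H := (tail w).
Hypothesis fin : forall r, 0 <= r < 1 -> hatw w r = (H r)%:E.
Hypothesis pos : forall r, 0 <= r < 1 -> 0 < H r.
Hypothesis mono : forall s t, 0 <= s -> s <= t -> t < 1 -> H t <= H s.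
Hypothesis dbl : forall t, 0 <= t < 1 -> H t <= D * H ((1 + t) / 2).

(** Let i be the first index with 1 - 2^i (1 - b) <= s. If i > 0, then s lies below the previous
    threshold and 1 - b s exceeds 2^i (1 - b) / 2; if i = 0, this is clear. The i-th term alone
    therefore dominates the kernel. *)
Lemma kernel_dyadic (b s kap : R) J : 0 <= b < 1 -> 0 <= s < 1 -> 1 <= kap -> 1 <= 2 ^+ J * (1 - b) ->
  (1 - b * s) `^ (1 - kap) <= \sum_(0 <= i < J.+1)
    (2 ^+ i * (1 - b) / 2) `^ (1 - kap) * (Num.max 0 (1 - 2 ^+ i * (1 - b)) <= s)%R%:R.
Proof.
move=> b01 s01 k1 HJ.
have t0 i : 0 <= (2 ^+ i * (1 - b) / 2) `^ (1 - kap) * (Num.max 0 (1 - 2 ^+ i * (1 - b)) <= s)%R%:R.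
  by rewrite mulr_ge0 ?powR_ge0.
have ex : exists i, 1 - 2 ^+ i * (1 - b) <= s by exists J; lra.
case: (ex_minnP ex) => i iP imin.
have iJ : (i <= J)%N by apply: imin; lra.
rewrite (bigD1_seq i) ?iota_uniq//=; last by rewrite mem_index_iota ltnS.
have -> : (Num.max 0 (1 - 2 ^+ i * (1 - b)) <= s) by rewrite ge_max iP andbT; lra.
rewrite mulr1; apply: (@le_trans _ _ ((2 ^+ i * (1 - b) / 2) `^ (1 - kap))); last first.
  by rewrite lerDl sumr_ge0.
apply: powR_le0; first by rewrite divr_gt0// mulr_gt0 ?exprn_gt0//; lra.
  case: i iP imin {iJ} => [|i] iP imin.
    rewrite expr0 mul1r; have : b * s <= b * 1 by apply: ler_wpM2l; lra.
    lra.
  have : ~~ (1 - 2 ^+ i * (1 - b) <= s) by apply/negP => /imin; rewrite ltnn.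
  rewrite -ltNge => si.
  have : b * s <= 1 * s by apply: ler_wpM2r; lra.
  rewrite exprS; lra.
lra.
Qed.

(** The midpoint between threshold i + 1 and 1 is at or beyond threshold i, also when truncation at
    0 occurs, so each doubling step advances one index at the price of a factor [D]. *)
Lemma tail_dyadic (b : R) i : 0 <= b < 1 -> H (Num.max 0 (1 - 2 ^+ i * (1 - b))) <= D ^+ i * H b.
Proof.
move=> b01; have b0' := D0.
have r01 j : 0 <= Num.max 0 (1 - 2 ^+ j * (1 - b)) < 1.
  rewrite le_max lexx /= gt_max ltr01 /=.
  have : 0 < 2 ^+ j * (1 - b) by rewrite mulr_gt0 ?exprn_gt0//; lra.
  lra.
elim: i => [|i ih].
  rewrite expr0 !mul1r; have -> // : Num.max 0 (1 - (1 - b)) = b.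
  by rewrite max_r; lra.
apply: (le_trans (dbl (r01 i.+1))); rewrite [D ^+ i.+1]exprS -mulrA; apply: ler_wpM2l; first exact: ltW.
apply: le_trans ih; have := r01 i; have := r01 i.+1 => h1 h2.
apply: mono; [by case/andP: h2| |lra].
rewrite ge_max; apply/andP; split; first lra.
have : 1 - 2 ^+ i.+1 * (1 - b) <= Num.max 0 (1 - 2 ^+ i.+1 * (1 - b)) by rewrite le_max lexx orbT.
by rewrite exprS; lra.
Qed.

(** Integrating the dyadic bound produces D^i 2^(i (1 - kap)), which is at most 2^-i because 2 D <=
    2^(kap - 1): the exponent has to beat the doubling constant. *)
Lemma kernel_mass (b kap : R) : 0 <= b < 1 -> 1 <= kap -> 2 * D <= 2 `^ (kap - 1) ->
  (\int[mu]_(s in `[0%R, 1%R[) (psi s * (1 - b * s) `^ (1 - kap))%:E <=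
    (2 `^ kap * ((1 - b) `^ (1 - kap) * H b))%:E)%E.
Proof.
move=> b01 k1 k2; have [mpsi psi0 _] := psiP.
have b1 : 0 < 1 - b by lra.
have [J JP] := exists_exp2 1 b1.
have HJ : 1 <= 2 ^+ J * (1 - b).
  by move: JP; rewrite ltr_pdivrMr ?exprn_gt0// mulrC => /ltW.
pose r i : R := Num.max 0 (1 - 2 ^+ i * (1 - b)).
have r01 j : 0 <= r j < 1.
  rewrite /r le_max lexx /= gt_max ltr01 /=.
  have : 0 < 2 ^+ j * (1 - b) by rewrite mulr_gt0 ?exprn_gt0//; lra.
  lra.
pose c i : R := (2 ^+ i * (1 - b) / 2) `^ (1 - kap).
have c0 i : 0 <= c i by exact: powR_ge0.
have mle (a : R) : measurable_fun setT (fun x : mT => (a <= x)%R%:R : mT).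
  have -> : (fun x : mT => (a <= x)%R%:R : mT) = (fun x : mT => if a <= x then 1 else 0).
    by apply/funext => x; case: ifP.
  by apply: measurable_fun_ifT => //; exact: measurable_fun_ler.
pose u i (s : mT) : mT := c i * (psi s * (r i <= s)%R%:R).
have u0 i s : 0 <= u i s by apply: mulr_ge0 => //; exact: mulr_ge0.
have mu_ i : measurable_fun setT (u i).
  apply: measurable_funM; first exact: measurable_cst.
  by apply: measurable_funM; [exact: mpsi|exact: mle].
apply: (@le_trans _ _ (\int[mu]_(s in `[0%R, 1%R[) (\sum_(i < J.+1) (u i s)%:E))%E).
  apply: ge0_le_integral_any => s /=; rewrite in_itv /= => s01.
    by rewrite lee_fin mulr_ge0 ?powR_ge0.
  rewrite sumEFin lee_fin.
  apply: (le_trans (ler_wpM2l (psi0 s) (kernel_dyadic b01 s01 k1 HJ))).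
  rewrite big_mkord mulr_sumr ler_sum// => i _.
  by rewrite /u /c /r mulrCA.
rewrite ge0_integral_sum//; first last.
- by move=> i s _; rewrite lee_fin.
- by move=> i; apply/measurable_EFinP; apply: measurable_funTS; exact: mu_.
have uI i : (\int[mu]_(s in `[0%R, 1%R[) (u i s)%:E = (c i * H (r i))%:E)%E.
  rewrite /u EFinM -fin ?r01// (hatw_profile _ psiP) ?r01//; last by case: w_doubling.
  rewrite -ge0_integralZl_EFin//; first last.
  - by apply/measurable_EFinP; exact: measurable_funTS.
  - by move=> s _; rewrite lee_fin.
  rewrite [LHS]integral_mkcond [RHS]integral_mkcond; apply: eq_integral => s _; rewrite !patchE.
  rewrite !mem_setE !in_itv /=; have [ri0 _] := andP (r01 i).
  have [rs|rs] /= := leP (r i) s.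
    by rewrite (le_trans ri0 rs) /=; case: ifP => // _; rewrite mulr1 -EFinM.
  by case: ifP => // _; rewrite mulr0 mulr0.
under eq_bigr do rewrite uI.
rewrite sumEFin lee_fin.
have cH i : c i * H (r i) <= 2 `^ (kap - 1) * ((1 - b) `^ (1 - kap) * H b) * 2^-1 ^+ i.
  have Hb : 0 < H b by exact: pos.
  apply: (le_trans (ler_wpM2l (c0 i) (tail_dyadic i b01))).
  have -> : c i = 2 `^ (kap - 1) * (1 - b) `^ (1 - kap) * (2 `^ (1 - kap)) ^+ i.
    rewrite /c -mulrA powRM ?exprn_ge0 ?divr_ge0 ?(ltW b1)// powRM ?invr_ge0 ?(ltW b1)//.
    rewrite -[2^-1]powR_inv1// -powRrM mulN1r opprB.
    rewrite -(powR_mulrn i (ler0n R 2)) powRAC powR_mulrn ?powR_ge0//; ring.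
  rewrite (_ : 2 `^ (kap - 1) * (1 - b) `^ (1 - kap) * (2 `^ (1 - kap)) ^+ i * (D ^+ i * H b) =
    2 `^ (kap - 1) * ((1 - b) `^ (1 - kap) * H b) * (2 `^ (1 - kap) * D) ^+ i); last by rewrite exprMn; ring.
  apply: ler_wpM2l; first by rewrite mulr_ge0 ?powR_ge0// mulr_ge0 ?powR_ge0// ltW.
  rewrite lerXn2r ?nnegrE ?mulr_ge0 ?powR_ge0 ?(ltW D0) ?invr_ge0//.
  rewrite -opprB powRN mulrC ler_pdivrMr ?powR_gt0//; lra.
apply: (@le_trans _ _ (\sum_(i < J.+1) 2 `^ (kap - 1) * ((1 - b) `^ (1 - kap) * H b) * 2^-1 ^+ i)).
  by apply: ler_sum => i _; exact: cH.
rewrite -mulr_sumr.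
have S2 : \sum_(i < J.+1) (2^-1 : R) ^+ i <= 2.
  have -> : \sum_(i < J.+1) (2^-1 : R) ^+ i = 2 - 2^-1 ^+ J.
    elim: J {JP HJ u0 mu_ uI} => [|J ih]; first by rewrite big_ord_recr big_ord0 /= expr0; lra.
    by rewrite big_ord_recr /= ih !exprS; field.
  by rewrite lerBlDr lerDl exprn_ge0.
have A0 : 0 <= 2 `^ (kap - 1) * ((1 - b) `^ (1 - kap) * H b).
  by rewrite mulr_ge0 ?powR_ge0// mulr_ge0 ?powR_ge0// ltW// pos.
apply: (le_trans (ler_wpM2l A0 S2)).
have -> : 2 `^ kap = 2 `^ (kap - 1) * 2 :> R.
  have E1 : 2 `^ (kap - 1 + 1) = 2 `^ (kap - 1) * 2 `^ 1 :> R.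
    by rewrite powRD//; apply/implyP => _; rewrite gt_eqF.
  by rewrite subrK powRr1 in E1.
by rewrite le_eqVlt; apply/orP; left; apply/eqP; ring.
Qed.

(** Doubling forces the tail to decay at most polynomially: the kernel in [kernel_mass] is at least
    1, so its integral is at least the tail at 0. *)
Lemma tail_lower (b kap : R) : 0 <= b < 1 -> 1 <= kap -> 2 * D <= 2 `^ (kap - 1) ->
  (1 - b) `^ kap <= 2 `^ kap / H 0 * wgt H b.
Proof.
move=> b01 k1 k2; have [mpsi psi0 _] := psiP.
have o01 : 0 <= (0 : R) < 1 by rewrite lexx ltr01.
have H0 := pos o01; have b1 : 0 < 1 - b by lra.
have : H 0 <= 2 `^ kap * ((1 - b) `^ (1 - kap) * H b).
  rewrite -lee_fin; apply: le_trans (kernel_mass b01 k1 k2).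
  rewrite -fin// (hatw_profile _ psiP)//; last by case: w_doubling.
  apply: ge0_le_integral_any => s /=; rewrite in_itv /= => s01; first by rewrite lee_fin.
  rewrite lee_fin ler_peMr// -[leLHS](powRr0 (1 - b * s)).
  have bs0 : 0 <= b * s by rewrite mulr_ge0//; lra.
  have bs1 : b * s < 1.
    by apply: (@le_lt_trans _ _ (b * 1)); [apply: ler_wpM2l; lra|rewrite mulr1; lra].
  by apply: ger_powR; lra.
rewrite powRD; last by apply/implyP => _; rewrite gt_eqF.
rewrite powRr1 ?(ltW b1)// powRN => H1; rewrite /wgt.
have P0 : 0 < (1 - b) `^ kap by rewrite powR_gt0.
move: (2 `^ kap) ((1 - b) `^ kap) P0 H1 => X P P0 H1.
rewrite (_ : X / H 0 * ((1 - b) * H b) = X * ((1 - b) * H b) / H 0); last by ring.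
rewrite ler_pdivlMr// (_ : X * ((1 - b) * H b) = P * (X * ((1 - b) / P * H b))); first by rewrite ler_pM2l.
by field; rewrite gt_eqF.
Qed.

End TestMass.

(** The scalar [lam] normalises the kernel of exponent [gam]: the mass is bounded by [rint_kernel]
    on each circle and by [kernel_mass] in the radius, and the powers of 1 - |a| and of the tail
    cancel. *)
Theorem test_functions (R : realType) (w : R[i] -> R) (psi : R -> R) (p : R) (k : nat) :
  doubling w -> profile w psi -> 0 < p ->
  exists B c : R, exists F : R[i] -> R[i] -> R[i], [/\ 0 < B, 0 < c
  & forall a, cmod a < 1 -> [/\ holo 1 (F a), (mass w p (F a) <= B%:E)%E
    & c * ((1 - cmod a) `^ (- k%:R) * wgt (tail w) (cmod a) `^ (- p^-1)) <= cmod (cderiv k (F a) a)]] /\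
  (forall rho e : R, 0 <= rho < 1 -> 0 < e -> exists2 sig : R, 0 <= sig < 1 &
    forall a z, sig < cmod a < 1 -> cmod z <= rho -> cmod (F a z) <= e).
Proof.
move=> wd psiP p0; have [D D0 [fin pos mono dbl]] := tail_spec wd psiP.
have [mpsi psi0 _] := psiP.
(* Large enough both for the circle integral, which wants an exponent at least 2, and for the
   convergence of the dyadic sum. *)
have [g0 [g02 g0D]] : exists g0 : nat, 2 <= g0%:R * p /\ 2 * D <= 2 `^ (g0%:R * p - 1).
  have [J JP] := exists_exp2 (2 * D) (ltr01 : 0 < 1 :> R).
  have J2 : 2 * D <= 2 `^ J%:R.
    by rewrite powR_mulrn//; move: JP; rewrite ltr_pdivrMr ?exprn_gt0// mul1r => /ltW.
  have [g0 g0P] : exists g0 : nat, (J.+2%:R : R) / p < g0%:R by exists (Num.bound ((J.+2%:R : R) / p)); apply: archi_boundP; rewrite divr_ge0// ltW.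
  have g0P' : J.+2%:R <= g0%:R * p by move: g0P; rewrite ltr_pdivrMr// => /ltW.
  have J0 : 0 <= J%:R :> R by [].
  rewrite -!natr1 in g0P'; exists g0; split; first lra.
  by apply: (le_trans J2); apply: ler_powR; lra.
(* With g0 powers of 1 - |a| the scalar is already bounded, by [tail_lower]. The additional one is
   the factor that drives the functions to 0 as |a| tends to 1. *)
pose gam := g0.+1; pose kap : R := gam%:R * p.
have gE : kap = g0%:R * p + p by rewrite /kap /gam -natr1; ring.
have k2 : 2 <= kap by lra.
have kD : 2 * D <= 2 `^ (kap - 1) by apply: (le_trans g0D); apply: ler_powR; lra.
pose lam b := (1 - b) ^+ gam * wgt (tail w) b `^ (- p^-1).
pose F a z := (lam (cmod a))%:C * test_fun gam k a z.
have ip : 0 < p^-1 by rewrite invr_gt0.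
have lam0 b : 0 <= b < 1 -> 0 <= lam b.
  by move=> b01; rewrite mulr_ge0 ?powR_ge0// exprn_ge0//; lra.
exists (2 * 2 `^ kap), (k`!%:R / 2 ^+ (gam + k)), F; split; last first.
  move=> rho e rho01 e0.
  have g1 : 1 <= g0%:R * p by lra.
  have H0 : 0 < tail w 0 by apply: pos; rewrite lexx ltr01.
  pose K := 2 `^ (g0%:R * p) / tail w 0.
  have K0 : 0 < K by rewrite divr_gt0 ?powR_gt0.
  pose X := K `^ p^-1 * (1 - rho) ^- gam.
  have X0 : 0 < X by rewrite mulr_gt0 ?powR_gt0// invr_gt0 exprn_gt0//; lra.
  (* On |z| <= rho the functions are at most (1 - |a|) X. *)
  exists (Num.max 0 (1 - e / X)).
    by rewrite le_max lexx /= gt_max ltr01 /= ltrBlDr ltrDl divr_gt0.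
  move=> a z /andP[]; rewrite gt_max => /andP[_ ea] a1 zr.
  have a0 := cmod_ge0 a; have a01 : 0 <= cmod a < 1 by rewrite a0.
  have z0 := cmod_ge0 z; have z1 : cmod z < 1 by lra.
  have W0 : 0 < wgt (tail w) (cmod a) by exact: weight_gt0.
  rewrite /F cmodM cmodR_ge0 ?lam0//.
  have b0 : 0 < 1 - cmod a by rewrite subr_gt0.
  have lamX : lam (cmod a) <= (1 - cmod a) * K `^ p^-1.
    rewrite /lam exprS -mulrA ler_wpM2l ?(ltW b0)//.
    have := tail_lower wd psiP D0 fin pos mono dbl a01 g1 g0D; rewrite -/K => Hl.
    have -> : (1 - cmod a) ^+ g0 = ((1 - cmod a) `^ (g0%:R * p)) `^ p^-1.
      by rewrite -powRrM mulfK ?gt_eqF// powR_mulrn// ltW.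
    apply: (@le_trans _ _ ((K * wgt (tail w) (cmod a)) `^ p^-1 * wgt (tail w) (cmod a) `^ (- p^-1))).
      apply: ler_wpM2r; first exact: powR_ge0.
      by apply: ge0_ler_powR; rewrite ?nnegrE ?powR_ge0 ?(ltW ip)// mulr_ge0// ltW.
    rewrite powRM ?(ltW K0) ?(ltW W0)// -mulrA -powRD ?subrr ?powRr0 ?mulr1//.
    by apply/implyP => _; rewrite (gt_eqF W0).
  have dz : 1 - rho <= cmod (1 - conjc a * z).
    apply: le_trans (cmod_one_sub_ge a z); rewrite lerD2l lerN2.
    by apply: le_trans zr; rewrite ler_piMl// ltW.
  have rr : 0 < 1 - rho by rewrite subr_gt0; case/andP: rho01.
  have tz : cmod (test_fun gam k a z) <= (1 - rho) ^- gam.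
    apply: (le_trans (cmod_test_fun_le gam k a1 z1)).
    rewrite lef_pV2 ?posrE ?exprn_gt0//; last by apply: lt_le_trans dz.
    by rewrite lerXn2r ?nnegrE ?cmod_ge0// ltW.
  apply: (@le_trans _ _ ((1 - cmod a) * X)).
    rewrite /X mulrA; apply: ler_pM => //; [exact: lam0|exact: cmod_ge0].
  by rewrite -ler_pdivlMr//; lra.
split; first by rewrite mulr_gt0// powR_gt0.
  by rewrite divr_gt0 ?exprn_gt0// ltr0n fact_gt0.
move=> a a1; have a0 := cmod_ge0 a; have a01 : 0 <= cmod a < 1 by rewrite a0.
have b0 : 0 < 1 - cmod a by rewrite subr_gt0.
have W0 : 0 < wgt (tail w) (cmod a) by exact: weight_gt0.
have hT := holo_test_fun gam k a1.
have hF : holo 1 (F a) by apply: holoM => //; exact: holo_cst.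
split => //; last first.
  rewrite /F (cderivZ _ hT)// cmodM cmodR_ge0 ?lam0//.
  have := ler_wpM2l (lam0 _ a01) (cderiv_test_fun gam k a1); apply: le_trans.
  rewrite /lam powR_invn ?(ltW b0)// exprMn exprD.
  rewrite le_eqVlt; apply/orP; left; apply/eqP.
  move: (wgt _ _ `^ _) (k`!%:R : R) => x y.
  by rewrite [(1 - cmod a) ^+ (gam + k)]exprD; field; rewrite !expf_neq0 ?gt_eqF.
rewrite (mass_polar wd psiP p0 hF).
pose L := lam (cmod a) `^ p.
have LE : L = (1 - cmod a) `^ kap * (wgt (tail w) (cmod a))^-1.
  rewrite /L /lam powRM ?powR_ge0 ?exprn_ge0 ?(ltW b0)// -powRrM mulNr mulVf ?gt_eqF//.
  by rewrite powR_inv1 ?(ltW W0)// -powR_mulrn ?(ltW b0)// -powRrM.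
have L0 : 0 <= L by exact: powR_ge0.
have cm s : 0 < s < 1 -> circle_mean (fun z => cmod (F a z) `^ p) s <= L * (1 - cmod a * s) `^ (1 - kap).
  move=> s01; have [s0 s1] := andP s01.
  pose a' := s%:C * a.
  have a'E : cmod a' = cmod a * s by rewrite /a' cmodM cmodR_ge0 ?(ltW s0)// mulrC.
  have a'1 : cmod a' < 1.
    rewrite a'E; apply: (@le_lt_trans _ _ (cmod a * 1)); last by rewrite mulr1.
    by apply: ler_wpM2l => //; exact: ltW.
  have := rint_kernel a'1 k2; rewrite a'E => Hr.
  have ck : rcont01 (fun t => cmod (1 - conjc a' * cis t) `^ (- kap)).
    under eq_fun do rewrite powRN.
    have nz t : 0 < cmod (1 - conjc a' * cis t).
      apply: lt_le_trans (cmod_one_sub_ge a' (cis t)); rewrite cmod_cis mulr1; lra.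
    apply: rcont01V => [|t]; last by rewrite gt_eqF// powR_gt0.
    apply: cont01_powR; [lra| |by move=> t; exact: cmod_ge0].
    apply: cont01_cmod; apply: cont01B; first exact: cont01_cst.
    by apply: cont01M; [exact: cont01_cst|exact: cont01_cis].
  apply: le_trans (ler_wpM2l L0 Hr); rewrite -rintZ//; apply: le_rint.
  - apply: (@rcont01_circle _ (fun z => cmod (F a z) `^ p)); first by rewrite (ltW s0).
    exact: disk_cont_cmod_powR.
  - by apply: rcont01M => //; exact: rcont01_cst.
  move=> t _; set z := s%:C * cis t.
  have z1 : cmod z < 1 by rewrite cmod_circle// ltW.
  have zE : conjc a' * cis t = conjc a * z.
    rewrite /a' /z (_ : conjc (s%:C * a) = s%:C * conjc a); first by ring.
    by case: (a) => x y; apply/eqP; rewrite eq_complex /=; apply/andP; split; apply/eqP; ring.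
  rewrite zE /F cmodM cmodR_ge0 ?lam0// powRM ?lam0 ?cmod_ge0// -/L ler_wpM2l//.
  have x0 : 0 < cmod (1 - conjc a * z) by rewrite cmod_gt0 one_sub_neq0.
  apply: (@le_trans _ _ ((cmod (1 - conjc a * z) ^- gam) `^ p)).
    apply: ge0_ler_powR; rewrite ?nnegrE ?(ltW p0) ?cmod_ge0//.
      by rewrite invr_ge0 exprn_ge0// ltW.
    exact: cmod_test_fun_le.
  by rewrite -powR_invn ?(ltW x0)// -powRrM mulNr.
apply: (@le_trans _ _ (\int[@lebesgue_measure R]_(s in `[0%R, 1%R[) ((2 * L)%:E * (psi s * (1 - cmod a * s) `^ (1 - kap))%:E))%E).
  rewrite [leLHS]integral_mkcond [leRHS]integral_mkcond; apply: ge0_le_integral_any => s _; rewrite !patchE.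
    case: ifPn => // /set_mem; rewrite /= in_itv /= => s01; rewrite lee_fin mulr_ge0//.
      by rewrite mulr_ge0//; lra.
    by apply: rint_ge0 => t _; exact: powR_ge0.
  rewrite !mem_setE !in_itv /=; case: ifPn => [s01|_]; last first.
    by case: ifP => // _; rewrite -EFinM lee_fin !mulr_ge0 ?powR_ge0.
  have [s0 s1] := andP s01; rewrite (ltW s0) s1 /= -EFinM lee_fin.
  have c0 : 0 <= 2 * s * psi s by rewrite mulr_ge0//; lra.
  apply: (le_trans (ler_wpM2l c0 (cm s s01))).
  set Y := _ `^ (1 - kap); have Y0 : 0 <= Y by exact: powR_ge0.
  rewrite (_ : 2 * s * psi s * (L * Y) = s * (2 * L * (psi s * Y))); last by ring.
  by rewrite ler_piMl ?(ltW s1)// !mulr_ge0.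
have mk : measurable_fun setT (fun s : measurableTypeR R => psi s * (1 - cmod a * s) `^ (1 - kap) : measurableTypeR R).
  apply: measurable_funM => //; apply: (measurableT_comp (@measurable_powR R (1 - kap))).
  by apply: measurable_funB => //; exact: measurable_funM.
rewrite ge0_integralZl_EFin//; first last.
- by rewrite mulr_ge0.
- by apply/measurable_EFinP; exact: measurable_funTS.
- by move=> s _; rewrite lee_fin mulr_ge0 ?powR_ge0.
have k1 : 1 <= kap by lra.
have := kernel_mass wd psiP D0 fin pos mono dbl a01 k1 kD => Hk.
apply: (@le_trans _ _ ((2 * L)%:E * (2 `^ kap * ((1 - cmod a) `^ (1 - kap) * tail w (cmod a)))%:E)%E).
  by apply: lee_wpmul2l => //; rewrite lee_fin mulr_ge0.
rewrite -EFinM lee_fin LE /wgt.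
have H0 : 0 < tail w (cmod a) by exact: pos.
rewrite powRD; last by apply/implyP => _; rewrite gt_eqF.
rewrite powRr1 ?(ltW b0)// powRN le_eqVlt; apply/orP; left; apply/eqP.
by field; rewrite !gt_eqF ?powR_gt0.
Qed.

(** * Scaling, sums and limits of the mass *)

Section MassRules.
Context {R : realType}.
Local Notation mu := (@lebesgue_measure R).
Local Notation mT := (measurableTypeR R).

Variables (w : R[i] -> R) (psi : R -> R) (p : R).
Hypotheses (w_doubling : doubling w) (psiP : profile w psi) (p0 : 0 < p).
Implicit Types (f g h : R[i] -> R[i]).

Lemma eq_mass f g : (forall z, cmod z < 1 -> f z = g z) -> mass w p f = mass w p g.
Proof. by move=> fg; apply: eq_integral => u /set_mem Du; rewrite fg. Qed.

Let psi0 s : 0 <= psi s. Proof. by case: psiP. Qed.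
Let mpsi : measurable_fun setT (psi : mT -> mT). Proof. by case: psiP. Qed.

Let mpsi' : measurable_fun (`]0, 1[%classic : set mT) (fun s : mT => 2 * s * psi s).
Proof. by apply: measurable_funM; [apply: measurable_funM => //; exact: measurable_id|exact: measurable_funTS]. Qed.

Let n0 (s : R) : (`]0, 1[%classic : set mT) s -> 0 <= 2 * s * psi s.
Proof. by have psi0' := psi0; rewrite /= in_itv /= => s01; rewrite mulr_ge0//; lra. Qed.

Let M f (s : R) := circle_mean (fun z => cmod (f z) `^ p) s.

Let M0 f s : 0 <= M f s. Proof. by apply: rint_ge0 => t _; exact: powR_ge0. Qed.

Let mM f : holo 1 f -> measurable_fun (`]0, 1[%classic : set mT) (fun s : mT => (2 * s * psi s * M f s)%:E).
Proof.
move=> hf; apply/measurable_EFinP; apply: measurable_funM => //.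
apply: measurable_circle_mean; first by move=> z; exact: powR_ge0.
exact: disk_cont_cmod_powR.
Qed.

Let nM f (s : R) : (`]0, 1[%classic : set mT) s -> (0 <= (2 * s * psi s * M f s)%:E)%E.
Proof. by move=> /n0 ?; rewrite lee_fin mulr_ge0. Qed.

Lemma circle_mean_add_le f g h (s : R) : 0 <= s < 1 -> holo 1 f -> holo 1 g -> holo 1 h ->
  (forall z, cmod z < 1 -> f z = g z + h z) ->
  circle_mean (fun z => cmod (f z) `^ p) s <=
  2 `^ p * (circle_mean (fun z => cmod (g z) `^ p) s + circle_mean (fun z => cmod (h z) `^ p) s).
Proof.
move=> s01 hf hg hh fE.
have cont u : holo 1 u -> rcont01 (fun t : R => cmod (u (s%:C * cis t)) `^ p).
  by move=> hu; apply: (@rcont01_circle _ (fun z => cmod (u z) `^ p)) => //; exact: disk_cont_cmod_powR.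
have cg := cont g hg; have ch := cont h hh; have cf := cont f hf.
rewrite /circle_mean -rintD// -rintZ; last exact: rcont01D.
apply: le_rint => //; first by apply: rcont01M; [exact: rcont01_cst|exact: rcont01D].
move=> t _; have [s0 s1] := andP s01.
rewrite fE; last by rewrite cmod_circle.
apply: le_trans (powR_add_le p0 (cmod_ge0 _) (cmod_ge0 _)).
by apply: ge0_ler_powR; rewrite ?nnegrE ?cmod_ge0 ?addr_ge0 ?cmod_ge0 ?(ltW p0)// cmodD.
Qed.

Lemma mass_scale (a : R) f : 0 <= a -> holo 1 f ->
  mass w p (fun z => a%:C * f z) = ((a `^ p)%:E * mass w p f)%E.
Proof.
move=> a0 hf; have haf : holo 1 (fun z => a%:C * f z) by apply: holoM => //; exact: holo_cst.
rewrite (mass_polar w_doubling psiP p0 haf) (mass_polar w_doubling psiP p0 hf).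
rewrite -ge0_integralZl_EFin ?powR_ge0//; first last.
- exact: mM.
- exact: nM.
apply: eq_integral => s /set_mem; rewrite /= in_itv /= => s01; rewrite -EFinM; congr EFin.
have cf : rcont01 (fun t : R => cmod (f (s%:C * cis t)) `^ p).
  apply: (@rcont01_circle _ (fun z => cmod (f z) `^ p)); last exact: disk_cont_cmod_powR.
  by case/andP: s01 => /ltW -> ->.
rewrite mulrCA; congr (_ * _); rewrite /circle_mean -rintZ//; apply: eq_rint => t _.
by rewrite cmodM cmodR_ge0// powRM// cmod_ge0.
Qed.

Lemma mass_add_le f g h : holo 1 f -> holo 1 g -> holo 1 h ->
  (forall z, cmod z < 1 -> f z = g z + h z) ->
  (mass w p f <= (2 `^ p)%:E * (mass w p g + mass w p h))%E.
Proof.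
move=> hf hg hh fE; rewrite !(mass_polar w_doubling psiP p0)//.
rewrite -ge0_integralD//; [|exact: nM|exact: mM|exact: nM|exact: mM].
rewrite -ge0_integralZl_EFin ?powR_ge0//; first last.
- by apply: emeasurable_funD; exact: mM.
- by move=> s s01; rewrite adde_ge0//; exact: nM.
apply: ge0_le_integral_any => s s01; first exact: nM.
rewrite -EFinD -EFinM lee_fin -mulrDr mulrCA; apply: ler_wpM2l; first exact: n0.
apply: circle_mean_add_le => //; move: s01; rewrite /= in_itv /=.
by case/andP => /ltW -> ->.
Qed.

Lemma massB_le f g : holo 1 f -> holo 1 g ->
  (mass w p (fun z => (f z - g z)%R) <= (2 `^ p)%:E * (mass w p f + mass w p g))%E.
Proof.
move=> hf hg; rewrite (_ : mass w p g = mass w p (fun z => - g z)).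
  apply: mass_add_le => //; first exact: holoB.
  by move=> z z1; have [d gd] := hg z z1; exists (- d); exact: cdiffN.
by apply: eq_integral => u _; rewrite cmodN.
Qed.

(** Fatou's lemma in the radius. On each circle [f] is eventually within 1 of F_j, so |f|^p <= 2^p
    (|F_j|^p + 1), and the summand 1 costs twice the tail at 0. *)
Lemma mass_limit_le (F : nat -> R[i] -> R[i]) f (B : R) : 0 <= B ->
  (forall j, holo 1 (F j) /\ (mass w p (F j) <= B%:E)%E) -> holo 1 f ->
  (forall s : R, 0 < s < 1 -> exists N : nat, forall j z, (N <= j)%N -> cmod z = s -> cmod (f z - F j z) <= 1) ->
  (mass w p f <= (2 `^ p * (B + 2 * tail w 0))%:E)%E.
Proof.
move=> B0 HF hf near1; pose u j (s : R) := ((2 `^ p)%:E * ((2 * s * psi s * M (F j) s)%:E + (2 * s * psi s)%:E))%E.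
have u0 j s : (`]0, 1[%classic : set mT) s -> (0 <= u j s)%E.
  move=> s01; apply: mule_ge0; first by rewrite lee_fin powR_ge0.
  by apply: adde_ge0; [exact: nM|rewrite lee_fin n0].
have mu1 : measurable_fun (`]0, 1[%classic : set mT) (fun s : mT => (2 * s * psi s)%:E) by exact/measurable_EFinP.
have mS j : measurable_fun (`]0, 1[%classic : set mT) (fun s : mT => (2 * s * psi s * M (F j) s)%:E + (2 * s * psi s)%:E)%E.
  by apply: emeasurable_funD => //; exact: (mM (HF j).1).
have mu_ j : measurable_fun (`]0, 1[%classic : set mT) (u j) by exact: measurable_funeM.
have uB j : (\int[mu]_(s in `]0%R, 1%R[) u j s <= (2 `^ p * (B + 2 * tail w 0))%:E)%E.
  rewrite ge0_integralZl_EFin ?powR_ge0//; last 1 first.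
    by move=> s s01; rewrite adde_ge0//; [exact: nM|rewrite lee_fin n0].
  rewrite ge0_integralD//; try solve [exact: nM|exact: (mM (HF j).1)|by move=> s s01; rewrite lee_fin n0].
  rewrite EFinM; apply: lee_wpmul2l; first by rewrite lee_fin powR_ge0.
  rewrite EFinD; apply: leeD; last exact: (profile_integral_le w_doubling psiP).
  by rewrite -(mass_polar w_doubling psiP p0 (HF j).1); exact: (HF j).2.
apply: (@le_trans _ _ (limn_einf (fun j => \int[mu]_(s in `]0%R, 1%R[) u j s)%E)).
  apply: le_trans (fatou _ _ mu_ u0); last exact: measurable_itv.
  rewrite (mass_polar w_doubling psiP p0 hf); apply: ge0_le_integral_any => s s01; first exact: nM.
  have s01' : 0 < s < 1 by move: s01; rewrite /= in_itv.
  have s01'' : 0 <= s < 1 by case/andP: s01' => /ltW -> ->.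
  have [N HN] := near1 s s01'; rewrite limn_einf_lim; apply: lime_ge; first exact: is_cvg_einfs.
  exists N => // j /= Nj; apply: le_ereal_inf_tmp => _ [i /= ji <-].
  have Ni := leq_trans Nj ji; rewrite /u -EFinD -EFinM lee_fin.
  rewrite -[X in _ + X]mulr1 -mulrDr mulrCA; apply: ler_wpM2l; first exact: n0.
  have hd : holo 1 (fun z => f z - F i z) by apply: holoB => //; exact: (HF i).1.
  have fE z : cmod z < 1 -> f z = F i z + (f z - F i z) by move=> _; ring.
  apply: (le_trans (circle_mean_add_le s01'' hf (HF i).1 hd fE)).
  rewrite ler_wpM2l ?powR_ge0// lerD2l -(rint_cst 1); apply: le_rint; last 2 first.
  - exact: rcont01_cst.
  - move=> t _; have <- : 1 `^ p = 1 :> R by rewrite powR1.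
    apply: ge0_ler_powR; rewrite ?nnegrE ?cmod_ge0 ?(ltW p0)//.
    by apply: HN => //; rewrite cmod_circle// ltW//; case/andP: s01'.
  apply: (@rcont01_circle _ (fun z => cmod (f z - F i z) `^ p)) => //.
  exact: (disk_cont_cmod_powR p0 hd).
rewrite limn_einf_lim; apply: lime_le; first exact: is_cvg_einfs.
near=> j; apply: le_trans (uB j); apply: ereal_inf_lbound; exists j => //=.
Unshelve. all: by end_near. Qed.

End MassRules.

(** * Limits along an ultrafilter *)

Section UltraLimits.
Context {R : realType}.
Variables (U : set_system nat) (UU : UltraFilter U).
Implicit Types (x y : nat -> R[i]) (a b : R[i]).

Let FU : Filter U. Proof. exact: (@ultra_proper _ _ UU). Qed.

(** Along an ultrafilter every bounded sequence converges, so pointwise limits exist at all points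
    of the disk at once, before any subsequence is extracted. *)
Definition ulim x a := forall e : R, 0 < e -> U [set j | cmod (x j - a) < e].

(** Compactness gives a cluster point of the image filter. If a neighbourhood of it were missing
    from that filter, its complement would belong to the filter, contrary to clustering. *)
Lemma ultra_limit_real (x : nat -> R) (M : R) : (forall j, `|x j| <= M) ->
  exists l : R, forall e : R, 0 < e -> U [set j | `|x j - l| < e].
Proof.
move=> xM; have := @segment_compact R (- M) M.
have PU := @ultra_proper _ _ UU.
have xI : (x @ U) [set` `[- M, M]].
  apply: (@filterE _ U _ [set j | x j \in `[- M, M]]) => j /=.
  by rewrite in_itv /= -ler_norml.
move=> /(_ (x @ U) _ xI)[l [_ ll]]; exists l => e e0.
have [//|nU] := in_ultra_setVsetC [set j | `|x j - l| < e] UU.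
have nB : nbhs l [set y : R | `|y - l| < e].
  by apply/nbhs_ballP; exists e => //= y; rewrite /ball /= distrC.
have [y [ny yl]] := ll [set y : R | ~ `|y - l| < e] _ nU nB.
by [].
Qed.

Lemma ulim_exists x (M : R) : (forall j, cmod (x j) <= M) -> exists a, ulim x a.
Proof.
move=> xM.
have [u uP] := @ultra_limit_real (fun j => complex.Re (x j)) M (fun j => le_trans (norm_Re_le _) (xM j)).
have [v vP] := @ultra_limit_real (fun j => complex.Im (x j)) M (fun j => le_trans (norm_Im_le _) (xM j)).
exists (u +i* v) => e e0; have e2 : 0 < e / 2 by rewrite divr_gt0.
apply: filterS2 (uP _ e2) (vP _ e2) => j /= h1 h2.
apply: (le_lt_trans (cmod_le_Re_Im _)).
by rewrite !(cReD, cImD, cReN, cImN) /=; lra.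
Qed.

Lemma ulim_cst a : ulim (fun=> a) a.
Proof. by move=> e e0; apply: filterE => j /=; rewrite subrr cmod0. Qed.

Lemma ulimB x y a b : ulim x a -> ulim y b -> ulim (fun j => x j - y j) (a - b).
Proof.
move=> xa yb e e0; have e2 : 0 < e / 2 by rewrite divr_gt0.
apply: filterS2 (xa _ e2) (yb _ e2) => j /= h1 h2.
rewrite (_ : x j - y j - (a - b) = (x j - a) - (y j - b)); last by ring.
by apply: (le_lt_trans (cmodB _ _)); lra.
Qed.

Lemma ulimD x y a b : ulim x a -> ulim y b -> ulim (fun j => x j + y j) (a + b).
Proof.
move=> xa yb e e0; have e2 : 0 < e / 2 by rewrite divr_gt0.
apply: filterS2 (xa _ e2) (yb _ e2) => j /= h1 h2.
rewrite (_ : x j + y j - (a + b) = (x j - a) + (y j - b)); last by ring.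
by apply: (le_lt_trans (cmodD _ _)); lra.
Qed.

Lemma ulimMr x a b : ulim x a -> ulim (fun j => x j * b) (a * b).
Proof.
move=> xa e e0; have b1 : 0 < cmod b + 1 by have := cmod_ge0 b; lra.
apply: filterS (xa _ (divr_gt0 e0 b1)) => j /= h1.
rewrite -mulrBl cmodM; move: h1; rewrite ltr_pdivlMr//; apply: le_lt_trans.
by rewrite ler_wpM2l ?cmod_ge0//; lra.
Qed.

Lemma ulim_sum N (x : nat -> nat -> R[i]) (a : nat -> R[i]) : (forall i, ulim (x i) (a i)) ->
  ulim (fun j => \sum_(i < N) x i j) (\sum_(i < N) a i).
Proof.
move=> xa; elim: N => [|N ih].
  rewrite big_ord0; under eq_fun do rewrite big_ord0; exact: ulim_cst.
rewrite big_ord_recr /=; under eq_fun do rewrite big_ord_recr /=.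
exact: ulimD.
Qed.

Lemma ulim_cmod_le x a (M : R) : ulim x a -> (forall j, cmod (x j) <= M) -> cmod a <= M.
Proof.
move=> xa xM; rewrite leNgt; apply/negP => Ma.
have e0 : 0 < cmod a - M by rewrite subr_gt0.
have [j /= h] := @filter_ex _ _ (@ultra_proper _ _ UU) _ (xa _ e0).
have := cmod_lb a (a - x j); rewrite (_ : a - (a - x j) = x j); last by ring.
by have := xM j; rewrite cmod_distC in h; lra.
Qed.

End UltraLimits.

(** * Montel's theorem *)

Section Montel.
Context {R : realType}.
Implicit Types (F : nat -> R[i] -> R[i]).

Lemma taylor_coef_le r rho (f : R[i] -> R[i]) (M : R) i : holo r f -> 0 < rho < r ->
  (forall z, cmod z <= rho -> cmod (f z) <= M) -> cmod (taylor_coef rho f i) <= M / rho ^+ i.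
Proof.
move=> hf /andP[r0 rr] fM; apply: cmod_cint_le => [|t _].
  apply: cont01M.
    apply: cont01_comp; last exact: cont01_circ.
    by move=> t _; apply: (holo_ccont hf); rewrite cmod_circ ?ltW.
  by apply: cont01V => [|t _]; [apply: cont01X; exact: cont01_circ|rewrite expf_neq0 ?circ_neq0].
rewrite cmodf cmodX cmod_circ ?(ltW r0)// ler_wpM2r ?invr_ge0 ?exprn_ge0 ?(ltW r0)//.
by apply: fM; rewrite cmod_circ ?(ltW r0).
Qed.

Lemma rint_circ_le r rho (f : R[i] -> R[i]) (M : R) : holo r f -> 0 < rho < r ->
  (forall z, cmod z <= rho -> cmod (f z) <= M) -> rint (fun t => cmod (f (circ rho t))) <= M.
Proof.
move=> hf /andP[r0 rr] fM; rewrite -(rint_cst M); apply: le_rint; last 2 first.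
- exact: rcont01_cst.
- by move=> t _; apply: fM; rewrite cmod_circ ?(ltW r0).
apply: cont01_cmod; apply: cont01_comp; last exact: cont01_circ.
by move=> t _; apply: (holo_ccont hf); rewrite cmod_circ ?ltW.
Qed.

Section UltraLimitFunction.
Variables (U : set_system nat) (UU : UltraFilter U) (F : nat -> R[i] -> R[i]) (f : R[i] -> R[i]).
Hypotheses (hF : forall j, holo 1 (F j))
  (bF : forall rho : R, 0 < rho < 1 -> exists M : R, forall j z, cmod z <= rho -> cmod (F j z) <= M)
  (fP : forall z, cmod z < 1 -> ulim U (fun j => F j z) (f z)).

Let FU : Filter U. Proof. exact: (@ultra_proper _ _ UU). Qed.

(** The first-order Taylor remainders at [z] are bounded by a multiple of |h|^2 uniformly in j, so
    the bound survives the limit; the derivative is the limit of the first Taylor coefficients. *)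
Lemma ulim_holo : holo 1 f.
Proof.
move=> z z1; have z0 := cmod_ge0 z.
pose r := (1 - cmod z) / 2; have r0 : 0 < r by rewrite /r; lra.
have [M MP] : exists M : R, forall j u, cmod u <= (1 + cmod z) / 2 -> cmod (F j u) <= M by apply: bF; lra.
have M0 : 0 <= M by apply: le_trans (cmod_ge0 (F 0%N 0)) _; apply: MP; rewrite cmod0; lra.
pose G j h := F j (z + 1 * h).
have hG j : holo (1 - cmod z) (G j).
  apply: (@holo_comp_affine _ 1) => // h hz; rewrite mul1r.
  by have := cmodD z h; lra.
have GM j h : cmod h <= r -> cmod (G j h) <= M.
  move=> hr; apply: MP; rewrite mul1r; apply: (le_trans (cmodD _ _)); move: hr; rewrite /r; lra.
have rr : 0 < r < 1 - cmod z by apply/andP; split => //; rewrite /r; lra.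
(* For one term and at the centre the remainder bound is 0, which identifies the zeroth
   coefficient. *)
have c0E j : taylor_coef r (G j) 0 = F j z.
  have := taylor_remainder (hG j) rr (z := 0) 1.
  rewrite cmod0 mul0r expr1 !mul0r big_ord1 expr0 mulr1 => /(_ r0) h.
  have : cmod (G j 0 - taylor_coef r (G j) 0) == 0 by rewrite eq_le h cmod_ge0.
  by rewrite cmod_eq0 subr_eq0 /G mul1r addr0 => /eqP.
have [d dP] : exists d, ulim U (fun j => taylor_coef r (G j) 1) d.
  apply: ulim_exists => j.
  exact: (taylor_coef_le 1 (hG j) rr (GM j)).
exists d => e e0; pose K := 2 * M / r ^+ 2.
have K0 : 0 <= K by apply: divr_ge0; [exact: mulr_ge0|apply: exprn_ge0; exact: ltW].
have K1 : 0 < K + 1 by lra.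
exists (Num.min (r / 2) (e / (K + 1))).
  by rewrite lt_min; apply/andP; split; exact: divr_gt0.
move=> h; rewrite lt_min => /andP[hr he]; have h0 := cmod_ge0 h.
have hz : cmod (z + h) < 1 by have := cmodD z h; move: hr; rewrite /r; lra.
have L : ulim U (fun j => F j (z + h) - F j z - taylor_coef r (G j) 1 * h) (f (z + h) - f z - d * h).
  by apply: ulimB; [apply: ulimB; exact: fP|exact: ulimMr].
have : cmod (f (z + h) - f z - d * h) <= K * cmod h ^+ 2.
  apply: (ulim_cmod_le UU L) => j.
  have hr' : cmod h < r by lra.
  have := taylor_remainder (hG j) rr 2 hr'.
  rewrite !big_ord_recr big_ord0 /= add0r expr0 mulr1 expr1 c0E.
  rewrite (_ : G j h - (F j z + taylor_coef r (G j) 1 * h) =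
    F j (z + h) - F j z - taylor_coef r (G j) 1 * h); last by rewrite /G mul1r; ring.
  move=> H; apply: (le_trans H).
  have q0 : 0 <= r / (r - cmod h) by rewrite divr_ge0 ?(ltW r0)//; lra.
  have I := rint_circ_le (hG j) rr (GM j).
  have q2 : r / (r - cmod h) <= 2 by rewrite ler_pdivrMr//; lra.
  have x0 : 0 <= (cmod h / r) ^+ 2 by rewrite exprn_ge0// divr_ge0// ltW.
  apply: (@le_trans _ _ ((cmod h / r) ^+ 2 * (r / (r - cmod h)) * M)).
    by apply: ler_wpM2l => //; exact: mulr_ge0.
  apply: (@le_trans _ _ ((cmod h / r) ^+ 2 * 2 * M)).
    by apply: ler_wpM2r => //; exact: ler_wpM2l.
  rewrite /K expr_div_n le_eqVlt; apply/orP; left; apply/eqP; ring.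
move=> H; apply: (le_trans H); rewrite expr2 mulrA ler_wpM2r//.
move: he; rewrite ltr_pdivlMr// mulrC => /ltW; apply: le_trans; rewrite ler_wpM2r//; lra.
Qed.

(** Taylor tails on |z| <= rho are small uniformly in j, and the finitely many remaining
    coefficients converge; pointwise limits thus become uniform. *)
Lemma ulim_uniform (rho e : R) : 0 <= rho < 1 -> 0 < e ->
  U [set j | forall z, cmod z <= rho -> cmod (f z - F j z) <= e].
Proof.
move=> /andP[rho0 rho1] e0; pose r := (1 + rho) / 2.
have rr : 0 < r < 1 by rewrite /r; apply/andP; split; lra.
have [r0 r1] := andP rr; have rhor : rho < r by rewrite /r; lra.
have [M MP] := bF rr.
have M0 : 0 <= M by apply: le_trans (cmod_ge0 (F 0%N 0)) _; apply: MP; rewrite cmod0; lra.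
pose c i j := taylor_coef r (F j) i.
have /choice[a aP] : forall i, exists a, ulim U (c i) a.
  by move=> i; apply: ulim_exists => j; exact: (taylor_coef_le i (hF j) rr (MP j)).
pose K := r / (r - rho) * M.
have K0 : 0 <= K by rewrite mulr_ge0// divr_ge0//; lra.
have x01 : 0 <= rho / r < 1 by rewrite divr_ge0 ?(ltW r0)//= ltr_pdivrMr//; lra.
have e3 : 0 < e / 3 by rewrite divr_gt0.
have [N HN] := exists_expr_le x01 K0 e3.
have rem j z : cmod z <= rho -> cmod (F j z - \sum_(i < N) c i j * z ^+ i) <= e / 3.
  move=> zr; have zr' : cmod z < r by lra.
  apply: (le_trans (taylor_remainder (hF j) rr N zr')).
  apply: le_trans HN; rewrite -mulrA /K; have z0 := cmod_ge0 z.
  have I := rint_circ_le (hF j) rr (MP j).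
  have I0 : 0 <= rint (fun t => cmod (F j (circ r t))) by apply: rint_ge0 => t _; exact: cmod_ge0.
  apply: ler_pM.
  - by rewrite exprn_ge0// divr_ge0// ltW.
  - by rewrite mulr_ge0// divr_ge0 ?(ltW r0)//; lra.
  - have zr'' : cmod z / r <= rho / r by rewrite ler_wpM2r// invr_ge0 ltW.
    by apply: lerXn2r zr''; rewrite nnegrE divr_ge0 ?(ltW r0).
  apply: ler_pM => //; first by rewrite divr_ge0 ?(ltW r0)//; lra.
  by rewrite ler_wpM2l ?(ltW r0)// lef_pV2 ?posrE; lra.
have remf z : cmod z <= rho -> cmod (f z - \sum_(i < N) a i * z ^+ i) <= e / 3.
  move=> zr; apply: (ulim_cmod_le UU _ (fun j => rem j z zr)).
  apply: ulimB; first by apply: fP; lra.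
  by apply: (@ulim_sum _ U UU N (fun i j => c i j * z ^+ i) (fun i => a i * z ^+ i)) => i; exact: ulimMr.
have poly : forall (N : nat) (e : R), 0 < e ->
    U [set j | forall z, cmod z <= rho -> cmod (\sum_(i < N) (a i - c i j) * z ^+ i) <= e].
  elim=> [|n ih] e' e'0.
    by apply: filterE => j z _; rewrite big_ord0 cmod0 ltW.
  have e2 : 0 < e' / 2 by rewrite divr_gt0.
  apply: filterS2 (ih _ e2) (aP n _ e2) => j /= h1 h2 z zr; rewrite big_ord_recr /=.
  apply: (le_trans (cmodD _ _)); have := h1 z zr.
  have : cmod ((a n - c n j) * z ^+ n) <= e' / 2.
    rewrite cmodM cmodX; apply: le_trans (ltW h2); rewrite cmod_distC ler_piMr ?cmod_ge0//.
    by rewrite exprn_ile1 ?cmod_ge0//; lra.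
  lra.
apply: filterS (poly N _ e3) => j /= h z zr.
have h1 := h z zr; have h2 := rem j z zr; have h3 := remf z zr.
rewrite (_ : f z - F j z = (f z - \sum_(i < N) a i * z ^+ i) + \sum_(i < N) (a i - c i j) * z ^+ i
   - (F j z - \sum_(i < N) c i j * z ^+ i)); last first.
  rewrite (_ : \sum_(i < N) (a i - c i j) * z ^+ i = \sum_(i < N) a i * z ^+ i - \sum_(i < N) c i j * z ^+ i).
    by ring.
  by rewrite -sumrB; apply: eq_bigr => i _; rewrite mulrBl.
apply: (le_trans (cmodB _ _)); have := cmodD (f z - \sum_(i < N) a i * z ^+ i) (\sum_(i < N) (a i - c i j) * z ^+ i).
lra.
Qed.

End UltraLimitFunction.

(** The ultrafilter refines the filter at infinity, so each of its sets contains arbitrarily large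
    indices. Picking at stage i an index with error 1 / (i + 1) on the disk of radius 1 - 1 / (i +
    1) extracts a genuine subsequence. *)
Theorem montel F : (forall j, holo 1 (F j)) ->
  (forall rho : R, 0 < rho < 1 -> exists M : R, forall j z, cmod z <= rho -> cmod (F j z) <= M) ->
  exists f phi, [/\ holo 1 f, {homo phi : i j / (i < j)%N}
    & forall rho e : R, 0 <= rho < 1 -> 0 < e -> exists N : nat, forall j z,
        (N <= j)%N -> cmod z <= rho -> cmod (f z - F (phi j) z) <= e].
Proof.
move=> hF bF; have [U [UU ooU]] := @ultraFilterLemma nat \oo _.
have PU := @ultra_proper _ _ UU.
have /choice[f fP] : forall z, exists a, cmod z < 1 -> ulim U (fun j => F j z) a.
  move=> z; have [z1|z1] := ltP (cmod z) 1; last by exists 0 => h; lra.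
  have [|M MP] := bF ((1 + cmod z) / 2).
    by have := cmod_ge0 z => z0; apply/andP; split; lra.
  have [|a aP] := @ulim_exists _ U UU (fun j => F j z) M; last by exists a.
  by move=> j; apply: MP; lra.
pose e i : R := i.+1%:R^-1.
have e0 i : 0 < e i by rewrite invr_gt0.
have e1 i : 0 <= 1 - e i < 1.
  by rewrite subr_ge0 invf_le1// ler1n /= ltrBlDr ltrDl e0.
have /choice[next nextP] : forall im : nat * nat, exists j, (im.2 < j)%N /\
    forall z, cmod z <= 1 - e im.1 -> cmod (f z - F j z) <= e im.1.
  move=> [i m] /=; have Um : U [set j | (m < j)%N] by apply: ooU; exists m.+1.
  have [j [jm jP]] := @filter_ex _ U PU _ (filterI Um (ulim_uniform UU hF bF fP (e1 i) (e0 i))).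
  by exists j.
pose phi := fix phi i := if i is i'.+1 then next (i, phi i') else next (0%N, 0%N).
have phiP i z : cmod z <= 1 - e i -> cmod (f z - F (phi i) z) <= e i.
  by case: i => [|i]; [exact: (nextP (0%N, 0%N)).2|exact: (nextP (i.+1, phi i)).2].
exists f, phi; split; first exact: (ulim_holo UU hF bF fP).
  by apply: homo_ltn => [|i] /=; [exact: ltn_trans|exact: (nextP (i.+1, phi i)).1].
move=> rho d /andP[rho0 rho1] d0.
have m0 : 0 < Num.min d (1 - rho) by rewrite lt_min d0; lra.
have [N NP] : exists N : nat, (Num.min d (1 - rho))^-1 < N%:R.
  by exists (Num.bound (Num.min d (1 - rho))^-1); apply: archi_boundP; rewrite invr_ge0 ltW.
exists N => j z Nj zr.
have : e j <= Num.min d (1 - rho).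
  rewrite /e -[leRHS]invrK lef_pV2 ?posrE ?invr_gt0 ?ltr0n//.
  by apply: (le_trans (ltW NP)); rewrite ler_nat (leq_trans Nj).
rewrite le_min => /andP[ed er]; apply: le_trans ed; apply: phiP; lra.
Qed.

End Montel.

(** * Rules for the generalized Volterra operator *)

Section GenVolterra.
Context {R : realType}.
Implicit Types (f g h : R[i] -> R[i]).

Let cont_seg f z : holo 1 f -> cmod z < 1 -> cont01 (fun t => f (0 + t%:C * (z - 0))).
Proof.
move=> hf z1; apply: (@cont01_seg _ 1) => [u|//|//]; first exact: holo_ccont.
by rewrite cmod0.
Qed.

Let seg_disk z (t : R) : cmod z < 1 -> 0 <= t <= 1 -> cmod (0 + t%:C * (z - 0)) < 1.
Proof.
move=> z1 /andP[t0 t1]; rewrite add0r subr0 cmodM cmodR_ge0//.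
by apply: le_lt_trans z1; rewrite ler_piMl// cmod_ge0.
Qed.

Lemma eq_volterra f g z : (forall u, cmod u < 1 -> f u = g u) -> cmod z < 1 ->
  volterra f z = volterra g z.
Proof.
move=> fg z1; rewrite !volterraE /cseg; congr (_ * _).
by apply: eq_cint => t t01; apply: fg; exact: seg_disk.
Qed.

Lemma volterraB f g z : holo 1 f -> holo 1 g -> cmod z < 1 ->
  volterra (fun u => f u - g u) z = volterra f z - volterra g z.
Proof.
move=> hf hg z1; rewrite !volterraE /cseg -mulrBr -cintB//; exact: cont_seg.
Qed.

Lemma volterraZ (a : R[i]) f z : holo 1 f -> cmod z < 1 ->
  volterra (fun u => a * f u) z = a * volterra f z.
Proof. by move=> hf z1; rewrite !volterraE /cseg cintZ; [ring|exact: cont_seg]. Qed.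

(** The path from 0 to [z] has length below 1, so integration does not increase a bound on a
    concentric disk. *)
Lemma volterra_le f (rho M : R) z : holo 1 f -> rho < 1 ->
  (forall u, cmod u <= rho -> cmod (f u) <= M) -> cmod z <= rho -> cmod (volterra f z) <= M.
Proof.
move=> hf rho1 fM zr; have z1 : cmod z < 1 by lra.
rewrite volterraE; have M0 : 0 <= M by apply: le_trans (cmod_ge0 (f z)) _; exact: fM.
have h : cmod (cseg f 0 z) <= cmod (z - 0) * M.
  apply: cmod_cseg_le => [|t t01]; first exact: cont_seg.
  apply: fM; rewrite add0r subr0 cmodM; have [t0 t1] := andP t01.
  by rewrite cmodR_ge0//; apply: le_trans zr; rewrite ler_piMl// cmod_ge0.
by apply: (le_trans h); rewrite subr0 ler_piMl// ltW.
Qed.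

Lemma iter_volterra_le j f (rho M : R) z : holo 1 f -> rho < 1 ->
  (forall u, cmod u <= rho -> cmod (f u) <= M) -> cmod z <= rho -> cmod (iter j volterra f z) <= M.
Proof.
move=> hf rho1 fM; elim: j z => [|j ih] z zr; first exact: fM.
by apply: (volterra_le (holo_iter_volterra j hf) rho1 _ zr) => u ur; exact: ih.
Qed.

Lemma eq_iter_volterra j f g : (forall u, cmod u < 1 -> f u = g u) ->
  forall z, cmod z < 1 -> iter j volterra f z = iter j volterra g z.
Proof. by move=> fg; elim: j => [|j ih] z z1; [exact: fg|exact: eq_volterra]. Qed.

Lemma iter_volterraB j f g : holo 1 f -> holo 1 g -> forall z, cmod z < 1 ->
  iter j volterra (fun u => f u - g u) z = iter j volterra f z - iter j volterra g z.
Proof.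
move=> hf hg; elim: j => [//|j ih] z z1 /=; rewrite (eq_volterra ih z1).
by apply: volterraB => //; exact: holo_iter_volterra.
Qed.

Lemma iter_volterraZ j (a : R[i]) f : holo 1 f -> forall z, cmod z < 1 ->
  iter j volterra (fun u => a * f u) z = a * iter j volterra f z.
Proof.
move=> hf; elim: j => [//|j ih] z z1 /=; rewrite (eq_volterra ih z1).
by apply: volterraZ => //; exact: holo_iter_volterra.
Qed.

Lemma holo_symbol f g k m : holo 1 f -> holo 1 g -> holo 1 (fun z => cderiv k f z * cderiv m g z).
Proof. by move=> hf hg; apply: holoM; [exact: (holo_cderiv hf k).1|exact: (holo_cderiv hg m).1]. Qed.

Variables (g : R[i] -> R[i]) (n k : nat).
Hypothesis hg : holo 1 g.

Lemma holo_gen_volterra f : holo 1 f -> holo 1 (gen_volterra g n k f).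
Proof. by move=> hf; apply: holo_iter_volterra; exact: holo_symbol. Qed.

Lemma gen_volterraB f h z : holo 1 f -> holo 1 h -> cmod z < 1 ->
  gen_volterra g n k (fun u => f u - h u) z = gen_volterra g n k f z - gen_volterra g n k h z.
Proof.
move=> hf hh z1.
have sf := holo_symbol k (n - k) hf hg; have sh := holo_symbol k (n - k) hh hg.
rewrite /gen_volterra (@eq_iter_volterra n _ (fun u => cderiv k f u * cderiv (n - k) g u - cderiv k h u * cderiv (n - k) g u))//.
  exact: iter_volterraB.
by move=> u u1; rewrite (cderivB hf hh)// mulrBl.
Qed.

Lemma gen_volterraZ (a : R[i]) f z : holo 1 f -> cmod z < 1 ->
  gen_volterra g n k (fun u => a * f u) z = a * gen_volterra g n k f z.
Proof.
move=> hf z1; have sf := holo_symbol k (n - k) hf hg.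
rewrite /gen_volterra (@eq_iter_volterra n _ (fun u => a * (cderiv k f u * cderiv (n - k) g u)))//.
  exact: iter_volterraZ.
by move=> u u1; rewrite (cderivZ _ hf)// mulrA.
Qed.

(** The (n - i)-fold integrals, i = 0, ..., n, are successive derivatives by [cdiff_volterra]. *)
Lemma cderiv_gen_volterra f z : holo 1 f -> cmod z < 1 ->
  cderiv n (gen_volterra g n k f) z = cderiv k f z * cderiv (n - k) g z.
Proof.
move=> hf z1; have sf := holo_symbol k (n - k) hf hg.
have := @cderiv_chain _ 1 n (fun i => iter (n - i) volterra (fun u => cderiv k f u * cderiv (n - k) g u)).
move=> /(_ _ n (leqnn n) z z1); rewrite subn0 subnn /=; apply => i lt_in u u1.
by rewrite -(subnSK lt_in) /=; apply: cdiff_volterra u1; exact: holo_iter_volterra.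
Qed.

End GenVolterra.

(** * Bounds on smaller disks *)

Section LocalBounds.
Context {R : realType}.
Implicit Types (f g v : R[i] -> R[i]).

(** The sub-mean inequality with exponent 1 on a single circle, of radius halfway between rho and
    1. *)
Lemma holo_bounded g (rho : R) : holo 1 g -> 0 <= rho < 1 ->
  exists2 G : R, 0 <= G & forall z, cmod z <= rho -> cmod (g z) <= G.
Proof.
move=> hg /andP[r0 r1]; pose s := (1 + rho) / 2.
have s1 : s < 1 by rewrite /s; lra.
have sr : 0 < s - rho by rewrite /s; lra.
have [Cm [Cm0 CmE]] : exists Cm : R, 0 <= Cm /\ circle_mean (fun z => cmod (g z) `^ 1) s <= Cm.
  exists (circle_mean (fun z => cmod (g z) `^ 1) s); split => //.
  by apply: rint_ge0 => t _; exact: powR_ge0.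
exists (2 * Cm / (s - rho)); first by rewrite divr_ge0 ?mulr_ge0// ltW.
move=> z zr; rewrite ler_pdivlMr//.
have := powR_le_circle_mean (ltr01 : 0 < 1 :> R) hg (_ : cmod z < s) s1.
rewrite powRr1 ?cmod_ge0// => H; have {}H := le_trans (H ltac:(lra)) CmE.
have : cmod (g z) * (s - rho) <= cmod (g z) * (s - cmod z).
  by apply: ler_wpM2l; [exact: cmod_ge0|lra].
move: (cmod (g z)) H => x; lra.
Qed.

Lemma symbol_small g k m (rho e : R) : holo 1 g -> 0 <= rho < 1 -> 0 < e ->
  exists2 e1 : R, 0 < e1 & forall v, holo 1 v -> (forall z, cmod z <= (1 + rho) / 2 -> cmod (v z) <= e1) ->
  forall z, cmod z <= rho -> cmod (cderiv k v z * cderiv m g z) <= e.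
Proof.
move=> hg rho01 e0; have [C C0 HC] := @cderiv_estimate R k.
have [G G0 HG] := holo_bounded (holo_cderiv hg m).1 rho01.
pose t := (1 - rho) / 2; have t0 : 0 < t by rewrite /t; lra.
have G1 : 0 < G + 1 by lra.
have tk : 0 < t ^+ k by rewrite exprn_gt0.
exists (e * t ^+ k / (C * (G + 1))); first by rewrite divr_gt0 ?mulr_gt0.
move=> v hv vs z zr.
have := HC 1 v z t (e * t ^+ k / (C * (G + 1))) hv t0 _ _.
move=> /(_ ltac:(rewrite /t; lra)) H.
have {}H : cmod (cderiv k v z) <= e / (G + 1).
  apply: le_trans (H _) _; last first.
    rewrite le_eqVlt; apply/orP; left; apply/eqP; field.
    by rewrite !gt_eqF.
  by move=> u ut; apply: vs; have := cmodD (u - z) z; rewrite subrK; rewrite /t in ut; lra.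
have g1 := HG z zr.
rewrite cmodM; apply: (@le_trans _ _ (e / (G + 1) * (G + 1))).
  by apply: ler_pM; rewrite ?cmod_ge0//; lra.
by rewrite mulfVK// gt_eqF.
Qed.

End LocalBounds.

(** * The symbol against the mass of images *)

Section SymbolBounds.
Context {R : realType}.
Variables (w : R[i] -> R) (psi : R -> R) (p q : R) (k n : nat) (g : R[i] -> R[i]).
Hypotheses (w_doubling : doubling w) (psiP : profile w psi) (p0 : 0 < p) (pq : p < q) (kn : (k < n)%N)
  (hg : holo 1 g).
Local Notation W := (wgt (tail w)).
Local Notation delta := (p^-1 - q^-1).
Local Notation T := (gen_volterra g n k).
Implicit Types (f : R[i] -> R[i]).

Let q0 : 0 < q. Proof. exact: lt_trans pq. Qed.

(** The size of |g^(n-k)(z)| at which the symbol quotient equals 1; see [symbol_quotientE]. *)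
Definition scale_bound (z : R[i]) : R := (1 - cmod z) `^ (- (n - k)%:R) * W (cmod z) `^ delta.

(** On |z| <= rho the product of derivatives is small because [v j] tends to 0 locally uniformly,
    and this is the additive error. Farther out the symbol is at most eps times its scale. Both
    errors are given the same eps, chosen with 2 C eps^q = e. *)
Lemma gen_volterra_tendsto0 (v : nat -> R[i] -> R[i]) :
  (forall eps : R, 0 < eps -> exists2 rho : R, 0 <= rho < 1 &
     forall z, rho < cmod z < 1 -> cmod (cderiv (n - k) g z) <= eps * scale_bound z) ->
  (forall j, holo 1 (v j) /\ (mass w p (v j) <= 1)%E) ->
  (forall rho e : R, 0 <= rho < 1 -> 0 < e -> exists N : nat, forall j z,
     (N <= j)%N -> cmod z <= rho -> cmod (v j z) <= e) ->
  forall e : R, 0 < e -> exists N : nat, forall j, (N <= j)%N -> (mass w q (T (v j)) <= e%:E)%E.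
Proof.
move=> Hg Hv v0 e e0; have [C C0 HC] := gen_volterra_mass w_doubling psiP p0 pq kn.
pose eps := (e / (2 * C)) `^ q^-1.
have eps0 : 0 < eps by rewrite powR_gt0// divr_gt0// mulr_gt0.
have epsE : eps `^ q = e / (2 * C).
  by rewrite /eps -powRrM mulVf ?gt_eqF// powRr1// divr_ge0 ?mulr_ge0// ltW.
have [rho rho01 Hrho] := Hg eps eps0.
have [e1 e10 He1] := symbol_small k (n - k) hg rho01 eps0.
have [|N HN] := v0 ((1 + rho) / 2) e1 _ e10; first by apply/andP; split; lra.
exists N => j Nj; have [hv v1] := Hv j.
have := HC (v j) g eps eps hv hg v1 (ltW eps0) eps0.
rewrite epsE (_ : C * (e / (2 * C) + e / (2 * C)) = e); last by field; rewrite gt_eqF.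
apply=> z z1.
have s0 : 0 <= scale_bound z by rewrite mulr_ge0 ?powR_ge0.
have [zr|zr] := leP (cmod z) rho.
  have := He1 (v j) hv (fun u ur => HN j u Nj ur) z zr.
  move=> h; apply: (le_trans h); rewrite lerDl; apply: mulr_ge0; first exact: ltW.
  by apply: mulr_ge0; [exact: s0|exact: cmod_ge0].
rewrite cmodM mulrC; apply: (@le_trans _ _ (eps * scale_bound z * cmod (cderiv k (v j) z))).
  by apply: ler_wpM2r; [exact: cmod_ge0|apply: Hrho; rewrite zr].
by rewrite -mulrA lerDr ltW.
Qed.

(** The growth bound for the n-th derivative of T f / lam, which is f^(k) g^(n-k) / lam, is divided
    by the lower bound for f^(k)(a); the exponents of 1 - |a| and W subtract to those of
    [scale_bound]. *)
Lemma symbol_le_of_mass : exists2 C : R, 0 < C & forall f (lam c : R) a, holo 1 f -> 0 < lam -> 0 < c ->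
  (mass w q (T f) <= (lam `^ q)%:E)%E -> cmod a < 1 ->
  c * ((1 - cmod a) `^ (- k%:R) * W (cmod a) `^ (- p^-1)) <= cmod (cderiv k f a) ->
  cmod (cderiv (n - k) g a) <= C * lam / c * scale_bound a.
Proof.
have [D D0 [fin pos mono dbl]] := tail_spec w_doubling psiP.
have [C C0 HC] := growth_cderiv w_doubling psiP n q0.
exists C => // f lam c a hf lam0 c0 Tf a1 fa.
have hT := holo_gen_volterra n k hg hf.
have a0 := cmod_ge0 a; have a01 : 0 <= cmod a < 1 by rewrite a0.
have W0 : 0 < W (cmod a) by exact: weight_gt0.
have b0 : 0 < 1 - cmod a by lra.
have il : 0 <= lam^-1 by rewrite invr_ge0 ltW.
have hS : holo 1 (fun z => (lam^-1)%:C * T f z) by apply: holoM => //; exact: holo_cst.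
have := HC _ a hS _ a1; rewrite (mass_scale w_doubling psiP q0 il hT) => H.
have {}H : cmod (cderiv n (fun z => (lam^-1)%:C * T f z) a) <= C * ((1 - cmod a) `^ (- n%:R) * W (cmod a) `^ (- q^-1)).
  apply: H; apply: (@le_trans _ _ ((lam^-1 `^ q)%:E * (lam `^ q)%:E)%E).
    by apply: lee_wpmul2l => //; rewrite lee_fin powR_ge0.
  by rewrite -EFinM -powRM ?(ltW lam0)// mulVf ?gt_eqF// powR1.
move: H; rewrite (cderivZ _ hT)// cmodM cmodR_ge0// cderiv_gen_volterra// cmodM.
rewrite ler_pdivrMl// => H.
have nkE : n%:R = k%:R + (n - k)%:R :> R by rewrite -natrD subnKC// ltnW.
have e1 : (1 - cmod a) `^ (- n%:R) = (1 - cmod a) `^ (- k%:R) * (1 - cmod a) `^ (- (n - k)%:R).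
  by rewrite -powRD ?nkE ?opprD//; apply/implyP => _; rewrite gt_eqF.
have e2 : W (cmod a) `^ (- q^-1) = W (cmod a) `^ (- p^-1) * W (cmod a) `^ delta.
  by rewrite -powRD ?addrA ?addNr ?add0r//; apply/implyP => _; rewrite gt_eqF.
rewrite e1 e2 in H; rewrite /scale_bound.
have P0 : 0 < (1 - cmod a) `^ (- k%:R) * W (cmod a) `^ (- p^-1) by rewrite mulr_gt0 ?powR_gt0.
move: (cmod (cderiv (n - k) g a)) (cmod_ge0 (cderiv (n - k) g a)) H => x x0 H.
have : c * ((1 - cmod a) `^ (- k%:R) * W (cmod a) `^ (- p^-1)) * x <=
   lam * (C * ((1 - cmod a) `^ (- k%:R) * (1 - cmod a) `^ (- (n - k)%:R) * (W (cmod a) `^ (- p^-1) * W (cmod a) `^ delta))).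
  by apply: le_trans H; apply: ler_wpM2r.
move: fa => _; move: P0; move: (_ `^ (- k%:R)) (_ `^ (- (n - k)%:R)) (_ `^ (- p^-1)) (_ `^ delta) => A B E F P0 h.
rewrite -(ler_pM2l (mulr_gt0 c0 P0)); apply: (le_trans h).
by rewrite le_eqVlt; apply/orP; left; apply/eqP; field; rewrite gt_eqF.
Qed.

End SymbolBounds.

(** * Bergman norm and mass *)

Section BergmanNorm.
Context {R : realType}.
Variables (w : R[i] -> R) (psi : R -> R) (p : R).
Hypotheses (w_doubling : doubling w) (psiP : profile w psi) (p0 : 0 < p).
Implicit Types (f : R[i] -> R[i]).

Lemma bergman_norm_le f (M : R) : 0 <= M ->
  (bergman_norm p w f <= M%:E)%E = (mass w p f <= (M `^ p)%:E)%E.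
Proof.
move=> M0; have ip : 0 < p^-1 by rewrite invr_gt0.
rewrite /bergman_norm -/(mass w p f); have := mass_ge0 w_doubling p f.
case: (mass w p f) => [r| |//]; last by move=> _; rewrite poweRyr ?gt_eqF// !leye_eq.
rewrite lee_fin => r0; rewrite poweR_EFin !lee_fin; apply/idP/idP => h.
  rewrite -[leLHS](powRr1 r0) -(mulVf (lt0r_neq0 p0)) powRrM.
  by apply: ge0_ler_powR; rewrite ?nnegrE ?powR_ge0 ?(ltW p0).
rewrite -[leRHS](powRr1 M0) -(mulfV (lt0r_neq0 p0)) powRrM.
by apply: ge0_ler_powR; rewrite ?nnegrE ?powR_ge0 ?(ltW ip).
Qed.

Lemma bergman_norm_ge0 f : (0 <= bergman_norm p w f)%E.
Proof. exact: poweR_ge0. Qed.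

Lemma bergman_normE f : bergman p w f -> exists2 N : R, 0 <= N & bergman_norm p w f = N%:E.
Proof.
move=> [_]; have := bergman_norm_ge0 f; case: (bergman_norm p w f) => [r| |]//.
by rewrite lee_fin => r0 _; exists r.
Qed.

Lemma bergman_of_mass f (M : R) : 0 <= M -> holo 1 f -> (mass w p f <= (M `^ p)%:E)%E -> bergman p w f.
Proof.
move=> M0 hf fM; split; first exact/analytic_on_diskE.
by move: fM; rewrite -bergman_norm_le// => h; apply: le_lt_trans h _; exact: ltry.
Qed.

Lemma mass_scaleV_le f (a B : R) : 0 < a -> holo 1 f ->
  (mass w p (fun z => ((a^-1)%:C * f z)%R) <= B%:E)%E = (mass w p f <= (a `^ p * B)%:E)%E.
Proof.
move=> a0 hf; have ia : 0 <= a^-1 by rewrite invr_ge0 ltW.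
rewrite (mass_scale w_doubling psiP p0 ia hf).
have P0 : 0 < a `^ p by rewrite powR_gt0.
have -> : a^-1 `^ p = (a `^ p)^-1.
  by rewrite -powR_inv1 ?(ltW a0)// -powRrM mulN1r powRN.
have := mass_ge0 w_doubling p f; case: (mass w p f) => [r| |]//.
  by move=> _; rewrite -EFinM !lee_fin ler_pdivrMl.
by move=> _; rewrite gt0_muley ?lte_fin ?invr_gt0// !leye_eq.
Qed.

Lemma bergman_norm_cvg0 (u : nat -> R[i] -> R[i]) :
  (bergman_norm p w (u j) @[j --> \oo] --> 0)%E <->
  forall e : R, 0 < e -> exists N : nat, forall j, (N <= j)%N -> (mass w p (u j) <= (e `^ p)%:E)%E.
Proof.
split=> [/fine_cvgP[[N1 _ fu] /cvgrPdist_lt cu] e e0|H].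
  have [N2 _ H2] := cu e e0; exists (maxn N1 N2) => j; rewrite geq_max => /andP[j1 j2].
  rewrite -bergman_norm_le ?(ltW e0)//; have := H2 j j2; rewrite /= sub0r normrN => h.
  rewrite -(fineK (fu j j1)) lee_fin; apply: le_trans (ltW h); exact: ler_norm.
have {}H : forall e : R, 0 < e -> exists N : nat, forall j, (N <= j)%N -> (bergman_norm p w (u j) <= e%:E)%E.
  by move=> e e0; have [N HN] := H e e0; exists N => j /HN; rewrite bergman_norm_le// ltW.
have fin j (e : R) : (bergman_norm p w (u j) <= e%:E)%E -> bergman_norm p w (u j) \is a fin_num.
  by move=> h; rewrite ge0_fin_numE ?bergman_norm_ge0//; apply: le_lt_trans h _; exact: ltry.
apply/fine_cvgP; split.
  by have [N HN] := H 1 ltr01; exists N => // j /HN /fin.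
apply/cvgrPdist_lt => e e0; have [N HN] := H (e / 2) (divr_gt0 e0 (ltr0Sn _ 1)).
exists N => // j /= /HN h; rewrite sub0r normrN ger0_norm ?fine_ge0 ?bergman_norm_ge0//.
have hf := fin _ _ h; rewrite -(fineK hf) lee_fin in h.
by move: h; lra.
Qed.

End BergmanNorm.

(** * The symbol quotient *)

Section Quotient.
Context {R : realType}.
Variables (w : R[i] -> R) (psi : R -> R) (p q : R) (k n : nat) (g : R[i] -> R[i]).
Hypotheses (w_doubling : doubling w) (psiP : profile w psi) (p0 : 0 < p) (pq : p < q) (kn : (k < n)%N)
  (hg : holo 1 g).
Local Notation W := (wgt (tail w)).
Local Notation delta := (p^-1 - q^-1).
Local Notation S := (symbol_quotient p q w g n k).
Local Notation sb := (scale_bound w p q k n).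

Let q0 : 0 < q. Proof. exact: lt_trans pq. Qed.

Lemma scale_exp_gt0 : 0 < delta.
Proof. by rewrite subr_gt0 ltf_pV2 ?posrE. Qed.

Lemma scale_bound_gt0 a : cmod a < 1 -> 0 < sb a.
Proof.
move=> a1; have [D D0 [fin pos mono dbl]] := tail_spec w_doubling psiP.
have a0 := cmod_ge0 a; rewrite mulr_gt0 ?powR_gt0//; first lra.
by apply: weight_gt0 => //; rewrite a0.
Qed.

Lemma symbol_quotientE a : cmod a < 1 -> S a = cmod (cderiv (n - k) g a) / sb a.
Proof.
move=> a1; have [D D0 [fin pos mono dbl]] := tail_spec w_doubling psiP.
have a0 := cmod_ge0 a; have H0 : 0 < tail w (cmod a) by apply: pos; rewrite a0.
have b0 : 0 < 1 - cmod a by lra.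
rewrite /symbol_quotient -/(tail w (cmod a)) /scale_bound /wgt powRM ?(ltW b0) ?(ltW H0)//.
rewrite powRN powR_mulrn ?(ltW b0)//.
by field; rewrite ?expf_neq0 ?gt_eqF ?powR_gt0.
Qed.

Lemma symbol_quotient_le a (L : R) : cmod a < 1 ->
  (S a <= L) = (cmod (cderiv (n - k) g a) <= L * sb a).
Proof. by move=> a1; rewrite symbol_quotientE// ler_pdivrMr// scale_bound_gt0. Qed.

Lemma symbol_quotient_ge0 a : cmod a < 1 -> 0 <= S a.
Proof. by move=> a1; rewrite symbol_quotientE// divr_ge0 ?cmod_ge0// ltW// scale_bound_gt0. Qed.

Lemma symbol_supP :
  (ereal_sup [set (S a)%:E | a in disk] < +oo)%E <->
  exists2 K : R, 0 < K & forall a, cmod a < 1 -> S a <= K.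
Proof.
split=> [|[K K0 HK]]; last first.
  apply: (@le_lt_trans _ _ K%:E); last exact: ltry.
  by apply: ge_ereal_sup => _ [a Da <-]; rewrite lee_fin; exact: HK.
set s := ereal_sup _ => sy.
have ub a : cmod a < 1 -> ((S a)%:E <= s)%E by move=> a1; apply: ereal_sup_ubound; exists a.
exists (`|fine s| + 1); first by rewrite ltr_wpDl.
move=> a a1; have := ub a a1; case: s sy {ub} => [r| |]//= _; rewrite lee_fin => h.
by have := ler_norm r; lra.
Qed.

Lemma symbol_limP : lim_boundary S 0 <-> forall e : R, 0 < e -> exists2 rho : R, 0 <= rho < 1 &
  forall a, rho < cmod a < 1 -> S a <= e.
Proof.
split=> H e e0.
  have [d d0 dP] := H e e0; exists (Num.max 0 (1 - d)).
    by rewrite le_max lexx /= gt_max ltr01 /=; move: d0 => /=; lra.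
  move=> a /andP[]; rewrite gt_max => /andP[_ da] a1.
  have B : ball (1 : R) d (cmod a) by rewrite /ball /= gtr0_norm; lra.
  by have := dP _ B a1 a erefl; rewrite subr0 => /(le_lt_trans (ler_norm _))/ltW.
have e2 : 0 < e / 2 by rewrite divr_gt0.
have [rho /andP[rho0 rho1] HR] := H _ e2; near=> r => a ar.
have a1 : cmod a < 1 by rewrite ar; near: r; exact: nbhs_left_lt.
rewrite subr0 ger0_norm ?symbol_quotient_ge0//; apply: (@le_lt_trans _ _ (e / 2)); last lra.
by apply: HR; rewrite a1 andbT ar; near: r; exact: nbhs_left_gt.
Unshelve. all: by end_near. Qed.

(** Near the boundary the quotient is at most 1. On |a| <= rho the derivative of [g] is bounded, and
    the scale is at least W(rho)^delta because W decreases. *)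
Lemma symbol_bounded_of_lim : lim_boundary S 0 -> exists2 K : R, 0 < K & forall a, cmod a < 1 -> S a <= K.
Proof.
move=> /symbol_limP/(_ 1 ltr01)[rho rho01 HR].
have [D D0 [fin pos mono dbl]] := tail_spec w_doubling psiP.
have [G G0 HG] := holo_bounded (holo_cderiv hg (n - k)).1 rho01.
have W0 : 0 < W rho by exact: weight_gt0.
have X0 : 0 < W rho `^ delta by rewrite powR_gt0.
exists (G / W rho `^ delta + 1); first by rewrite ltr_wpDl// divr_ge0// ltW.
move=> a a1; have a0 := cmod_ge0 a; have GW : 0 <= G / W rho `^ delta by rewrite divr_ge0// ltW.
have [ar|ar] := leP (cmod a) rho; last first.
  by apply: (@le_trans _ _ 1); [apply: HR; rewrite ar|lra].
rewrite symbol_quotient_le//; apply: (le_trans (HG a ar)).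
apply: (@le_trans _ _ (G / W rho `^ delta * sb a)); last first.
  by apply: ler_wpM2r; [exact/ltW/scale_bound_gt0|lra].
rewrite mulrAC ler_pdivlMr//; apply: ler_wpM2l => //.
have A1 : 1 <= (1 - cmod a) `^ (- (n - k)%:R).
  rewrite -[leLHS](powRr0 (1 - cmod a)).
  by apply: ger_powR; [lra|rewrite oppr_le0].
have [r0 r1] := andP rho01.
have A2 : W rho <= W (cmod a) by exact: (weight_mono pos mono).
have A3 : W rho `^ delta <= W (cmod a) `^ delta.
  apply: ge0_ler_powR; rewrite ?nnegrE; first exact/ltW/scale_exp_gt0.
  - exact: ltW.
  - by apply: le_trans A2; exact: ltW.
  - exact: A2.
apply: (le_trans A3); rewrite /scale_bound.
exact: ler_peMl (powR_ge0 _ _) A1.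
Qed.

End Quotient.

(** * Boundedness *)

Section Boundedness.
Context {R : realType}.
Variables (w : R[i] -> R) (psi : R -> R) (p q : R) (k n : nat) (g : R[i] -> R[i]).
Hypotheses (w_doubling : doubling w) (psiP : profile w psi) (p0 : 0 < p) (pq : p < q) (kn : (k < n)%N)
  (hg : holo 1 g).
Local Notation W := (wgt (tail w)).
Local Notation S := (symbol_quotient p q w g n k).
Local Notation sb := (scale_bound w p q k n).
Local Notation T := (gen_volterra g n k).
Implicit Types (f : R[i] -> R[i]).

Let q0 : 0 < q. Proof. exact: lt_trans pq. Qed.

Lemma mass_gen_volterraV f (a B : R) : 0 < a -> holo 1 f ->
  (mass w q (T (fun z => ((a^-1)%:C * f z)%R)) <= B%:E)%E = (mass w q (T f) <= (a `^ q * B)%:E)%E.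
Proof.
move=> a0 hf; transitivity (mass w q (fun z => ((a^-1)%:C * T f z)%R) <= B%:E)%E.
  by rewrite (@eq_mass _ _ _ _ (fun z => (a^-1)%:C * T f z))// => z z1; exact: gen_volterraZ.
exact: (mass_scaleV_le w_doubling psiP q0 B a0 (holo_gen_volterra n k hg hf)).
Qed.

(** After scaling [f] to mass at most 1, the quotient bound is the hypothesis of [gen_volterra_mass]
    with eta = 0 and eps = K. *)
Lemma gen_volterra_mass_bound : (exists2 K : R, 0 < K & forall a, cmod a < 1 -> S a <= K) ->
  exists2 C : R, 0 < C & forall f (M : R), holo 1 f -> 0 < M -> (mass w p f <= (M `^ p)%:E)%E ->
    (mass w q (T f) <= ((C * M) `^ q)%:E)%E.
Proof.
move=> [K K0 HK]; have [C C0 HC] := gen_volterra_mass w_doubling psiP p0 pq kn.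
have A0 : 0 <= C * K `^ q by rewrite mulr_ge0 ?powR_ge0// ltW.
exists ((C * K `^ q) `^ q^-1); first by rewrite powR_gt0// mulr_gt0// powR_gt0.
move=> f M hf M0 fM; pose v z := (M^-1)%:C * f z.
have hv : holo 1 v by apply: holoM => //; exact: holo_cst.
have v1 : (mass w p v <= 1)%E by rewrite (mass_scaleV_le w_doubling psiP p0 _ M0 hf) mulr1.
have := HC v g 0 K hv hg v1 (lexx 0) K0.
rewrite powR0 ?gt_eqF// add0r => H.
have {H} : (mass w q (T v) <= (C * K `^ q)%:E)%E.
  apply: H => z z1; rewrite add0r cmodM mulrC.
  have := HK z z1; rewrite (symbol_quotient_le _ _ _ _ _ w_doubling psiP)// => h.
  by rewrite mulrA; apply: ler_wpM2r; [exact: cmod_ge0|exact: h].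
move=> h; have {h} h := etrans (esym (mass_gen_volterraV _ M0 hf)) h.
apply: (le_trans h); rewrite lee_fin.
by rewrite powRM ?powR_ge0 ?(ltW M0)// -powRrM mulVf ?gt_eqF// powRr1// mulrC.
Qed.

Theorem bounded_of_symbol : (exists2 K : R, 0 < K & forall a, cmod a < 1 -> S a <= K) ->
  bounded_operator p q w T.
Proof.
move=> /gen_volterra_mass_bound[C C0 HC]; exists C => f bf.
have [N N0 NE] := bergman_normE bf; have hf := (analytic_on_diskE f).1 bf.1.
have hT := holo_gen_volterra n k hg hf.
(* The norm of [f] may be 0, so [f] is scaled by numbers M above its norm, and M tends to the norm
   at the end. *)
have key (M : R) : N < M -> (bergman_norm q w (T f) <= (C * M)%:E)%E.
  move=> NM; have M0 : 0 < M by exact: le_lt_trans NM.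
  rewrite (bergman_norm_le w_doubling q0)//; last by rewrite mulr_ge0// ltW.
  by apply: HC => //; rewrite -(bergman_norm_le w_doubling p0) ?(ltW M0)// NE lee_fin ltW.
have N1 : N < N + 1 by rewrite ltrDl.
have bT : bergman q w (T f).
  have N1' : 0 <= C * (N + 1) by rewrite mulr_ge0 ?(ltW C0)//; lra.
  by apply: (bergman_of_mass w_doubling q0 N1' hT); rewrite -(bergman_norm_le w_doubling q0)//; exact: key.
split=> //; have [Y Y0 YE] := bergman_normE bT; rewrite NE YE -EFinM lee_fin.
apply/ler_addgt0Pr => e e0; have eC : 0 < e / C by rewrite divr_gt0.
have := key (N + e / C); rewrite ltrDl => /(_ eC); rewrite YE lee_fin.
by rewrite mulrDr [C * (e / C)]mulrCA mulfV ?gt_eqF// mulr1.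
Qed.

(** Test functions have norms bounded uniformly in [a], hence so do their images, and
    [symbol_le_of_mass] converts this into a bound on the quotient at [a]. *)
Theorem symbol_of_bounded : bounded_operator p q w T ->
  exists2 K : R, 0 < K & forall a, cmod a < 1 -> S a <= K.
Proof.
move=> [C HC]; have [B [c [F [[B0 c0 HF] _]]]] := test_functions k w_doubling psiP p0.
have [K K0 HK] := symbol_le_of_mass w_doubling psiP p0 pq kn hg.
pose N := B `^ p^-1; have N0 : 0 < N by rewrite powR_gt0.
have NE : N `^ p = B by rewrite /N -powRrM mulVf ?gt_eqF// powRr1// ltW.
(* The operator bound is an arbitrary real number; |C| + 1 is a positive replacement. *)
pose lam := (`|C| + 1) * N; have C1 : 0 < `|C| + 1 by rewrite ltr_wpDl.
have lam0 : 0 < lam by rewrite mulr_gt0.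
exists (K * lam / c); first by rewrite divr_gt0// mulr_gt0.
move=> a a1; have [hF FB Fa] := HF a a1; rewrite (symbol_quotient_le _ _ _ _ _ w_doubling psiP)//.
have bF : bergman p w (F a) by apply: (bergman_of_mass w_doubling p0 (ltW N0)) => //; rewrite NE.
apply: (HK (F a)) => //; have [bT TF] := HC _ bF.
rewrite -(bergman_norm_le w_doubling q0) ?(ltW lam0)//; apply: (le_trans TF).
have : (bergman_norm p w (F a) <= N%:E)%E by rewrite (bergman_norm_le w_doubling p0) ?(ltW N0)// NE.
have [Y Y0 ->] := bergman_normE bF; rewrite lee_fin => YN; rewrite -EFinM lee_fin /lam.
apply: (@le_trans _ _ ((`|C| + 1) * Y)); last by apply: ler_wpM2l => //; exact: ltW.
by apply: ler_wpM2r => //; have := ler_norm C; lra.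
Qed.

End Boundedness.

(** * Compactness *)

Section Compactness.
Context {R : realType}.
Variables (w : R[i] -> R) (psi : R -> R) (p q : R) (k n : nat) (g : R[i] -> R[i]).
Hypotheses (w_doubling : doubling w) (psiP : profile w psi) (p0 : 0 < p) (pq : p < q) (kn : (k < n)%N)
  (hg : holo 1 g).
Local Notation W := (wgt (tail w)).
Local Notation S := (symbol_quotient p q w g n k).
Local Notation T := (gen_volterra g n k).
Implicit Types (f : R[i] -> R[i]).

Let q0 : 0 < q. Proof. exact: lt_trans pq. Qed.

Lemma bergman_montel (F : nat -> R[i] -> R[i]) (B : R) :
  (forall j, holo 1 (F j) /\ (mass w p (F j) <= B%:E)%E) ->
  exists f phi, [/\ holo 1 f, {homo phi : i j / (i < j)%N}
    & forall rho e : R, 0 <= rho < 1 -> 0 < e -> exists N : nat, forall j z,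
        (N <= j)%N -> cmod z <= rho -> cmod (f z - F (phi j) z) <= e].
Proof.
move=> HF; have [D D0 [fin pos mono dbl]] := tail_spec w_doubling psiP.
have [C C0 HC] := growth w_doubling psiP.
apply: montel => [j|rho rho01]; first exact: (HF j).1.
have rho01' : 0 <= rho < 1 by case/andP: rho01 => /ltW -> ->.
have W0 : 0 < W rho by exact: weight_gt0.
exists ((C * B / W rho) `^ p^-1) => j z zr; have [hj FB] := HF j.
have z1 : cmod z < 1 by case/andP: rho01 => _; exact: le_lt_trans.
have h := HC p B (F j) z p0 hj FB z1.
have A2 : W rho <= W (cmod z).
  by case/andP: rho01 => _ r1; exact: (weight_mono pos mono (cmod_ge0 z) zr r1).
have h2 : cmod (F j z) `^ p <= C * B / W rho.
  rewrite ler_pdivlMr//; apply: le_trans h; apply: ler_wpM2l => //; exact: powR_ge0.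
rewrite -[leLHS](powRr1 (cmod_ge0 _)) -(mulfV (lt0r_neq0 p0)) powRrM.
apply: ge0_ler_powR => //; rewrite ?nnegrE ?powR_ge0//; first by rewrite invr_ge0 ltW.
by apply: le_trans h2; exact: powR_ge0.
Qed.

(** Along a Montel subsequence the differences from the limit [f] have bounded mass and tend to 0
    locally uniformly; scaled to mass at most 1 they fall under [gen_volterra_tendsto0]. By Fatou
    [f] belongs to the source space, so T f is an admissible limit. *)
Theorem compact_of_symbol : lim_boundary S 0 -> compact_operator p q w T.
Proof.
move=> lim0; have bdS := symbol_bounded_of_lim w_doubling psiP p0 pq hg lim0.
have [C0 HC0] := bounded_of_symbol w_doubling psiP p0 pq kn hg bdS.
split=> [f /HC0[]//|F M HF].
have M0 : 0 <= M by rewrite -lee_fin; apply: le_trans (HF 0%N).2; exact: bergman_norm_ge0.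
have HF' j : holo 1 (F j) /\ (mass w p (F j) <= (M `^ p)%:E)%E.
  have [[aF _] bF] := HF j; split; first exact/analytic_on_diskE.
  by rewrite -(bergman_norm_le w_doubling p0).
have [f [phi [hf homo_phi conv]]] := bergman_montel HF'.
have P0 : 0 <= M `^ p by exact: powR_ge0.
have fB : (mass w p f <= (2 `^ p * (M `^ p + 2 * tail w 0))%:E)%E.
  apply: (mass_limit_le w_doubling psiP p0 P0 (fun j => HF' (phi j)) hf) => s s01.
  have s01' : 0 <= s < 1 by case/andP: s01 => /ltW -> ->.
  have [N HN] := conv s 1 s01' ltr01; exists N => j z Nj zs; apply: HN => //.
  by rewrite zs.
have [B2 fB2] : exists B2 : R, (mass w p f <= B2%:E)%E by exists (2 `^ p * (M `^ p + 2 * tail w 0)).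
have B20 : 0 <= B2 by rewrite -lee_fin; apply: le_trans fB2; exact: mass_ge0.
(* The summand 1 keeps the scaling factor positive even if both mass bounds vanish. *)
pose lam := (2 `^ p * (B2 + M `^ p) + 1) `^ p^-1.
have L0 : 0 < 2 `^ p * (B2 + M `^ p) + 1 by rewrite ltr_wpDl// mulr_ge0 ?powR_ge0// addr_ge0.
have lam0 : 0 < lam by rewrite powR_gt0.
have lamE : lam `^ p = 2 `^ p * (B2 + M `^ p) + 1 by rewrite /lam -powRrM mulVf ?gt_eqF// powRr1// ltW.
pose u j z := f z - F (phi j) z.
have hu j : holo 1 (u j) by apply: holoB => //; exact: (HF' _).1.
pose v j z := (lam^-1)%:C * u j z.
have Hv j : holo 1 (v j) /\ (mass w p (v j) <= 1)%E.
  split; first by apply: holoM => //; exact: holo_cst.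
  rewrite (mass_scaleV_le w_doubling psiP p0 _ lam0 (hu j)) mulr1 lamE.
  apply: (le_trans (massB_le w_doubling psiP p0 hf (HF' (phi j)).1)).
  apply: (@le_trans _ _ ((2 `^ p)%:E * (B2%:E + (M `^ p)%:E))%E).
    by apply: lee_wpmul2l; [rewrite lee_fin powR_ge0|apply: leeD => //; exact: (HF' _).2].
  by rewrite -EFinD -EFinM lee_fin lerDl.
have v0 : forall rho e : R, 0 <= rho < 1 -> 0 < e -> exists N : nat, forall j z,
     (N <= j)%N -> cmod z <= rho -> cmod (v j z) <= e.
  move=> rho e rho01 e0; have [N HN] := conv rho (lam * e) rho01 (mulr_gt0 lam0 e0).
  exists N => j z Nj zr; rewrite /v cmodM cmodR_ge0 ?invr_ge0 ?(ltW lam0)// ler_pdivrMl//.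
  exact: HN.
have small := gen_volterra_tendsto0 w_doubling psiP p0 pq kn hg _ Hv v0.
have hTf := holo_gen_volterra n k hg hf.
have bf : bergman p w f.
  apply: (bergman_of_mass w_doubling p0 (powR_ge0 B2 p^-1) hf).
  by rewrite -powRrM mulVf ?gt_eqF// powRr1.
exists phi, (T f); split => //; first exact: (HC0 f bf).1.
apply/(bergman_norm_cvg0 w_doubling q0) => e e0.
have e1 : 0 < (e / lam) `^ q by rewrite powR_gt0// divr_gt0.
have [eps eps0|N HN] := small _ _ e1.
  have [rho rho01 HR] := (symbol_limP p q k n g w_doubling psiP).1 lim0 eps eps0.
  exists rho => // z zr; rewrite -(symbol_quotient_le _ _ _ _ _ w_doubling psiP); first exact: HR.
  by case/andP: zr.
have LE : lam `^ q * (e / lam) `^ q = e `^ q.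
  by rewrite -powRM ?divr_ge0 ?(ltW lam0) ?(ltW e0)// mulrC mulfVK ?gt_eqF.
exists N => j /HN h.
have := etrans (esym (mass_gen_volterraV k n w_doubling psiP p0 pq hg _ lam0 (hu j))) h.
rewrite LE => {}h; apply: le_trans h; rewrite le_eqVlt; apply/orP; left; apply/eqP.
apply: eq_integral => x /set_mem Dx; congr ((_ `^ q * _)%:E).
by rewrite /u (gen_volterraB n k hg hf (HF' _).1 Dx) cmod_distC.
Qed.

(** Suppose the quotient exceeds [e] at points with |a| -> 1. The images of the test functions there
    have a subsequence converging in norm, and its limit is 0 because the images tend to 0
    pointwise. But images of small mass force a small quotient. *)
Theorem symbol_of_compact : compact_operator p q w T -> lim_boundary S 0.
Proof.
move=> [bT cT]; apply/(symbol_limP p q k n g w_doubling psiP) => e e0; apply: contrapT => neg.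
have [D D0 [fin pos mono dbl]] := tail_spec w_doubling psiP.
have [B [c [F [[B0 c0 HF] F0]]]] := test_functions k w_doubling psiP p0.
have [K K0 HK] := symbol_le_of_mass w_doubling psiP p0 pq kn hg.
have /choice[a aP] : forall j : nat, exists a : R[i], 1 - j.+1%:R^-1 < cmod a < 1 /\ e < S a.
  move=> j; apply: contrapT => na; apply: neg; exists (1 - j.+1%:R^-1).
    by rewrite subr_ge0 invf_le1// ler1n /= ltrBlDr ltrDl invr_gt0.
  by move=> a aj; rewrite leNgt; apply/negP => eS; apply: na; exists a.
have a1 j : cmod (a j) < 1 by have [/andP[]] := aP j.
pose N := B `^ p^-1; have N0 : 0 < N by rewrite powR_gt0.
have NE : N `^ p = B by rewrite /N -powRrM mulVf ?gt_eqF// powRr1// ltW.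
have hF j : holo 1 (F (a j)) by have [] := HF _ (a1 j).
have FB j : (mass w p (F (a j)) <= (N `^ p)%:E)%E by rewrite NE; have [] := HF _ (a1 j).
have [|phi [h [homo_phi bh cvg]]] := cT (fun j => F (a j)) N.
  move=> j; split; first exact: (bergman_of_mass w_doubling p0 (ltW N0)).
  by rewrite (bergman_norm_le w_doubling p0) ?(ltW N0).
have hh := (analytic_on_diskE h).1 bh.1.
have {}cvg := (bergman_norm_cvg0 w_doubling q0 _).1 cvg.
have phi_ge j : (j <= phi j)%N.
  by elim: j => [//|j ih]; apply: (leq_ltn_trans ih); exact: homo_phi.
have hT j : holo 1 (T (F (a (phi j)))) by exact: holo_gen_volterra.
(* Test functions with |a| close to 1 are small on a disk of radius larger than |z|, hence so is the
   product of derivatives on |u| <= |z|, and n integrations do not enlarge it. *)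
have T0 z e1 : cmod z < 1 -> 0 < e1 -> exists N, forall j, (N <= j)%N -> cmod (T (F (a (phi j))) z) <= e1.
  move=> z1 e10; have z01 : 0 <= cmod z < 1 by rewrite cmod_ge0.
  have [d d0 Hd] := symbol_small k (n - k) hg z01 e10.
  have [|sig /andP[sig0 sig1] Hs] := F0 ((1 + cmod z) / 2) d _ d0; first by apply/andP; split; lra.
  have [J HJ] : exists J : nat, (1 - sig)^-1 < J%:R.
    by exists (Num.bound (1 - sig)^-1); apply: archi_boundP; rewrite invr_ge0; lra.
  exists J => j Jj; apply: (@iter_volterra_le _ n _ (cmod z) e1 z (holo_symbol k (n - k) (hF _) hg) z1 _ (lexx _)).
  apply: Hd => // u ur; apply: Hs => //; rewrite a1 andbT.
  have [/andP[aj _] _] := aP (phi j); apply: le_lt_trans aj.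
  rewrite lerBrDr addrC -lerBrDr.
  rewrite -[leRHS]invrK lef_pV2 ?posrE ?invr_gt0 ?ltr0n//; last by rewrite subr_gt0.
  apply: (le_trans (ltW HJ)); rewrite ler_nat; apply: (leq_trans Jj).
  by apply: (leq_trans (phi_ge j)).
(* Norm convergence implies pointwise convergence through [growth]; [e1] is the norm that the growth
   estimate turns into d / 2 at [z]. *)
have h0 z : cmod z < 1 -> h z = 0.
  move=> z1; apply/eqP; rewrite -cmod_eq0 eq_le cmod_ge0 andbT; apply/ler_addgt0Pr => d d0.
  have W0 : 0 < W (cmod z) by apply: (weight_gt0 pos); rewrite cmod_ge0.
  have [G G0 HG] := growth w_doubling psiP.
  have d2 : 0 < d / 2 by rewrite divr_gt0.
  pose e1 := (W (cmod z) / G) `^ q^-1 * (d / 2).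
  have e10 : 0 < e1 by rewrite mulr_gt0// powR_gt0// divr_gt0.
  have [N1 H1] := T0 z (d / 2) z1 d2; have [N2 H2] := cvg e1 e10.
  have := H1 _ (leq_maxl N1 N2); have := H2 _ (leq_maxr N1 N2); set j := maxn N1 N2.
  move=> mj tj; have hu : holo 1 (fun u => T (F (a (phi j))) u - h u) by exact: holoB.
  have := HG q _ _ z q0 hu mj z1.
  rewrite /e1 powRM ?powR_ge0 ?(ltW d2)// -powRrM mulVf ?gt_eqF// powRr1 ?divr_ge0 ?(ltW W0) ?(ltW G0)//.
  rewrite (_ : G * (W (cmod z) / G * (d / 2) `^ q) = (d / 2) `^ q * W (cmod z)); last by field; rewrite gt_eqF.
  rewrite ler_pM2r// => /(ge0_ler_powR (_ : 0 <= q^-1)).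
  rewrite invr_ge0 (ltW q0) !nnegrE !powR_ge0 => /(_ isT isT isT).
  rewrite -!powRrM mulfV ?gt_eqF// !powRr1 ?cmod_ge0 ?(ltW d2)// => uj.
  have := cmodB (T (F (a (phi j))) z) (T (F (a (phi j))) z - h z).
  rewrite opprB addrCA subrr addr0 add0r; lra.
(* Makes the bound K lam / c of [symbol_le_of_mass] equal to [e], which contradicts the choice of
   the points. *)
pose lam := e * c / K; have lam0 : 0 < lam by rewrite divr_gt0// mulr_gt0.
have [J HJ] := cvg lam lam0; have := HJ J (leqnn J) => mJ.
have := aP (phi J) => -[_]; rewrite ltNge => /negP; apply.
rewrite (symbol_quotient_le _ _ _ _ _ w_doubling psiP) ?a1//.
have [_ _ Fa] := HF _ (a1 (phi J)).
have mT : (mass w q (T (F (a (phi J)))) <= (lam `^ q)%:E)%E.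
  apply: le_trans mJ; rewrite le_eqVlt; apply/orP; left; apply/eqP.
  by apply: eq_mass => z z1; rewrite h0// subr0.
have := HK _ lam c _ (hF (phi J)) lam0 c0 mT (a1 _) Fa.
by rewrite (_ : K * lam / c = e)// /lam; field; rewrite !gt_eqF.
Qed.

End Compactness.

Theorem theorem1 (R : realType) (p q : R) (w : R[i] -> R) (k n : nat)
    (g : R[i] -> R[i])
    (p_gt0 : 0 < p) (p_lt_q : p < q) (w_doubling : doubling w)
    (k_lt_n : (k < n)%N) (g_analytic : analytic_on_disk g) :
  (bounded_operator p q w (gen_volterra g n k) <->
   (ereal_sup [set (symbol_quotient p q w g n k a)%:E | a in disk] < +oo)%E)
  /\
  (compact_operator p q w (gen_volterra g n k) <->
   lim_boundary (symbol_quotient p q w g n k) 0).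
Proof.
have [w_weight w_radial _] := w_doubling.
have [psi psiP] := exists_profile w_weight w_radial.
have hg := (analytic_on_diskE g).1 g_analytic.
split; split.
- by move=> /(symbol_of_bounded w_doubling psiP p_gt0 p_lt_q k_lt_n hg)/symbol_supP.
- by move=> /symbol_supP/(bounded_of_symbol w_doubling psiP p_gt0 p_lt_q k_lt_n hg).
- exact: symbol_of_compact psiP _ _ _ _.
- exact: compact_of_symbol psiP _ _ _ _.
Qed.
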